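(* Let $\mathcal{V}=\{V_\omega,\psi_\omega\}_{\omega\in\Omega}$ be a continuous complex vector bundle over a compact metric space $\Omega$ with a continuous family of Hermitian symplectic forms $\psi_\omega$ on the fibers, and let $T:\Omega\to\Omega$ be a homeomorphism. Let $A_t:\mathcal{V}\to\mathcal{V}$, $t\in(-\epsilon,\epsilon)$, be a monotonic family of Hermitian symplectic cocycles over $T$, uniformly $C^l$ in $t$ with $l\in\{2,3,\dots,\infty,\omega\}$. Assume moreover that $A_t$ is partially hyperbolic for every $t\in(-\epsilon,\epsilon)$, with splitting $E^u_t\oplus E^c_t\oplus E^s_t$ and constant center dimension. Then there exist a neighborhood $(-\epsilon',\epsilon')$ of $0$ and a family of Hermitian symplectic mappings $B_t:E^c_0\to E^c_t$, $t\in(-\epsilon',\epsilon')$ (fiberwise linear isomorphisms $B_t(\omega):E^c_0(\omega)\to E^c_t(\omega)$ preserving the restrictions of $\psi_\omega$) such that (1) $B_t$ is uniformly $C^{l-1}$ in $t$; (2) $\partial_tB_t$ and $B_t$ are continuous in $(t,\omega)$; (3) the maps $C_t:E^c_0\to E^c_0$ defined by $C_t|_{E^c_0(\omega)}:=B_t(T\omega)^{-1}\circ A_t|_{E^c_t(\omega)}\circ B_t(\omega)|_{E^c_0(\omega)}$ form a monotonic family of Hermitian symplectic cocycles on the bundle $E^c_0$ over $T$.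
   Context: A Hermitian symplectic form $\psi$ on a complex vector space is conjugate-linear in the first and linear in the second argument, skew-Hermitian ($\psi(X,Y)=-\overline{\psi(Y,X)}$) and non-degenerate. Its signature is that of the Hermitian matrix $i(\psi(v_i,v_j))_{i,j}$ in any basis (number of positive minus number of negative eigenvalues). A vector $v$ is isotropic if $\psi(v,v)=0$. Let $(V,\psi)$, $(V',\psi')$ be $2d$-dimensional Hermitian symplectic spaces of signature $0$. A $C^1$ path $\gamma:I\to V\setminus\{0\}$ is monotonic increasing (decreasing) if $\psi(\gamma(t),\gamma'(t))>0$ ($<0$) for all $t\in I$. A $C^1$ one-parameter family of linear maps $A_t:(V,\psi)\to(V',\psi')$ with $\psi'(A_tv,A_tw)=\psi(v,w)$ is monotonic if for any nonzero isotropic vector $v\in V$ the curve $t\mapsto A_tv$ is monotonic in $(V',\psi')$. A family of Hermitian symplectic cocycles $A_t:\mathcal{V}\to\mathcal{V}$, $t\in I$, over $T$ (fiberwise maps $A_t(\omega):(V_\omega,\psi_\omega)\to(V_{T\omega},\psi_{T\omega})$ preserving the forms), such that $\partial_tA_t$ exists and $A_t,\partial_tA_t$ are continuous in $(t,\omega)$, is monotonic if for every $\omega$ the family $t\mapsto A_t(\omega)$ is a $C^1$ monotonic family of Hermitian symplectic mappings in this sense. A cocycle $A:\mathcal{V}\to\mathcal{V}$ over $T$ is partially hyperbolic if there is a continuous $A$-invariant splitting $V_\omega=E^u(\omega)\oplus E^c(\omega)\oplus E^s(\omega)$ that is dominated (there is $N\ge1$ such that, for every $\omega$ and unit vectors $v,v'$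 in consecutive bundles in the order $E^u,E^c,E^s$, $\|A_N(\omega)v\|>\|A_N(\omega)v'\|$, where $A_N$ is the $N$-th iterate and norms come from a continuous Hermitian metric), and constants $K,c>0$ with $\|A_n(\omega)v\|\le Ke^{-cn}\|v\|$ for $v\in E^s(\omega)$ and $\|A_n(\omega)^{-1}v\|\le Ke^{-cn}\|v\|$ for $v\in E^u(T^n\omega)$, $n\ge0$. ''Uniformly $C^l$ in $t$'' means that, in local trivializations, the $t$-derivatives up to order $l$ exist and are continuous in $(t,\omega)$ (for $l=\omega$: real-analytic in $t$, locally uniformly in the base point). Conventions: $\infty-1=\infty$, $\omega-1=\omega$.
   Formalization: It is additionally assumed that the restriction of ψ_ω to E^c_t(ω) is non-degenerate for all t and ω; without this E^c_0 need not be Hermitian symplectic and (3) can fail, e.g. for a one-dimensional isotropic center over a point. *)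

(* Defs.v *)
From HB Require Import structures.
From mathcomp Require Import all_boot all_order all_algebra.
From mathcomp Require Import all_classical all_reals all_analysis.
From mathcomp Require Import complex.
Set Implicit Arguments.
Unset Strict Implicit.
Unset Printing Implicit Defensive.
Import Order.TTheory GRing.Theory Num.Theory.
Import numFieldNormedType.Exports.
Local Open Scope classical_set_scope.
Local Open Scope ring_scope.
Local Open Scope complex_scope.

(* Regularity classes C^n, C^oo and C^omega. *)
Inductive smoothness := Cfin of nat | Cinfty | Comega.

Definition smooth_pred (l : smoothness) : smoothness :=
  match l with Cfin n => Cfin n.-1 | Cinfty => Cinfty | Comega => Comega end.

Definition smooth_ge (n : nat) (l : smoothness) : bool :=
  match l with Cfin m => (n <= m)%N | Cinfty | Comega => true end.

Section Defs.
Context {R : realType}.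
Local Notation C := R[i].

(* C carries no topology here: it is identified with R^2 through Re and Im. *)
Definition cplx_continuous_at (X : topologicalType) (g : X -> C) (x : X) :=
  {for x, continuous (fun y => complex.Re (g y))} /\
  {for x, continuous (fun y => complex.Im (g y))}.

Definition cplx_derive (g : R -> C) (t : R) : C :=
  derive1 (fun s => complex.Re (g s)) t +i* derive1 (fun s => complex.Im (g s)) t.

Section Forms.
Context {W : vectType C}.
Implicit Types (psi : W -> W -> C) (gamma : R -> W) (I : set R).

Definition sesquilinear_form psi :=
  (forall a u v w, psi (a *: u + v) w = (a^*)%C * psi u w + psi v w) /\
  (forall a u v w, psi u (a *: v + w) = a * psi u v + psi u w).

Definition nondegenerate_form psi := forall v, (forall w, psi v w = 0) -> v = 0.

Definition hs_form psi :=
  [/\ sesquilinear_form psi,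
      forall v w, psi v w = - ((psi w v)^*)%C &
      nondegenerate_form psi].

Definition eigenvalues n (M : 'M[C]_n) : seq C :=
  sval (closed_field_poly_normal (char_poly M)).

(* The choice of the basis is irrelevant by Sylvester's law of inertia. *)
Definition hs_signature psi : int :=
  let b := vbasis (fullv : {vspace W}) in
  let s := eigenvalues
    (\matrix_(i < \dim {:W}, j < \dim {:W}) ('i%C * psi b`_i b`_j)) in
  (count (fun z => 0 < z) s)%:Z - (count (fun z => z < 0) s)%:Z.

Definition hermitian_product (h : W -> W -> C) :=
  [/\ sesquilinear_form h,
      forall v w, h v w = ((h w v)^*)%C &
      forall v, v != 0 -> 0 < h v v].

Definition herm_norm (h : W -> W -> C) (v : W) : R :=
  Num.sqrt (complex.Re (h v v)).

(* Velocity and regularity of a path are computed in the coordinates of a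
   basis of W, whose choice is irrelevant. *)
Definition path_coord gamma (i : 'I_(\dim {:W})) (t : R) : C :=
  coord (vbasis (fullv : {vspace W})) i (gamma t).

Definition velocity gamma (t : R) : W :=
  \sum_(i < \dim {:W})
    cplx_derive (path_coord gamma i) t *: (vbasis (fullv : {vspace W}))`_i.

Definition C1_path I gamma :=
  forall i t, I t ->
    [/\ derivable (fun s => complex.Re (path_coord gamma i s)) t 1,
        derivable (fun s => complex.Im (path_coord gamma i s)) t 1 &
        cplx_continuous_at (cplx_derive (path_coord gamma i)) t].

(* In the order of R[i], 0 < z means that z is real and positive. *)
Definition monotonic_path I psi gamma :=
  [/\ C1_path I gamma,
      forall t, I t -> gamma t != 0 &
      (forall t, I t -> 0 < psi (gamma t) (velocity gamma t)) \/
      (forall t, I t -> psi (gamma t) (velocity gamma t) < 0)].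

End Forms.

Section Bundles.
Context {Om : topologicalType}.

(* A local trivialization over [fdom] is recorded by the local frame that it
   sends to the standard basis of C^flen; the values of [fvec] outside [fdom]
   are irrelevant. *)
Record lframe (F : Om -> vectType C) := LFrame {
  fdom : set Om;
  flen : nat;
  fvec : forall w, flen.-tuple (F w) }.

Record vbundle := VBundle {
  fiber :> Om -> vectType C;
  frames : set (lframe fiber) }.
Arguments frames : clear implicits.

Definition cont_section (V : vbundle) (U : set Om) (s : forall w, V w) :=
  forall f, frames V f -> forall i w, U w -> fdom f w ->
    cplx_continuous_at (fun x => coord (fvec f x) i (s x)) w.

Definition is_vbundle (V : vbundle) :=
  [/\ forall e, frames V e -> open (fdom e) /\
        (forall w, fdom e w -> basis_of fullv (fvec e w)),
      forall w, exists2 e, frames V e & fdom e w &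
      forall e, frames V e -> forall j : 'I_(flen e),
        cont_section (fdom e) (fun w => (fvec e w)`_j)].

(* The trivializations of a subbundle are the local frames consisting of
   continuous sections of the ambient bundle. *)
Definition subbundle (V : vbundle) (E : forall w, {vspace V w}) : vbundle :=
  @VBundle (fun w => subvs_of (E w) : vectType C)
    [set e | [/\ open (fdom e),
                 forall w, fdom e w -> basis_of fullv (fvec e w) &
                 forall j : 'I_(flen e),
                   @cont_section V (fdom e) (fun w => vsval (fvec e w)`_j)]].

(* Continuity of the field of subspaces E amounts to the existence of such
   frames around every point. *)
Definition continuous_subbundle (V : vbundle) (E : forall w, {vspace V w}) :=
  is_vbundle (subbundle E).

Definition continuous_form (V : vbundle) (psi : forall w, V w -> V w -> C) :=
  forall e, frames V e -> forall i j : 'I_(flen e), forall w, fdom e w ->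
    cplx_continuous_at (fun x => psi x (fvec e x)`_i (fvec e x)`_j) w.

Definition restr_form (V : vbundle) (E : forall w, {vspace V w})
    (psi : forall w, V w -> V w -> C) :
    forall w, subbundle E w -> subbundle E w -> C :=
  fun w u v => psi w (vsval u) (vsval v).

Definition hs_bundle (d : nat) (V : vbundle)
    (psi : forall w, V w -> V w -> C) :=
  [/\ is_vbundle V,
      forall w, hs_form (psi w),
      continuous_form psi &
      forall w, \dim {: V w} = d.*2 /\ hs_signature (psi w) = 0].

(* Uniform regularity in t of a function of (t, w) on I x U, for I and U open. *)
Definition unif_Cn (n : nat) (I : set R) (U : set Om) (g : R -> Om -> R) :=
  forall m t w, (m <= n)%N -> I t -> U w ->
    (forall k, (k < m)%N -> derivable (derive1n k (fun s => g s w)) t 1) /\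
    {for (t, w), continuous (fun p : R * Om => derive1n m (fun s => g s p.2) p.1)}.

(* The bound on the coefficients makes the convergence of the Taylor series
   locally uniform in (t, w), also for complex t near t0. *)
Definition unif_analytic (I : set R) (U : set Om) (g : R -> Om -> R) :=
  forall t0 w0, I t0 -> U w0 ->
  exists (r M : R) (a : nat -> Om -> R), 0 < r /\
    (\forall w \near w0,
       (forall n, `|a n w| * r ^+ n <= M) /\
       (forall t, `|t - t0| < r ->
          pseries (fun n => a n w) (t - t0) @ \oo --> g t w)).

Definition unif_smooth_fun (l : smoothness) (I : set R) (U : set Om)
    (g : R -> Om -> R) :=
  match l with
  | Cfin n => unif_Cn n I U g
  | Cinfty => forall n, unif_Cn n I U g
  | Comega => (forall n, unif_Cn n I U g) /\ unif_analytic I U g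
  end.

(* Regularity of a family F_t(w) : V_w -> W_(S w): that of its matrix entries
   in local trivializations. *)
Definition unif_smooth (l : smoothness) (I : set R) (V W : vbundle)
    (S : Om -> Om) (F : R -> forall w, 'Hom(V w, W (S w))) :=
  forall e f, frames V e -> frames W f ->
  forall (j : 'I_(flen e)) (i : 'I_(flen f)),
  let entry t w := coord (fvec f (S w)) i (F t w (fvec e w)`_j) in
  let U := fdom e `&` S @^-1` fdom f in
  unif_smooth_fun l I U (fun t w => complex.Re (entry t w)) /\
  unif_smooth_fun l I U (fun t w => complex.Im (entry t w)).

Section Cocycles.
Context (V : vbundle) (T : Om -> Om).
Implicit Types (A : forall w, 'Hom(V w, V (T w))).

Definition hs_cocycle (psi : forall w, V w -> V w -> C) A :=
  forall w u v, psi (T w) (A w u) (A w v) = psi w u v.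

Fixpoint cocycle_iter A (n : nat) (w : Om) : 'Hom(V w, V (iter n T w)) :=
  match n with
  | 0 => \1%VF
  | m.+1 => (A (iter m T w) \o cocycle_iter A m w)%VF
  end.

Definition monotonic_family (I : set R) (psi : forall w, V w -> V w -> C)
    (A : R -> forall w, 'Hom(V w, V (T w))) :=
  [/\ forall t, I t -> hs_cocycle psi (A t),
      unif_smooth (Cfin 1) I A &
      forall w (v : V w), v != 0 -> psi w v v = 0 ->
        monotonic_path I (psi (T w)) (fun t => A t w v)].

Definition dominates A (h : forall w, V w -> V w -> C) (N : nat)
    (E F : forall w, {vspace V w}) :=
  forall w u v, u \in E w -> v \in F w ->
    herm_norm (h w) u = 1 -> herm_norm (h w) v = 1 ->
    herm_norm (h (iter N T w)) (cocycle_iter A N w v) <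
    herm_norm (h (iter N T w)) (cocycle_iter A N w u).

Definition invariant_subbundle A (E : forall w, {vspace V w}) :=
  forall w, (A w @: E w)%VS = E (T w).

Definition partially_hyperbolic A (Eu Ec Es : forall w, {vspace V w}) :=
  [/\ forall w, (Eu w + Ec w + Es w)%VS = fullv /\
        directv (Eu w + Ec w + Es w),
      [/\ continuous_subbundle Eu, continuous_subbundle Ec &
          continuous_subbundle Es],
      [/\ invariant_subbundle A Eu, invariant_subbundle A Ec &
          invariant_subbundle A Es] &
      exists h : forall w, V w -> V w -> C,
        [/\ forall w, hermitian_product (h w),
            continuous_form h,
            exists2 N, (1 <= N)%N &
              dominates A h N Eu Ec /\ dominates A h N Ec Es &
            exists K c : R, [/\ 0 < K, 0 < c,
              forall n w v, v \in Es w ->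
                herm_norm (h (iter n T w)) (cocycle_iter A n w v) <=
                K * expR (- c * n%:R) * herm_norm (h w) v &
              forall n w v, v \in Eu (iter n T w) ->
                herm_norm (h w) ((cocycle_iter A n w)^-1%VF v) <=
                K * expR (- c * n%:R) * herm_norm (h (iter n T w)) v]]].

(* B followed by the inclusion of E_t into V. *)
Definition incl_family (E : R -> forall w, {vspace V w})
    (B : forall t w, 'Hom(subvs_of (E 0 w), subvs_of (E t w))) :
    R -> forall w, 'Hom(subbundle (E 0) w, V (id w)) :=
  fun t w => (linfun (@vsval _ _ (E t w)) \o B t w)%VF.

Definition conj_cocycle (E : R -> forall w, {vspace V w})
    (A : R -> forall w, 'Hom(V w, V (T w)))
    (B : forall t w, 'Hom(subvs_of (E 0 w), subvs_of (E t w))) :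
    R -> forall w, 'Hom(subbundle (E 0) w, subbundle (E 0) (T w)) :=
  fun t w =>
    ((B t (T w))^-1 \o
     (linfun (fun u => vsproj (E t (T w)) (A t w (vsval u))) \o B t w))%VF.

End Cocycles.
End Bundles.
End Defs.
Arguments vbundle R Om : clear implicits.
Arguments hs_bundle {R Om} d V psi.
Arguments restr_form {R Om V} E psi w u v.

(* Main.v *)
Require Import Defs.
From HB Require Import structures.
From mathcomp Require Import all_boot all_order all_algebra.
From mathcomp Require Import all_classical all_reals all_analysis.
From mathcomp Require Import complex.
From mathcomp Require Import ring lra zify.
Set Implicit Arguments.
Unset Strict Implicit.
Unset Printing Implicit Defensive.
Import Order.TTheory GRing.Theory Num.Theory.
Import numFieldNormedType.Exports.
Local Open Scope classical_set_scope.
Local Open Scope ring_scope.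

(* Embedding V in a trivial bundle turns cocycles, forms and invariant bundles
   into matrix functions of (t, w).  Domination makes E^s_t and E^u_t, for small
   t, the graphs over E^s_0 and E^u_0 of fixed points of graph transforms.  These
   are contractions for the sup norm, for suitably weighted C^n norms and for
   norms of power series in t, and smallness of A_t - A_0 in such a norm gives
   the regularity in t of the fixed point.

   Domination also forces E^c_t to be psi-orthogonal to E^s_t and E^u_t, which are
   isotropic.  Hence E^c_t is the orthogonal of E^s_t + E^u_t, that is the graph of
   a map Y_t on E^c_0 obtained from the psi-adjoints of the two graph maps, and Y_t
   takes its values in the orthogonal of E^c_0.  Correcting 1 + Y_t by a factor
   1 + Z_t with Z_t of second order gives the isometry B_t.  Then
   psi(B_0' u, v) = 0 on E^c_0, so psi(C_t u, C_t' u) equals psi(A_0 u, A_0' u) at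
   t = 0; it does not vanish on the isotropic unit vectors of E^c_0, which form a
   compact set, and therefore keeps its sign for small t.

   By inertia the isotropic bundles E^s_t and E^u_t have the same dimension and
   E^c_t has signature 0; so all ranks are independent of t. *)

(** * Complex functions and matrices *)

(** Apart from the center dimension, nothing is assumed on how the splitting depends on t, and the
    base is only a compact metric space. So all norms differentiate in t alone: composition with the
    base map then costs nothing, however fast T separates points. The graph found as a fixed point
    is identified afterwards with the given bundle, by comparing growth rates at the same t and by
    equality of ranks. One interval has to serve every C^n at once. It is therefore fixed by the sup
    norm only; the m-th derivative enters a C^n norm with a weight th^m, and shrinking th makes the
    higher orders harmless. The iterates of a fixed-point map do not mention the norm, so a single
    limit inherits every regularity class. All implicit definitions in t are polynomial fixed-point
    equations: the inverses of the cocycle and of B_t are adjoints for the form, and the inverse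
    square root that turns 1 + Y_t into an isometry is again a fixed point. Hence an abstract norm
    has to support only sums, products, constants, composition with base maps and series. *)

Section ComplexParts.
Context {R : realType}.
Local Notation K := R[i].
Implicit Types x y : K.

Lemma ReD x y : complex.Re (x + y) = complex.Re x + complex.Re y.
Proof. by case: x y => [? ?] [? ?]. Qed.
Lemma ImD x y : complex.Im (x + y) = complex.Im x + complex.Im y.
Proof. by case: x y => [? ?] [? ?]. Qed.
Lemma ReN x : complex.Re (- x) = - complex.Re x.
Proof. by case: x. Qed.
Lemma ImN x : complex.Im (- x) = - complex.Im x.
Proof. by case: x. Qed.
Lemma ReB x y : complex.Re (x - y) = complex.Re x - complex.Re y.
Proof. by rewrite ReD ReN. Qed.
Lemma ImB x y : complex.Im (x - y) = complex.Im x - complex.Im y.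
Proof. by rewrite ImD ImN. Qed.
Lemma RecM x y : complex.Re (x * y) =
  complex.Re x * complex.Re y - complex.Im x * complex.Im y.
Proof. by case: x y => [? ?] [? ?]. Qed.
Lemma ImcM x y : complex.Im (x * y) =
  complex.Re x * complex.Im y + complex.Im x * complex.Re y.
Proof. by case: x y => [? ?] [? ?]. Qed.
Lemma ReJ x : complex.Re (x^*)%C = complex.Re x.
Proof. by case: x. Qed.
Lemma ImJ x : complex.Im (x^*)%C = - complex.Im x.
Proof. by case: x. Qed.
Lemma complex_ext x y :
  complex.Re x = complex.Re y -> complex.Im x = complex.Im y -> x = y.
Proof. by case: x y => [? ?] [? ?] /= -> ->. Qed.
Lemma Re_sum I (r : seq I) (P : pred I) (F : I -> K) :
  complex.Re (\sum_(i <- r | P i) F i) = \sum_(i <- r | P i) complex.Re (F i).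
Proof. exact: (big_morph _ ReD). Qed.

(** The taxicab norm of C = R^2: real-valued and submultiplicative, and directly comparable with the
    real and imaginary parts in which continuity and regularity are stated. *)
Definition n1 x : R := `|complex.Re x| + `|complex.Im x|.

Lemma n1_ge0 x : 0 <= n1 x. Proof. exact: addr_ge0. Qed.
Lemma n1_0 : n1 0 = 0. Proof. by rewrite /n1 /= normr0 addr0. Qed.
Lemma n1_eq0 x : n1 x = 0 -> x = 0.
Proof.
move=> /eqP; rewrite paddr_eq0// !normr_eq0 => /andP[/eqP a /eqP b].
exact: complex_ext.
Qed.
Lemma n1D x y : n1 (x + y) <= n1 x + n1 y.
Proof.
rewrite /n1 ReD ImD addrACA; apply: lerD; exact: ler_normD.
Qed.
Lemma n1N x : n1 (- x) = n1 x.
Proof. by rewrite /n1 ReN ImN !normrN. Qed.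
Lemma n1J x : n1 (x^*)%C = n1 x.
Proof. by rewrite /n1 ReJ ImJ normrN. Qed.
Lemma n1M x y : n1 (x * y) <= n1 x * n1 y.
Proof.
rewrite /n1 RecM ImcM.
apply: (@le_trans _ _ (`|complex.Re x| * `|complex.Re y| + `|complex.Im x| * `|complex.Im y|
   + (`|complex.Re x| * `|complex.Im y| + `|complex.Im x| * `|complex.Re y|))).
  by rewrite -!normrM; apply: lerD; [exact: ler_normB|exact: ler_normD].
by rewrite le_eqVlt; apply/orP; left; apply/eqP; ring.
Qed.
Lemma n1_real (r : R) x : n1 (r%:C%C * x) = `|r| * n1 x.
Proof. by rewrite /n1 RecM ImcM /= !mul0r subr0 addr0 !normrM mulrDr. Qed.
Lemma Re_le_n1 x : `|complex.Re x| <= n1 x. Proof. by rewrite lerDl. Qed.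
Lemma Im_le_n1 x : `|complex.Im x| <= n1 x. Proof. by rewrite lerDr. Qed.
Lemma n1_sum I (r : seq I) (P : pred I) (F : I -> K) :
  n1 (\sum_(i <- r | P i) F i) <= \sum_(i <- r | P i) n1 (F i).
Proof.
elim/big_ind2 : _ => [|x1 x2 y1 y2 h1 h2|//]; first by rewrite n1_0.
by apply: (le_trans (n1D _ _)); exact: lerD.
Qed.

Definition nrm m n (M : 'M[K]_(m, n)) : R := \sum_i \sum_j n1 (M i j).

Lemma nrm_ge0 m n (M : 'M[K]_(m, n)) : 0 <= nrm M.
Proof. by do 2!apply: sumr_ge0 => ? _; exact: n1_ge0. Qed.
Lemma nrm0 m n : nrm (0 : 'M[K]_(m, n)) = 0.
Proof. by rewrite /nrm big1// => i _; rewrite big1// => j _; rewrite mxE n1_0. Qed.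
Lemma n1_le_nrm m n (M : 'M[K]_(m, n)) i j : n1 (M i j) <= nrm M.
Proof.
rewrite /nrm (bigD1 i)//= (bigD1 j)//= -addrA lerDl; apply: addr_ge0.
  by apply: sumr_ge0 => ? _; exact: n1_ge0.
by do 2!apply: sumr_ge0 => ? _; exact: n1_ge0.
Qed.
Lemma nrm_eq0 m n (M : 'M[K]_(m, n)) : nrm M = 0 -> M = 0.
Proof.
move=> h; apply/matrixP => i j; rewrite mxE; apply: n1_eq0.
by apply/eqP; rewrite eq_le n1_ge0 -h n1_le_nrm.
Qed.
Lemma nrm_gt0 m n (M : 'M[K]_(m, n)) : M != 0 -> 0 < nrm M.
Proof.
move=> h; rewrite lt_neqAle nrm_ge0 andbT; apply: contra h => /eqP h.
by apply/eqP/nrm_eq0.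
Qed.
Lemma nrmN m n (M : 'M[K]_(m, n)) : nrm (- M) = nrm M.
Proof. by do 2!apply: eq_bigr => ? _; rewrite mxE n1N. Qed.
Lemma nrmD m n (M M' : 'M[K]_(m, n)) : nrm (M + M') <= nrm M + nrm M'.
Proof.
rewrite -big_split; apply: ler_sum => i _ /=; rewrite -big_split.
by apply: ler_sum => j _ /=; rewrite mxE n1D.
Qed.
Lemma nrmB m n (M M' : 'M[K]_(m, n)) : nrm (M - M') <= nrm M + nrm M'.
Proof. by rewrite -(nrmN M'); exact: nrmD. Qed.
Lemma nrmM m n q (M : 'M[K]_(m, n)) (M' : 'M[K]_(n, q)) :
  nrm (M *m M') <= nrm M * nrm M'.
Proof.
apply: (@le_trans _ _ (\sum_i \sum_j \sum_k n1 (M i k) * n1 (M' k j))).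
  apply: ler_sum => i _; apply: ler_sum => j _; rewrite mxE.
  by apply: (le_trans (n1_sum _ _ _)); apply: ler_sum => k _; exact: n1M.
rewrite /nrm mulr_suml; apply: ler_sum => i _.
rewrite exchange_big /= mulr_suml; apply: ler_sum => k _.
rewrite -mulr_sumr; apply: ler_wpM2l; first exact: n1_ge0.
rewrite (bigD1 k)//= lerDl.
by do 2!apply: sumr_ge0 => ? _; exact: n1_ge0.
Qed.
Lemma nrm_real m n (r : R) (M : 'M[K]_(m, n)) : nrm (r%:C%C *: M) = `|r| * nrm M.
Proof.
rewrite /nrm mulr_sumr; apply: eq_bigr => i _; rewrite mulr_sumr.
by apply: eq_bigr => j _; rewrite mxE n1_real.
Qed.
Lemma nrm_le_n1 m n (M : 'M[K]_(m, n)) b : (forall i j, n1 (M i j) <= b) ->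
  nrm M <= (m * n)%:R * b.
Proof.
move=> h; apply: (@le_trans _ _ (\sum_(i < m) \sum_(j < n) b)).
  by apply: ler_sum => i _; apply: ler_sum => j _.
by rewrite !sumr_const !card_ord -mulrnA mulr_natl mulnC.
Qed.

Definition adj m n (M : 'M[K]_(m, n)) : 'M[K]_(n, m) := map_mx (@conjc R) M^T.

Lemma adjE m n (M : 'M[K]_(m, n)) i j : adj M i j = ((M j i)^*)%C.
Proof. by rewrite !mxE. Qed.
Lemma adjK m n (M : 'M[K]_(m, n)) : adj (adj M) = M.
Proof. by apply/matrixP => i j; rewrite !adjE conjcK. Qed.
Lemma adjD m n (M M' : 'M[K]_(m, n)) : adj (M + M') = adj M + adj M'.
Proof. by apply/matrixP => i j; rewrite !mxE rmorphD. Qed.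
Lemma adjN m n (M : 'M[K]_(m, n)) : adj (- M) = - adj M.
Proof. by apply/matrixP => i j; rewrite !mxE rmorphN. Qed.
Lemma adjB m n (M M' : 'M[K]_(m, n)) : adj (M - M') = adj M - adj M'.
Proof. by rewrite adjD adjN. Qed.
Lemma adj0 m n : adj (0 : 'M[K]_(m, n)) = 0.
Proof. by apply/matrixP => i j; rewrite !mxE rmorph0. Qed.
Lemma adj_1 n : adj (1%:M : 'M[K]_n) = 1%:M.
Proof.
by apply/matrixP => i j; rewrite adjE !mxE eq_sym; case: eqP => _; rewrite ?rmorph1 ?rmorph0.
Qed.
Lemma adjM m n q (M : 'M[K]_(m, n)) (M' : 'M[K]_(n, q)) :
  adj (M *m M') = adj M' *m adj M.
Proof.
apply/matrixP => i j; rewrite adjE !mxE rmorph_sum /=; apply: eq_bigr => k _.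
by rewrite rmorphM mulrC !adjE.
Qed.
Lemma adj_scale m n a (M : 'M[K]_(m, n)) : adj (a *: M) = (a^*)%C *: adj M.
Proof. by apply/matrixP => i j; rewrite !mxE rmorphM. Qed.
Lemma nrm_adj m n (M : 'M[K]_(m, n)) : nrm (adj M) = nrm M.
Proof.
rewrite /nrm exchange_big; do 2!apply: eq_bigr => ? _.
by rewrite adjE n1J.
Qed.

Lemma adj_mul_ge0 n m (M : 'M[K]_(n, m)) (x : 'cV[K]_m) :
  0 <= complex.Re ((adj x *m (adj M *m M) *m x) ord0 ord0).
Proof.
have -> : adj x *m (adj M *m M) *m x = adj (M *m x) *m (M *m x).
  by rewrite adjM !mulmxA.
rewrite mxE Re_sum; apply: sumr_ge0 => i _; rewrite adjE RecM ReJ ImJ.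
by rewrite mulNr opprK addr_ge0// -expr2 sqr_ge0.
Qed.
Lemma adj_mul_eq0 n (x : 'cV[K]_n) : complex.Re ((adj x *m x) ord0 ord0) = 0 -> x = 0.
Proof.
rewrite mxE Re_sum => /eqP; rewrite psumr_eq0; last first.
  move=> i _; rewrite adjE RecM ReJ ImJ.
  by rewrite mulNr opprK addr_ge0// -expr2 sqr_ge0.
move=> /allP h; apply/matrixP => i j; rewrite ord1 mxE.
have := h i (mem_index_enum _); rewrite /= adjE RecM ReJ ImJ mulNr opprK.
rewrite paddr_eq0 -?expr2 ?sqr_ge0// !sqrf_eq0 => /andP[/eqP a /eqP b].
exact: complex_ext.
Qed.

End ComplexParts.

(** * Continuity of complex and matrix functions *)

Section Continuity.
Context {R : realType}.
Local Notation K := R[i].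
Context {X : topologicalType}.
Local Notation cc := (@cplx_continuous_at R X).
Implicit Types (g : X -> K) (x : X).

Lemma cc_cst (a : K) x : cc (fun=> a) x.
Proof. by split; exact: cvg_cst. Qed.
Lemma ccD g g' x : cc g x -> cc g' x -> cc (fun y => g y + g' y) x.
Proof.
move=> [a b] [a' b']; split.
  under [X in {for x, continuous X}]eq_fun do rewrite ReD.
  exact: (@cvgD _ _ _ _ _ _ _ _ _ a a').
under [X in {for x, continuous X}]eq_fun do rewrite ImD.
exact: (@cvgD _ _ _ _ _ _ _ _ _ b b').
Qed.
Lemma ccN g x : cc g x -> cc (fun y => - g y) x.
Proof.
move=> [a b]; split.
  under [X in {for x, continuous X}]eq_fun do rewrite ReN.
  exact: (@cvgN _ _ _ _ _ _ _ a).
under [X in {for x, continuous X}]eq_fun do rewrite ImN.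
exact: (@cvgN _ _ _ _ _ _ _ b).
Qed.
Lemma ccJ g x : cc g x -> cc (fun y => (g y)^*%C) x.
Proof.
move=> [a b]; split.
  by under [X in {for x, continuous X}]eq_fun do rewrite ReJ.
under [X in {for x, continuous X}]eq_fun do rewrite ImJ.
exact: (@cvgN _ _ _ _ _ _ _ b).
Qed.
Lemma ccM g g' x : cc g x -> cc g' x -> cc (fun y => g y * g' y) x.
Proof.
move=> [a b] [a' b']; split.
  under [X in {for x, continuous X}]eq_fun do rewrite RecM.
  apply: (@cvgB _ _ _ _ _ _ _ _ _); [exact: (cvgM a a')|exact: (cvgM b b')].
under [X in {for x, continuous X}]eq_fun do rewrite ImcM.
apply: (@cvgD _ _ _ _ _ _ _ _ _); [exact: (cvgM a b')|exact: (cvgM b a')].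
Qed.
Lemma cc_real (f : X -> R) x : {for x, continuous f} -> cc (fun y => (f y)%:C%C) x.
Proof. by move=> h; split => //=; exact: cvg_cst. Qed.
Lemma cc_sum I (r : seq I) (P : pred I) (F : I -> X -> K) x :
  (forall i, P i -> cc (F i) x) -> cc (fun y => \sum_(i <- r | P i) F i y) x.
Proof.
move=> h; elim: r => [|i r ih].
  by under eq_fun do rewrite big_nil; exact: cc_cst.
under eq_fun do rewrite big_cons.
by case: (boolP (P i)) => // /h hi; exact: ccD.
Qed.
Lemma cc_prod I (r : seq I) (P : pred I) (F : I -> X -> K) x :
  (forall i, P i -> cc (F i) x) -> cc (fun y => \prod_(i <- r | P i) F i y) x.
Proof.
move=> h; elim: r => [|i r ih].
  by under eq_fun do rewrite big_nil; exact: cc_cst.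
under eq_fun do rewrite big_cons.
by case: (boolP (P i)) => // /h hi; exact: ccM.
Qed.
Lemma ccV g x : g x != 0 -> cc g x -> cc (fun y => (g y)^-1) x.
Proof.
move=> gx [a b].
have h y : (g y)^-1 = (complex.Re (g y) / (complex.Re (g y) ^+ 2 + complex.Im (g y) ^+ 2)
   +i* - (complex.Im (g y) / (complex.Re (g y) ^+ 2 + complex.Im (g y) ^+ 2)))%C.
  by case: (g y) => u v.
have d0 : complex.Re (g x) ^+ 2 + complex.Im (g x) ^+ 2 != 0.
  apply: contra gx; rewrite paddr_eq0 ?sqr_ge0// !sqrf_eq0 => /andP[/eqP u /eqP v].
  by apply/eqP; exact: complex_ext.
have cd : {for x, continuous (fun y => (complex.Re (g y) ^+ 2 + complex.Im (g y) ^+ 2)^-1)}.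
  by apply: cvgV => //; apply: (@cvgD _ _ _ _ _ _ _ _ _); rewrite expr2;
   [exact: (cvgM a a)|exact: (cvgM b b)].
split.
  under [X in {for x, continuous X}]eq_fun do rewrite h /=.
  exact: (cvgM a cd).
under [X in {for x, continuous X}]eq_fun do rewrite h /=.
apply: (@cvgN _ _ _ _ _ _ _).
exact: (cvgM b cd).
Qed.
Lemma cc_near g g' x : (\forall y \near x, g y = g' y) -> cc g x -> cc g' x.
Proof.
move=> h; have hx := nbhs_singleton h; move=> [a b]; split.
  rewrite /prop_for /continuous_at /= -hx.
  by apply: cvg_trans a; apply: near_eq_cvg; apply: filterS h => y ->.
rewrite /prop_for /continuous_at /= -hx.
by apply: cvg_trans b; apply: near_eq_cvg; apply: filterS h => y ->.
Qed.
Lemma n1_continuous g x : cc g x -> {for x, continuous (fun y => n1 (g y))}.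
Proof.
move=> [a b]; apply: (@cvgD _ _ _ _ _ _ _ _ _).
  exact: (cvg_norm a).
exact: (cvg_norm b).
Qed.

Definition cm m n (F : X -> 'M[K]_(m, n)) x := forall i j, cc (fun y => F y i j) x.

Lemma cm_cst m n (M : 'M[K]_(m, n)) x : cm (fun=> M) x.
Proof. by move=> i j; exact: cc_cst. Qed.
Lemma cmD m n (F G : X -> 'M[K]_(m, n)) x : cm F x -> cm G x -> cm (fun y => F y + G y) x.
Proof.
by move=> f g i j; under eq_fun do rewrite mxE; exact: ccD.
Qed.
Lemma cmN m n (F : X -> 'M[K]_(m, n)) x : cm F x -> cm (fun y => - F y) x.
Proof.
by move=> f i j; under eq_fun do rewrite mxE; exact: ccN.
Qed.
Lemma cmB m n (F G : X -> 'M[K]_(m, n)) x : cm F x -> cm G x -> cm (fun y => F y - G y) x.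
Proof. by move=> f g; apply: cmD => //; exact: cmN. Qed.
Lemma cm_adj m n (F : X -> 'M[K]_(m, n)) x : cm F x -> cm (fun y => adj (F y)) x.
Proof.
by move=> f i j; under eq_fun do rewrite adjE; exact: ccJ.
Qed.
Lemma cmM m n q (F : X -> 'M[K]_(m, n)) (G : X -> 'M[K]_(n, q)) x :
  cm F x -> cm G x -> cm (fun y => F y *m G y) x.
Proof.
move=> f g i j; under eq_fun do rewrite mxE.
by apply: cc_sum => k _; exact: ccM.
Qed.
Lemma cmZ m n (a : X -> K) (F : X -> 'M[K]_(m, n)) x :
  cc a x -> cm F x -> cm (fun y => a y *: F y) x.
Proof.
by move=> f g i j; under eq_fun do rewrite mxE; exact: ccM.
Qed.
Lemma cc_det n (F : X -> 'M[K]_n) x : cm F x -> cc (fun y => \det (F y)) x.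
Proof.
move=> f; rewrite /determinant; apply: cc_sum => s _; apply: ccM.
  exact: cc_cst.
by apply: cc_prod => i _.
Qed.
(** Cramer's rule: determinant and adjugate are polynomial in the entries. *)
Lemma cm_inv n (F : X -> 'M[K]_n) x : (forall y, F y \in unitmx) ->
  cm F x -> cm (fun y => invmx (F y)) x.
Proof.
move=> u f.
have -> : (fun y => invmx (F y)) = (fun y => (\det (F y))^-1 *: \adj (F y)).
  by apply/funext => y; rewrite /invmx u.
apply: cmZ.
  apply: ccV; last exact: cc_det.
  by have := u x; rewrite unitmxE unitfE.
move=> i j; under eq_fun do rewrite !mxE.
rewrite /cofactor; apply: ccM; first exact: cc_cst.
by apply: cc_det => k l; under eq_fun do rewrite !mxE.
Qed.
Lemma nrm_continuous m n (F : X -> 'M[K]_(m, n)) x :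
  cm F x -> {for x, continuous (fun y => nrm (F y))}.
Proof.
move=> f; rewrite /nrm.
have sumc I (r : seq I) (G : I -> X -> R) : (forall i, {for x, continuous (G i)}) ->
   {for x, continuous (fun y => \sum_(i <- r) G i y)}.
  move=> h; elim: r => [|i r ih].
    by under [X in {for x, continuous X}]eq_fun do rewrite big_nil; exact: cvg_cst.
  under [X in {for x, continuous X}]eq_fun do rewrite big_cons.
  exact: (@cvgD _ _ _ _ _ _ _ _ _ (h i) ih).
by apply: (sumc) => i; apply: (sumc) => j; exact: n1_continuous.
Qed.

End Continuity.

Lemma cm_comp {R : realType} {X Y : topologicalType} m n (F : Y -> 'M[R[i]]_(m, n))
  (f : X -> Y) x : {for x, continuous f} -> cm F (f x) -> cm (fun y => F (f y)) x.
Proof.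
move=> cf h i j; have [a b] := h i j; split.
  exact: (@continuous_comp _ _ _ f _ x cf a).
exact: (@continuous_comp _ _ _ f _ x cf b).
Qed.

(** * Compactness of the base and of balls of vectors *)

Section Compactness.
Context {R : realType} {Om : topologicalType}.
Hypothesis cOm : compact [set: Om].
Local Notation K := R[i].

Lemma compact_lb (Y : topologicalType) (S : set Y) (f : Y -> R) : compact S ->
  (forall y, S y -> {for y, continuous f}) -> (forall y, S y -> 0 < f y) ->
  exists2 e, 0 < e & forall y, S y -> e <= f y.
Proof.
move=> cS cf fp; have [S0|S0] := pselect (S !=set0); last first.
  by exists 1 => // y Sy; exfalso; apply: S0; exists y.
have cf' : {within S, continuous f}.
  by apply: continuous_in_subspaceT => y; rewrite inE => /cf.
have [c cS' h] := compact_EVT_min S0 cS cf'.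
by exists (f c); [apply: fp; rewrite inE in cS'|move=> y Sy; apply: h; rewrite inE].
Qed.

Lemma compact_bound (f : Om -> R) : continuous f ->
  exists2 b, 0 < b & forall w, f w <= b.
Proof.
move=> cf; have [[w0 _]|S0] := pselect ([set: Om] !=set0); last first.
  by exists 1 => // y; exfalso; apply: S0; exists y.
have cf' : {within [set: Om], continuous f} by apply: continuous_subspaceT.
have [c _ h] := compact_EVT_max (ex_intro _ w0 I : [set: Om] !=set0) cOm cf'.
exists (`|f c| + 1); first by rewrite ltr_wpDl.
by move=> w; apply: (le_trans (h w _)); rewrite ?inE//;
  apply: (le_trans (ler_norm _)); rewrite lerDl.
Qed.

Lemma cm_bound m n (F : Om -> 'M[K]_(m, n)) : (forall w, cm F w) ->
  exists2 b, 0 < b & forall w, nrm (F w) <= b.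
Proof. by move=> h; apply: compact_bound => w; exact: nrm_continuous. Qed.

(** Complex vectors have no topology of their own here, so the balls of C^n are parametrized by row
    vectors of R^(2n), whose closed boxes are compact. *)
Definition vec_of n (x : 'rV[R]_(n + n)) : 'cV[K]_n :=
  \col_i (x ord0 (lshift n i) +i* x ord0 (rshift n i))%C.
Definition of_vec n (v : 'cV[K]_n) : 'rV[R]_(n + n) :=
  row_mx (\row_i complex.Re (v i ord0)) (\row_i complex.Im (v i ord0)).
Lemma of_vecK n (v : 'cV[K]_n) : vec_of (of_vec v) = v.
Proof.
apply/matrixP => i j; rewrite mxE (ord1 j) row_mxEl row_mxEr !mxE.
by case: (v i _).
Qed.
Lemma cm_vec_of n (y : Om * 'rV[R]_(n + n)) :
  cm (fun z : Om * 'rV[R]_(n + n) => vec_of z.2) y.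
Proof.
move=> i j; split.
  under [X in {for y, continuous X}]eq_fun do rewrite mxE /=.
  apply: (@continuous_comp _ _ _ snd (fun x : 'rV[R]_(n + n) => x ord0 (lshift n i))).
    exact: cvg_snd.
  exact: coord_continuous.
under [X in {for y, continuous X}]eq_fun do rewrite mxE /=.
apply: (@continuous_comp _ _ _ snd (fun x : 'rV[R]_(n + n) => x ord0 (rshift n i))).
  exact: cvg_snd.
exact: coord_continuous.
Qed.

(** Used with [g] a sum of non-negative continuous defects, whose zero set singles out, for
    instance, the unit vectors in the range of a projection. The constraints define a closed part of
    the compact product of the base with a box. *)
Lemma ball_bundle_lb n (b : R) (f g : Om -> 'cV[K]_n -> R) :
  continuous (fun z : Om * 'rV[R]_(n + n) => f z.1 (vec_of z.2)) ->
  continuous (fun z : Om * 'rV[R]_(n + n) => g z.1 (vec_of z.2)) ->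
  (forall w x, nrm x <= b -> g w x = 0 -> 0 < f w x) ->
  exists2 e, 0 < e & forall w x, nrm x <= b -> g w x = 0 -> e <= f w x.
Proof.
move=> cf cg h.
pose Bx : set 'rV[R]_(n + n) := [set v | forall i, (`[(- b), b]%classic : set R) (v ord0 i)].
have cB : compact Bx.
  by apply: (@rV_compact R _ (fun=> `[(- b), b]%classic)) => i; exact: segment_compact.
pose S := ([set: Om] `*` Bx) `&`
  [set z : Om * 'rV[R]_(n + n) | nrm (vec_of z.2) <= b /\ g z.1 (vec_of z.2) = 0].
have cS : compact S.
  apply: compact_closedI; first exact: compact_setX.
  apply: closedI.
    apply: (@closed_comp _ _ (fun z : Om * 'rV[R]_(n + n) => nrm (vec_of z.2)) [set x : R | x <= b]).
      by move=> z _; exact: (nrm_continuous (F := fun z : Om * 'rV[R]_(n + n) => vec_of z.2) (cm_vec_of z)).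
    exact: closed_le.
  apply: (@closed_comp _ _ (fun z : Om * 'rV[R]_(n + n) => g z.1 (vec_of z.2)) [set x : R | x = 0]).
    by move=> z _; exact: cg.
  exact: closed_eq.
have [y _|y [_ [h1 h2]]|e e0 he] := compact_lb (f := fun z => f z.1 (vec_of z.2)) cS.
- exact: cf.
- exact: h.
exists e => // w x xb gx.
have := he (w, of_vec x); rewrite /= of_vecK; apply.
split; last by rewrite /= of_vecK.
split => // i /=.
have bb j : n1 (x j ord0) <= b by apply: le_trans xb; exact: n1_le_nrm.
rewrite in_itv /= -ler_norml /of_vec mxE; case: fintype.split => j; rewrite mxE.
  by apply: le_trans (bb j); exact: Re_le_n1.
by apply: le_trans (bb j); exact: Im_le_n1.
Qed.

(** The tube lemma for an arbitrary filter: it makes estimates that are local in the base point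
    uniform. *)
Lemma compact_unif (I : Type) (F : set_system I) (P : I -> Om -> Prop) : Filter F ->
  (forall w : Om, \forall w' \near w & i \near F, P i w') ->
  \forall i \near F, forall w, P i w.
Proof.
move=> FF h; move/compact_near_coveringP : (cOm).
move=> /(_ I F P FF (fun x _ => h x)) h'.
by apply: filterS h' => i hi w; exact: hi.
Qed.

End Compactness.

(** * Series *)

Section RealSeries.
Context {R : realType}.

Lemma bounded_series_cvg (s : nat -> R) M : (forall k, 0 <= s k) ->
  (forall n, series s n <= M) -> cvgn (series s).
Proof.
move=> s0 sM; apply: nondecreasing_is_cvgn.
  by apply: nondecreasing_series => k _ _.
by exists M => _ [n _ <-].
Qed.

Lemma abs_series_cvg (a s : nat -> R) M : (forall k, `|a k| <= s k) ->
  (forall n, series s n <= M) -> cvgn (series a).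
Proof.
move=> h sM; apply: normed_cvg; apply: (series_le_cvg _ _ h) => //.
- by move=> k; exact: le_trans (h k).
- by apply: bounded_series_cvg sM => k; exact: le_trans (h k).
Qed.

Lemma abs_series_tail (a s : nat -> R) M l : (forall k, `|a k| <= s k) ->
  (forall n, series s n <= M) -> series a @ \oo --> l ->
  forall n, `|l - series a n| <= limn (series s) - series s n.
Proof.
move=> h sM al n.
have s0 k : 0 <= s k by exact: le_trans (h k).
have cs := bounded_series_cvg s0 sM.
have c1 : (fun k => `|series a k - series a n|) @ \oo --> `|l - series a n|.
  by apply: cvg_norm; apply: cvgB => //; exact: cvg_cst.
have c2 : (fun k => series s k - series s n) @ \oo --> limn (series s) - series s n.
  by apply: cvgB => //; exact: cvg_cst.
apply: (ler_cvg_to c1 c2); near=> k.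
have nk : (n <= k)%N by near: k; exact: nbhs_infty_ge.
rewrite !sub_series nk; apply: (le_trans (ler_norm_sum _ _ _)).
by apply: ler_sum => i _.
Unshelve. all: by end_near. Qed.

Lemma series_tail_small (s : nat -> R) M : (forall k, 0 <= s k) ->
  (forall n, series s n <= M) ->
  forall e, 0 < e -> exists n, limn (series s) - series s n <= e.
Proof.
move=> s0 sM e e0.
have cs := bounded_series_cvg s0 sM.
have /cvgrPdist_le/(_ _ e0)[n _ hn] : series s @ \oo --> limn (series s) by [].
by exists n; apply: le_trans (hn n (leqnn _)); exact: ler_norm.
Qed.

Lemma quotE (f : R -> R) (t h : R) :
  h^-1 *: ((f \o shift t) (h *: 1) - f t) = h^-1 * (f (t + h) - f t).
Proof.
rewrite -[RHS]/(h^-1 *: (f (t + h) - f t)); congr (_ *: (f _ - _)).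
by rewrite /= addrC; congr (_ + _); exact: mulr1.
Qed.

Lemma cvg_le_bound (u : nat -> R) (l M : R) : u @ \oo --> l ->
  (\forall n \near \oo, u n <= M) -> l <= M.
Proof. by move=> ul h; apply: (ler_cvg_to ul (cvg_cst M)). Qed.

Lemma cvg_bsum (J : Type) (r : seq J) (u : J -> nat -> R) (l : J -> R) :
  (forall i, u i @ \oo --> l i) ->
  (fun n => \sum_(i <- r) u i n) @ \oo --> \sum_(i <- r) l i.
Proof.
move=> h; elim: r => [|i r ih].
  by rewrite big_nil; under eq_fun do rewrite big_nil; exact: cvg_cst.
rewrite big_cons; under eq_fun do rewrite big_cons.
exact: cvgD.
Qed.

Lemma is_derive_quotP (f : R -> R) (t l : R) : is_derive t 1 f l <->
  (forall e, 0 < e -> \forall h \near 0^', `|h^-1 * (f (t + h) - f t) - l| <= e).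
Proof.
split.
  move=> [df dfl] e e0.
  have : h^-1 *: ((f \o shift t) (h *: 1) - f t) @[h --> 0^'] --> l.
    by rewrite -dfl; exact: df.
  move=> /cvgrPdist_le/(_ _ e0); apply: filterS => h.
  by rewrite distrC quotE.
move=> H.
have c : h^-1 *: ((f \o shift t) (h *: 1) - f t) @[h --> 0^'] --> l.
  apply/cvgrPdist_le => e e0; apply: filterS (H e e0) => h.
  by rewrite distrC quotE.
apply: DeriveDef; first by apply/cvg_ex; exists l.
exact: cvg_lim c.
Qed.

Lemma ball_in_open (I : set R) t : open I -> I t ->
  exists2 r, 0 < r & forall s, `|s - t| < r -> I s.
Proof.
move=> oI It; have /nbhs_ballP[r /= r0 h] := open_nbhs_nbhs (conj oI It).
by exists r => // s st; apply: h; rewrite /ball /= distrC.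
Qed.

Lemma mean_value_le (f df : R -> R) (t h c : R) :
  (forall s, `|s - t| <= `|h| -> is_derive s 1 f (df s)) ->
  (forall s, `|s - t| <= `|h| -> `|df s| <= c) ->
  `|f (t + h) - f t| <= c * `|h|.
Proof.
have main (a b : R) : a <= b -> (forall s : R, a <= s <= b -> is_derive s 1 f (df s)) ->
    (forall s : R, a <= s <= b -> `|df s| <= c) -> `|f b - f a| <= c * (b - a).
  move=> ab d1 d2.
  have dM x : x \in `]a, b[%R -> is_derive x 1 f (df x).
    by rewrite in_itv /= => /andP[xa xb]; apply: d1; rewrite !ltW.
  have cM : {within `[a, b], continuous f}.
    apply: derivable_within_continuous => x; rewrite in_itv /= => xab.
    by have [] := d1 x xab.
  have [x xab ->] := MVT_segment ab dM cM; rewrite in_itv /= in xab.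
  by rewrite normrM (@ger0_norm _ (b - a)) ?subr_ge0// ler_wpM2r ?subr_ge0// d2.
move=> d1 d2; have [h0|h0] := leP 0 h.
  have e1 s : t <= s <= t + h -> `|s - t| <= `|h|.
    by move=> ?; rewrite (ger0_norm h0) ler_norml; apply/andP; split; lra.
  have /= := main t (t + h) _ (fun s hs => d1 s (e1 s hs)) (fun s hs => d2 s (e1 s hs)).
  have -> : t + h - t = h by ring.
  rewrite (ger0_norm h0); apply; lra.
have e1 s : t + h <= s <= t -> `|s - t| <= `|h|.
  by move=> ?; rewrite (ltr0_norm h0) ler_norml; apply/andP; split; lra.
have /= := main (t + h) t _ (fun s hs => d1 s (e1 s hs)) (fun s hs => d2 s (e1 s hs)).
have -> : t - (t + h) = - h by ring.
rewrite distrC (ltr0_norm h0); apply; lra.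
Qed.

(** By the mean value inequality the tail of the difference quotients is at most the tail of the
    majorant [c], uniformly in the increment; only finitely many terms remain to be
    differentiated. *)
Lemma is_derive_series (f df : nat -> R -> R) (F G : R -> R) (c : nat -> R) M
    (I : set R) t : open I -> I t ->
  (forall k s, I s -> is_derive s 1 (f k) (df k s)) ->
  (forall k s, I s -> `|df k s| <= c k) ->
  (forall n, series c n <= M) ->
  (forall s, I s -> series (fun k => f k s) @ \oo --> F s) ->
  (series (fun k => df k t) @ \oo --> G t) ->
  is_derive t 1 F (G t).
Proof.
move=> oI It d1 d2 cM FI GI; apply/is_derive_quotP => e e0.
have c0 k : 0 <= c k by exact: le_trans (d2 k t It).
have e3 : 0 < e / 3 by rewrite divr_gt0.
have [n hn] := series_tail_small c0 cM e3.
have dP : is_derive t 1 (fun s => \sum_(k < n) f k s) (\sum_(k < n) df k t).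
  have -> : (fun s => \sum_(k < n) f k s) = (\sum_(k < n) f k).
    by apply/funext => s; rewrite fct_sumE.
  by apply: is_derive_sum => k; exact: d1.
have /is_derive_quotP/(_ _ e3) h1 := dP.
have [r r0 hr] := ball_in_open oI It.
have h2 : \forall h \near (0 : R)^', `|h| < r.
  by apply: nbhs_dnbhs; apply/nbhs_ballP; exists r => //= h; rewrite /ball /= sub0r normrN.
have h3 : \forall h \near (0 : R)^', h != 0 by exact: nbhs_dnbhs_neq.
near=> h.
have hr' : `|h| < r by near: h.
have hn0 : h != 0 by near: h.
have hI s : `|s - t| <= `|h| -> I s by move=> hs; apply: hr; exact: le_lt_trans hr'.
have Ith : I (t + h) by apply: hI; rewrite addrC addKr.
have tail : `|(F (t + h) - F t) - (\sum_(k < n) f k (t + h) - \sum_(k < n) f k t)|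
   <= `|h| * (limn (series c) - series c n).
  have hb k : `|f k (t + h) - f k t| <= `|h| * c k.
    rewrite mulrC; apply: (@mean_value_le _ (df k)) => s hs.
      by apply: d1; exact: hI.
    by apply: d2; exact: hI.
  have sE : series (fun k => `|h| * c k) = (fun m => `|h| * series c m).
    by apply/funext => m; rewrite /series /= mulr_sumr.
  have hM m : series (fun k => `|h| * c k) m <= `|h| * M.
    by rewrite sE; apply: ler_wpM2l.
  have hl : series (fun k => f k (t + h) - f k t) @ \oo --> F (t + h) - F t.
    have -> : series (fun k => f k (t + h) - f k t) =
      (fun m => series (fun k => f k (t + h)) m - series (fun k => f k t) m).
      by apply/funext => m; rewrite /series /= -sumrB.
    by apply: cvgB; exact: FI.
  have := abs_series_tail hb hM hl n.
  have -> : limn (series (fun k => `|h| * c k)) = `|h| * limn (series c).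
    rewrite sE; apply: cvg_lim => //; apply: cvgMr.
    exact: (bounded_series_cvg c0 cM).
  by rewrite sE -mulrBr /series /= !big_mkord sumrB.
have tailG : `|G t - \sum_(k < n) df k t| <= e / 3.
  have := abs_series_tail (fun k => d2 k t It) cM GI n.
  by rewrite {1}/series /= big_mkord => h'; apply: (le_trans h').
have h1' : `|h^-1 * (\sum_(k < n) f k (t + h) - \sum_(k < n) f k t) - \sum_(k < n) df k t| <= e / 3.
  by near: h.
set P := \sum_(k < n) f k (t + h) - \sum_(k < n) f k t in tail h1'.
set D := \sum_(k < n) df k t in tailG h1'.
have tail' : `|h^-1 * ((F (t + h) - F t) - P)| <= e / 3.
  rewrite normrM normfV ler_pdivrMl ?normr_gt0//.
  by apply: (le_trans tail); apply: ler_wpM2l.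
have -> : h^-1 * (F (t + h) - F t) - G t =
   h^-1 * ((F (t + h) - F t) - P) + (h^-1 * P - D) - (G t - D) by ring.
have -> : e = e / 3 + e / 3 + e / 3 by field.
apply: (le_trans (ler_normB _ _)); apply: lerD => //.
by apply: (le_trans (ler_normD _ _)); apply: lerD.
Unshelve. all: by end_near. Qed.

End RealSeries.

(** * Cauchy products of truncated power series *)

Section CauchyProduct.
Context {R : realType}.
Implicit Types (x y s r : nat -> R).

Definition cprod x y m := \sum_(i < m.+1) x i * y (m - i)%N.

Lemma cprod_partial x y (k : nat) (th : R) :
  \sum_(m < k) cprod x y m * th ^+ m =
  \sum_(i < k) \sum_(j < k - i) (x i * th ^+ i) * (y j * th ^+ j).
Proof.
transitivity (\sum_(m < k) \sum_(i < k | (i <= m)%N) x i * th ^+ i * (y (m - i)%N * th ^+ (m - i))).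
  apply: eq_bigr => m _; rewrite /cprod mulr_suml.
  rewrite (big_ord_widen_cond k xpredT (fun i => x i * y (m - i)%N * th ^+ m) (ltn_ord m)).
  rewrite big_mkcondl; apply: eq_big => [i|i im]; first by rewrite ltnS.
  move: im; rewrite ltnS => im.
  have -> : th ^+ m = th ^+ i * th ^+ (m - i) by rewrite -exprD subnKC.
  ring.
rewrite (exchange_big_dep xpredT)//=; apply: eq_bigr => i _.
transitivity (\sum_(i <= m < k) x i * th ^+ i * (y (m - i)%N * th ^+ (m - i))).
  by rewrite big_geq_mkord.
rewrite -{1}(add0n (i : nat)) big_addn big_mkord; apply: eq_bigr => j _.
by rewrite addnK.
Qed.

Lemma cprod_majorant s r (k : nat) (th : R) : 0 <= th -> (forall i, 0 <= s i) ->
  (forall i, 0 <= r i) ->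
  \sum_(m < k) cprod s r m * th ^+ m <=
  (\sum_(i < k) s i * th ^+ i) * (\sum_(j < k) r j * th ^+ j).
Proof.
move=> th0 s0 r0; rewrite cprod_partial mulr_suml; apply: ler_sum => i _.
rewrite -mulr_sumr; apply: ler_wpM2l; first by rewrite mulr_ge0 ?exprn_ge0.
rewrite (big_ord_widen k (fun j => r j * th ^+ j) (leq_subr i k)).
rewrite big_mkcond; apply: ler_sum => j _; case: ifP => // _.
by rewrite mulr_ge0 ?exprn_ge0.
Qed.

Lemma cprod_ge0 s r m : (forall i, 0 <= s i) -> (forall i, 0 <= r i) -> 0 <= cprod s r m.
Proof. by move=> s0 r0; apply: sumr_ge0 => i _; rewrite mulr_ge0. Qed.

Lemma cprod_norm x y s r m : (forall i, (i <= m)%N -> `|x i| <= s i) ->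
  (forall i, (i <= m)%N -> `|y i| <= r i) -> `|cprod x y m| <= cprod s r m.
Proof.
move=> xs yr; apply: (le_trans (ler_norm_sum _ _ _)); apply: ler_sum => i _.
by rewrite normrM; apply: ler_pM => //; [apply: xs; rewrite -ltnS|apply: yr; exact: leq_subr].
Qed.

(** The product of the partial sums exceeds the partial Cauchy sum by the terms with i, j < k <= i +
    j; compared with its majorant at radius [th], each of these gains a factor (|u| / th)^k. *)
Lemma cprod_remainder x y s r (k : nat) (th u A B : R) : 0 < th -> `|u| <= th ->
  (forall i, `|x i| <= s i) -> (forall i, `|y i| <= r i) ->
  \sum_(i < k) s i * th ^+ i <= A -> \sum_(i < k) r i * th ^+ i <= B ->
  `|(\sum_(i < k) x i * u ^+ i) * (\sum_(j < k) y j * u ^+ j) -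
    \sum_(m < k) cprod x y m * u ^+ m| <= (`|u| / th) ^+ k * (A * B).
Proof.
move=> th0 uth xs yr hA hB.
have s0 i : 0 <= s i by exact: le_trans (xs i).
have r0 i : 0 <= r i by exact: le_trans (yr i).
have q0 : 0 <= `|u| / th by rewrite divr_ge0// ltW.
have q1 : `|u| / th <= 1 by rewrite ler_pdivrMr// mul1r.
have uE : `|u| = `|u| / th * th by rewrite divfK// gt_eqF.
apply: (@le_trans _ _ ((`|u| / th) ^+ k *
   ((\sum_(i < k) s i * th ^+ i) * (\sum_(j < k) r j * th ^+ j)))); last first.
  apply: ler_wpM2l; first exact: exprn_ge0.
  by apply: ler_pM => //; apply: sumr_ge0 => i _; rewrite mulr_ge0 ?exprn_ge0// ltW.
rewrite cprod_partial mulr_suml -sumrB mulr_suml mulr_sumr.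
apply: (le_trans (ler_norm_sum _ _ _)); apply: ler_sum => i _.
rewrite mulr_sumr mulrA mulr_sumr.
rewrite [X in `|_ - X|](big_ord_widen k
  (fun j => x i * u ^+ i * (y j * u ^+ j)) (leq_subr i k)).
rewrite [X in `|_ - X|]big_mkcond -sumrB.
apply: (le_trans (ler_norm_sum _ _ _)); apply: ler_sum => j _.
case: ifPn => [_|].
  by rewrite subrr normr0 !mulr_ge0 ?exprn_ge0// ltW.
rewrite -leqNgt leq_subLR subr0 => kij.
rewrite !normrM !normrX.
apply: (@le_trans _ _ (s i * `|u| ^+ i * (r j * `|u| ^+ j))).
  by apply: ler_pM; rewrite ?mulr_ge0 ?exprn_ge0//; apply: ler_wpM2r;
     rewrite ?exprn_ge0.
move: q0 q1 uE; move: (`|u| / th) => q q0 q1 ->; rewrite !exprMn.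
have -> : s i * (q ^+ i * th ^+ i) * (r j * (q ^+ j * th ^+ j)) =
   q ^+ (i + j) * (s i * th ^+ i * (r j * th ^+ j)) by rewrite exprD; ring.
rewrite -[leRHS]mulrA; apply: ler_wpM2r.
  by rewrite !mulr_ge0 ?exprn_ge0// ltW.
exact: ler_wiXn2l.
Qed.

End CauchyProduct.

(** * Norms on functions of time and base point *)

Section NormSystems.
Context {R : realType} {Om : topologicalType}.
Implicit Types (g : R -> Om -> R) (M : R).

(* An abstract Banach algebra of functions of (t, w), given by the relation
   "g has norm at most M". *)
Record normsys := NormSys {
  dom : set R;
  bnd : (R -> Om -> R) -> R -> Prop;
  bnd_ext : forall g g' M, (forall t w, dom t -> g t w = g' t w) ->
    bnd g M -> bnd g' M;
  bnd_le : forall g M M', M <= M' -> bnd g M -> bnd g M';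
  bnd_val : forall g M t w, bnd g M -> dom t -> `|g t w| <= M;
  bndD : forall g g' M M', bnd g M -> bnd g' M' ->
    bnd (fun t w => g t w + g' t w) (M + M');
  bndN : forall g M, bnd g M -> bnd (fun t w => - g t w) M;
  bndM : forall g g' M M', bnd g M -> bnd g' M' ->
    bnd (fun t w => g t w * g' t w) (M * M');
  bnd_comp : forall (f : Om -> Om) g M, continuous f -> bnd g M ->
    bnd (fun t w => g t (f w)) M;
  bnd_cst : forall (b : Om -> R) M, continuous b -> 0 <= M ->
    (forall w, `|b w| <= M) -> bnd (fun _ w => b w) M;
  bnd_series : forall (u : nat -> R -> Om -> R) (m : nat -> R) g M,
    (forall k, 0 <= m k) -> (forall n, series m n <= M) ->
    (forall k, bnd (u k) (m k)) ->
    (forall t w, dom t -> series (fun k => u k t w) @ \oo --> g t w) ->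
    bnd g M }.

Section Sup.
Variable D : set R.
Definition sup_bnd g M := 0 <= M /\ forall t w, D t -> `|g t w| <= M.

Program Definition sup_sys := @NormSys D sup_bnd _ _ _ _ _ _ _ _ _.
Next Obligation. by move=> g g' M e [? h]; split=> // t w Dt; rewrite -e// h. Qed.
Next Obligation. by move=> g M M' MM [? h]; split=> [|t w Dt]; [lra|apply: le_trans (h t w Dt) MM]. Qed.
Next Obligation. by move=> g M t w [_ h] Dt; exact: h. Qed.
Next Obligation.
move=> g g' M M' [? h] [? h']; split=> [|t w Dt]; first lra.
by apply: (le_trans (ler_normD _ _)); apply: lerD; [exact: h|exact: h'].
Qed.
Next Obligation. by move=> g M [? h]; split=> // t w Dt; rewrite normrN h. Qed.
Next Obligation.
move=> g g' M M' [? h] [? h']; split=> [|t w Dt]; first exact: mulr_ge0.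
by rewrite normrM ler_pM// ?h ?h'.
Qed.
Next Obligation. by move=> f g M _ [? h]; split=> // t w Dt; exact: h. Qed.
Next Obligation. by move=> b M _ M0 h; split. Qed.
Next Obligation.
move=> u m g M m0 mM h c; split=> [|t w Dt].
  by apply: le_trans (mM 0%N); rewrite /series /= big_geq.
have := abs_series_tail (fun k => (h k).2 t w Dt) mM (c t w Dt) 0.
rewrite {1}/series /= big_geq// subr0 => /le_trans; apply.
rewrite /series /= big_geq// subr0.
apply: limr_le; first exact: bounded_series_cvg mM.
by apply: nearW => n; exact: mM.
Qed.
End Sup.

Section Cn.
Variables (n : nat) (th : R) (I : set R).
Hypothesis th0 : 0 < th.
Hypothesis oI : open I.

(* d m is the m-th t-derivative divided by m!, so that products correspond to
   Cauchy products. *)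
Definition taylor_fam g (d : nat -> R -> Om -> R) :=
  [/\ forall t w, I t -> d 0%N t w = g t w,
      forall m t w, (m < n)%N -> I t ->
        is_derive t 1 (d m ^~ w) (m.+1%:R * d m.+1 t w) &
      forall m t w, (m <= n)%N -> I t ->
        {for (t, w), continuous (fun p : R * Om => d m p.1 p.2)}].

(** For every [th > 0] the weights th^m are compatible with Cauchy products, so bounds multiply. For
    small [th] the orders m > 0 become negligible, and smallness reduces to smallness in the sup
    norm. *)
Definition Cn_bnd g M := exists d s, [/\ taylor_fam g d,
   forall m, 0 <= s m,
   forall m t w, (m <= n)%N -> I t -> `|d m t w| <= s m &
   \sum_(m < n.+1) s m * th ^+ m <= M].

Lemma Cn_ext g g' M : (forall t w, I t -> g t w = g' t w) -> Cn_bnd g M -> Cn_bnd g' M.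
Proof.
move=> e [d [s [[h1 h2 h3] h4 h5 h6]]]; exists d, s; split => //; split => //.
by move=> t w It; rewrite h1// e.
Qed.

Lemma Cn_le g M M' : M <= M' -> Cn_bnd g M -> Cn_bnd g M'.
Proof.
move=> MM [d [s [h1 h4 h5 h6]]]; exists d, s; split => //.
exact: le_trans MM.
Qed.

Lemma Cn_val g M t w : Cn_bnd g M -> I t -> `|g t w| <= M.
Proof.
move=> [d [s [[h1 h2 h3] h4 h5 h6]]] It; rewrite -h1//.
apply: (le_trans (h5 0%N t w (leq0n _) It)); apply: le_trans h6.
rewrite big_ord_recl /= expr0 mulr1 lerDl.
by apply: sumr_ge0 => i _; rewrite mulr_ge0 ?exprn_ge0// ltW.
Qed.

Lemma Cn_D g g' M M' : Cn_bnd g M -> Cn_bnd g' M' ->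
  Cn_bnd (fun t w => g t w + g' t w) (M + M').
Proof.
move=> [d [s [[h1 h2 h3] h4 h5 h6]]] [d' [s' [[h1' h2' h3'] h4' h5' h6']]].
exists (fun m t w => d m t w + d' m t w), (fun m => s m + s' m); split.
- split.
  + by move=> t w It; rewrite h1// h1'.
  + move=> m t w mn It; rewrite mulrDr.
    by apply: is_deriveD; [exact: h2|exact: h2'].
  + move=> m t w mn It.
    exact: (@cvgD _ _ _ _ _ _ _ _ _ (h3 m t w mn It) (h3' m t w mn It)).
- by move=> m; rewrite addr_ge0.
- move=> m t w mn It; apply: (le_trans (ler_normD _ _)).
  by apply: lerD; [exact: h5|exact: h5'].
- under eq_bigr do rewrite mulrDl.
  by rewrite big_split /=; exact: lerD.
Qed.

Lemma Cn_N g M : Cn_bnd g M -> Cn_bnd (fun t w => - g t w) M.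
Proof.
move=> [d [s [[h1 h2 h3] h4 h5 h6]]].
exists (fun m t w => - d m t w), s; split => //.
- split.
  + by move=> t w It; rewrite h1.
  + move=> m t w mn It; rewrite mulrN.
    by apply: is_deriveN; exact: h2.
  + move=> m t w mn It; exact: (@cvgN _ _ _ _ _ _ _ (h3 m t w mn It)).
- by move=> m t w mn It; rewrite normrN; exact: h5.
Qed.

Lemma continuous_bsum (X : topologicalType) (J : Type) (r : seq J) (f : J -> X -> R) x :
  (forall i, {for x, continuous (f i)}) ->
  {for x, continuous (fun y => \sum_(i <- r) f i y)}.
Proof.
move=> h; elim: r => [|i r ih].
  by under [X in {for x, continuous X}]eq_fun do rewrite big_nil; exact: cvg_cst.
under [X in {for x, continuous X}]eq_fun do rewrite big_cons.
exact: (@cvgD _ _ _ _ _ _ _ _ _ (h i) ih).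
Qed.

(** The Leibniz rule for derivatives divided by factorials: the product of orders i and m+1-i arises
    with coefficient i from one factor and m+1-i from the other. *)
Lemma cprod_derive_eq (x y : nat -> R) m :
  \sum_(i < m.+1) (x i * ((m - i).+1%:R * y (m - i).+1%N) + y (m - i)%N * (i.+1%:R * x i.+1)) =
  m.+1%:R * cprod x y m.+1.
Proof.
rewrite /cprod mulr_sumr big_split /=.
transitivity (\sum_(i < m.+2) ((m.+1 - i)%:R * (x i * y (m.+1 - i)%N) +
    i%:R * (x i * y (m.+1 - i)%N))); last first.
  apply: eq_bigr => i _; rewrite -mulrDl -natrD subnK//.
  by rewrite -ltnS.
rewrite big_split /=; congr (_ + _).
  rewrite [RHS]big_ord_recr /= subnn mul0r addr0; apply: eq_bigr => i _.
  rewrite subSn; first ring.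
  by rewrite -ltnS.
rewrite [RHS]big_ord_recl /= mul0r add0r; apply: eq_bigr => i _.
by rewrite /bump /= add1n subSS; ring.
Qed.

Lemma Cn_M g g' M M' : Cn_bnd g M -> Cn_bnd g' M' ->
  Cn_bnd (fun t w => g t w * g' t w) (M * M').
Proof.
move=> [d [s [[h1 h2 h3] h4 h5 h6]]] [d' [s' [[h1' h2' h3'] h4' h5' h6']]].
exists (fun m t w => cprod (d ^~ t ^~ w) (d' ^~ t ^~ w) m), (cprod s s'); split.
- split.
  + by move=> t w It; rewrite /cprod big_ord1 h1// h1'.
  + move=> m t w mn It; rewrite -cprod_derive_eq.
    have -> : (fun u => cprod (d ^~ u ^~ w) (d' ^~ u ^~ w) m) =
      \sum_(i < m.+1) (d i ^~ w * d' (m - i)%N ^~ w).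
      by apply/funext => u; rewrite fct_sumE.
    apply: is_derive_sum => i.
    have im : (i <= m)%N by rewrite -ltnS.
    apply: is_deriveM; [apply: h2|apply: h2'] => //; first exact: leq_ltn_trans mn.
    by apply: leq_ltn_trans mn; exact: leq_subr.
  + move=> m t w mn It; rewrite /cprod; apply: continuous_bsum => i.
    have im : (i <= m)%N by rewrite -ltnS.
    apply: (cvgM (h3 i t w _ It) (h3' (m - i)%N t w _ It)); first exact: leq_trans mn.
    by apply: leq_trans mn; exact: leq_subr.
- by move=> m; exact: cprod_ge0.
- move=> m t w mn It; apply: cprod_norm => i im; [apply: h5|apply: h5'] => //;
  exact: leq_trans mn.
- apply: (le_trans (cprod_majorant _ (ltW th0) h4 h4')).
  by apply: ler_pM => //; apply: sumr_ge0 => i _; rewrite mulr_ge0 ?exprn_ge0// ltW.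
Qed.

Lemma Cn_comp (f : Om -> Om) g M : continuous f -> Cn_bnd g M ->
  Cn_bnd (fun t w => g t (f w)) M.
Proof.
move=> cf [d [s [[h1 h2 h3] h4 h5 h6]]].
exists (fun m t w => d m t (f w)), s; split => //; last by move=> *; exact: h5.
split.
- by move=> t w It; rewrite h1.
- by move=> m t w mn It; exact: (h2 m t (f w)).
- move=> m t w mn It.
  apply: (@continuous_comp _ _ _ (fun p : R * Om => (p.1, f p.2))
    (fun p : R * Om => d m p.1 p.2)); last exact: h3.
  apply: (@cvg_pair _ _ _ _ (nbhs t) (nbhs (f w))); first exact: cvg_fst.
  by apply: (@cvg_comp _ _ _ snd f); [exact: cvg_snd|exact: cf].
Qed.

Lemma Cn_cst (b : Om -> R) M : continuous b -> 0 <= M ->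
  (forall w, `|b w| <= M) -> Cn_bnd (fun _ w => b w) M.
Proof.
move=> cb M0 h.
exists (fun m _ w => if m == 0%N then b w else 0), (fun m => if m == 0%N then M else 0); split.
- split => //.
  + by move=> m t w mn It; rewrite mulr0; exact: is_derive_cst.
  + move=> [|m] t w mn It /=; last exact: cvg_cst.
    by apply: (@continuous_comp _ _ _ snd b); [exact: cvg_snd|exact: cb].
- by move=> [].
- by move=> [|m] t w mn It //=; rewrite normr0.
- rewrite big_ord_recl /= expr0 mulr1 big1 ?addr0// => i _.
  by rewrite /= mul0r.
Qed.

Lemma Cn_series (u : nat -> R -> Om -> R) (m : nat -> R) g M :
  (forall k, 0 <= m k) -> (forall n, series m n <= M) ->
  (forall k, Cn_bnd (u k) (m k)) ->
  (forall t w, I t -> series (fun k => u k t w) @ \oo --> g t w) ->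
  Cn_bnd g M.
Proof.
move=> m0 mM H ug.
have /choice[d /choice[s hds]] := H.
have M0 : 0 <= M by apply: le_trans (mM 0%N); rewrite /series /= big_geq.
(* A single term of the weighted sum is at most the whole. So every order j has its own majorant,
   summable in k with sum at most M / th^j, and the series may be differentiated term by term. *)
have skj k j : (j <= n)%N -> s k j <= m k / th ^+ j.
  move=> jn; have [_ s0 _ hs] := hds k; rewrite ler_pdivlMr ?exprn_gt0//.
  apply: le_trans hs; rewrite -ltnS in jn.
  rewrite (bigD1 (Ordinal jn))//= lerDl.
  by apply: sumr_ge0 => i _; rewrite mulr_ge0 ?exprn_ge0// ltW.
have s0 k j : 0 <= s k j by have [_ h _ _] := hds k.
have sM j N : (j <= n)%N -> series (s ^~ j) N <= M / th ^+ j.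
  move=> jn; rewrite ler_pdivlMr ?exprn_gt0//; apply: le_trans (mM N).
  rewrite /series /= mulr_suml; apply: ler_sum => k _.
  by rewrite -ler_pdivlMr ?exprn_gt0//; exact: skj.
have dle k j t w : (j <= n)%N -> I t -> `|d k j t w| <= s k j.
  by have [_ _ h _] := hds k; exact: h.
pose D j t w := limn (series (fun k => d k j t w)).
have cD j t w : (j <= n)%N -> I t -> series (fun k => d k j t w) @ \oo --> D j t w.
  move=> jn It; apply: (abs_series_cvg (s := s ^~ j) (M := M / th ^+ j)) => N.
    exact: dle.
  exact: sM.
have tl j t w N : (j <= n)%N -> I t -> `|D j t w - series (fun k => d k j t w) N|
    <= limn (series (s ^~ j)) - series (s ^~ j) N.
  by move=> jn It; apply: (abs_series_tail (fun k => dle k j t w jn It) (fun N => sM j N jn)); exact: cD.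
(* Beyond order n nothing bounds the majorants, so their sum is replaced there by the default 0. *)
exists D, (fun j => if (j <= n)%N then limn (series (s ^~ j)) else 0); split.
- split.
  + move=> t w It; rewrite /D; apply: cvg_lim => //.
    suff -> : (fun k => d k 0 t w) = (fun k => u k t w) by exact: ug.
    by apply/funext => k; have [[h _ _] _ _ _] := hds k; rewrite h.
  + move=> j t w jn It.
    apply: (@is_derive_series _ (fun k s => d k j s w) (fun k s => j.+1%:R * d k j.+1 s w)
      (D j ^~ w) (fun s => j.+1%:R * D j.+1 s w) (fun k => j.+1%:R * s k j.+1)
      (j.+1%:R * (M / th ^+ j.+1)) I) => //.
    * by move=> k r Ir; have [[_ h _] _ _ _] := hds k; exact: h.
    * by move=> k r Ir; rewrite normrM ger0_norm// ler_wpM2l// dle.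
    * move=> N; rewrite /series /= -mulr_sumr ler_wpM2l//.
      exact: (sM j.+1 N).
    * by move=> r Ir; apply: cD => //; exact: ltnW.
    * have -> : series (fun k => j.+1%:R * d k j.+1 t w) =
         (fun N => j.+1%:R * series (fun k => d k j.+1 t w) N).
         by apply/funext => N; rewrite /series /= mulr_sumr.
      by apply: cvgMr; exact: cD.
  + move=> j t w jn It; apply/cvgrPdist_le => e e0.
    have e3 : 0 < e / 3 by rewrite divr_gt0.
    have [N hN] := series_tail_small (fun k => s0 k j) (fun N => sM j N jn) e3.
    have tl' r v : I r -> `|D j r v - series (fun k => d k j r v) N| <= e / 3.
      by move=> Ir; exact: le_trans (tl j r v N jn Ir) hN.
    have cP : {for (t, w), continuous (fun p : R * Om => series (fun k => d k j p.1 p.2) N)}.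
      rewrite /series /=; apply: continuous_bsum => k.
      by have [[_ _ h] _ _ _] := hds k; exact: h.
    have /cvgrPdist_le/(_ _ e3) h1 := cP.
    have h2 : \forall p \near (t, w), I p.1.
      have : \forall x \near t, I x by exact: open_nbhs_nbhs.
      by move=> h2; apply: (@cvg_fst _ _ (nbhs t) (nbhs w) _ _ h2).
    near=> p.
    have Ip : I p.1 by near: p.
    have h1p : `|series (fun k => d k j t w) N - series (fun k => d k j p.1 p.2) N| <= e / 3.
      by near: p.
    rewrite /=.
    have -> : D j t w - D j p.1 p.2 = (D j t w - series (fun k => d k j t w) N)
       + (series (fun k => d k j t w) N - series (fun k => d k j p.1 p.2) N)
       - (D j p.1 p.2 - series (fun k => d k j p.1 p.2) N) by ring.
    have -> : e = e / 3 + e / 3 + e / 3 by field.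
    apply: (le_trans (ler_normB _ _)); apply: lerD; last exact: tl'.
    by apply: (le_trans (ler_normD _ _)); apply: lerD => //; exact: tl'.
- move=> j; case: ifP => // jn; apply: limr_ge.
    by apply: (bounded_series_cvg (fun k => s0 k j) (fun N => sM j N jn)).
  by apply: nearW => N; apply: sumr_ge0.
- move=> j t w jn It; rewrite jn.
  have := tl j t w 0%N jn It.
  by rewrite /series /= !big_geq// !subr0.
- have c : (fun N => \sum_(j < n.+1) series (s ^~ j) N * th ^+ j) @ \oo -->
      \sum_(j < n.+1) (if (j <= n)%N then limn (series (s ^~ j)) else 0) * th ^+ j.
    apply: cvg_bsum => j; apply: cvgMl.
    have jn : (j <= n)%N by rewrite -ltnS.
    rewrite jn.
    exact: (bounded_series_cvg (fun k => s0 k j) (fun N => sM j N jn)).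
  apply: (cvg_le_bound c); apply: nearW => N.
  apply: le_trans (mM N).
  rewrite /series /=.
  under eq_bigr do rewrite mulr_suml.
  rewrite exchange_big /=; apply: ler_sum => k _.
  by have [_ _ _ h] := hds k.
Unshelve. all: by end_near. Qed.

Definition Cn_sys := NormSys Cn_ext Cn_le Cn_val Cn_D Cn_N Cn_M Cn_comp Cn_cst Cn_series.

End Cn.

Section Analytic.
Variables (t0 r : R).
Hypothesis r0 : 0 < r.

(** Norm of a power series at [t0] whose coefficients have a majorant uniform in w. Continuity in w
    is left to the C^n norms, which are controlled for the class C^omega as well. *)
Definition an_bnd g M := exists (d : nat -> Om -> R) (s : nat -> R), [/\
   forall m, 0 <= s m,
   forall m w, `|d m w| <= s m,
   forall k, \sum_(m < k) s m * r ^+ m <= M &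
   forall t w, `|t - t0| < r ->
     (fun k => \sum_(m < k) d m w * (t - t0) ^+ m) @ \oo --> g t w].

Lemma an_bnd0 g M : an_bnd g M -> 0 <= M.
Proof. by move=> [d [s [_ _ h _]]]; apply: le_trans (h 0%N); rewrite big_ord0. Qed.

(** A term of order m >= k satisfies |u|^m <= (|u| / r)^k r^m, so the tail is controlled by the norm
    at radius [r]. *)
Lemma an_remainder (x : nat -> R) (s : nat -> R) M u l (k : nat) :
  (forall m, `|x m| <= s m) -> (forall k, \sum_(m < k) s m * r ^+ m <= M) ->
  `|u| < r -> (fun k => \sum_(m < k) x m * u ^+ m) @ \oo --> l ->
  `|l - \sum_(m < k) x m * u ^+ m| <= (`|u| / r) ^+ k * M.
Proof.
move=> xs sM ur xl.
have q0 : 0 <= `|u| / r by rewrite divr_ge0// ltW.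
have q1 : `|u| / r <= 1 by rewrite ler_pdivrMr// mul1r ltW.
have uE : `|u| = `|u| / r * r by rewrite divfK// gt_eqF.
have c : (fun K => `|\sum_(m < K) x m * u ^+ m - \sum_(m < k) x m * u ^+ m|) @ \oo -->
   `|l - \sum_(m < k) x m * u ^+ m|.
  by apply: cvg_norm; apply: cvgB => //; exact: cvg_cst.
apply: (cvg_le_bound c); near=> K.
have kK : (k <= K)%N by near: K; exact: nbhs_infty_ge.
rewrite -(big_mkord xpredT (fun m => x m * u ^+ m)).
rewrite -[X in `|_ - X|](big_mkord xpredT (fun m => x m * u ^+ m)).
rewrite [X in `|X - _|](big_cat_nat (n := k))//= addrAC subrr add0r.
apply: (@le_trans _ _ ((`|u| / r) ^+ k * \sum_(m < K) s m * r ^+ m)); last first.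
  by apply: ler_wpM2l => //; exact: exprn_ge0.
rewrite -(big_mkord xpredT (fun m => s m * r ^+ m)).
rewrite [X in _ <= _ * X](big_cat_nat (n := k))//= mulrDr.
apply: (@le_trans _ _ ((`|u| / r) ^+ k * \sum_(k <= m < K) s m * r ^+ m)); last first.
  rewrite lerDr mulr_ge0 ?exprn_ge0//; apply: sumr_ge0 => i _.
  rewrite mulr_ge0 ?exprn_ge0//; [exact: le_trans (xs i)|exact: ltW].
rewrite mulr_sumr; apply: (le_trans (ler_norm_sum _ _ _)).
rewrite big_nat [leRHS]big_nat; apply: ler_sum => i /andP[ki iK].
rewrite normrM normrX.
apply: (@le_trans _ _ (s i * `|u| ^+ i)); first by rewrite ler_wpM2r ?exprn_ge0.
rewrite {1}uE; move: q0 q1; move: (`|u| / r) => q q0 q1.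
rewrite exprMn mulrCA; apply: ler_wpM2r; last exact: ler_wiXn2l.
by rewrite mulr_ge0 ?exprn_ge0//; [exact: le_trans (xs i)|exact: ltW].
Unshelve. all: by end_near. Qed.

Lemma geo0 (u M : R) : `|u| < r -> (fun k => (`|u| / r) ^+ k * M) @ \oo --> 0.
Proof.
move=> ur; rewrite -(mul0r M); apply: cvgMl.
have q1 : Num.norm (`|u| / r) < 1.
  rewrite ger0_norm; first by rewrite ltr_pdivrMr// mul1r.
  by rewrite divr_ge0// ltW.
have := cvg_geometric 1 q1.
rewrite /geometric /=.
under eq_fun do rewrite mul1r.
by [].
Qed.

Program Definition an_sys := @NormSys [set t | `|t - t0| < r] an_bnd _ _ _ _ _ _ _ _ _.
Next Obligation.
move=> g g' M e [d [s [h1 h2 h3 h4]]]; exists d, s; split => // t w tr.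
by rewrite -e//; exact: h4.
Qed.
Next Obligation.
move=> g M M' MM [d [s [h1 h2 h3 h4]]]; exists d, s; split => // k.
exact: le_trans MM.
Qed.
Next Obligation.
move=> g M t w [d [s [h1 h2 h3 h4]]] tr.
have := an_remainder 0%N (h2 ^~ w) h3 tr (h4 t w tr).
by rewrite big_ord0 subr0 expr0 mul1r.
Qed.
Next Obligation.
move=> g g' M M' [d [s [h1 h2 h3 h4]]] [d' [s' [h1' h2' h3' h4']]].
exists (fun m w => d m w + d' m w), (fun m => s m + s' m); split.
- by move=> m; rewrite addr_ge0.
- by move=> m w; apply: (le_trans (ler_normD _ _)); exact: lerD.
- move=> k; under eq_bigr do rewrite mulrDl.
  by rewrite big_split; exact: lerD.
- move=> t w tr; under eq_fun do under eq_bigr do rewrite mulrDl.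
  under eq_fun do rewrite big_split /=.
  by apply: cvgD; [exact: h4|exact: h4'].
Qed.
Next Obligation.
move=> g M [d [s [h1 h2 h3 h4]]]; exists (fun m w => - d m w), s; split => //.
- by move=> m w; rewrite normrN.
- move=> t w tr; under eq_fun do under eq_bigr do rewrite mulNr.
  under eq_fun do rewrite sumrN.
  by apply: cvgN; exact: h4.
Qed.
Next Obligation.
move=> g g' M M' H H'; have M0 := an_bnd0 H; have M0' := an_bnd0 H'.
move: H H' => [d [s [h1 h2 h3 h4]]] [d' [s' [h1' h2' h3' h4']]].
exists (fun m w => cprod (d ^~ w) (d' ^~ w) m), (cprod s s'); split.
- by move=> m; exact: cprod_ge0.
- by move=> m w; exact: cprod_norm.
- move=> k; apply: (le_trans (cprod_majorant _ (ltW r0) h1 h1')).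
  by apply: ler_pM => //; apply: sumr_ge0 => i _; rewrite mulr_ge0 ?exprn_ge0// ltW.
- move=> t w tr.
  have c1 := cvgM (h4 t w tr) (h4' t w tr).
  (* The partial Cauchy sums are the products of the partial sums minus a defect, which tends to 0
     by [cprod_remainder] and [geo0]. *)
  have -> : (fun k => \sum_(m < k) cprod (d^~ w) (d'^~ w) m * (t - t0) ^+ m) =
    (fun k => (\sum_(m < k) d m w * (t - t0) ^+ m) * (\sum_(m < k) d' m w * (t - t0) ^+ m)
    - ((\sum_(m < k) d m w * (t - t0) ^+ m) * (\sum_(m < k) d' m w * (t - t0) ^+ m)
       - \sum_(m < k) cprod (d^~ w) (d'^~ w) m * (t - t0) ^+ m)).
    by apply/funext => k; ring.
  rewrite -[X in _ --> X]subr0; apply: cvgB; first exact: c1.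
  apply: norm_cvg0; apply: (@squeeze_cvgr _ _ _ _ (fun=> 0)
    (fun k => (`|t - t0| / r) ^+ k * (M * M'))).
  + apply: nearW => k; rewrite normr_ge0 /=.
    by apply: cprod_remainder => //; exact: ltW.
  + exact: cvg_cst.
  + exact: geo0.
Qed.
Next Obligation.
move=> f g M cf [d [s [h1 h2 h3 h4]]]; exists (fun m w => d m (f w)), s; split => //.
by move=> t w tr; exact: h4.
Qed.
Next Obligation.
move=> b M cb M0 h.
exists (fun m w => if m == 0%N then b w else 0), (fun m => if m == 0%N then M else 0); split.
- by move=> [].
- by move=> [|m] w //=; rewrite normr0.
- case=> [|k]; first by rewrite big_ord0.
  rewrite big_ord_recl /= expr0 mulr1 big1 ?addr0// => i _.
  by rewrite /= mul0r.
- move=> t w tr; apply: cvg_near_cst; exists 1%N => // -[//|k] _.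
  rewrite /= big_ord_recl /= expr0 mulr1 big1 ?addr0// => i _.
  by rewrite /= mul0r.
Qed.
Next Obligation.
move=> u m g M m0 mM H ug.
have /choice[d /choice[s hds]] := H.
have M0 : 0 <= M by apply: le_trans (mM 0%N); rewrite /series /= big_geq.
have s0 k j : 0 <= s k j by have [h _ _ _] := hds k.
have skj k j : s k j <= m k / r ^+ j.
  have [_ _ hs _] := hds k; rewrite ler_pdivlMr ?exprn_gt0//.
  apply: le_trans (hs j.+1); rewrite big_ord_recr /= lerDr.
  by apply: sumr_ge0 => i _; rewrite mulr_ge0 ?exprn_ge0// ltW.
have sM j N : series (s ^~ j) N <= M / r ^+ j.
  rewrite ler_pdivlMr ?exprn_gt0//; apply: le_trans (mM N).
  rewrite /series /= mulr_suml; apply: ler_sum => k _.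
  by rewrite -ler_pdivlMr ?exprn_gt0//; exact: skj.
have dle k j w : `|d k j w| <= s k j by have [_ h _ _] := hds k.
pose D j w := limn (series (fun k => d k j w)).
have cD j w : series (fun k => d k j w) @ \oo --> D j w.
  exact: (abs_series_cvg (fun k => dle k j w) (sM j)).
exists D, (fun j => limn (series (s ^~ j))); split.
- move=> j; apply: limr_ge.
    exact: (bounded_series_cvg (fun k => s0 k j) (sM j)).
  by apply: nearW => N; apply: sumr_ge0.
- move=> j w; have := abs_series_tail (fun k => dle k j w) (sM j) (cD j w) 0%N.
  by rewrite /series /= !big_geq// !subr0.
- move=> K.
  have c : (fun N => \sum_(j < K) series (s ^~ j) N * r ^+ j) @ \oo -->
      \sum_(j < K) limn (series (s ^~ j)) * r ^+ j.
    apply: cvg_bsum => j; apply: cvgMl.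
    exact: (bounded_series_cvg (fun k => s0 k j) (sM j)).
  apply: (cvg_le_bound c); apply: nearW => N.
  apply: le_trans (mM N).
  rewrite /series /=.
  under eq_bigr do rewrite mulr_suml.
  rewrite exchange_big /=; apply: ler_sum => k _.
  by have [_ _ h _] := hds k; exact: h.
- move=> t w tr.
  (* The remainders of the [u k] share the factor (|t - t0| / r)^K; their sum over k gives the
     remainder of the limit. *)
  suff rem K : `|g t w - \sum_(j < K) D j w * (t - t0) ^+ j| <= (`|t - t0| / r) ^+ K * M.
    apply: cvg_sub0 (cvg_cst (g t w)); rewrite /=.
    apply: norm_cvg0; apply: (@squeeze_cvgr _ _ _ _ (fun=> 0)
      (fun k => (`|t - t0| / r) ^+ k * M)); [|exact: cvg_cst|exact: geo0].
    apply: nearW => k; rewrite normr_ge0 /= distrC; exact: rem.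
  have c : (fun N => `|\sum_(k < N) (u k t w - \sum_(j < K) d k j w * (t - t0) ^+ j)|) @ \oo
     --> `|g t w - \sum_(j < K) D j w * (t - t0) ^+ j|.
    apply: cvg_norm.
    have -> : (fun N => \sum_(k < N) (u k t w - \sum_(j < K) d k j w * (t - t0) ^+ j)) =
      (fun N => series (fun k => u k t w) N -
        \sum_(j < K) series (fun k => d k j w) N * (t - t0) ^+ j).
      apply/funext => N; rewrite sumrB /series /= !big_mkord; congr (_ - _).
      rewrite exchange_big /=; apply: eq_bigr => j _.
      by rewrite mulr_suml big_mkord.
    apply: cvgB; first exact: ug.
    by apply: cvg_bsum => j; apply: cvgMl; exact: cD.
  apply: (cvg_le_bound c); apply: nearW => N.
  apply: (le_trans (ler_norm_sum _ _ _)).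
  apply: (@le_trans _ _ (\sum_(k < N) (`|t - t0| / r) ^+ K * m k)).
    apply: ler_sum => k _; have [_ h2 h3 h4] := hds k.
    exact: (an_remainder K (h2 ^~ w) h3 tr (h4 t w tr)).
  rewrite -mulr_sumr; apply: ler_wpM2l.
    by rewrite exprn_ge0// divr_ge0// ltW.
  by have := mM N; rewrite /series /= big_mkord.
Qed.

End Analytic.
End NormSystems.

(** * Norms of matrix functions *)

Section MatrixNorms.
Context {R : realType} {Om : topologicalType}.
Local Notation K := R[i].
Local Notation normsys := (@normsys R Om).
Variable S : normsys.

Definition bndC (g : R -> Om -> K) (M : R) :=
  bnd S (fun t w => complex.Re (g t w)) M /\ bnd S (fun t w => complex.Im (g t w)) M.

Lemma bndC_eq g g' M : (forall t w, g t w = g' t w) -> bndC g M -> bndC g' M.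
Proof. by move=> e [a b]; split; [apply: bnd_ext a|apply: bnd_ext b] => t w _; rewrite e. Qed.
Lemma bndC_D g g' M M' : bndC g M -> bndC g' M' ->
  bndC (fun t w => g t w + g' t w) (M + M').
Proof.
move=> [a b] [a' b']; split.
  by apply: bnd_ext (bndD a a') => t w _; rewrite ReD.
by apply: bnd_ext (bndD b b') => t w _; rewrite ImD.
Qed.
Lemma bndC_N g M : bndC g M -> bndC (fun t w => - g t w) M.
Proof.
move=> [a b]; split.
  by apply: bnd_ext (bndN a) => t w _; rewrite ReN.
by apply: bnd_ext (bndN b) => t w _; rewrite ImN.
Qed.
Lemma bndC_J g M : bndC g M -> bndC (fun t w => (g t w)^*%C) M.
Proof.
move=> [a b]; split.
  by apply: bnd_ext a => t w _; rewrite ReJ.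
by apply: bnd_ext (bndN b) => t w _; rewrite ImJ.
Qed.
Lemma bndC_M g g' M M' : bndC g M -> bndC g' M' ->
  bndC (fun t w => g t w * g' t w) (2 * (M * M')).
Proof.
move=> [a b] [a' b']; rewrite mulr_natl mulr2n; split.
  by apply: bnd_ext (bndD (bndM a a') (bndN (bndM b b'))) => t w _; rewrite RecM.
by apply: bnd_ext (bndD (bndM a b') (bndM b a')) => t w _; rewrite ImcM.
Qed.
Lemma bndC_cst (b : Om -> K) M : (forall w, cplx_continuous_at b w) -> 0 <= M ->
  (forall w, n1 (b w) <= M) -> bndC (fun _ => b) M.
Proof.
move=> cb M0 h; split.
  apply: (@bnd_cst _ _ S (fun w => complex.Re (b w))) => // w.
    by have [] := cb w.
  exact: le_trans (Re_le_n1 _) (h w).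
apply: (@bnd_cst _ _ S (fun w => complex.Im (b w))) => // w.
  by have [] := cb w.
exact: le_trans (Im_le_n1 _) (h w).
Qed.
Lemma bndC_0 : bndC (fun _ _ => 0) 0.
Proof. by apply: (bndC_cst (b := fun=> 0)) => // w; [exact: cc_cst|rewrite n1_0]. Qed.
Lemma bndC_sum (k : nat) (g : 'I_k -> R -> Om -> K) M :
  (forall i, bndC (g i) M) -> bndC (fun t w => \sum_i g i t w) (k%:R * M).
Proof.
elim: k g => [|k ih] g h.
  by rewrite mul0r; apply: bndC_eq bndC_0 => t w; rewrite big_ord0.
have /= h1 := ih (fun i => g (lift ord0 i)) (fun i => h _).
have -> : k.+1%:R * M = M + k%:R * M by rewrite -natr1 mulrDl mul1r addrC.
by apply: bndC_eq (bndC_D (h ord0) h1) => t w; rewrite big_ord_recl.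
Qed.
Lemma bndC_le g M M' : M <= M' -> bndC g M -> bndC g M'.
Proof. by move=> MM [a b]; split; exact: bnd_le MM _. Qed.

Context {N : nat}.
Implicit Types F G : R -> Om -> 'M[K]_N.

(** The bound is entrywise, so a matrix product costs a factor 2N: 2 for complex multiplication by
    real and imaginary parts, N for the sum over the inner index. *)
Definition bndX F M := forall i j, bndC (fun t w => F t w i j) M.

Lemma bndX_eq F G M : (forall t w, F t w = G t w) -> bndX F M -> bndX G M.
Proof. by move=> e h i j; apply: bndC_eq (h i j) => t w; rewrite e. Qed.
Lemma bndX_le F M M' : M <= M' -> bndX F M -> bndX F M'.
Proof. by move=> MM h i j; exact: bndC_le MM (h i j). Qed.
Lemma bndX_D F G M M' : bndX F M -> bndX G M' -> bndX (fun t w => F t w + G t w) (M + M').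
Proof. by move=> a b i j; apply: bndC_eq (bndC_D (a i j) (b i j)) => t w; rewrite mxE. Qed.
Lemma bndX_N F M : bndX F M -> bndX (fun t w => - F t w) M.
Proof. by move=> a i j; apply: bndC_eq (bndC_N (a i j)) => t w; rewrite mxE. Qed.
Lemma bndX_adj F M : bndX F M -> bndX (fun t w => adj (F t w)) M.
Proof. by move=> a i j; apply: bndC_eq (bndC_J (a j i)) => t w; rewrite adjE. Qed.
Lemma bndX_comp (f : Om -> Om) F M : continuous f -> bndX F M -> bndX (fun t w => F t (f w)) M.
Proof.
move=> cf h i j; have [a b] := h i j; split.
  exact: (bnd_comp cf a).
exact: (bnd_comp cf b).
Qed.
Lemma bndX_cst (b : Om -> 'M[K]_N) M : (forall w, cm b w) -> 0 <= M ->
  (forall w, nrm (b w) <= M) -> bndX (fun _ => b) M.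
Proof.
move=> cb M0 h i j; apply: (bndC_cst (b := fun w => b w i j)) => // w.
  exact: cb.
exact: le_trans (n1_le_nrm _ _ _) (h w).
Qed.
Lemma bndX_M F G M M' : bndX F M -> bndX G M' ->
  bndX (fun t w => F t w *m G t w) (N%:R * (2 * (M * M'))).
Proof.
move=> a b i j; apply: bndC_eq (bndC_sum (fun k => bndC_M (a i k) (b k j))) => t w.
by rewrite mxE.
Qed.
(** Domination bounds only the product of [nrm (D w)] and [nrm (a w)] at one and the same w, while
    the suprema of the two factors may have a large product. So the outer factors, which do not
    depend on t, are merged into one scalar coefficient before the norm is taken. *)
Lemma bndX_sandwich (D a : Om -> 'M[K]_N) F la M :
  (forall w, cm D w) -> (forall w, cm a w) -> 0 <= la ->
  (forall w, nrm (D w) * nrm (a w) <= la) -> bndX F M ->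
  bndX (fun t w => D w *m F t w *m a w) (N%:R * (N%:R * (2 * (la * M)))).
Proof.
move=> cD ca la0 h hF i j.
have hc k l : bndC (fun _ w => D w i k * a w l j) la.
  apply: (bndC_cst (b := fun w => D w i k * a w l j)) => //= w.
    by apply: ccM; [exact: cD|exact: ca].
  apply: (le_trans (n1M _ _)); apply: le_trans (h w).
  by apply: ler_pM; rewrite ?n1_ge0 ?n1_le_nrm.
apply: bndC_eq (bndC_sum (fun k => bndC_sum (fun l => bndC_M (hc k l) (hF k l)))) => t w.
rewrite mxE exchange_big; apply: eq_bigr => l _.
by rewrite mxE mulr_suml; apply: eq_bigr => k _; ring.
Qed.
Lemma bndX_val F M t w : bndX F M -> dom S t -> nrm (F t w) <= (N * N)%:R * (M + M).
Proof.
move=> h Dt; apply: nrm_le_n1 => i j; have [a b] := h i j.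
by apply: lerD; [exact: (bnd_val w a)|exact: (bnd_val w b)].
Qed.
End MatrixNorms.

(** * Smallness and fixed points in all norms at once *)

Section Small.
Context {R : realType} {Om : topologicalType}.
Hypothesis cOm : compact [set: Om].
Local Notation K := R[i].
Local Notation normsys := (@normsys R Om).
Context {N : nat}.
Variable Delta : R -> Om -> 'M[K]_N.
Implicit Types F G X Y : R -> Om -> 'M[K]_N.

(* The norm systems in which Delta is small form a filter; estimates along it
   hold simultaneously for all regularity classes. *)
Definition nsys_filter : set_system normsys :=
  [set P | exists2 d, 0 < d & forall S, bndX S Delta d -> P S].

Global Instance nsys_filterP : Filter nsys_filter.
Proof.
split; first by exists 1.
  move=> P Q [d d0 hd] [e e0 he]; exists (Num.min d e); first by rewrite lt_min d0.
  move=> S hS; split; [apply: hd|apply: he]; apply: bndX_le hS.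
    by rewrite ge_min lexx.
  by rewrite ge_min lexx orbT.
by move=> P Q PQ [d d0 hd]; exists d => // S /hd /PQ.
Qed.

Definition small F := forall e, 0 < e -> \forall S \near nsys_filter, bndX S F e.
Definition bdd F := exists2 M, 0 < M & \forall S \near nsys_filter, bndX S F M.

Lemma small_Delta : small Delta.
Proof. by move=> e e0; exists e. Qed.
Lemma small_bdd F : small F -> bdd F.
Proof. by move=> h; exists 1 => //; exact: h. Qed.
Lemma small_eq F G : (forall t w, F t w = G t w) -> small F -> small G.
Proof. by move=> e h d /h; apply: filterS => S; exact: bndX_eq. Qed.
Lemma bdd_eq F G : (forall t w, F t w = G t w) -> bdd F -> bdd G.
Proof. by move=> e [M M0 h]; exists M => //; apply: filterS h => S; exact: bndX_eq. Qed.
Lemma smallD F G : small F -> small G -> small (fun t w => F t w + G t w).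
Proof.
move=> f g e e0; have e2 : 0 < e / 2 by rewrite divr_gt0.
apply: filterS2 (f _ e2) (g _ e2) => S a b.
by have := bndX_D a b; rewrite -splitr.
Qed.
Lemma smallN F : small F -> small (fun t w => - F t w).
Proof. by move=> f e /f; apply: filterS => S; exact: bndX_N. Qed.
Lemma small_adj F : small F -> small (fun t w => adj (F t w)).
Proof. by move=> f e /f; apply: filterS => S; exact: bndX_adj. Qed.
Lemma small_comp (f : Om -> Om) F : continuous f -> small F -> small (fun t w => F t (f w)).
Proof. by move=> cf h e /h; apply: filterS => S; exact: bndX_comp. Qed.
Lemma small_Mr F G : small F -> bdd G -> small (fun t w => F t w *m G t w).
Proof.
move=> f [M M0 g] e e0.
have d0 : 0 < e / (N.+1%:R * (2 * M)) by rewrite divr_gt0// !mulr_gt0.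
apply: filterS2 (f _ d0) g => S a b.
apply: bndX_le (bndX_M a b).
have := ltr0Sn R N; rewrite -[N.+1]addn1 natrD => N1.
have -> : N%:R * (2 * (e / ((N%:R + 1) * (2 * M)) * M)) = e * (N%:R / (N%:R + 1)) :> R.
  by field; rewrite !gt_eqF.
by rewrite ger_pMr// ler_pdivrMr// mul1r lerDl.
Qed.
Lemma small_Ml F G : bdd F -> small G -> small (fun t w => F t w *m G t w).
Proof.
move=> f g; apply: small_eq (small_adj (small_Mr (small_adj g) _)); last first.
  have [M M0 h] := f; exists M; [exact: M0|].
  by apply: filterS h => S; exact: bndX_adj.
by move=> t w; rewrite -adjM adjK.
Qed.
Lemma bddD F G : bdd F -> bdd G -> bdd (fun t w => F t w + G t w).
Proof.
move=> [M M0 f] [M' M0' g]; exists (M + M'); first exact: addr_gt0.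
by apply: filterS2 f g => S; exact: bndX_D.
Qed.
Lemma bddM F G : bdd F -> bdd G -> bdd (fun t w => F t w *m G t w).
Proof.
move=> [M M0 f] [M' M0' g]; exists (N.+1%:R * (2 * (M * M'))).
  by rewrite !mulr_gt0.
apply: filterS2 f g => S a b; apply: bndX_le (bndX_M a b).
by rewrite ler_wpM2r ?ler_nat// !mulr_ge0// ltW.
Qed.
Lemma bdd_adj F : bdd F -> bdd (fun t w => adj (F t w)).
Proof. by move=> [M M0 h]; exists M => //; apply: filterS h => S; exact: bndX_adj. Qed.
Lemma bdd_comp (f : Om -> Om) F : continuous f -> bdd F -> bdd (fun t w => F t (f w)).
Proof. by move=> cf [M M0 h]; exists M => //; apply: filterS h => S; exact: bndX_comp. Qed.
Lemma bdd_cst (b : Om -> 'M[K]_N) : (forall w, cm b w) -> bdd (fun _ => b).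
Proof.
move=> cb; have [M M0 h] := cm_bound cOm cb; exists M => //.
by apply: filterE => S; apply: bndX_cst => //; exact: ltW.
Qed.

(** Picard iteration from 0. The limit is formed pointwise, without reference to a norm, so that the
    same X serves all norm systems; each system in which [Psi] contracts yields its own bound on
    X. *)
Lemma fixpt (Psi : (R -> Om -> 'M[K]_N) -> R -> Om -> 'M[K]_N) (rho : R) : 0 < rho ->
  (\forall S \near nsys_filter, forall X Y M, 0 <= M -> bndX S X rho -> bndX S Y rho ->
     bndX S (fun t w => X t w - Y t w) M ->
     bndX S (fun t w => Psi X t w - Psi Y t w) (M / 2)) ->
  small (Psi (fun _ _ => 0)) ->
  exists2 X, small X &
    \forall S \near nsys_filter, forall t w, dom S t -> X t w = Psi X t w.
Proof.
move=> rho0 Hlip H0.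
pose Xk k := iter k Psi (fun _ _ => 0).
pose X t w : 'M[K]_N := \matrix_(i, j)
  (limn (fun k => complex.Re (Xk k t w i j)) +i* limn (fun k => complex.Im (Xk k t w i j)))%C.
have geoS (e : R) n : series (fun k => e / 2 ^+ k.+1) n = e - e / 2 ^+ n.
  elim: n => [|n ih]; first by rewrite /series /= big_geq// expr0 divr1 subrr.
  rewrite seriesSr ih exprS; field.
  by rewrite expf_neq0// pnatr_eq0.
have key (S : normsys) (e : R) : 0 < e <= rho ->
  (forall X Y M, 0 <= M -> bndX S X rho -> bndX S Y rho ->
     bndX S (fun t w => X t w - Y t w) M ->
     bndX S (fun t w => Psi X t w - Psi Y t w) (M / 2)) ->
  bndX S (Psi (fun _ _ => 0)) (e / 2) ->
  bndX S X e /\ forall t w, dom S t -> X t w = Psi X t w.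
  move=> /andP[e0 er] lip p0.
  have e2 k : 0 <= e / 2 ^+ k by rewrite divr_ge0 ?exprn_ge0// ltW.
  (* Differences of at most e / 2^(k+1) keep the k-th iterate within e - e / 2^k, hence in the ball
     of radius [rho] on which [Psi] contracts. *)
  have step k : bndX S (fun t w => Xk k.+1 t w - Xk k t w) (e / 2 ^+ k.+1) /\
      bndX S (Xk k) (e - e / 2 ^+ k).
    elim: k => [|k [ih1 ih2]].
      split.
        by rewrite expr1; apply: bndX_eq p0 => t w /=; rewrite subr0.
      rewrite expr0 divr1 subrr => i j.
      by apply: bndC_eq (bndC_0 S) => t w /=; rewrite mxE.
    have b2 : bndX S (Xk k.+1) (e - e / 2 ^+ k.+1).
      have := bndX_D ih1 ih2.
      have -> : e / 2 ^+ k.+1 + (e - e / 2 ^+ k) = e - e / 2 ^+ k.+1.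
        by rewrite exprS; field; rewrite expf_neq0// pnatr_eq0.
      by apply: bndX_eq => t w; rewrite subrK.
    split=> //.
    have l1 k' : e - e / 2 ^+ k' <= rho.
      by apply: le_trans er; rewrite gerBl divr_ge0 ?exprn_ge0// ltW.
    have := lip _ _ _ (e2 _) (bndX_le (l1 _) b2) (bndX_le (l1 _) ih2) ih1.
    have -> : e / 2 ^+ k.+1 / 2 = e / 2 ^+ k.+2.
      by rewrite [in RHS]exprS; field; rewrite expf_neq0// pnatr_eq0.
    by [].
  have st1 k := (step k).1.
  have tele (q : K -> R) (qB : forall x y, q (x - y) = q x - q y) k0 n t w i j :
     series (fun k => q ((Xk (k0 + k).+1 t w - Xk (k0 + k)%N t w) i j)) n =
     q (Xk (k0 + n)%N t w i j) - q (Xk k0 t w i j).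
    elim: n => [|n ih]; first by rewrite /series /= big_geq// addn0 subrr.
    by rewrite seriesSr ih addnS mxE [X in q (_ + X)]mxE qB; ring.
  have bs k0 n : series (fun k => e / 2 ^+ (k0 + k).+1) n <= e / 2 ^+ k0.
    have -> : series (fun k => e / 2 ^+ (k0 + k).+1) n = series (fun k => (e / 2 ^+ k0) / 2 ^+ k.+1) n.
      apply: eq_bigr => k _; rewrite -addnS exprD; field.
      by rewrite !expf_neq0// pnatr_eq0.
    by rewrite geoS gerBl; apply: divr_ge0; rewrite ?exprn_ge0.
  have b0 k0 k : 0 <= e / 2 ^+ (k0 + k).+1 by rewrite divr_ge0 ?exprn_ge0// ltW.
  have cvR (q : K -> R) (qB : forall x y, q (x - y) = q x - q y)
     (bq : forall F M, bndX S F M -> forall i j, bnd S (fun t w => q (F t w i j)) M)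
     t w i j : dom S t ->
     (fun k => q (Xk k t w i j)) @ \oo --> limn (fun k => q (Xk k t w i j)).
    move=> Dt.
    have cs : cvgn (series (fun k => q ((Xk (0 + k).+1 t w - Xk (0 + k)%N t w) i j))).
      apply: (abs_series_cvg (s := fun k => e / 2 ^+ (0 + k).+1) (M := e / 2 ^+ 0)).
        by move=> k; exact: (bnd_val w (bq _ _ (st1 k) i j) Dt).
      exact: bs.
    suff : cvgn (fun k => q (Xk k t w i j)) by [].
    have -> : (fun k => q (Xk k t w i j)) = (fun n =>
      series (fun k => q ((Xk (0 + k).+1 t w - Xk (0 + k)%N t w) i j)) n +
      q (Xk 0%N t w i j)).
      by apply/funext => n; rewrite (tele q qB) subrK.
    by apply: is_cvgD => //; exact: is_cvg_cst.
  have bqR F M : bndX S F M -> forall i j, bnd S (fun t w => complex.Re (F t w i j)) M.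
    by move=> h i j; have [] := h i j.
  have bqI F M : bndX S F M -> forall i j, bnd S (fun t w => complex.Im (F t w i j)) M.
    by move=> h i j; have [] := h i j.
  have tailb k0 : bndX S (fun t w => X t w - Xk k0 t w) (e / 2 ^+ k0).
    move=> i j; split.
      apply: (bnd_series (b0 k0) (bs k0)
        (u := fun k t w => complex.Re ((Xk (k0 + k).+1 t w - Xk (k0 + k)%N t w) i j))).
        by move=> k; apply: bqR; exact: st1.
      move=> t w Dt.
      have -> : series (fun k => complex.Re ((Xk (k0 + k).+1 t w - Xk (k0 + k)%N t w) i j)) =
        (fun n => complex.Re (Xk (k0 + n)%N t w i j) - complex.Re (Xk k0 t w i j)).
        by apply/funext => n; rewrite (tele (@complex.Re R) (@ReB R)).
      rewrite !mxE ReD ReN /=; apply: cvgB; last exact: cvg_cst.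
      have := cvR _ (@ReB R) bqR t w i j Dt.
      rewrite -(cvg_shiftn k0) /=; by under eq_fun do rewrite addnC.
    apply: (bnd_series (b0 k0) (bs k0)
      (u := fun k t w => complex.Im ((Xk (k0 + k).+1 t w - Xk (k0 + k)%N t w) i j))).
      by move=> k; apply: bqI; exact: st1.
    move=> t w Dt.
    have -> : series (fun k => complex.Im ((Xk (k0 + k).+1 t w - Xk (k0 + k)%N t w) i j)) =
      (fun n => complex.Im (Xk (k0 + n)%N t w i j) - complex.Im (Xk k0 t w i j)).
      by apply/funext => n; rewrite (tele (@complex.Im R) (@ImB R)).
    rewrite !mxE ImD ImN /=; apply: cvgB; last exact: cvg_cst.
    have := cvR _ (@ImB R) bqI t w i j Dt.
    rewrite -(cvg_shiftn k0) /=; by under eq_fun do rewrite addnC.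
  have Xe : bndX S X e.
    have := tailb 0%N; rewrite expr0 divr1.
    by apply: bndX_eq => t w; rewrite subr0.
  split=> // t w Dt.
  have st2 k : bndX S (Xk k) rho.
    by apply: bndX_le (step k).2; apply: le_trans er; rewrite gerBl divr_ge0 ?exprn_ge0// ltW.
  (* X and Psi X are both geometrically close to the iterate k+1, so their difference is bounded by
     arbitrarily small numbers. *)
  have dif k : bndX S (fun t w => X t w - Psi X t w) (e / 2 ^+ k).
    have h1 := tailb k.+1.
    have h2 := lip _ _ _ (e2 _) (bndX_le er Xe) (st2 k) (tailb k).
    have := bndX_D h1 (bndX_N h2).
    have -> : e / 2 ^+ k.+1 + e / 2 ^+ k / 2 = e / 2 ^+ k.
      by rewrite exprS; field; rewrite expf_neq0// pnatr_eq0.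
    by apply: bndX_eq => s v /=; rewrite opprB addrA subrK.
  apply/eqP; rewrite -subr_eq0; apply/eqP/nrm_eq0/eqP; rewrite eq_le nrm_ge0 andbT.
  have c : (fun k => (N * N)%:R * (e / 2 ^+ k + e / 2 ^+ k)) @ \oo --> ((N * N)%:R * (0 + 0) : R).
    have c1 : (fun k => e / 2 ^+ k) @ \oo --> (0 : R).
      have : Num.norm (2^-1 : R) < 1 by rewrite ger0_norm// invf_lt1// ltr1n.
      move/(cvg_geometric e); rewrite /geometric /=.
      by under eq_fun do rewrite exprVn.
    by apply: cvgMr; exact: cvgD.
  rewrite addr0 mulr0 in c.
  apply: (ler_cvg_to (cvg_cst _) c); apply: nearW => k /=.
  exact: bndX_val (dif k) Dt.
have half (e : R) : 0 < e -> 0 < Num.min e rho <= rho.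
  by move=> e0; rewrite lt_min e0 rho0 ge_min lexx orbT.
exists X.
  move=> e e0; have /andP[m0 m1] := half e e0.
  have h2 : 0 < Num.min e rho / 2 by rewrite divr_gt0.
  apply: filterS2 Hlip (H0 _ h2) => S lip p0.
  apply: bndX_le (key S _ (half e e0) lip p0).1.
  by rewrite ge_min lexx.
have h2 : 0 < rho / 2 by rewrite divr_gt0.
apply: filterS2 Hlip (H0 _ h2) => S lip p0.
by apply: (key S rho _ lip p0).2; rewrite rho0 lexx.
Qed.

End Small.

(** * Contractions and the graph transform *)

Section GraphAlgebra.
Context {F : pzRingType} {N : nat}.
Implicit Types x y d a dd P Q : 'M[F]_N.

(** The graph equation, solved for x and sorted by size; [y] is the graph map at the image point.
    The leading term, linear in y, is contracted by the domination gap; every other term contains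
    [dd] or is of second order in x and y. *)
Lemma graph_alg1 x y d a AA0 dd P : a = AA0 + dd -> x = x *m P ->
  x = d *m y *m (AA0 *m P) + ((d *m y *m (dd *m P) + d *m y *m (a *m x *m P)) +
     (- (d *m dd *m P) - d *m dd *m (x *m P))) ->
  x = d *m y *m a *m (P + x) - d *m dd *m (P + x).
Proof.
move=> ae xp E; have ap : a *m P = AA0 *m P + dd *m P by rewrite ae mulmxDl.
rewrite [LHS]E -!mulmxA -xp (mulmxDr a) ap !mulmxDr opprD !addrA.
by [].
Qed.

(** Multiplication by [AA0], of which [d] is a right inverse on the range of [Q], turns the solved
    equation back into invariance: images of graph vectors lie on the graph of [y]. *)
Lemma graph_alg2 x y d a AA0 dd P Q : a = AA0 + dd -> AA0 *m d = Q -> Q *m y = y ->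
  Q *m AA0 *m P = 0 -> Q *m AA0 *m x = AA0 *m x ->
  x = d *m y *m a *m (P + x) - d *m dd *m (P + x) ->
  Q *m a *m (P + x) = y *m a *m (P + x).
Proof.
move=> ae ad qy z qx E.
have E2 : AA0 *m x = y *m a *m (P + x) - Q *m dd *m (P + x).
  by rewrite {1}E mulmxBr !mulmxA ad qy.
rewrite {1}ae (mulmxDr Q) mulmxDl (mulmxDr (Q *m AA0)) z add0r qx E2 subrK.
by [].
Qed.

(** Every term of the equation begins with [d], whose range lies in that of [Q]; so a solution
    automatically takes its values where a graph map should. *)
Lemma graph_struct1 Q d y (a0 p dd a x : 'M[F]_N) : Q *m d = d ->
  x = d *m y *m (a0 *m p) + ((d *m y *m (dd *m p) + d *m y *m (a *m x *m p)) +
     (- (d *m dd *m p) - d *m dd *m (x *m p))) -> x = Q *m x.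
Proof.
by move=> qd; move: (x *m p) (a *m x *m p) => xp axp ->; rewrite !mulmxDr !mulmxN !mulmxA qd.
Qed.

Lemma graph_struct2 d y (a0 p dd a x : 'M[F]_N) : p *m p = p ->
  x = d *m y *m (a0 *m p) + ((d *m y *m (dd *m p) + d *m y *m (a *m x *m p)) +
     (- (d *m dd *m p) - d *m dd *m (x *m p))) -> x = x *m p.
Proof.
by move=> pp E; rewrite {1}E [in RHS]E !mulmxDl !mulNmx -!mulmxA !pp.
Qed.

End GraphAlgebra.

(** * Calculus of Lipschitz operators and the graph transform *)

Section LipschitzOperators.
Context {R : realType} {Om : topologicalType}.
Hypothesis cOm : compact [set: Om].
Local Notation K := R[i].
Local Notation normsys := (@normsys R Om).
Context {N : nat}.
Variable Delta : R -> Om -> 'M[K]_N.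
Local Notation mfun := (R -> Om -> 'M[K]_N).
Implicit Types (F G X Y : mfun) (Phi Psi : mfun -> mfun).
Local Notation NF := (nsys_filter Delta).

Definition val_at (S : normsys) (rho c : R) Phi :=
  forall X, bndX S X rho -> bndX S (Phi X) c.
Definition lip_at (S : normsys) (rho c : R) Phi :=
  forall X Y M, 0 <= M -> bndX S X rho -> bndX S Y rho ->
    bndX S (fun t w => X t w - Y t w) M ->
    bndX S (fun t w => Phi X t w - Phi Y t w) (c * M).

(* Near X = 0 and Delta = 0: LB operators are bounded and Lipschitz, V0 ones
   have moreover small values, LS ones small values and Lipschitz constant. *)
Definition LB Phi := exists2 C, 0 < C & exists2 rho, 0 < rho &
  \forall S \near NF, val_at S rho C Phi /\ lip_at S rho C Phi.
Definition VS Phi := forall e, 0 < e -> exists2 rho, 0 < rho &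
  \forall S \near NF, val_at S rho e Phi.
Definition V0 Phi := LB Phi /\ VS Phi.
Definition LS Phi := forall e, 0 < e -> exists2 rho, 0 < rho &
  \forall S \near NF, val_at S rho e Phi /\ lip_at S rho e Phi.

Lemma val_le S rho rho' c Phi : rho' <= rho -> val_at S rho c Phi -> val_at S rho' c Phi.
Proof. by move=> h v X hX; apply: v; exact: bndX_le hX. Qed.
Lemma lip_le S rho rho' c Phi : rho' <= rho -> lip_at S rho c Phi -> lip_at S rho' c Phi.
Proof. by move=> h v X Y M M0 hX hY; apply: v => //; apply: bndX_le h _. Qed.

Lemma LS_LB Phi : LS Phi -> LB Phi.
Proof. by move=> h; have [rho r0 H] := h 1 ltr01; exists 1 => //; exists rho. Qed.
Lemma LS_V0 Phi : LS Phi -> V0 Phi.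
Proof.
move=> h; split; first exact: LS_LB.
by move=> e /h[rho r0 H]; exists rho => //; apply: filterS H => S [].
Qed.
Lemma LB_cst F : bdd Delta F -> LB (fun=> F).
Proof.
move=> [M M0 h]; exists M => //; exists 1 => //; apply: filterS h => S h; split=> //.
move=> X Y M' M'0 _ _ _; apply: (bndX_le (M := 0)); first by rewrite mulr_ge0// ltW.
by move=> i j; apply: bndC_eq (bndC_0 S) => t w; rewrite subrr mxE.
Qed.
Lemma LS_cst F : small Delta F -> LS (fun=> F).
Proof.
move=> H e e0; exists 1 => //; apply: filterS (H e e0) => S h; split=> //.
move=> X Y M' M'0 _ _ _; apply: (bndX_le (M := 0)); first by rewrite mulr_ge0// ltW.
by move=> i j; apply: bndC_eq (bndC_0 S) => t w; rewrite subrr mxE.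
Qed.
Lemma V0_id : V0 id.
Proof.
split; last by move=> e e0; exists e => //; apply: filterE => S X.
exists 1 => //; exists 1 => //; apply: filterE => S; split=> //.
by move=> X Y M M0 _ _; rewrite mul1r.
Qed.
Lemma V0_comp (f : Om -> Om) Phi : continuous f -> V0 Phi ->
  V0 (fun X t w => Phi X t (f w)).
Proof.
move=> cf [[C C0 [rho r0 H]] H2]; split.
  exists C => //; exists rho => //; apply: filterS H => S [h1 h2]; split.
    by move=> X hX; apply: bndX_comp => //; exact: h1.
  move=> X Y M M0 hX hY hXY.
  exact: (bndX_comp cf (h2 _ _ _ M0 hX hY hXY)).
move=> e /H2[r rr h]; exists r => //; apply: filterS h => S h X hX.
by apply: bndX_comp => //; exact: h.
Qed.

Lemma lip_M S rho Phi Psi a b a' b' : val_at S rho a Phi -> lip_at S rho b Phi ->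
  val_at S rho a' Psi -> lip_at S rho b' Psi ->
  lip_at S rho (N%:R * (2 * (b * a')) + N%:R * (2 * (a * b')))
    (fun X t w => Phi X t w *m Psi X t w).
Proof.
move=> v1 l1 v2 l2 X Y M M0 hX hY hXY.
have h1 := bndX_M (l1 _ _ _ M0 hX hY hXY) (v2 _ hX).
have h2 := bndX_M (v1 _ hY) (l2 _ _ _ M0 hX hY hXY).
have := bndX_D h1 h2.
have -> : N%:R * (2 * (b * M * a')) + N%:R * (2 * (a * (b' * M))) =
  (N%:R * (2 * (b * a')) + N%:R * (2 * (a * b'))) * M by ring.
by apply: bndX_eq => t w; rewrite mulmxBl mulmxBr addrA subrK.
Qed.
Lemma val_M S rho Phi Psi a a' : val_at S rho a Phi -> val_at S rho a' Psi ->
  val_at S rho (N%:R * (2 * (a * a'))) (fun X t w => Phi X t w *m Psi X t w).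
Proof. by move=> v1 v2 X hX; exact: (bndX_M (v1 _ hX) (v2 _ hX)). Qed.

Lemma val_leC S rho c c' Phi : c <= c' -> val_at S rho c Phi -> val_at S rho c' Phi.
Proof. by move=> cc h X /h; exact: bndX_le. Qed.
Lemma lip_leC S rho c c' Phi : c <= c' -> lip_at S rho c Phi -> lip_at S rho c' Phi.
Proof.
move=> cc h X Y M M0 hX hY hXY; apply: bndX_le (h _ _ _ M0 hX hY hXY).
exact: ler_wpM2r.
Qed.

(* N * (2 * (a * b)) <= e as soon as b <= e / (2 (N + 1) a) *)
Let cc (e a : R) : R := e / (N.+1%:R * (2 * a)).
Let cc_gt0 e a : 0 < e -> 0 < a -> 0 < cc e a.
Proof. by move=> e0 a0; rewrite divr_gt0// !mulr_gt0. Qed.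
Let cc_le e a : 0 < e -> 0 < a -> N%:R * (2 * (a * cc e a)) <= e.
Proof.
move=> e0 a0; rewrite /cc.
have N1 : (0 : R) < N%:R + 1 by rewrite natr1.
rewrite -[N.+1%:R]natr1.
have -> : N%:R * (2 * (a * (e / ((N%:R + 1) * (2 * a))))) = e * (N%:R / (N%:R + 1)) :> R.
  by field; rewrite !gt_eqF.
by rewrite ger_pMr// ler_pdivrMr// mul1r lerDl.
Qed.

Lemma LB_M Phi Psi : LB Phi -> LB Psi -> LB (fun X t w => Phi X t w *m Psi X t w).
Proof.
move=> [C C0 [r r0 H]] [C' C'0 [r' r'0 H']].
exists (N.+1%:R * (2 * (C * C')) + N.+1%:R * (2 * (C * C'))).
  by rewrite addr_gt0// !mulr_gt0.
exists (Num.min r r'); first by rewrite lt_min r0.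
have rl : Num.min r r' <= r by rewrite ge_min lexx.
have rl' : Num.min r r' <= r' by rewrite ge_min lexx orbT.
have h0 : N%:R * (2 * (C * C')) <= N.+1%:R * (2 * (C * C')).
  by rewrite ler_wpM2r ?ler_nat// !mulr_ge0// ltW.
have h1 : 0 <= N.+1%:R * (2 * (C * C')) by rewrite !mulr_ge0// ltW.
apply: filterS2 H H' => S [v l] [v' l'].
have := val_le rl v; have := lip_le rl l; have := val_le rl' v'; have := lip_le rl' l'.
move=> {}l' {}v' {}l {}v; split.
  apply: val_leC (val_M v v'); lra.
by apply: lip_leC (lip_M v l v' l'); lra.
Qed.

Lemma V0_Ml Phi Psi : LB Phi -> V0 Psi -> V0 (fun X t w => Phi X t w *m Psi X t w).
Proof.
move=> h1 [h2 h3]; split; first exact: LB_M.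
move: h1 => [C C0 [r r0 H]] e e0.
have [r' r'0 H'] := h3 _ (cc_gt0 e0 C0).
exists (Num.min r r'); first by rewrite lt_min r0.
have rl : Num.min r r' <= r by rewrite ge_min lexx.
have rl' : Num.min r r' <= r' by rewrite ge_min lexx orbT.
apply: filterS2 H H' => S [v l] v'.
apply: val_leC (val_M (val_le rl v) (val_le rl' v')); exact: cc_le.
Qed.
Lemma V0_Mr Phi Psi : V0 Phi -> LB Psi -> V0 (fun X t w => Phi X t w *m Psi X t w).
Proof.
move=> [h2 h3] h1; split; first exact: LB_M.
move: h1 => [C C0 [r r0 H]] e e0.
have [r' r'0 H'] := h3 _ (cc_gt0 e0 C0).
exists (Num.min r r'); first by rewrite lt_min r0.
have rl : Num.min r r' <= r by rewrite ge_min lexx.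
have rl' : Num.min r r' <= r' by rewrite ge_min lexx orbT.
apply: filterS2 H H' => S [v l] v'.
apply: val_leC (val_M (val_le rl' v') (val_le rl v)).
rewrite [X in 2 * X]mulrC; exact: cc_le.
Qed.

(** Second-order smallness: in the product rule each Lipschitz constant is multiplied by the small
    value of the other factor. *)
Lemma LS_VV Phi Psi : V0 Phi -> V0 Psi -> LS (fun X t w => Phi X t w *m Psi X t w).
Proof.
move=> [[C C0 [r1 r10 H1]] h1] [[C' C'0 [r2 r20 H2]] h2] e e0.
have e2 : 0 < e / 2 by rewrite divr_gt0.
have [r3 r30 H3] := h1 _ (cc_gt0 e2 C'0).
have [r4 r40 H4] := h2 _ (cc_gt0 e2 C0).
pose r := Num.min (Num.min r1 r2) (Num.min r3 r4).
have l1 : r <= r1 by rewrite !ge_min lexx.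
have l2 : r <= r2 by rewrite !ge_min lexx orbT.
have l3 : r <= r3 by rewrite !ge_min lexx !orbT.
have l4 : r <= r4 by rewrite !ge_min lexx !orbT.
exists r; first by rewrite !lt_min r10 r20 r30.
apply: filterS2 (filterI H1 H2) (filterI H3 H4) => S [[v1 i1] [v2 i2]] [v3 v4].
have k1 := cc_le e2 C0; have k2 := cc_le e2 C'0; split.
  have := val_M (val_le l1 v1) (val_le l4 v4); apply: val_leC; lra.
have := lip_M (val_le l3 v3) (lip_le l1 i1) (val_le l4 v4) (lip_le l2 i2).
apply: lip_leC; rewrite [cc (e / 2) C' * C']mulrC; lra.
Qed.
Lemma LS_Ml Phi Psi : LB Phi -> LS Psi -> LS (fun X t w => Phi X t w *m Psi X t w).
Proof.
move=> [C C0 [r1 r10 H1]] h e e0.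
have e2 : 0 < e / 2 by rewrite divr_gt0.
have [r2 r20 H2] := h _ (cc_gt0 e2 C0).
exists (Num.min r1 r2); first by rewrite lt_min r10.
have l1 : Num.min r1 r2 <= r1 by rewrite ge_min lexx.
have l2 : Num.min r1 r2 <= r2 by rewrite ge_min lexx orbT.
apply: filterS2 H1 H2 => S [v1 i1] [v2 i2].
have k1 := cc_le e2 C0; split.
  have := val_M (val_le l1 v1) (val_le l2 v2); apply: val_leC; lra.
have := lip_M (val_le l1 v1) (lip_le l1 i1) (val_le l2 v2) (lip_le l2 i2).
by apply: lip_leC; lra.
Qed.
Lemma LS_Mr Phi Psi : LS Phi -> LB Psi -> LS (fun X t w => Phi X t w *m Psi X t w).
Proof.
move=> h [C C0 [r1 r10 H1]] e e0.
have e2 : 0 < e / 2 by rewrite divr_gt0.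
have [r2 r20 H2] := h _ (cc_gt0 e2 C0).
exists (Num.min r1 r2); first by rewrite lt_min r10.
have l1 : Num.min r1 r2 <= r1 by rewrite ge_min lexx.
have l2 : Num.min r1 r2 <= r2 by rewrite ge_min lexx orbT.
apply: filterS2 H1 H2 => S [v1 i1] [v2 i2].
have k1 := cc_le e2 C0; rewrite [X in 2 * X]mulrC in k1; split.
  have := val_M (val_le l2 v2) (val_le l1 v1); apply: val_leC; lra.
have := lip_M (val_le l2 v2) (lip_le l2 i2) (val_le l1 v1) (lip_le l1 i1).
by apply: lip_leC; lra.
Qed.
Lemma LS_D Phi Psi : LS Phi -> LS Psi -> LS (fun X t w => Phi X t w + Psi X t w).
Proof.
move=> h1 h2 e e0; have e2 : 0 < e / 2 by rewrite divr_gt0.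
have [r1 r10 H1] := h1 _ e2; have [r2 r20 H2] := h2 _ e2.
exists (Num.min r1 r2); first by rewrite lt_min r10.
have l1 : Num.min r1 r2 <= r1 by rewrite ge_min lexx.
have l2 : Num.min r1 r2 <= r2 by rewrite ge_min lexx orbT.
apply: filterS2 H1 H2 => S [v1 i1] [v2 i2]; split.
  move=> X hX; have := bndX_D (val_le l1 v1 hX) (val_le l2 v2 hX).
  by rewrite -splitr.
move=> X Y M M0 hX hY hXY.
have := bndX_D (lip_le l1 i1 M0 hX hY hXY) (lip_le l2 i2 M0 hX hY hXY).
rewrite -mulrDl -splitr; apply: bndX_eq => t w.
by rewrite opprD addrACA.
Qed.
Lemma LS_N Phi : LS Phi -> LS (fun X t w => - Phi X t w).
Proof.
move=> h e /h[r r0 H]; exists r => //; apply: filterS H => S [v i]; split.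
  by move=> X /v; exact: bndX_N.
move=> X Y M M0 hX hY hXY.
by apply: bndX_eq (bndX_N (i _ _ _ M0 hX hY hXY)) => t w; rewrite opprB opprK addrC.
Qed.
Lemma LS_adj Phi : LS Phi -> LS (fun X t w => adj (Phi X t w)).
Proof.
move=> h e /h[r r0 H]; exists r => //; apply: filterS H => S [v i]; split.
  by move=> X /v; exact: bndX_adj.
move=> X Y M M0 hX hY hXY.
by apply: bndX_eq (bndX_adj (i _ _ _ M0 hX hY hXY)) => t w; rewrite adjB.
Qed.

(** [Lead] contributes a Lipschitz constant 1/4 and, close to 0, [Phi] another 1/4; together they
    make the 1/2 that [fixpt] asks for. *)
Lemma fixpt_LS (Lead Phi : mfun -> mfun) :
  (forall S X Y M, 0 <= M -> bndX S (fun t w => X t w - Y t w) M ->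
     bndX S (fun t w => Lead X t w - Lead Y t w) (M / 4)) ->
  (forall t w, Lead (fun _ _ => 0) t w = 0) ->
  LS Phi ->
  exists2 X, small Delta X &
    \forall S \near NF, forall t w, dom S t -> X t w = Lead X t w + Phi X t w.
Proof.
move=> hL L0 hP.
have e4 : (0 : R) < 1 / 4 by rewrite divr_gt0.
have [rho r0 H] := hP _ e4.
apply: (@fixpt _ _ _ Delta (fun X t w => Lead X t w + Phi X t w) rho) => //.
  apply: filterS H => S [v i] X Y M M0 hX hY hXY.
  have := bndX_D (hL S X Y M M0 hXY) (i _ _ _ M0 hX hY hXY).
  have -> : M / 4 + 1 / 4 * M = M / 2 by field.
  by apply: bndX_eq => t w; rewrite opprD addrACA.
move=> e e0; have [r r0' H'] := hP _ e0.
apply: filterS H' => S [v _].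
have z0 : bndX S (fun _ _ => 0 : 'M[K]_N) r.
  apply: (bndX_le (M := 0)); first exact: ltW.
  by move=> i j; apply: bndC_eq (bndC_0 S) => t w; rewrite mxE.
by apply: bndX_eq (v _ z0) => t w; rewrite L0 add0r.
Qed.

Section Graph.
Variables (tau : Om -> Om) (AA : mfun) (AA0 P Q D : Om -> 'M[K]_N).
Hypothesis ctau : continuous tau.
Hypotheses (cA : forall w, cm AA0 w) (cP : forall w, cm P w) (cD : forall w, cm D w).
Hypothesis AAs : small Delta (fun t w => AA t w - AA0 w).
Hypotheses (PP : forall w, P w *m P w = P w) (PQ : forall w, P w *m Q w = 0)
  (QP : forall w, Q w *m P w = 0).
Hypotheses (PA : forall w, P (tau w) *m AA0 w = AA0 w *m P w)
  (QA : forall w, Q (tau w) *m AA0 w = AA0 w *m Q w).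
Hypotheses (QD : forall w, Q w *m D w = D w) (DQ : forall w, D w *m Q (tau w) = D w)
  (AD : forall w, AA0 w *m D w = Q (tau w)).
Hypothesis gap : forall w, nrm (D w) * nrm (AA0 w *m P w) <= (16 * (N.+1%:R * N.+1%:R))^-1.

(** [D] inverts the cocycle on the range of [Q]. The sandwich estimate costs 2 N^2, so the constant
    in [gap] leaves a Lipschitz constant of at most 1/8 for the leading term, within the 1/4
    allowed; N + 1 in place of N keeps that constant positive for N = 0. *)
Lemma graph_transform : exists2 X, small Delta X &
  \forall S \near NF, forall t w, dom S t ->
    [/\ X t w = Q w *m X t w, X t w = X t w *m P w &
        Q (tau w) *m AA t w *m (P w + X t w) = X t (tau w) *m AA t w *m (P w + X t w)].
Proof.
have [DD DDE] : exists DD : mfun, forall t w, DD t w = AA t w - AA0 w.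
  by exists (fun t w => AA t w - AA0 w).
pose Lead (X : mfun) (t : R) w := D w *m X t (tau w) *m (AA0 w *m P w).
pose Phi (X : mfun) (t : R) w :=
  ((D w *m X t (tau w)) *m (DD t w *m P w) +
  (D w *m X t (tau w)) *m ((AA t w *m X t w) *m P w)) +
  (- ((D w *m DD t w) *m P w) - ((D w *m DD t w) *m (X t w *m P w))).
have bA : bdd Delta AA.
  have := bddD (small_bdd AAs) (bdd_cst cOm Delta cA).
  by apply: bdd_eq => t w; rewrite subrK.
have LD := LB_cst (bdd_cst cOm Delta cD).
have LP := LB_cst (bdd_cst cOm Delta cP).
have LA := LB_cst bA.
have SD : LS (fun=> DD) by apply/LS_cst/(small_eq _ AAs) => t w; rewrite DDE.
have VX := V0_comp ctau V0_id.
have hPhi : LS Phi.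
  apply: LS_D.
    apply: LS_D.
      apply: LS_Ml; first by apply: LB_M LD _; case: VX.
      exact: LS_Mr SD LP.
    apply: LS_VV; first exact: V0_Ml LD VX.
    exact: V0_Mr (V0_Ml LA V0_id) LP.
  apply: LS_D; apply: LS_N.
    exact: LS_Mr (LS_Ml LD SD) LP.
  apply: LS_Mr (LS_Ml LD SD) _.
  by apply: LB_M LP; case: V0_id.
have cAP w : cm (fun w => AA0 w *m P w) w by apply: cmM; [exact: cA|exact: cP].
have n0 : (0 : R) < N.+1%:R by [].
have hLead S X Y M : 0 <= M -> bndX S (fun t w => X t w - Y t w) M ->
    bndX S (fun t w => Lead X t w - Lead Y t w) (M / 4).
  move=> M0 hXY.
  have la0 : (0 : R) <= (16 * (N.+1%:R * N.+1%:R))^-1.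
    by rewrite invr_ge0 !mulr_ge0.
  have := bndX_sandwich cD cAP la0 gap (bndX_comp ctau hXY).
  move=> h; apply: bndX_le (bndX_eq _ h); last first.
    by move=> t w; rewrite /Lead mulmxBr mulmxBl.
  have n1' : N%:R <= N.+1%:R :> R by rewrite ler_nat.
  apply: (@le_trans _ _ (N.+1%:R * (N.+1%:R * (2 * ((16 * (N.+1%:R * N.+1%:R))^-1 * M))))).
    apply: ler_pM => //; first by rewrite !mulr_ge0.
    by apply: ler_pM => //; rewrite !mulr_ge0.
  have -> : N.+1%:R * (N.+1%:R * (2 * ((16 * (N.+1%:R * N.+1%:R))^-1 * M))) = M / 8.
    by field; rewrite gt_eqF.
  by rewrite ler_wpM2l// lef_pV2 ?posrE// ler_nat.
have [|X Xs H] := fixpt_LS hLead _ hPhi.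
  by move=> t w; rewrite /Lead mulmx0 mul0mx.
exists X => //; apply: filterS H => S H t w Dt.
have XQ v : X t v = Q v *m X t v by exact: graph_struct1 (QD v) (H t v Dt).
have XP v : X t v = X t v *m P v by exact: graph_struct2 (PP v) (H t v Dt).
split=> //.
have AE : AA t w = AA0 w + DD t w by rewrite DDE addrC subrK.
apply: (graph_alg2 AE (AD w)).
- by rewrite -XQ.
- by rewrite QA -mulmxA QP mulmx0.
- by rewrite QA -mulmxA -XQ.
- exact: graph_alg1 AE (XP w) (H t w Dt).
Qed.

End Graph.
End LipschitzOperators.

(** * Dominated invariant projections *)

Section RealFacts.
Context {R : realType}.

Lemma expr_cvg0 (mu : R) : 0 <= mu < 1 -> (fun n => mu ^+ n) @ \oo --> 0.
Proof.
move=> /andP[m0 m1]; have h : Num.norm mu < 1 by rewrite ger0_norm.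
have := cvg_geometric 1 h; rewrite /geometric /=.
by under eq_fun do rewrite mul1r.
Qed.

Lemma expr_small (mu C e : R) : 0 <= mu < 1 -> 0 < e ->
  exists2 n, (0 < n)%N & C * mu ^+ n <= e.
Proof.
move=> h e0; have c : (fun n => C * mu ^+ n) @ \oo --> C * 0.
  by apply: cvgMr; exact: expr_cvg0.
rewrite mulr0 in c; have /cvgrPdist_le/(_ _ e0)[n _ hn] := c.
exists n.+1 => //; have := hn n.+1 (leqnSn n); rewrite sub0r normrN.
exact: le_trans (ler_norm _).
Qed.

Lemma le_geom_eq0 (mu a C : R) : 0 <= mu < 1 -> 0 <= a ->
  (forall n, a <= C * mu ^+ n) -> a = 0.
Proof.
move=> h a0 H; apply/eqP; rewrite eq_le a0 andbT.
have c : (fun n => C * mu ^+ n) @ \oo --> C * 0.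
  by apply: cvgMr; exact: expr_cvg0.
rewrite mulr0 in c; apply: (ler_cvg_to (cvg_cst _) c); exact: nearW.
Qed.

Lemma ratio_induct (a z : nat -> R) : (forall m, a m.+1 * z m <= a m * z m.+1) ->
  (forall m, 0 < z m) -> forall m, a m * z 0%N <= a 0%N * z m.
Proof.
move=> h zp; elim=> [//|m ih].
rewrite -(ler_pM2r (zp m)) mulrAC; apply: (le_trans (ler_wpM2r (ltW (zp 0%N)) (h m))).
by rewrite mulrAC [leRHS]mulrAC; apply: ler_wpM2r ih; exact: ltW.
Qed.

Lemma ratio_up (B nx pa z0 a0 zm ny : R) : 0 <= B -> 0 <= z0 -> 0 <= a0 ->
  nx <= B * pa -> pa * z0 <= a0 * zm -> zm <= B * ny -> nx * z0 <= B * B * a0 * ny.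
Proof.
move=> B0 z00 a00 h1 h2 h3.
apply: (le_trans (ler_wpM2r z00 h1)); rewrite -(mulrA B pa).
apply: (le_trans (ler_wpM2l B0 h2)); rewrite mulrA.
apply: (le_trans (ler_wpM2l (mulr_ge0 B0 a00) h3)).
by rewrite le_eqVlt; apply/orP; left; apply/eqP; ring.
Qed.

Lemma ratio_down (nx z0 c2 ny f C m bQ y : R) : 0 < nx -> 0 <= f -> 0 <= c2 ->
  nx * z0 <= c2 * ny -> ny * f <= C * m * (bQ * nx * y) ->
  z0 * f <= c2 * (C * bQ * y) * m.
Proof.
move=> nx0 f0 c0 h1 h2; rewrite -(ler_pM2l nx0) (mulrA nx z0).
apply: (le_trans (ler_wpM2r f0 h1)); rewrite -(mulrA c2 ny).
apply: (le_trans (ler_wpM2l c0 h2)).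
by rewrite le_eqVlt; apply/orP; left; apply/eqP; ring.
Qed.

Lemma expr_mul_le (mu : R) (b n : nat) : 0 <= mu < 1 -> (0 < b)%N -> mu ^+ (b * n) <= mu ^+ n.
Proof.
move=> /andP[m0 m1] b0; apply: ler_wiXn2l => //; first exact: ltW.
by rewrite leq_pmull.
Qed.
End RealFacts.

Section Iterates.
Context {R : realType} {Om : Type} {N : nat}.
Local Notation K := R[i].
Implicit Types (T : Om -> Om) (A P : Om -> 'M[K]_N).

Fixpoint miter T A n w : 'M[K]_N :=
  if n is m.+1 then A (iter m T w) *m miter T A m w else 1%:M.

Lemma miterD T A m n w : miter T A (m + n) w = miter T A m (iter n T w) *m miter T A n w.
Proof.
elim: m => [|m ih] /=; first by rewrite mul1mx.
by rewrite ih mulmxA iterD.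
Qed.

Lemma miter_comm T A P : (forall w, P (T w) *m A w = A w *m P w) ->
  forall n w, P (iter n T w) *m miter T A n w = miter T A n w *m P w.
Proof.
move=> h; elim=> [|n ih] w /=; first by rewrite mulmx1 mul1mx.
by rewrite mulmxA h -mulmxA ih mulmxA.
Qed.

Lemma miter_block T A b n w :
  miter (iter b T) (miter T A b) n w = miter T A (b * n) w.
Proof.
elim: n => [|n ih]; first by rewrite muln0.
rewrite mulnS miterD /= ih; congr (miter _ _ _ _ *m _).
by rewrite mulnC; elim: n {ih} => //= n ->; rewrite mulSn iterD.
Qed.

Lemma iter_block T b n w : iter n (iter b T) w = iter (b * n) T w.
Proof. by rewrite mulnC; elim: n => //= n ->; rewrite mulSn iterD. Qed.

Lemma nrm_col m n (M : 'M[K]_(m, n)) : nrm M = \sum_j nrm (col j M).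
Proof.
rewrite /nrm exchange_big; apply: eq_bigr => j _; apply: eq_bigr => i _.
by rewrite big_ord1 mxE.
Qed.
End Iterates.

Lemma iter_continuous (X : topologicalType) (T : X -> X) n : continuous T -> continuous (iter n T).
Proof.
move=> cT; elim: n => [|n ih] x /=; first exact: cvg_id.
by apply: (@continuous_comp _ _ _ (iter n T) T); [exact: ih|exact: cT].
Qed.

Lemma cm_miter (R : realType) (X : topologicalType) N (T : X -> X) (A : X -> 'M[R[i]]_N) n :
  continuous T -> (forall w, cm A w) -> forall w, cm (miter T A n) w.
Proof.
move=> cT cA; elim: n => [|n ih] w /=; first exact: cm_cst.
apply: cmM; last exact: ih.
by apply: cm_comp; [exact: iter_continuous|exact: cA].
Qed.

(** * Inverting a form on the range of a projection *)

Section FormInverse.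
Context {R : realType} {N : nat}.
Local Notation K := R[i].
Implicit Types P Psi : 'M[K]_N.

Definition form_ext P Psi := adj P *m Psi *m P + adj (1%:M - P) *m (1%:M - P).
(* form_ext is invertible and agrees with Psi on the range of the projection P,
   so form_inv inverts Psi there. *)
Definition form_inv P Psi := P *m invmx (form_ext P Psi) *m adj P.

Section OneForm.
Variables P Psi : 'M[K]_N.
Hypothesis PP : P *m P = P.
Hypothesis nd : forall x : 'cV[K]_N, adj P *m Psi *m P *m x = 0 -> P *m x = 0.

Let PI : (1%:M - P) *m P = 0. Proof. by rewrite mulmxBl mul1mx PP subrr. Qed.
Let aPP : adj P *m adj P = adj P. Proof. by rewrite -adjM PP. Qed.

Lemma form_extP : form_ext P Psi *m P = adj P *m Psi *m P.
Proof. by rewrite /form_ext mulmxDl -!mulmxA PI !mulmx0 addr0 PP. Qed.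
Lemma adjP_form_ext : adj P *m form_ext P Psi = adj P *m Psi *m P.
Proof. by rewrite /form_ext mulmxDr !mulmxA aPP -adjM PI adj0 mul0mx addr0. Qed.

(** A kernel vector is killed by [P], since the form is non-degenerate on the range of [P], and then
    by [1 - P], since the added term is the Gram matrix of [1 - P]. *)
Lemma form_ext_unit : form_ext P Psi \in unitmx.
Proof.
rewrite -unitmx_tr -row_free_unit -kermx_eq0; apply/negPn/negP.
move=> /rowV0Pn[y /sub_kermxP yF y0].
have Fy : form_ext P Psi *m y^T = 0 by rewrite -[form_ext _ _]trmxK -trmx_mul yF trmx0.
have z1 : P *m y^T = 0 by apply: nd; rewrite -adjP_form_ext -mulmxA Fy mulmx0.
have z2 : (1%:M - P) *m y^T = 0.
  have h : adj (1%:M - P) *m ((1%:M - P) *m y^T) = 0.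
    by move: Fy; rewrite /form_ext mulmxDl -(mulmxA _ P) z1 mulmx0 add0r mulmxA.
  by apply: adj_mul_eq0; rewrite adjM -mulmxA h mulmx0 mxE.
have : y^T = 0 by rewrite -[y^T]mul1mx -[1%:M](subrK P) mulmxDl z1 z2 addr0.
by move/(congr1 trmx); rewrite trmxK trmx0; move/eqP: y0.
Qed.

Lemma form_inv_l : P *m form_inv P Psi = form_inv P Psi.
Proof. by rewrite /form_inv !mulmxA PP. Qed.
Lemma form_inv_r : form_inv P Psi *m adj P = form_inv P Psi.
Proof. by rewrite /form_inv -mulmxA aPP. Qed.
Lemma form_inv_mul_form : form_inv P Psi *m (adj P *m Psi *m P) = P.
Proof.
rewrite /form_inv -mulmxA !mulmxA -(mulmxA _ (adj P) (adj P)) aPP -(mulmxA _ (adj P)).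
by rewrite -(mulmxA _ (adj P *m Psi)) -form_extP -mulmxA mulKmx ?form_ext_unit// PP.
Qed.
Lemma mul_form_inv : adj P *m Psi *m P *m form_inv P Psi = adj P.
Proof.
rewrite /form_inv !mulmxA -(mulmxA _ P P) PP -adjP_form_ext -(mulmxA (adj P)).
by rewrite mulmxV ?form_ext_unit// mulmx1 aPP.
Qed.
End OneForm.

Lemma cm_form_inv (X : topologicalType) (P Psi : X -> 'M[K]_N) (x : X) :
  (forall y, P y *m P y = P y) ->
  (forall y (v : 'cV[K]_N), adj (P y) *m Psi y *m P y *m v = 0 -> P y *m v = 0) ->
  (forall y, cm P y) -> (forall y, cm Psi y) -> cm (fun y => form_inv (P y) (Psi y)) x.
Proof.
move=> PP nd cP cPsi; apply: cmM; last by apply: cm_adj; exact: cP.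
apply: cmM; first exact: cP.
apply: cm_inv => [y|]; first exact: (form_ext_unit (PP y) (@nd y)).
apply: cmD.
  apply: cmM; last exact: cP.
  by apply: cmM; [apply: cm_adj; exact: cP|exact: cPsi].
have cI : cm (fun v => 1%:M - P v) x by apply: cmB; [exact: cm_cst|exact: cP].
exact: (cmM (cm_adj cI) cI).
Qed.
End FormInverse.

(** * Matrix cocycles and their invariant projections *)

Section Cocycle.
Context {R : realType} {Om : topologicalType}.
Hypothesis cOm : compact [set: Om].
Local Notation K := R[i].
Context {N : nat}.
Local Notation mx := (Om -> 'M[K]_N).

(** A cocycle on the summand [p] of a trivial bundle. Maps and form are extended by zero along the
    kernel of [p], whence the absorption rules. [Ai w] is the inverse of [A (Tinv w)], indexed so
    that exchanging [T] with [Tinv] and [A] with [Ai] gives a cocycle again. *)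
Record cocyc (T Tinv : Om -> Om) (A Ai p Psi : mx) : Prop := Cocyc {
  co_T : continuous T;
  co_Tinv : continuous Tinv;
  co_TK : cancel T Tinv;
  co_TinvK : cancel Tinv T;
  co_cA : forall w, cm A w;
  co_cAi : forall w, cm Ai w;
  co_cp : forall w, cm p w;
  co_cPsi : forall w, cm Psi w;
  co_pp : forall w, p w *m p w = p w;
  co_Ap : forall w, A w *m p w = A w;
  co_pA : forall w, p (T w) *m A w = A w;
  co_Aip : forall w, Ai w *m p w = Ai w;
  co_pAi : forall w, p (Tinv w) *m Ai w = Ai w;
  co_AiA : forall w, Ai (T w) *m A w = p w;
  co_AAi : forall w, A w *m Ai (T w) = p (T w);
  co_form : forall w, adj (A w) *m Psi (T w) *m A w = Psi w;
  co_Psip : forall w, Psi w *m p w = Psi w;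
  co_pPsi : forall w, adj (p w) *m Psi w = Psi w }.

Lemma cocyc_inv T Tinv A Ai p Psi : cocyc T Tinv A Ai p Psi -> cocyc Tinv T Ai A p Psi.
Proof.
case=> c1 c2 TK TinvK c3 c4 c5 c6 pp Ap pA Aip pAi AiA AAi fm Pp pP; split => //.
- by move=> w; rewrite -[in RHS](TinvK w) -AAi TinvK.
- by move=> w; rewrite -[in Ai w](TinvK w) AiA.
- move=> w; have f := fm (Tinv w); have a := AAi (Tinv w); rewrite !TinvK in f a.
  rewrite -f !mulmxA -adjM a -!mulmxA a mulmxA pP; exact: Pp.
Qed.

Variables (T Tinv : Om -> Om) (A Ai p Psi : mx).
Hypothesis co : cocyc T Tinv A Ai p Psi.

Fixpoint minv n w : 'M[K]_N :=
  if n is m.+1 then minv m w *m Ai (T (iter m T w)) else p w.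

Lemma minv_p n w : minv n w *m p (iter n T w) = minv n w.
Proof. by case: n => [|n] /=; [rewrite (co_pp co)|rewrite -mulmxA (co_Aip co)]. Qed.
Lemma minvK n w : minv n w *m miter T A n w = p w.
Proof.
elim: n => [|n ih] /=; first by rewrite mulmx1.
by rewrite -mulmxA (mulmxA (Ai _)) (co_AiA co) mulmxA minv_p.
Qed.
Lemma miterK n w : miter T A n w *m minv n w = p (iter n T w).
Proof.
elim: n => [|n ih] /=; first by rewrite mul1mx.
by rewrite -mulmxA (mulmxA (miter _ _ _ _)) ih mulmxA (co_Ap co) (co_AAi co).
Qed.
Lemma cm_minv n w : cm (minv n) w.
Proof.
elim: n w => [|n ih] w /=; first exact: (co_cp co).
apply: cmM; first exact: ih.
apply: (@cm_comp _ _ _ _ _ Ai (fun v => T (iter n T v))); last exact: (co_cAi co).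
by apply: (@continuous_comp _ _ _ (iter n T) T);
   [exact: iter_continuous (co_T co) _|exact: (co_T co)].
Qed.
Lemma miter_p n w : p (iter n T w) *m miter T A n w = miter T A n w *m p w.
Proof. by apply: miter_comm => v; rewrite (co_pA co) (co_Ap co). Qed.
Lemma miter_inj n w (x : 'cV[K]_N) : p w *m x = x -> miter T A n w *m x = 0 -> x = 0.
Proof. by move=> px /(congr1 (mulmx (minv n w))); rewrite mulmxA minvK px mulmx0. Qed.
Lemma miter_form n w :
  adj (miter T A n w) *m Psi (iter n T w) *m miter T A n w = Psi w.
Proof.
elim: n => [|n ih] /=; first by rewrite adj_1 mul1mx mulmx1.
rewrite adjM !mulmxA -(mulmxA (adj _) (adj _)) -(mulmxA (adj _)) (co_form co).
exact: ih.
Qed.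

(** [P] is the weaker bundle. The product form covers zero vectors, and the rate is recorded along
    the multiples of a block length [b] only. *)
Definition dominated (P Q : mx) := exists b C mu, [/\ (0 < b)%N, 0 < C, 0 <= mu < 1 &
  forall n w (v u : 'cV[K]_N), P w *m v = v -> Q w *m u = u ->
  nrm (miter T A (b * n) w *m v) * nrm u <= C * mu ^+ n * (nrm (miter T A (b * n) w *m u) * nrm v)].

Record invproj (P : mx) : Prop := InvProj {
  ip_c : forall w, cm P w;
  ip_PP : forall w, P w *m P w = P w;
  ip_p : forall w, P w *m p w = P w;
  ip_pP : forall w, p w *m P w = P w;
  ip_A : forall w, P (T w) *m A w = A w *m P w }.

Lemma ip_minv P : invproj P -> forall n w, P w *m minv n w = minv n w *m P (iter n T w).
Proof.
move=> ip n w.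
have h := miter_comm (ip_A ip) n w.
have : minv n w *m (P (iter n T w) *m miter T A n w) *m minv n w =
  minv n w *m (miter T A n w *m P w) *m minv n w by rewrite h.
rewrite !mulmxA minvK (ip_pP ip) -!mulmxA miterK => <-.
by rewrite (ip_p ip).
Qed.

Lemma miter_gt0 n w (x : 'cV[K]_N) : p w *m x = x -> x != 0 -> 0 < nrm (miter T A n w *m x).
Proof.
move=> px x0; apply: nrm_gt0; apply: contra x0 => /eqP h.
by apply/eqP; exact: miter_inj px h.
Qed.

Section Dichotomy.
Variables (P Q : mx).
Hypotheses (iP : invproj P) (iQ : invproj Q) (PQ : forall w, P w *m Q w = 0)
  (QP : forall w, Q w *m P w = 0) (PQp : forall w, P w + Q w = p w).
Hypothesis dm : dominated P Q.

(** Domination speaks of pairs of vectors, the graph transform of operator norms. A column of [Q] at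
    the end point, pulled back, is compared with a column of [P] at the starting point; the sum over
    all pairs of columns is the product of the norms. *)
Lemma gap_exists (e : R) : 0 < e -> exists2 n, (0 < n)%N &
  forall w, nrm (minv n w *m Q (iter n T w)) * nrm (miter T A n w *m P w) <= e.
Proof.
move=> e0; have [b [C [mu [b0 C0 mu1 H]]]] := dm.
have [bP bP0 hP] := cm_bound cOm (ip_c iP).
have [bQ bQ0 hQ] := cm_bound cOm (ip_c iQ).
have [n n0 hn] := expr_small (C * (bQ * bP)) mu1 e0.
exists (b * n)%N; first by rewrite muln_gt0 b0.
move=> w; set D := minv _ _ *m _; set M := miter _ _ _ _ *m _.
rewrite (nrm_col D) (nrm_col M) mulr_suml.
apply: (@le_trans _ _ (\sum_i \sum_j C * mu ^+ n * (nrm (col i (Q (iter (b * n) T w))) *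
   nrm (col j (P w))))).
  apply: ler_sum => i _; rewrite mulr_sumr; apply: ler_sum => j _.
  have QD : Q w *m D = D by rewrite /D mulmxA (ip_minv iQ) -mulmxA (ip_PP iQ).
  have MD : miter T A (b * n) w *m D = Q (iter (b * n) T w).
    by rewrite /D mulmxA miterK (ip_pP iQ).
  have := H n w (P w *m delta_mx j ord0) (D *m delta_mx i ord0).
  rewrite (mulmxA (P w)) (ip_PP iP) (mulmxA (Q w)) QD => /(_ erefl erefl).
  by rewrite (mulmxA _ D) MD (mulmxA _ (P w)) -/M -!colE mulrC.
rewrite -[leRHS]mulr1; apply: (@le_trans _ _ (C * mu ^+ n * (bQ * bP))); last first.
  by rewrite mulr1 -mulrA [_ * (bQ * bP)]mulrC mulrA.
under eq_bigr do rewrite -mulr_sumr -mulr_sumr -nrm_col.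
rewrite -mulr_sumr -mulr_suml -nrm_col; apply: ler_wpM2l.
  by have /andP[m0 _] := mu1; rewrite mulr_ge0 ?exprn_ge0// ltW.
by apply: ler_pM; rewrite ?nrm_ge0.
Qed.

End Dichotomy.

(* The psi-orthogonal projection onto the range of Pc intertwines the cocycle;
   the image under it of a vector of P is as short as the vector itself, which
   the domination forbids unless it vanishes. *)
Lemma dominated_orth (P Q Pc : mx) : invproj P -> invproj Pc -> dominated P Q ->
  (forall w, Q w *m Pc w = Pc w) ->
  (forall w (x : 'cV[K]_N), adj (Pc w) *m Psi w *m Pc w *m x = 0 -> Pc w *m x = 0) ->
  forall w, adj (Pc w) *m Psi w *m P w = 0.
Proof.
move=> iP ic [b [C [mu [b0 C0 mu1 H]]]] QPc nd w.
pose Rc v := form_inv (Pc v) (Psi v) *m Psi v.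
have PcR v : Pc v *m Rc v = Rc v by rewrite /Rc mulmxA form_inv_l ?(ip_PP ic).
have cR v : cm Rc v.
  apply: cmM; last exact: (co_cPsi co).
  apply: cm_form_inv; [exact: (ip_PP ic)|exact: nd|exact: (ip_c ic)|exact: (co_cPsi co)].
have FR v : adj (Pc v) *m Psi v *m Rc v = adj (Pc v) *m Psi v.
  have := mul_form_inv (ip_PP ic v) (nd v).
  by rewrite -(mulmxA _ (Pc v)) (form_inv_l _ (ip_PP ic v)) /Rc mulmxA => ->.
have Runiq v (M : 'M[K]_N) : Pc v *m M = M -> adj (Pc v) *m Psi v *m M = 0 -> M = 0.
  move=> h1 h2; have := form_inv_mul_form (ip_PP ic v) (nd v) => /(congr1 (mulmx^~ M)).
  by rewrite -(mulmxA _ _ M) -(mulmxA _ (Pc v)) h1 h2 mulmx0 => ->.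
clearbody Rc.
(* Both sides take values in the range of [Pc] and, the form being invariant, pair equally with it;
   non-degeneracy makes them equal. *)
have RA v : Rc (T v) *m A v = A v *m Rc v.
  apply/eqP; rewrite -subr_eq0; apply/eqP/(Runiq (T v)).
    by rewrite mulmxBr !mulmxA PcR (ip_A ic) -(mulmxA _ (Pc v)) PcR.
  have e : adj (Pc (T v)) *m Psi (T v) *m A v = adj (Ai (T v) *m Pc (T v)) *m Psi v.
    rewrite -[in RHS](co_form co) !mulmxA -adjM !mulmxA (co_AAi co) (ip_pP ic).
    by [].
  have e2 : adj (Ai (T v) *m Pc (T v)) = adj (Ai (T v) *m Pc (T v)) *m adj (Pc v).
    rewrite -adjM mulmxA.
    have := ip_minv ic 1 v; rewrite /= => e3.
    have AiE : p v *m Ai (T v) = Ai (T v).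
      by have := co_pAi co (T v); rewrite (co_TK co).
    by congr adj; rewrite AiE in e3; rewrite e3 -mulmxA (ip_PP ic).
  rewrite mulmxBr !mulmxA FR e e2 -!mulmxA.
  by rewrite (mulmxA (adj (Pc v)) (Psi v) (Rc v)) FR subrr.
have R0 : Rc w *m P w = 0.
  have [bR bR0 hR] := cm_bound cOm cR.
  have col0 (x : 'cV[K]_N) : Rc w *m P w *m x = 0.
    rewrite -mulmxA; have [->|x0] := eqVneq (P w *m x) 0; first by rewrite mulmx0.
    apply: nrm_eq0; apply: (le_geom_eq0 mu1 (C := C * bR * nrm (P w *m x))) => [|n].
      exact: nrm_ge0.
    set k := (b * n)%N.
    have h := H n w (P w *m x) (Rc w *m (P w *m x)).
    have px : p w *m (P w *m x) = P w *m x by rewrite mulmxA (ip_pP iP).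
    have g0 := miter_gt0 k px x0.
    have {h} := h _ _; rewrite (mulmxA (P w)) (ip_PP iP) => /(_ erefl).
    have QR : Q w *m (Rc w *m (P w *m x)) = Rc w *m (P w *m x).
      by rewrite mulmxA -{1}PcR (mulmxA (Q w)) QPc PcR.
    move=> /(_ QR).
    have -> : miter T A (b * n) w *m (Rc w *m (P w *m x)) =
      Rc (iter k T w) *m (miter T A k w *m (P w *m x)).
      by rewrite mulmxA -(miter_comm RA) -mulmxA.
    rewrite -/k => h.
    have h2 : nrm (Rc (iter k T w) *m (miter T A k w *m (P w *m x))) <=
       bR * nrm (miter T A k w *m (P w *m x)).
      by apply: (le_trans (nrmM _ _)); rewrite ler_wpM2r ?nrm_ge0.
    rewrite -(ler_pM2l g0); apply: (le_trans h).
    have mu0 : 0 <= C * mu ^+ n.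
      by have /andP[m0 _] := mu1; rewrite mulr_ge0 ?exprn_ge0// ltW.
    have h3 := ler_wpM2r (nrm_ge0 (P w *m x)) h2.
    apply: (le_trans (ler_wpM2l mu0 h3)).
    by rewrite le_eqVlt; apply/orP; left; apply/eqP; ring.
  apply/matrixP => i j; have := col0 (delta_mx j ord0); rewrite -colE.
  by move/matrixP/(_ i ord0); rewrite !mxE.
by rewrite -FR -mulmxA R0 mulmx0.
Qed.

(* The form is invariant and the iterates of the vectors tend to 0. *)
Lemma contracted_isotropic (P : mx) (C mu : R) : invproj P -> 0 <= mu < 1 ->
  (forall n w (v : 'cV[K]_N), P w *m v = v -> nrm (miter T A n w *m v) <= C * mu ^+ n * nrm v) ->
  forall w, adj (P w) *m Psi w *m P w = 0.
Proof.
move=> iP mu1 H w; apply: nrm_eq0.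
have [bP bP0 hP] := cm_bound cOm (co_cPsi co).
have HM n : nrm (miter T A n w *m P w) <= C * mu ^+ n * nrm (P w).
  rewrite !nrm_col mulr_sumr; apply: ler_sum => j _.
  by rewrite !colE -mulmxA; apply: H; rewrite mulmxA (ip_PP iP).
apply: (le_geom_eq0 mu1 (C := `|C| * nrm (P w) * bP * (`|C| * nrm (P w)))) => [|n].
  exact: nrm_ge0.
have -> : adj (P w) *m Psi w *m P w = adj (miter T A n w *m P w) *m Psi (iter n T w) *m
  (miter T A n w *m P w).
  by rewrite -(miter_form n w) adjM !mulmxA.
have /andP[m0 m1] := mu1.
have a0 : 0 <= `|C| * nrm (P w) by rewrite mulr_ge0// nrm_ge0.
have h1 : nrm (miter T A n w *m P w) <= `|C| * nrm (P w) * mu ^+ n.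
  apply: (le_trans (HM n)); rewrite mulrAC; apply: ler_wpM2r; first exact: exprn_ge0.
  by apply: ler_wpM2r; [exact: nrm_ge0|exact: ler_norm].
have h2 : nrm (miter T A n w *m P w) <= `|C| * nrm (P w).
  by apply: (le_trans h1); rewrite ler_piMr// exprn_ile1// ltW.
apply: (le_trans (nrmM _ _)).
apply: (@le_trans _ _ ((`|C| * nrm (P w) * bP) * (`|C| * nrm (P w) * mu ^+ n))).
  apply: ler_pM => //; rewrite ?nrm_ge0//.
  apply: (le_trans (nrmM _ _)); rewrite nrm_adj.
  by apply: ler_pM => //; rewrite nrm_ge0.
by rewrite mulrA.
Qed.

End Cocycle.

(** * Uniqueness of the invariant graph *)

Section Uniqueness.
Context {R : realType} {Om : topologicalType}.
Hypothesis cOm : compact [set: Om].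
Local Notation K := R[i].
Context {N : nat}.
Local Notation mx := (Om -> 'M[K]_N).

Section Growth.
Variables (P Q p P1 Q1 AA0 AA X X1 D : 'M[K]_N).
Hypotheses (PQ : P *m Q = 0) (QP : Q *m P = 0) (PQp : P + Q = p).
Hypotheses (PP : P *m P = P) (QQ : Q *m Q = Q).
Hypotheses (PA : P1 *m AA0 = AA0 *m P) (QA : Q1 *m AA0 = AA0 *m Q).
Hypotheses (XQ : X = Q *m X) (XP : X = X *m P) (X1P : X1 = X1 *m P1).
Hypothesis DA : D *m AA0 *m Q = Q.
Hypothesis gr : Q1 *m AA *m (P + X) = X1 *m AA *m (P + X).

Lemma graph_PA : P1 *m AA *m (P + X) = AA0 *m P + P1 *m (AA - AA0) *m (P + X).
Proof.
have h : P1 *m AA0 *m (P + X) = AA0 *m P.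
  by rewrite PA -mulmxA mulmxDr XQ (mulmxA P) PQ mul0mx addr0 PP.
by rewrite mulmxBr mulmxBl h [RHS]addrC subrK.
Qed.

Lemma graph_dec (y : 'cV[K]_N) : p *m y = y ->
  y = (P + X) *m (P *m y) + (Q *m y - X *m P *m y).
Proof.
move=> py; rewrite mulmxA mulmxDl PP -XP mulmxDl -{1}py -PQp mulmxDl.
by rewrite addrACA subrr addr0.
Qed.

(** The graph is carried into the graph, so only the deviation [z] of y from it produces the next
    deviation; [D] recovers [z] up to an error with the factor [AA - AA0]. *)
Lemma graph_dev (y : 'cV[K]_N) : p *m y = y ->
  let z := Q *m y - X *m P *m y in
  D *m (Q1 *m (AA *m y) - X1 *m P1 *m (AA *m y)) = z + D *m (Q1 - X1) *m (AA - AA0) *m z.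
Proof.
move=> py z.
have Qz : Q *m z = z by rewrite /z mulmxBr !mulmxA QQ -XQ.
have Pz : P *m z = 0 by rewrite -Qz mulmxA PQ mul0mx.
have e1 : (Q1 - X1) *m AA *m y = (Q1 - X1) *m AA *m z.
  rewrite {1}(graph_dec py) -/z mulmxDr !mulmxA 3!mulmxBl gr subrr !mul0mx add0r.
  by [].
have e2 : D *m ((Q1 - X1) *m AA0 *m z) = z.
  rewrite mulmxBl X1P -(mulmxA X1) PA QA mulmxBl -(mulmxA AA0) Qz.
  rewrite !mulmxA -(mulmxA _ P z) Pz mulmx0 subr0 -Qz !mulmxA DA.
  by [].
have -> : Q1 *m (AA *m y) - X1 *m P1 *m (AA *m y) = (Q1 - X1) *m AA *m y.
  by rewrite -X1P -mulmxBl mulmxA.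
have e3 : (Q1 - X1) *m AA *m z = (Q1 - X1) *m AA0 *m z + (Q1 - X1) *m (AA - AA0) *m z.
  by rewrite -mulmxDl -mulmxDr [AA0 + _]addrC subrK.
by rewrite e1 e3 mulmxDr e2 !mulmxA.
Qed.

(** In one step the P-part of a graph vector is multiplied by at most c, the bracket in the first
    estimate assumed, and a deviation by at least 1 / (2 nrm D), where the 2 absorbs the error of
    [graph_dev]. That estimate says that the first factor is at most the second. *)
Lemma growth_ratio (x y : 'cV[K]_N) : p *m x = x -> p *m y = y ->
  Q *m x = X *m P *m x ->
  2 * nrm D * (nrm (AA0 *m P) + nrm P1 * nrm (AA - AA0) * nrm (P + X)) <= 1 ->
  nrm D * nrm (Q1 - X1) * nrm (AA - AA0) <= 1 / 2 ->
  nrm (P1 *m (AA *m x)) * nrm (Q *m y - X *m P *m y) <=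
  nrm (P *m x) * nrm (Q1 *m (AA *m y) - X1 *m P1 *m (AA *m y)).
Proof.
move=> px py gx h1 h2.
set z := Q *m y - _; set z1 := Q1 *m _ - _.
have ex : P1 *m (AA *m x) = (AA0 *m P + P1 *m (AA - AA0) *m (P + X)) *m (P *m x).
  by rewrite -graph_PA {1}(graph_dec px) gx subrr addr0 !mulmxA.
have b1 : nrm (P1 *m (AA *m x)) <=
   (nrm (AA0 *m P) + nrm P1 * nrm (AA - AA0) * nrm (P + X)) * nrm (P *m x).
  rewrite ex; apply: (le_trans (nrmM _ _)); apply: ler_wpM2r; first exact: nrm_ge0.
  apply: (le_trans (nrmD _ _)); rewrite lerD2l; apply: (le_trans (nrmM _ _)).
  by apply: ler_wpM2r; [exact: nrm_ge0|exact: nrmM].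
have b2 : nrm z <= 2 * (nrm D * nrm z1).
  have e := graph_dev py; rewrite /= -/z -/z1 in e.
  have ez : z = D *m z1 - D *m (Q1 - X1) *m (AA - AA0) *m z by rewrite e addrK.
  have := nrmB (D *m z1) (D *m (Q1 - X1) *m (AA - AA0) *m z).
  rewrite -ez => h.
  have k1 := nrmM D z1.
  have k2 : nrm (D *m (Q1 - X1) *m (AA - AA0) *m z) <= 1 / 2 * nrm z.
    apply: (le_trans (nrmM _ _)); apply: ler_wpM2r; first exact: nrm_ge0.
    apply: le_trans h2; apply: (le_trans (nrmM _ _)); apply: ler_wpM2r; first exact: nrm_ge0.
    exact: nrmM.
  lra.
have := ler_pM (nrm_ge0 _) (nrm_ge0 _) b1 b2 => /le_trans; apply.
set c := _ + _ in h1 *.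
have -> : c * nrm (P *m x) * (2 * (nrm D * nrm z1)) =
   (2 * nrm D * c) * (nrm (P *m x) * nrm z1) by ring.
by rewrite ler_piMl// mulr_ge0// nrm_ge0.
Qed.
End Growth.

(** Nested ranges of equal rank coincide, and a projection fixes its range. The transposes turn
    column spaces into row spaces. *)
Lemma proj_rank_eq (G P' : 'M[K]_N) : \rank G = \rank P' -> P' *m G = G ->
  P' *m P' = P' -> G *m G = G -> G *m P' = P'.
Proof.
move=> r e p' g.
have h : (G^T <= P'^T)%MS by rewrite -e trmx_mul submxMl.
have := eqmxP; have : (G^T == P'^T)%MS.
  by rewrite -(geq_leqif (mxrank_leqif_eq h)) !mxrank_tr r.
move=> /andP[_ /submxP[D hD]] _.
apply: trmx_inj; rewrite trmx_mul hD -mulmxA -trmx_mul.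
by rewrite g.
Qed.

Variables (T Tinv : Om -> Om) (A0 Ai0 A1 Ai1 p Psi : mx).
Hypothesis co0 : cocyc T Tinv A0 Ai0 p Psi.
Hypothesis co1 : cocyc T Tinv A1 Ai1 p Psi.
Variables (P Q P' Q' : mx).
Hypotheses (iP : invproj T A0 p P) (iQ : invproj T A0 p Q)
  (PQ : forall w, P w *m Q w = 0) (QP : forall w, Q w *m P w = 0)
  (PQp : forall w, P w + Q w = p w).
Hypotheses (iP' : invproj T A1 p P') (iQ' : invproj T A1 p Q')
  (PQ' : forall w, P' w *m Q' w = 0) (QP' : forall w, Q' w *m P' w = 0)
  (PQp' : forall w, P' w + Q' w = p w).
Hypothesis dm : dominated T A1 P' Q'.
Variable n0 : nat.
Hypothesis n0_gt0 : (0 < n0)%N.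
Let tau := iter n0 T.
Let AA0 := miter T A0 n0.
Let AA := miter T A1 n0.
Let D w := minv T Ai0 p n0 w *m Q (tau w).
Variable X : mx.
Hypotheses (XQ : forall w, X w = Q w *m X w) (XP : forall w, X w = X w *m P w)
  (gr : forall w, Q (tau w) *m AA w *m (P w + X w) = X (tau w) *m AA w *m (P w + X w)).
Hypotheses
  (h1 : forall w, 2 * nrm (D w) * (nrm (AA0 w *m P w) +
     nrm (P (tau w)) * nrm (AA w - AA0 w) * nrm (P w + X w)) <= 1)
  (h2 : forall w, nrm (D w) * nrm (Q (tau w) - X (tau w)) * nrm (AA w - AA0 w) <= 1 / 2).
Variable B : R.
Hypotheses (hB : forall w, nrm (P w + X w) <= B) (hB2 : forall w, nrm (Q w - X w) <= B).
Hypothesis rk : forall w, \rank (P w) = \rank (P' w).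

(* Vectors of the graph of X grow at most half as fast as the deviation from
   the graph, while vectors of P' are dominated by those off P'; so the graph
   and the range of P' are nested, hence equal. *)
Lemma graph_unique w : P' w *m (P w + X w) = P w + X w /\ (P w + X w) *m P' w = P' w.
Proof.
have PA v : P (tau v) *m AA0 v = AA0 v *m P v by exact: (miter_comm (ip_A iP)).
have QA v : Q (tau v) *m AA0 v = AA0 v *m Q v by exact: (miter_comm (ip_A iQ)).
have DA v : D v *m AA0 v *m Q v = Q v.
  by rewrite /D -(mulmxA _ (Q _)) QA -!mulmxA (ip_PP iQ) mulmxA (minvK co0) (ip_pP iQ).
have XPQ v : X v *m P v = X v by rewrite -XP.
have GG v : (P v + X v) *m (P v + X v) = P v + X v.
  have PX0 : P v *m X v = 0 by rewrite XQ mulmxA PQ mul0mx.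
  have XX0 : X v *m X v = 0 by rewrite {1}XP -mulmxA PX0 mulmx0.
  by rewrite mulmxDl !mulmxDr (ip_PP iP) PX0 -XP XX0 !addr0.
have PX v : P v *m (P v + X v) = P v.
  by rewrite mulmxDr (ip_PP iP) XQ mulmxA PQ mul0mx addr0.
have GP v : (P v + X v) *m P v = P v + X v by rewrite mulmxDl (ip_PP iP) -XP.
have rkG v : \rank (P v + X v)%R = \rank (P v).
  apply/eqP; rewrite eqn_leq; apply/andP; split.
    by rewrite -{1}GP mxrankM_maxr.
  by rewrite -{1}PX mxrankM_maxr.
have pG v : p v *m (P v + X v) = P v + X v.
  by rewrite mulmxDr (ip_pP iP) {1}XQ mulmxA (ip_pP iQ) -XQ.
have dev (y : 'cV[K]_N) v : p v *m y = y ->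
    Q v *m y - X v *m P v *m y = y - (P v + X v) *m y.
  by move=> py; rewrite -{3}py -PQp !mulmxDl -XP opprD addrACA subrr add0r.
have key (x y : 'cV[K]_N) : (P w + X w) *m x = x -> P' w *m y = y ->
    P' w *m x = x \/ (P w + X w) *m y = y.
  move=> Gx Py.
  have px : p w *m x = x by rewrite -Gx mulmxA pG.
  have py : p w *m y = y by rewrite -Py mulmxA (ip_pP iP').
  have [->|nx] := eqVneq (P' w *m x) x; first by left.
  have [->|ny] := eqVneq ((P w + X w) *m y) y; first by right.
  exfalso.
  (* The orbits of a graph vector off P' and of a vector of P' off the graph. The ratio xn / yn
     stays bounded, because yn has a deviation from the graph that grows at least as fast as xn; by
     domination yn / xn tends to 0 along a subsequence, because x has a component in Q'. Both cannot
     hold. *)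
  pose xn m := miter tau AA m w *m x; pose yn m := miter tau AA m w *m y.
  have pAA v : p (tau v) *m AA v = AA v *m p v by exact: (miter_p co1).
  have pm m : p (iter m tau w) *m miter tau AA m w = miter tau AA m w *m p w.
    exact: miter_comm.
  have pxn m : p (iter m tau w) *m xn m = xn m by rewrite mulmxA pm -mulmxA px.
  have pyn m : p (iter m tau w) *m yn m = yn m by rewrite mulmxA pm -mulmxA py.
  have Gxn m : Q (iter m tau w) *m xn m = X (iter m tau w) *m P (iter m tau w) *m xn m.
    elim: m => [|m ih].
      apply/eqP; rewrite -subr_eq0 dev ?pxn//= /xn /= mul1mx Gx subrr//.
    have ex : xn m = (P (iter m tau w) + X (iter m tau w)) *m (P (iter m tau w) *m xn m).
      have := @graph_dec (P (iter m tau w)) (Q (iter m tau w)) _ (X (iter m tau w)) (PQp _) (ip_PP iP _) (XP _) _ (pxn m).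
      by rewrite ih subrr addr0.
    have -> : xn m.+1 = AA (iter m tau w) *m xn m by rewrite /xn /= mulmxA.
    rewrite -XP {1 2}ex !mulmxA gr.
    by [].
  pose zn m := Q (iter m tau w) *m yn m - X (iter m tau w) *m P (iter m tau w) *m yn m.
  have step m : nrm (P (iter m.+1 tau w) *m xn m.+1) * nrm (zn m) <=
      nrm (P (iter m tau w) *m xn m) * nrm (zn m.+1).
    have := growth_ratio (PQ _) (PQp _) (ip_PP iP _) (ip_PP iQ _) (PA _) (QA _)
      (XQ _) (XP _) (XP _) (DA _) (gr _) (pxn m) (pyn m) (Gxn m) (h1 _) (h2 _).
    by rewrite /zn /xn /yn /= !mulmxA.
  have z0 : 0 < nrm (zn 0%N).
    apply: nrm_gt0; rewrite /zn /yn /= mul1mx dev// subr_eq0 eq_sym.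
    exact: ny.
  have zpos m : 0 < nrm (zn m).
    elim: m => [//|m ih].
    have xpos : 0 < nrm (P (iter m.+1 tau w) *m xn m.+1).
      apply: nrm_gt0; apply/eqP => e.
      have : xn m.+1 = 0.
        have := @graph_dec (P (iter m.+1 tau w)) (Q (iter m.+1 tau w)) _ (X (iter m.+1 tau w)) (PQp _) (ip_PP iP _) (XP _) _ (pxn m.+1).
        by rewrite Gxn subrr addr0 e mulmx0.
      rewrite /xn miter_block => /(miter_inj co1 px) x0.
      by move/eqP: nx; apply; rewrite x0 mulmx0.
    have := lt_le_trans (mulr_gt0 xpos ih) (step m).
    by rewrite lt_neqAle => /andP[/eqP h _]; apply: nrm_gt0; apply/eqP => e; apply: h; rewrite e nrm0 mulr0.
  have ratio m : nrm (P (iter m tau w) *m xn m) * nrm (zn 0%N) <=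
      nrm (P w *m x) * nrm (zn m).
    have := ratio_induct step zpos m.
    by rewrite [xn 0%N]mul1mx.
  have B0 : 0 <= B by exact: le_trans (nrm_ge0 _) (hB w).
  have xle m : nrm (xn m) <= B * nrm (P (iter m tau w) *m xn m).
    have := @graph_dec (P (iter m tau w)) (Q (iter m tau w)) _ (X (iter m tau w)) (PQp _) (ip_PP iP _) (XP _) _ (pxn m).
    rewrite Gxn subrr addr0 => e; rewrite {1}e; apply: (le_trans (nrmM _ _)).
    by apply: ler_wpM2r; rewrite ?nrm_ge0.
  have zle m : nrm (zn m) <= B * nrm (yn m).
    have -> : zn m = (Q (iter m tau w) - X (iter m tau w)) *m yn m.
      by rewrite /zn -XP mulmxBl.
    by apply: (le_trans (nrmM _ _)); apply: ler_wpM2r; rewrite ?nrm_ge0.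
  have up m : nrm (xn m) * nrm (zn 0%N) <= B * B * nrm (P w *m x) * nrm (yn m).
    by apply: (ratio_up _ _ _ (xle m) (ratio m) (zle m)); rewrite ?nrm_ge0.
  have [b [C [mu [b0 C0 mu1 H]]]] := dm.
  have [bQ bQ0 hQ] := cm_bound cOm (ip_c iQ').
  pose f := Q' w *m x.
  have f0 : 0 < nrm f.
    apply: nrm_gt0; apply/eqP => e; move/eqP: nx; apply.
    by rewrite -{2}px -PQp' mulmxDl -/f e addr0.
  have mu0 : 0 <= mu by case/andP: mu1.
  have down m : nrm (yn (b * m)) * nrm f <= C * mu ^+ m * (bQ * nrm (xn (b * m)) * nrm y).
    have := H (n0 * m)%N w y f Py _; rewrite /f mulmxA (ip_PP iQ') => /(_ erefl).
    have -> : (b * (n0 * m) = n0 * (b * m))%N by rewrite mulnCA.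
    rewrite -miter_block -/tau -/AA -/(yn _) -/f => h; apply: (le_trans h).
    have e : miter tau AA (b * m) w *m f = Q' (iter (b * m) tau w) *m xn (b * m)%N.
      rewrite /f /xn !mulmxA miter_block -(miter_comm (ip_A iQ')) /tau iter_block.
      by [].
    apply: ler_pM.
    - by rewrite mulr_ge0 ?exprn_ge0// ltW.
    - by rewrite mulr_ge0 ?nrm_ge0.
    - by apply: ler_wpM2l; [exact: ltW|exact: expr_mul_le].
    - apply: ler_wpM2r; first exact: nrm_ge0.
      by rewrite e; apply: (le_trans (nrmM _ _)); apply: ler_wpM2r; rewrite ?nrm_ge0.
  pose c1 := nrm (zn 0%N); pose c2 := B * B * nrm (P w *m x).
  have xpos m : 0 < nrm (xn m).
    rewrite /xn miter_block; apply: (miter_gt0 co1) => //.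
    by apply/eqP => x0; move/eqP: nx; apply; rewrite x0 mulmx0.
  have c20 : 0 <= c2 by rewrite !mulr_ge0 ?nrm_ge0.
  have fin m : c1 * nrm f <= c2 * (C * bQ * nrm y) * mu ^+ m.
    by apply: (ratio_down _ _ _ (up (b * m)%N) (down m)); rewrite ?nrm_ge0.
  have := le_geom_eq0 mu1 (mulr_ge0 (ltW z0) (ltW f0)) fin.
  by move/eqP; rewrite mulf_eq0 !gt_eqF.
(* Over all pairs the alternative [key] means inclusion: if one graph vector lies off P', every
   vector of P' lies on the graph; otherwise the graph lies in P'. Equality follows from the
   ranks. *)
have [/existsP[i hi]|] := boolP [exists i, P' w *m (P w + X w) *m delta_mx i (0 : 'I_1) != (P w + X w) *m delta_mx i 0].
  have all_y (y : 'cV[K]_N) : P' w *m y = y -> (P w + X w) *m y = y.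
    move=> Py; have [] := key ((P w + X w) *m delta_mx i 0) y _ Py => //.
      by rewrite mulmxA GG.
    by move=> e; move: hi; rewrite -mulmxA e eqxx.
  have e1 : (P w + X w) *m P' w = P' w.
    apply/matrixP => k j.
    have := all_y (P' w *m delta_mx j 0); rewrite mulmxA (ip_PP iP') => /(_ erefl).
    by rewrite mulmxA -!colE => /matrixP/(_ k 0); rewrite !mxE.
  split=> //; apply: (proj_rank_eq _ e1 (GG w) (ip_PP iP' w)).
  by rewrite rkG rk.
move=> /existsPn h.
have e1 : P' w *m (P w + X w) = P w + X w.
  apply/matrixP => k j; have := h j; rewrite negbK -!colE => /eqP/matrixP/(_ k 0).
  by rewrite !mxE.
split=> //; apply: (proj_rank_eq _ e1 (ip_PP iP' w) (GG w)).
by rewrite rkG rk.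
Qed.

End Uniqueness.

(** * Exponential domination from a Hermitian metric *)

Section Domination.
Context {R : realType} {Om : topologicalType}.
Hypothesis cOm : compact [set: Om].
Local Notation K := R[i].
Context {N : nat}.
Local Notation mx := (Om -> 'M[K]_N).
Implicit Types P Q H : mx.

Definition quad H w (x : 'cV[K]_N) : R := complex.Re ((adj x *m H w *m x) ord0 ord0).

Lemma quad_ub H w x : quad H w x <= nrm (H w) * nrm x ^+ 2.
Proof.
apply: (le_trans (ler_norm _)); apply: (le_trans (Re_le_n1 _)).
apply: (le_trans (n1_le_nrm _ _ _)); apply: (le_trans (nrmM _ _)).
rewrite expr2 mulrA; apply: ler_wpM2r; first exact: nrm_ge0.
by apply: (le_trans (nrmM _ _)); rewrite nrm_adj mulrC.
Qed.

Lemma quadZ H w x (r : R) : quad H w (r%:C%C *: x) = r ^+ 2 * quad H w x.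
Proof.
rewrite /quad adj_scale -!scalemxAl -scalemxAr !mxE conjc_real.
by case: (\sum_j _) => a b /=; rewrite !mul0r !subr0 expr2 mulrA.
Qed.

Lemma quad0 H w : quad H w 0 = 0.
Proof. by rewrite /quad mulmx0 mxE. Qed.

Lemma rate_bound (C m mu b z y y' : R) : 0 <= C -> 0 <= m <= mu -> 0 <= z -> 0 <= y' <= b * y ->
  C * m * (z * y') <= C * b * (mu * (z * y)).
Proof.
move=> C0 /andP[m0 mm] z0 /andP[y0 yy].
have -> : C * m * (z * y') = C * (m * (z * y')) by ring.
have -> : C * b * (mu * (z * y)) = C * (mu * (z * (b * y))) by ring.
apply: ler_wpM2l => //; apply: ler_pM => //; first exact: mulr_ge0.
exact: ler_wpM2l.
Qed.

Lemma le_of_sq (x y k : R) : 0 <= y -> 0 <= k -> x ^+ 2 <= k ^+ 2 * y ^+ 2 -> x <= k * y.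
Proof.
move=> y0 k0; rewrite -exprMn => h.
have [x0|x0] := leP x 0; first by apply: (le_trans x0); rewrite mulr_ge0.
by rewrite -(@ler_pXn2r _ 2%N) ?nnegrE ?mulr_ge0// ltW.
Qed.

Section OneCocycle.
Variables (T Tinv : Om -> Om) (A Ai p Psi : mx).
Hypothesis co : cocyc T Tinv A Ai p Psi.
Variable H : mx.
Hypothesis cH : forall w, cm H w.
Hypothesis H0 : forall w x, p w *m x = x -> x != 0 -> 0 < quad H w x.

Lemma quad_ge0 w x : p w *m x = x -> 0 <= quad H w x.
Proof.
move=> px; by have [->|x0] := eqVneq x 0; [rewrite quad0|apply/ltW/H0].
Qed.

Lemma cm_fst n (F : Om -> 'M[K]_n) m (y : Om * 'rV[R]_m) : (forall w, cm F w) ->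
  cm (fun z : Om * 'rV[R]_m => F z.1) y.
Proof.
move=> cF; apply: (@cm_comp _ _ _ _ _ F (fun z : Om * 'rV[R]_m => z.1)); last exact: cF.
exact: cvg_fst.
Qed.

(** The lower bound is attained on the compact set of unit vectors in the range of [p], the zero set
    of [g] below, and extends by homogeneity. *)
Lemma quad_equiv : exists c C : R, [/\ 0 < c, 0 < C &
  forall w x, p w *m x = x -> c * nrm x ^+ 2 <= quad H w x /\ quad H w x <= C * nrm x ^+ 2].
Proof.
have [C C0 hC] := cm_bound cOm cH.
pose g w (x : 'cV[K]_N) := nrm (p w *m x - x) + `|nrm x - 1|.
have [||w x _ gx|c c0 hc] := @ball_bundle_lb R Om cOm N 1 (quad H) g.
- move=> z; have h : cm (fun z : Om * 'rV[R]_(N + N) => adj (vec_of z.2) *m H z.1 *m vec_of z.2) z.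
    apply: cmM (@cm_vec_of _ _ _ z); apply: cmM (cm_fst _ cH).
    by apply: cm_adj; exact: (@cm_vec_of _ _ _ z).
  by have [] := h ord0 ord0.
- move=> z; apply: (@cvgD _ _ _ _ _ _ _ _ _).
    have h : cm (fun z : Om * 'rV[R]_(N + N) => p z.1 *m vec_of z.2 - vec_of z.2) z.
      apply: cmB (@cm_vec_of _ _ _ z); apply: cmM (@cm_vec_of _ _ _ z).
      exact: cm_fst (co_cp co).
    exact: (nrm_continuous h).
  apply: cvg_norm; apply: cvgB; last exact: cvg_cst.
  exact: (nrm_continuous (@cm_vec_of _ _ _ z)).
- move: gx => /eqP; rewrite /g paddr_eq0 ?nrm_ge0// normr_eq0 !subr_eq0.
  move=> /andP[/eqP h1 /eqP h2].
  apply: H0; first by apply/eqP; rewrite -subr_eq0; apply/eqP/nrm_eq0.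
  by apply/eqP => e; move: h2; rewrite e nrm0 => /esym/eqP; rewrite oner_eq0.
exists c, C; split => // w x px; split; last first.
  apply: (le_trans (quad_ub _ _ _)); by rewrite ler_wpM2r ?hC ?exprn_ge0 ?nrm_ge0.
have [->|x0] := eqVneq x 0.
  by rewrite nrm0 expr0n mulr0 quad0.
have n0 := nrm_gt0 x0.
have e : nrm (((nrm x)^-1)%:C%C *: x) = 1.
  by rewrite nrm_real ger0_norm ?invr_ge0 ?ltW// mulVf// gt_eqF.
have := hc w (((nrm x)^-1)%:C%C *: x) _ _.
rewrite /g e lexx -scalemxAr px !subrr nrm0 normr0 addr0 => /(_ erefl erefl).
rewrite quadZ exprVn => h.
by rewrite -ler_pdivlMr ?exprn_gt0// mulrC.
Qed.

(** The block length is a parameter, so that two dominations can be added at a common length. *)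
Definition dominated_at (b : nat) P Q := exists C mu : R, [/\ 0 < C, 0 <= mu < 1 &
  forall n w (v u : 'cV[K]_N), P w *m v = v -> Q w *m u = u ->
  nrm (miter T A (b * n) w *m v) * nrm u <= C * mu ^+ n * (nrm (miter T A (b * n) w *m u) * nrm v)].

Lemma dominated_atP b P Q : (0 < b)%N -> dominated_at b P Q -> dominated T A P Q.
Proof. by move=> b0 [C [mu [h1 h2 h3]]]; exists b, C, mu. Qed.

Lemma max_rate (m1 m2 : R) : 0 <= m1 < 1 -> 0 <= m2 < 1 ->
  exists mu : R, [/\ 0 <= mu < 1, forall n, m1 ^+ n <= mu ^+ n & forall n, m2 ^+ n <= mu ^+ n].
Proof.
move=> /andP[a1 b1] /andP[a2 b2]; exists (Num.max m1 m2); split.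
- by rewrite le_max a1 gt_max b1 b2.
- by move=> n; apply: lerXn2r; rewrite ?nnegrE ?le_max ?a1 ?lexx.
- by move=> n; apply: lerXn2r; rewrite ?nnegrE ?le_max ?a1 ?lexx ?orbT.
Qed.

Lemma dominated_addl b P1 P2 Q : (forall w, cm P1 w) -> (forall w, cm P2 w) ->
  (forall w, P1 w *m P1 w = P1 w) -> (forall w, P2 w *m P2 w = P2 w) ->
  dominated_at b P1 Q -> dominated_at b P2 Q ->
  dominated_at b (fun w => P1 w + P2 w) Q.
Proof.
move=> c1 c2 PP1 PP2 [C1 [m1 [C10 m10 h1]]] [C2 [m2 [C20 m20 h2]]].
have [mu [mu1 e1 e2]] := max_rate m10 m20.
have [b1 b10 hb1] := cm_bound cOm c1.
have [b2 b20 hb2] := cm_bound cOm c2.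
exists (C1 * b1 + C2 * b2), mu; split => //; first by rewrite addr_gt0// mulr_gt0.
move=> n w v u Pv Qu.
have k1 := h1 n w (P1 w *m v) u _ Qu; rewrite mulmxA PP1 in k1.
have k2 := h2 n w (P2 w *m v) u _ Qu; rewrite mulmxA PP2 in k2.
have {}k1 := k1 erefl; have {}k2 := k2 erefl.
have mu0 : 0 <= mu ^+ n by rewrite exprn_ge0//; case/andP: mu1.
set z := nrm (miter T A (b * n) w *m u) in k1 k2 *.
have z0 : 0 <= z by exact: nrm_ge0.
have l1 : C1 * m1 ^+ n * (z * nrm (P1 w *m v)) <= C1 * b1 * (mu ^+ n * (z * nrm v)).
  apply: rate_bound => //; first exact: ltW.
    by rewrite e1 exprn_ge0//; case/andP: m10.
  by rewrite nrm_ge0 (le_trans (nrmM _ _))// ler_wpM2r ?nrm_ge0.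
have l2 : C2 * m2 ^+ n * (z * nrm (P2 w *m v)) <= C2 * b2 * (mu ^+ n * (z * nrm v)).
  apply: rate_bound => //; first exact: ltW.
    by rewrite e2 exprn_ge0//; case/andP: m20.
  by rewrite nrm_ge0 (le_trans (nrmM _ _))// ler_wpM2r ?nrm_ge0.
have -> : nrm (miter T A (b * n) w *m v) =
  nrm (miter T A (b * n) w *m (P1 w *m v) + miter T A (b * n) w *m (P2 w *m v)).
  by rewrite -mulmxDr -mulmxDl Pv.
apply: (le_trans (ler_wpM2r (nrm_ge0 u) (nrmD _ _))).
rewrite mulrDl -(mulrA (_ + _)) (mulrDl (C1 * b1)); apply: lerD.
  exact: le_trans k1 l1.
exact: le_trans k2 l2.
Qed.

Lemma dominated_addr b P Q1 Q2 : invproj T A p Q1 -> invproj T A p Q2 ->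
  dominated_at b P Q1 -> dominated_at b P Q2 ->
  dominated_at b P (fun w => Q1 w + Q2 w).
Proof.
move=> i1 i2 [C1 [m1 [C10 m10 h1]]] [C2 [m2 [C20 m20 h2]]].
have [mu [mu1 e1 e2]] := max_rate m10 m20.
have [b1 b10 hb1] := cm_bound cOm (ip_c i1).
have [b2 b20 hb2] := cm_bound cOm (ip_c i2).
exists (C1 * b1 + C2 * b2), mu; split => //; first by rewrite addr_gt0// mulr_gt0.
move=> n w v u Pv Qu.
have k1 := h1 n w v (Q1 w *m u) Pv; rewrite mulmxA (ip_PP i1) in k1.
have k2 := h2 n w v (Q2 w *m u) Pv; rewrite mulmxA (ip_PP i2) in k2.
have {}k1 := k1 erefl; have {}k2 := k2 erefl.
rewrite mulmxA -(miter_comm (ip_A i1)) -mulmxA in k1.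
rewrite mulmxA -(miter_comm (ip_A i2)) -mulmxA in k2.
have mu0 : 0 <= mu ^+ n by rewrite exprn_ge0//; case/andP: mu1.
set z := nrm (miter T A (b * n) w *m u).
have z0 : 0 <= z by exact: nrm_ge0.
have l1 : C1 * m1 ^+ n * (nrm (Q1 (iter (b * n) T w) *m (miter T A (b * n) w *m u)) * nrm v)
   <= C1 * b1 * (mu ^+ n * (z * nrm v)).
  rewrite [_ * nrm v]mulrC [z * _]mulrC; apply: rate_bound; rewrite ?nrm_ge0//; first exact: ltW.
    by rewrite e1 exprn_ge0//; case/andP: m10.
  by rewrite /= (le_trans (nrmM _ _))// ler_wpM2r.
have l2 : C2 * m2 ^+ n * (nrm (Q2 (iter (b * n) T w) *m (miter T A (b * n) w *m u)) * nrm v)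
   <= C2 * b2 * (mu ^+ n * (z * nrm v)).
  rewrite [_ * nrm v]mulrC [z * _]mulrC; apply: rate_bound; rewrite ?nrm_ge0//; first exact: ltW.
    by rewrite e2 exprn_ge0//; case/andP: m20.
  by rewrite /= (le_trans (nrmM _ _))// ler_wpM2r.
have -> : nrm u = nrm (Q1 w *m u + Q2 w *m u) by rewrite -mulmxDl Qu.
apply: (le_trans (ler_wpM2l (nrm_ge0 _) (nrmD _ _))).
rewrite mulrDr -(mulrA (_ + _)) (mulrDl (C1 * b1)); apply: lerD.
  exact: le_trans k1 l1.
exact: le_trans k2 l2.
Qed.

(** Compactness of the unit vectors turns a strict inequality between squared norms over one block
    into a uniform factor mu < 1. The resulting inequality is homogeneous in both vectors and can be
    iterated. *)
Lemma dominated_quad (b : nat) P Q : (0 < b)%N -> invproj T A p P -> invproj T A p Q ->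
  (forall w v u, P w *m v = v -> Q w *m u = u -> v != 0 -> u != 0 ->
     quad H (iter b T w) (miter T A b w *m v) * quad H w u <
     quad H (iter b T w) (miter T A b w *m u) * quad H w v) ->
  dominated_at b P Q.
Proof.
move=> b0 iP iQ strict.
pose up (x : 'cV[K]_(N + N)) := usubmx x; pose dn (x : 'cV[K]_(N + N)) := dsubmx x.
pose AH w := adj (miter T A b w) *m H (iter b T w) *m miter T A b w.
have AHE w v : quad H (iter b T w) (miter T A b w *m v) = quad AH w v.
  by rewrite /quad /AH adjM !mulmxA.
have cAb := cm_miter b (co_T co) (co_cA co).
have cAH w : cm AH w.
  apply: cmM; last exact: cAb.
  apply: cmM; first by apply: cm_adj; exact: cAb.
  by apply: cm_comp; [exact: iter_continuous (co_T co) _|exact: cH].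
pose f w x := quad AH w (dn x) * quad H w (up x) - quad AH w (up x) * quad H w (dn x).
pose g w x := (nrm (P w *m up x - up x) + nrm (Q w *m dn x - dn x)) +
   (`|nrm (up x) - 1| + `|nrm (dn x) - 1|).
have cup (z : Om * 'rV[R]_((N + N) + (N + N))) : cm (fun z : Om * 'rV[R]_((N + N) + (N + N)) => up (vec_of z.2)) z.
  move=> i j; under eq_fun do rewrite /up mxE; exact: (@cm_vec_of _ _ _ z).
have cdn (z : Om * 'rV[R]_((N + N) + (N + N))) : cm (fun z : Om * 'rV[R]_((N + N) + (N + N)) => dn (vec_of z.2)) z.
  move=> i j; under eq_fun do rewrite /dn mxE; exact: (@cm_vec_of _ _ _ z).
have cq (G : mx) (x : Om * 'rV[R]_((N + N) + (N + N)) -> 'cV[K]_N) : (forall w, cm G w) -> (forall z, cm x z) ->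
   forall z, {for z, continuous (fun z => quad G z.1 (x z))}.
  move=> cG cx z.
  have h : cm (fun z => adj (x z) *m G z.1 *m x z) z.
    apply: cmM (cx z); apply: cmM (cm_fst _ cG).
    by apply: cm_adj.
  by have [] := h ord0 ord0.
(* The pair (v, u) is stacked into a single vector; two unit vectors have stacked norm 2, whence the
   radius. *)
have [||w x _ gx|e e0 he] := @ball_bundle_lb R Om cOm (N + N) 2 f g.
- move=> z; apply: (@cvgB _ _ _ _ _ _ _ _ _); apply: cvgM; exact: cq.
- have cdiff (G : mx) (x : Om * 'rV[R]_((N + N) + (N + N)) -> 'cV[K]_N) : (forall w, cm G w) -> (forall z, cm x z) ->
     forall z, {for z, continuous (fun z => nrm (G z.1 *m x z - x z))}.
    move=> cG cx z.
    have h : cm (fun z => G z.1 *m x z - x z) z.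
      by apply: cmB (cx z); apply: cmM (cx z); exact: cm_fst.
    exact: (nrm_continuous h).
  have cn1 (x : Om * 'rV[R]_((N + N) + (N + N)) -> 'cV[K]_N) : (forall z, cm x z) ->
     forall z, {for z, continuous (fun z => `|nrm (x z) - 1|)}.
    move=> cx z; apply: cvg_norm; apply: cvgB; last exact: cvg_cst.
    exact: (nrm_continuous (cx z)).
  move=> z; apply: (@cvgD _ _ _ _ _ _ _ _ _); apply: (@cvgD _ _ _ _ _ _ _ _ _).
  + exact: (cdiff P _ (ip_c iP) cup z).
  + exact: (cdiff Q _ (ip_c iQ) cdn z).
  + exact: (cn1 _ cup z).
  + exact: (cn1 _ cdn z).
- move: gx => /eqP; rewrite /g paddr_eq0 ?addr_ge0 ?nrm_ge0//.
  rewrite paddr_eq0 ?nrm_ge0// paddr_eq0// !normr_eq0 !subr_eq0.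
  move=> /andP[/andP[/eqP/nrm_eq0/eqP h1 /eqP/nrm_eq0/eqP h2] /andP[/eqP h3 /eqP h4]].
  rewrite /f subr_gt0 -!AHE; apply: strict.
  + by apply/eqP; rewrite -subr_eq0.
  + by apply/eqP; rewrite -subr_eq0.
  + by apply/eqP => e; move: h3; rewrite e nrm0 => /esym/eqP; rewrite oner_eq0.
  + by apply/eqP => e; move: h4; rewrite e nrm0 => /esym/eqP; rewrite oner_eq0.
have [BA BA0 hBA] := cm_bound cOm cAH.
have [BH BH0 hBH] := cm_bound cOm cH.
pose B := BA * BH; have B0 : 0 < B by rewrite mulr_gt0.
(* On unit vectors the gap [f] is at least [e] and the larger product is at most [B], so the
   proportion e / (B + e) of that product can be given away; the summand [e] in the denominator
   ensures mu >= 0. *)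
pose mu := 1 - e / (B + e).
have Be : 0 < B + e by rewrite addr_gt0.
have mu01 : 0 <= mu < 1.
  rewrite /mu subr_ge0 ler_pdivrMr// mul1r lerDr (ltW B0) /= ltrBlDr ltrDl.
  by rewrite divr_gt0.
have PpP w v : P w *m v = v -> p w *m v = v by move=> <-; rewrite mulmxA (ip_pP iP).
have QpQ w v : Q w *m v = v -> p w *m v = v by move=> <-; rewrite mulmxA (ip_pP iQ).
have unit1 w v u : P w *m v = v -> Q w *m u = u -> nrm v = 1 -> nrm u = 1 ->
   quad AH w v * quad H w u <= mu * (quad AH w u * quad H w v).
  move=> Pv Qu v1 u1.
  have := he w (col_mx v u) _ _.
  have -> : nrm (col_mx v u) = 2.
    rewrite /nrm big_split_ord /=.
    under eq_bigr do under eq_bigr do rewrite col_mxEu.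
    under [X in _ + X = _]eq_bigr do under eq_bigr do rewrite col_mxEd.
    by rewrite -!/(nrm _) v1 u1.
  rewrite lexx /g /f /up /dn col_mxKu col_mxKd Pv Qu !subrr !nrm0 v1 u1 subrr normr0 !addr0.
  move=> /(_ erefl erefl) h.
  have ub : quad AH w u * quad H w v <= B.
    apply: ler_pM.
    - by rewrite -AHE; apply: quad_ge0; rewrite mulmxA (miter_p co) -mulmxA QpQ.
    - by apply: quad_ge0; exact: PpP.
    - by apply: (le_trans (quad_ub _ _ _)); rewrite u1 expr1n mulr1.
    - by apply: (le_trans (quad_ub _ _ _)); rewrite v1 expr1n mulr1.
  have : e / (B + e) * (quad AH w u * quad H w v) <= e.
    rewrite mulrAC ler_pdivrMr// ; apply: ler_wpM2l; first exact: ltW.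
    by apply: (le_trans ub); rewrite lerDl ltW.
  rewrite /mu mulrBl mul1r; lra.
have one w v u : P w *m v = v -> Q w *m u = u ->
   quad AH w v * quad H w u <= mu * (quad AH w u * quad H w v).
  move=> Pv Qu.
  have [->|v0] := eqVneq v 0.
    by rewrite !quad0 ?mul0r ?mulr0 ?mul0r ?mulr0.
  have [->|u0] := eqVneq u 0.
    by rewrite !quad0 ?mul0r ?mulr0 ?mul0r ?mulr0.
  have nv := nrm_gt0 v0; have nu := nrm_gt0 u0.
  have n1E (x : 'cV[K]_N) : 0 < nrm x -> nrm (((nrm x)^-1)%:C%C *: x) = 1.
    by move=> x0; rewrite nrm_real ger0_norm ?invr_ge0 ?ltW// mulVf// gt_eqF.
  have := unit1 w (((nrm v)^-1)%:C%C *: v) (((nrm u)^-1)%:C%C *: u) _ _ (n1E _ nv) (n1E _ nu).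
  rewrite -!scalemxAr Pv Qu !quadZ => /(_ erefl erefl).
  set a := (nrm v)^-1 ^+ 2; set c := (nrm u)^-1 ^+ 2.
  have -> : a * quad AH w v * (c * quad H w u) = a * c * (quad AH w v * quad H w u) by ring.
  have -> : mu * (c * quad AH w u * (a * quad H w v)) = a * c * (mu * (quad AH w u * quad H w v)) by ring.
  by rewrite ler_pM2l// mulr_gt0// exprn_gt0// invr_gt0.
have iterq n w v u : P w *m v = v -> Q w *m u = u ->
   quad H (iter (b * n) T w) (miter T A (b * n) w *m v) * quad H w u <=
   mu ^+ n * (quad H (iter (b * n) T w) (miter T A (b * n) w *m u) * quad H w v).
  move=> Pv Qu; elim: n => [|n ih].
    by rewrite muln0 /= !mul1mx expr0 mul1r mulrC.
  set k := (b * n)%N in ih *.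
  have -> : (b * n.+1 = b + k)%N by rewrite mulnS.
  have := one (iter k T w) (miter T A k w *m v) (miter T A k w *m u).
  rewrite !mulmxA !(miter_comm (ip_A iP)) !(miter_comm (ip_A iQ)) -!mulmxA Pv Qu => /(_ erefl erefl).
  have AHk (x : 'cV[K]_N) : quad AH (iter k T w) (miter T A k w *m x) =
      quad H (iter (b + k) T w) (miter T A (b + k) w *m x).
    by rewrite -AHE -iterD mulmxA -miterD.
  rewrite !AHk.
  have qv0 m : 0 <= quad H (iter m T w) (miter T A m w *m v).
    by apply: quad_ge0; rewrite mulmxA (miter_p co) -mulmxA PpP.
  have qu0 m : 0 <= quad H (iter m T w) (miter T A m w *m u).
    by apply: quad_ge0; rewrite mulmxA (miter_p co) -mulmxA QpQ.
  have qu00 : 0 <= quad H w u by apply: quad_ge0; exact: QpQ.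
  have [u0|u0] := eqVneq u 0.
    by move=> _; rewrite u0 !mulmx0 !quad0 !(mulr0, mul0r).
  have kp : 0 < quad H (iter k T w) (miter T A k w *m u).
    apply: H0; first by rewrite mulmxA (miter_p co) -mulmxA QpQ.
    apply/eqP => e'; have := miter_inj co (QpQ _ _ _ Qu) e'.
    by move/eqP: u0.
  have mu0 : 0 <= mu by case/andP: mu01.
  move: ih kp (qv0 (b + k)%N) (qu0 (b + k)%N) (qv0 k).
  move: (quad H (iter (b + k) T w) (miter T A (b + k) w *m v)) => V1.
  move: (quad H (iter (b + k) T w) (miter T A (b + k) w *m u)) => U1.
  move: (quad H (iter k T w) (miter T A k w *m v)) => V.
  move: (quad H (iter k T w) (miter T A k w *m u)) => U.
  move: (quad H w u) qu00 => u00 hu; move: (quad H w v) => v00 ih kp V10 U10 V0 st.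
  rewrite -(ler_pM2l kp).
  apply: (@le_trans _ _ (mu * (U1 * V) * u00)).
    by rewrite mulrA [U * V1]mulrC; apply: ler_wpM2r.
  apply: (@le_trans _ _ (mu * U1 * (mu ^+ n * (U * v00)))).
    by rewrite -!mulrA; do 2!apply: ler_wpM2l => //; rewrite !mulrA in ih *.
  by rewrite le_eqVlt; apply/orP; left; apply/eqP; rewrite exprS; ring.
have [c [C [c0 C0 qe]]] := quad_equiv.
(* [mu] is the rate of squared norms, and C / c is the square root of the factor lost in passing
   between the metric and [nrm] for two vectors. *)
exists (C / c), (Num.sqrt mu).
have /andP[mu0 mu1] := mu01.
split; first by rewrite divr_gt0.
  rewrite sqrtr_ge0 /=.
  have -> : 1 = Num.sqrt (1 : R) by rewrite sqrtr1.
  by rewrite ltr_sqrt.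
move=> n w v u Pv Qu; apply: le_of_sq.
- by rewrite mulr_ge0 ?nrm_ge0.
- by rewrite mulr_ge0 ?exprn_ge0 ?sqrtr_ge0// divr_ge0// ltW.
have h := iterq n w v u Pv Qu.
have pk (x : 'cV[K]_N) : p w *m x = x ->
    p (iter (b * n) T w) *m (miter T A (b * n) w *m x) = miter T A (b * n) w *m x.
  by move=> px; rewrite mulmxA (miter_p co) -mulmxA px.
have [a1 _] := qe _ _ (pk _ (PpP _ _ _ Pv)).
have [_ a2] := qe _ _ (pk _ (QpQ _ _ _ Qu)).
have [a3 _] := qe w u (QpQ _ _ _ Qu); have [_ a4] := qe w v (PpP _ _ _ Pv).
have -> : (C / c * Num.sqrt mu ^+ n) ^+ 2 = mu ^+ n * (C / c) ^+ 2.
  by rewrite exprMn mulrC -exprM mulnC exprM sqr_sqrtr.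
have qvn : 0 <= quad H (iter (b * n) T w) (miter T A (b * n) w *m v).
  by apply: quad_ge0; rewrite mulmxA (miter_p co) -mulmxA PpP.
have qun : 0 <= quad H (iter (b * n) T w) (miter T A (b * n) w *m u).
  by apply: quad_ge0; rewrite mulmxA (miter_p co) -mulmxA QpQ.
have qv : 0 <= quad H w v by apply: quad_ge0; exact: PpP.
move: a1 a2 a3 a4 h qvn qun qv.
move: (nrm (miter T A (b * n) w *m v)) (nrm (miter T A (b * n) w *m u)) => x1 x2.
move: (quad H _ (miter T A (b * n) w *m v)) (quad H _ (miter T A (b * n) w *m u)) => q1 q2.
move: (quad H w u) (quad H w v) (nrm u) (nrm v) => q3 q4 x3 x4 a1 a2 a3 a4 h p1 p2 p4.
have mn : 0 <= mu ^+ n by exact: exprn_ge0.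
have s1 : c * x1 ^+ 2 * (c * x3 ^+ 2) <= q1 * q3.
  by apply: ler_pM => //; rewrite mulr_ge0 ?sqr_ge0// ltW.
have s2 : mu ^+ n * (q2 * q4) <= mu ^+ n * (C * x2 ^+ 2 * (C * x4 ^+ 2)).
  by apply: ler_wpM2l => //; apply: ler_pM.
have s := le_trans s1 (le_trans h s2).
have c2 : 0 < c ^+ 2 by rewrite exprn_gt0.
rewrite -(ler_pM2l c2).
have -> : c ^+ 2 * (x1 * x3) ^+ 2 = c * x1 ^+ 2 * (c * x3 ^+ 2) by ring.
apply: (le_trans s); rewrite le_eqVlt; apply/orP; left; apply/eqP.
by field; rewrite gt_eqF.
Qed.

Lemma rate_quad P (k r : R) : invproj T A p P -> 0 < k -> 0 <= r < 1 ->
  (forall n w v, P w *m v = v ->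
    quad H (iter n T w) (miter T A n w *m v) <= (k * r ^+ n) ^+ 2 * quad H w v) ->
  exists2 C, 0 < C & forall n w (v : 'cV[K]_N), P w *m v = v ->
    nrm (miter T A n w *m v) <= C * r ^+ n * nrm v.
Proof.
move=> iP k0 /andP[r0 r1] h.
have PpP w v : P w *m v = v -> p w *m v = v by move=> <-; rewrite mulmxA (ip_pP iP).
have [c [C [c0 C0 qe]]] := quad_equiv.
exists (k * Num.sqrt (C / c)); first by rewrite mulr_gt0// sqrtr_gt0 divr_gt0.
move=> n w v Pv; apply: le_of_sq; first exact: nrm_ge0.
  by rewrite !mulr_ge0 ?sqrtr_ge0 ?exprn_ge0// ltW.
have pvn : p (iter n T w) *m (miter T A n w *m v) = miter T A n w *m v.
  by rewrite mulmxA (miter_p co) -mulmxA PpP.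
have [a1 _] := qe _ _ pvn.
have [_ a2] := qe w v (PpP _ _ _ Pv).
have e : (k * Num.sqrt (C / c) * r ^+ n) ^+ 2 = (k * r ^+ n) ^+ 2 * (C / c).
  by rewrite !exprMn sqr_sqrtr ?divr_ge0 ?ltW// mulrAC.
rewrite e -(ler_pM2l c0); apply: (le_trans a1); apply: (le_trans (h n w v Pv)).
apply: (le_trans (ler_wpM2l (sqr_ge0 _) a2)).
by rewrite le_eqVlt; apply/orP; left; apply/eqP; field; rewrite gt_eqF.
Qed.

Lemma rate_quad_inv P (k r : R) : invproj T A p P -> 0 < k -> 0 <= r < 1 ->
  (forall n w v, P w *m v = v ->
    quad H w v <= (k * r ^+ n) ^+ 2 * quad H (iter n T w) (miter T A n w *m v)) ->
  exists2 C, 0 < C & forall n w (v : 'cV[K]_N), P w *m v = v ->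
    nrm v <= C * r ^+ n * nrm (miter T A n w *m v).
Proof.
move=> iP k0 /andP[r0 r1] h.
have PpP w v : P w *m v = v -> p w *m v = v by move=> <-; rewrite mulmxA (ip_pP iP).
have [c [C [c0 C0 qe]]] := quad_equiv.
exists (k * Num.sqrt (C / c)); first by rewrite mulr_gt0// sqrtr_gt0 divr_gt0.
move=> n w v Pv; apply: le_of_sq; first exact: nrm_ge0.
  by rewrite !mulr_ge0 ?sqrtr_ge0 ?exprn_ge0// ltW.
have pvn : p (iter n T w) *m (miter T A n w *m v) = miter T A n w *m v.
  by rewrite mulmxA (miter_p co) -mulmxA PpP.
have [_ a1] := qe _ _ pvn.
have [a2 _] := qe w v (PpP _ _ _ Pv).
have e : (k * Num.sqrt (C / c) * r ^+ n) ^+ 2 = (k * r ^+ n) ^+ 2 * (C / c).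
  by rewrite !exprMn sqr_sqrtr ?divr_ge0 ?ltW// mulrAC.
rewrite e -(ler_pM2l c0); apply: (le_trans a2); apply: (le_trans (h n w v Pv)).
apply: (le_trans (ler_wpM2l (sqr_ge0 _) a1)).
by rewrite le_eqVlt; apply/orP; left; apply/eqP; field; rewrite gt_eqF.
Qed.

(** Partial hyperbolicity compares consecutive bundles only; contraction of E^s and expansion of E^u
    supply the remaining comparison. Of the two factors r^(b n) one is bounded by r^n and the other
    by 1. *)
Lemma dominated_rates b P Q (C C' r : R) : (0 < b)%N -> 0 < C -> 0 < C' -> 0 <= r < 1 ->
  (forall n w (v : 'cV[K]_N), P w *m v = v ->
    nrm (miter T A n w *m v) <= C * r ^+ n * nrm v) ->
  (forall n w (v : 'cV[K]_N), Q w *m v = v ->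
    nrm v <= C' * r ^+ n * nrm (miter T A n w *m v)) ->
  dominated_at b P Q.
Proof.
move=> b0 C0 C'0 r01 h1 h2; exists (C * C'), r; split => //; first exact: mulr_gt0.
have /andP[r0 r1] := r01.
move=> n w v u Pv Qu.
have a := ler_pM (nrm_ge0 _) (nrm_ge0 _) (h1 (b * n)%N w v Pv) (h2 (b * n)%N w u Qu).
apply: (le_trans a).
have x1 := expr_mul_le n r01 b0.
have x2 : r ^+ (b * n) <= 1 by rewrite exprn_ile1// ltW.
move: (nrm_ge0 v) (nrm_ge0 (miter T A (b * n) w *m u)).
move: (nrm v) (nrm (miter T A (b * n) w *m u)) => y z y0 z0.
have -> : C * r ^+ (b * n) * y * (C' * r ^+ (b * n) * z) =
  r ^+ (b * n) * r ^+ (b * n) * (C * C' * (z * y)) by ring.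
have -> : C * C' * r ^+ n * (z * y) = r ^+ n * (C * C' * (z * y)) by ring.
apply: ler_wpM2r; first by rewrite !mulr_ge0// ltW.
rewrite -[leRHS]mulr1; apply: ler_pM => //; exact: exprn_ge0.
Qed.

Lemma miter_inv n w : miter T A n (iter n Tinv w) *m miter Tinv Ai n w *m p w = p w.
Proof.
have ci := cocyc_inv co.
elim: n => [|n ih]; first by rewrite /= !mul1mx.
have e v : miter T A n.+1 (Tinv v) = miter T A n v *m A (Tinv v).
  by rewrite -addn1 miterD /= mulmx1 (co_TinvK co).
rewrite [iter _ _ _]/= e [miter Tinv _ _ _]/=.
rewrite -!mulmxA (mulmxA (A _)) (co_AiA ci).
by rewrite (mulmxA (p _)) (miter_p ci) -!mulmxA (co_pp co) mulmxA.
Qed.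

(** Both vectors are pulled back along the orbit and domination is read at their preimages, which
    exchanges the roles of the bundles. *)
Lemma dominated_flip P Q : invproj T A p P -> invproj T A p Q ->
  dominated T A P Q -> dominated Tinv Ai Q P.
Proof.
move=> iP iQ [b [C [mu [b0 C0 mu1 h]]]]; exists b, C, mu; split => // n w v u Qv Pu.
have ci := cocyc_inv co.
set k := (b * n)%N.
have cP (S : mx) : invproj T A p S -> forall x : 'cV[K]_N, S w *m x = x ->
   S (iter k Tinv w) *m (miter Tinv Ai k w *m x) = miter Tinv Ai k w *m x /\
   miter T A k (iter k Tinv w) *m (miter Tinv Ai k w *m x) = x.
  move=> iS x Sx; have px : p w *m x = x by rewrite -Sx mulmxA (ip_pP iS).
  split; last by rewrite -{1}px !mulmxA miter_inv px.
  have SA v0 : S (Tinv v0) *m Ai v0 = Ai v0 *m S v0.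
    have := ip_A iS (Tinv v0); rewrite (co_TinvK co) => e.
    have : Ai v0 *m (S v0 *m A (Tinv v0)) *m Ai v0 = Ai v0 *m (A (Tinv v0) *m S (Tinv v0)) *m Ai v0.
      by rewrite e.
    rewrite !mulmxA (co_AAi ci) -!mulmxA (co_AiA ci) (ip_p iS).
    by rewrite (mulmxA (p _)) (ip_pP iS) => ->.
  by rewrite mulmxA (miter_comm SA) -mulmxA Sx.
have [e1 e2] := cP _ iQ _ Qv; have [e3 e4] := cP _ iP _ Pu.
have := h n (iter k Tinv w) _ _ e3 e1; rewrite -/k e2 e4 => h'.
by rewrite mulrC; apply: (le_trans h'); rewrite [nrm v * _]mulrC.
Qed.

Lemma invproj_flip P : invproj T A p P -> invproj Tinv Ai p P.
Proof.
move=> iP; have ci := cocyc_inv co; split; try by case: iP.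
move=> v0; have := ip_A iP (Tinv v0); rewrite (co_TinvK co) => e.
have : Ai v0 *m (P v0 *m A (Tinv v0)) *m Ai v0 = Ai v0 *m (A (Tinv v0) *m P (Tinv v0)) *m Ai v0.
  by rewrite e.
rewrite !mulmxA (co_AAi ci) -!mulmxA (co_AiA ci) (ip_p iP).
by rewrite (mulmxA (p _)) (ip_pP iP) => ->.
Qed.

Lemma rate_flip P (C mu : R) : invproj T A p P ->
  (forall n w (v : 'cV[K]_N), P w *m v = v ->
    nrm v <= C * mu ^+ n * nrm (miter T A n w *m v)) ->
  forall n w (v : 'cV[K]_N), P w *m v = v ->
    nrm (miter Tinv Ai n w *m v) <= C * mu ^+ n * nrm v.
Proof.
move=> iP h n w v Pv; have iP' := invproj_flip iP.
have pv : p w *m v = v by rewrite -Pv mulmxA (ip_pP iP).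
have := h n (iter n Tinv w) (miter Tinv Ai n w *m v).
rewrite mulmxA (miter_comm (ip_A iP')) -mulmxA Pv => /(_ erefl).
by rewrite -{2}pv !mulmxA miter_inv pv.
Qed.

End OneCocycle.
End Domination.

(** * Dependence of the splitting on time *)

Section StableGraph.
Context {R : realType} {Om : topologicalType}.
Hypothesis cOm : compact [set: Om].
Local Notation K := R[i].
Context {N : nat}.
Local Notation mx := (Om -> 'M[K]_N).
Variable Delta : R -> mx.
Local Notation NF := (nsys_filter Delta).

Lemma small_val (F : R -> mx) e : small Delta F -> 0 < e ->
  \forall S \near NF, forall t w, dom S t -> nrm (F t w) <= e.
Proof.
move=> sF e0.
have d0 : 0 < e / ((N * N).+1%:R * 2) by rewrite divr_gt0// mulr_gt0.
apply: filterS (sF _ d0) => S h t w Dt.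
apply: (le_trans (bndX_val w h Dt)).
set n := (N * N)%N; have n1 : (0 : R) < n%:R + 1 by rewrite natr1.
rewrite -[n.+1%:R]natr1.
have -> : n%:R * (e / ((n%:R + 1) * 2) + e / ((n%:R + 1) * 2)) = e * (n%:R / (n%:R + 1)) :> R.
  by field; rewrite gt_eqF.
by rewrite ger_pMr// ler_pdivrMr// mul1r lerDl.
Qed.

Lemma small_miter (T : Om -> Om) (A : R -> mx) (A0 : mx) n : continuous T -> (forall w, cm A0 w) ->
  small Delta (fun t w => A t w - A0 w) ->
  small Delta (fun t w => miter T (A t) n w - miter T A0 n w).
Proof.
move=> cT cA sA.
have bA : bdd Delta A.
  have := bddD (small_bdd sA) (bdd_cst cOm Delta cA).
  by apply: bdd_eq => t w; rewrite subrK.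
have bm k : bdd Delta (fun t => miter T (A t) k).
  elim: k => [|k ih] /=; first by apply: (bdd_cst cOm) => w; exact: cm_cst.
  apply: bddM ih; apply: (bdd_comp (f := iter k T)) bA; exact: iter_continuous.
elim: n => [|n ih] /=.
  move=> e e0; apply: filterE => S i j; apply: bndC_le (ltW e0) _.
  by apply: bndC_eq (bndC_0 S) => t w; rewrite subrr mxE.
have s1 := small_Mr (small_comp (f := iter n T) (iter_continuous cT) sA) (bm n).
have cA' : forall w, cm (fun w => A0 (iter n T w)) w.
  by move=> w; apply: cm_comp (cA _); exact: iter_continuous.
have s2 := small_Ml (bdd_cst cOm Delta cA') ih.
apply: small_eq (smallD s1 s2) => t w /=.
by rewrite mulmxBl mulmxBr addrA subrK.
Qed.

Variables (T Tinv : Om -> Om) (A Ai : R -> mx) (p Psi : mx) (I : set R).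
Hypothesis I0 : I 0.
Hypothesis co : forall t, I t -> cocyc T Tinv (A t) (Ai t) p Psi.
Hypothesis sA : small Delta (fun t w => A t w - A 0 w).
Variables P Q : R -> mx.
Hypotheses (iP : forall t, I t -> invproj T (A t) p (P t))
  (iQ : forall t, I t -> invproj T (A t) p (Q t))
  (PQ : forall t w, I t -> P t w *m Q t w = 0)
  (QP : forall t w, I t -> Q t w *m P t w = 0)
  (PQp : forall t w, I t -> P t w + Q t w = p w)
  (dm : forall t, I t -> dominated T (A t) (P t) (Q t))
  (rk : forall t w, I t -> \rank (P 0 w) = \rank (P t w)).

(* For t near 0 the range of P t is the graph over the range of P 0 of the fixed
   point of the graph transform of an iterate of A t. *)
Lemma stable_graph : exists2 X : R -> mx, small Delta X &
  \forall S \near NF, forall t, dom S t -> I t -> forall w,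
    [/\ X t w = X t w *m P 0 w, P t w *m (P 0 w + X t w) = P 0 w + X t w &
        (P 0 w + X t w) *m P t w = P t w].
Proof.
have co0 := co I0; have iP0 := iP I0; have iQ0 := iQ I0.
have g0 : (0 : R) < (16 * (N.+1%:R * N.+1%:R))^-1 by rewrite invr_gt0 !mulr_gt0.
have [n n0 gap] := gap_exists cOm co0 iP0 iQ0 (dm I0) g0.
pose tau := iter n T.
have ctau : continuous tau by exact: iter_continuous (co_T co0).
pose D w := minv T (Ai 0) p n w *m Q 0 (tau w).
have cD w : cm D w.
  apply: cmM; first exact: (cm_minv co0).
  by apply: cm_comp; [exact: ctau|exact: (ip_c iQ0)].
have cAA := cm_miter n (co_T co0) (co_cA co0).
have sAA := small_miter n (co_T co0) (co_cA co0) sA.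
have PA w : P 0 (tau w) *m miter T (A 0) n w = miter T (A 0) n w *m P 0 w.
  exact: (miter_comm (ip_A iP0)).
have QA w : Q 0 (tau w) *m miter T (A 0) n w = miter T (A 0) n w *m Q 0 w.
  exact: (miter_comm (ip_A iQ0)).
have QD w : Q 0 w *m D w = D w.
  by rewrite /D mulmxA (ip_minv co0 iQ0) -mulmxA (ip_PP iQ0).
have AD w : miter T (A 0) n w *m D w = Q 0 (tau w).
  by rewrite /D mulmxA (miterK co0) (ip_pP iQ0).
have [X sX HX] := graph_transform cOm ctau cAA (ip_c iP0) cD sAA (ip_PP iP0)
  (fun w => QP w I0) QA QD AD gap.
have [bP bP0 hP] := cm_bound cOm (ip_c iP0).
have [bQ bQ0 hQ] := cm_bound cOm (ip_c iQ0).
have [bD bD0 hD] := cm_bound cOm cD.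
(* With [AA - AA0] of norm at most 1 / (4 c), every perturbation term in the two estimates required
   by [graph_unique] is at most 1/4. The gap contributes another 1/4 to the first one, and twice the
   sum is 1. *)
pose c := 1 + bD * (bP + bQ + 1) * (bP + bQ + 1).
have c0 : 0 < c by rewrite addr_gt0// !mulr_gt0// !addr_gt0.
have d0 : 0 < (4 * c)^-1 by rewrite invr_gt0 mulr_gt0.
have sX1 := small_val sX ltr01; have sAA1 := small_val sAA d0.
exists X => //.
apply: filterS2 (filterI sX1 sAA1) HX => S [x1 a1] gX t Dt It w.
have XQ v : X t v = Q 0 v *m X t v by have [] := gX t v Dt.
have XP v : X t v = X t v *m P 0 v by have [] := gX t v Dt.
have gr v : Q 0 (tau v) *m miter T (A t) n v *m (P 0 v + X t v) =
   X t (tau v) *m miter T (A t) n v *m (P 0 v + X t v) by have [] := gX t v Dt.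
have bPX v : nrm (P 0 v + X t v) <= bP + bQ + 1.
  apply: (le_trans (nrmD _ _)); apply: (@le_trans _ _ (bP + 1)).
    by apply: lerD; [exact: hP|exact: x1].
  by rewrite lerD2r lerDl ltW.
have bQX v : nrm (Q 0 v - X t v) <= bP + bQ + 1.
  apply: (le_trans (nrmB _ _)); apply: (@le_trans _ _ (bQ + 1)).
    by apply: lerD; [exact: hQ|exact: x1].
  by rewrite lerD2r lerDr ltW.
have b0 : 0 <= bP + bQ + 1 by rewrite !addr_ge0// ltW.
have cc : bD * (bP + bQ + 1) * (bP + bQ + 1) * (4 * c)^-1 <= 1 / 4.
  rewrite ler_pdivrMr ?mulr_gt0//.
  have -> : 1 / 4 * (4 * c) = c by field.
  by rewrite /c lerDr.
have bP1 : bP <= bP + bQ + 1 by rewrite -addrA lerDl addr_ge0// ltW.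
have h1 v : 2 * nrm (D v) * (nrm (miter T (A 0) n v *m P 0 v) +
     nrm (P 0 (tau v)) * nrm (miter T (A t) n v - miter T (A 0) n v) *
     nrm (P 0 v + X t v)) <= 1.
  have k1 : nrm (D v) * nrm (miter T (A 0) n v *m P 0 v) <= 1 / 4.
    apply: (le_trans (gap v)); rewrite -[X in _ <= X]invrK invf_div divr1.
    rewrite lef_pV2 ?posrE ?mulr_gt0//.
    apply: (@le_trans _ _ (16 * 1)); first by rewrite mulr1 ler_nat.
    apply: ler_wpM2l => //; rewrite -[X in X <= _]mulr1; apply: ler_pM => //;
    by rewrite ler1n.
  have k2 : nrm (D v) * (nrm (P 0 (tau v)) * nrm (miter T (A t) n v - miter T (A 0) n v) *
     nrm (P 0 v + X t v)) <= 1 / 4.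
    apply: le_trans cc.
    have -> : bD * (bP + bQ + 1) * (bP + bQ + 1) * (4 * c)^-1 =
      bD * ((bP + bQ + 1) * (4 * c)^-1 * (bP + bQ + 1)) by ring.
    apply: ler_pM; rewrite ?hD ?mulr_ge0 ?nrm_ge0//.
    apply: ler_pM; rewrite ?bPX ?mulr_ge0 ?nrm_ge0//.
    apply: ler_pM; rewrite ?nrm_ge0 ?a1//.
    exact: le_trans (hP _) bP1.
  move: k1 k2; move: (nrm (D v)) => nD.
  move: (nrm (miter T (A 0) n v *m P 0 v)) => x.
  move: (_ * _ * _) => y k1 k2; rewrite -mulrA mulrDr; lra.
have h2 v : nrm (D v) * nrm (Q 0 (tau v) - X t (tau v)) *
   nrm (miter T (A t) n v - miter T (A 0) n v) <= 1 / 2.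
  apply: (@le_trans _ _ (1 / 4)); last lra.
  apply: le_trans cc; apply: ler_pM; rewrite ?a1 ?mulr_ge0 ?nrm_ge0//.
  apply: (@le_trans _ _ (bD * (bP + bQ + 1))); first by apply: ler_pM; rewrite ?nrm_ge0.
  by rewrite ler_peMr ?mulr_ge0// ?(ltW bD0)// lerDr addr_ge0// ltW.
have [u1 u2] := graph_unique cOm co0 (co It) iP0 iQ0 (fun w => PQ w I0) (fun w => PQp w I0)
   (iP It) (iQ It) (fun w => PQp w It) (dm It) n0 XQ XP gr h1 h2 bPX bQX (fun w => rk w It) w.
by split.
Qed.

End StableGraph.

(** * Adjoints for the form and the correction to an isometry *)

Section Dagger.
Context {R : realType} {N : nat}.
Local Notation K := R[i].
Local Notation M := 'M[K]_N.
Variables p Psi Lam : M.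
Hypotheses (pp : p *m p = p) (skew : adj Psi = - Psi) (Psip : Psi *m p = Psi)
  (LP : Lam *m Psi = p) (PL : Psi *m Lam = adj p) (pL : p *m Lam = Lam) (Lp : Lam *m adj p = Lam).

Lemma pPsi : adj p *m Psi = Psi.
Proof.
have : adj (Psi *m p) = adj Psi by rewrite Psip.
by rewrite adjM skew mulmxN => /oppr_inj.
Qed.

Lemma adj_Lam : adj Lam = - Lam.
Proof.
have h : Psi *m (- adj Lam) = adj p by rewrite mulmxN -mulNmx -skew -adjM LP.
have e : Lam *m (Psi *m (- adj Lam)) = Lam by rewrite h Lp.
rewrite mulmxA LP mulmxN in e.
have e2 : adj Lam = p *m adj Lam by rewrite -{1}Lp adjM adjK.
by rewrite -[in RHS]e opprK -e2.
Qed.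

(* The adjoint for the form Psi: Lam inverts Psi on the range of p. *)
Definition dag (A : M) : M := Lam *m adj A *m Psi.

Lemma dagD A B : dag (A + B) = dag A + dag B.
Proof. by rewrite /dag adjD mulmxDr mulmxDl. Qed.
Lemma dagM A B : A *m p = A -> dag (A *m B) = dag B *m dag A.
Proof.
move=> Ap; rewrite /dag adjM !mulmxA -(mulmxA _ Psi Lam) PL -(mulmxA _ (adj p)) -adjM Ap.
by [].
Qed.
Lemma dagMr A B : p *m B = B -> dag (A *m B) = dag B *m dag A.
Proof.
move=> pB; rewrite /dag adjM !mulmxA -(mulmxA _ Psi Lam) PL -(mulmxA Lam (adj B) (adj p)) -adjM pB.
by [].
Qed.
Lemma dagK A : dag (dag A) = p *m A *m p.
Proof.
rewrite /dag !adjM adjK skew adj_Lam !(mulmxN, mulNmx) opprK.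
by rewrite !mulmxA LP -(mulmxA _ Lam) LP.
Qed.
Lemma p_dag A : p *m dag A = dag A.
Proof. by rewrite /dag !mulmxA pL. Qed.
Lemma dag_p A : dag A *m p = dag A.
Proof. by rewrite /dag -!mulmxA Psip. Qed.
Lemma Psi_dag A : A *m p = A -> Psi *m dag A = adj A *m Psi.
Proof. by move=> Ap; rewrite /dag !mulmxA PL -adjM Ap. Qed.
Lemma Psi_eq0 m (A : 'M[K]_(N, m)) : p *m A = A -> Psi *m A = 0 -> A = 0.
Proof. by move=> pA h; rewrite -pA -LP -mulmxA h mulmx0. Qed.

Section CenterMap.
Variables Pc : M.
Hypotheses (PcPc : Pc *m Pc = Pc) (Pcp : Pc *m p = Pc) (pPc : p *m Pc = Pc).
Hypothesis Pco : Psi *m Pc = adj Pc *m Psi.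

Lemma dag_Pc : dag Pc = Pc.
Proof. by rewrite /dag -mulmxA -Pco mulmxA LP. Qed.

(* The terms of (1 + Z) (1 + L) (1 + Z) besides 1 + Z + Z. *)
Definition Wpoly (L Z : M) := L + Z *m Z + Z *m L + L *m Z + Z *m L *m Z.

Variables (Y Z L : M).
Hypotheses (pY : p *m Y = Y) (PcY : adj Pc *m Psi *m Y = 0).
Hypothesis LE : L = Pc *m dag Y *m Y *m Pc.
Hypothesis ZE : Z = (- (1 / 4 : R))%:C%C *: (Pc *m (Wpoly L Z + dag (Wpoly L Z)) *m Pc).

Lemma PcZ : Pc *m Z = Z.
Proof. by rewrite ZE -scalemxAr !mulmxA PcPc. Qed.
Lemma ZPc : Z *m Pc = Z.
Proof. by rewrite ZE -scalemxAl -!mulmxA PcPc. Qed.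
Let pZ : p *m Z = Z. Proof. by rewrite -PcZ mulmxA pPc. Qed.
Let Zp : Z *m p = Z. Proof. by rewrite -ZPc -mulmxA Pcp. Qed.
Let pLL : p *m L = L. Proof. by rewrite LE !mulmxA pPc. Qed.
Let LLp : L *m p = L. Proof. by rewrite LE -!mulmxA Pcp. Qed.
Let PcL : Pc *m L = L. Proof. by rewrite LE !mulmxA PcPc. Qed.
Let LPc : L *m Pc = L. Proof. by rewrite LE -!mulmxA PcPc. Qed.

Lemma dag_scale (r : R) A : dag (r%:C%C *: A) = r%:C%C *: dag A.
Proof. by rewrite /dag adj_scale conjc_real -scalemxAr -scalemxAl. Qed.

Lemma dag_L : dag L = L.
Proof.
have e1 : dag (Y *m Pc) = Pc *m dag Y by rewrite dagMr// dag_Pc.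
have e2 : dag (dag Y *m (Y *m Pc)) = Pc *m dag Y *m (Y *m p).
  by rewrite (dagM _ (dag_p Y)) e1 dagK pY.
have -> : L = Pc *m (dag Y *m (Y *m Pc)) by rewrite LE !mulmxA.
rewrite (dagM _ Pcp) dag_Pc e2 -!mulmxA.
by rewrite pPc.
Qed.

Lemma dag_Wpoly : dag Z = Z -> dag (Wpoly L Z) = Wpoly L Z.
Proof.
move=> dZ; rewrite /Wpoly !dagD.
have -> : dag (Z *m L *m Z) = Z *m L *m Z.
  by rewrite -mulmxA (dagM _ Zp) (dagM _ LLp) dZ dag_L mulmxA.
by rewrite (dagM _ Zp) (dagM _ Zp) (dagM _ LLp) dZ dag_L (addrAC _ (L *m Z)).
Qed.

(** The equation for Z contains W averaged with its adjoint, so a solution is self-adjoint by its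
    very form, without an appeal to uniqueness. Then W is self-adjoint too, and the equation becomes
    2 Z = - W. *)
Lemma dag_Z : dag Z = Z.
Proof.
have key A : p *m A *m p = A -> dag (Pc *m (A + dag A) *m Pc) = Pc *m (A + dag A) *m Pc.
  move=> pA; rewrite dagMr// dag_Pc dagM// dag_Pc dagD dagK pA addrC mulmxA.
  by [].
rewrite {1}ZE dag_scale key -?ZE//.
have pW : p *m Wpoly L Z = Wpoly L Z.
  by rewrite /Wpoly !mulmxDr !mulmxA pLL pZ.
have Wp : Wpoly L Z *m p = Wpoly L Z.
  by rewrite /Wpoly !mulmxDl -!mulmxA LLp Zp.
by rewrite pW Wp.
Qed.

Lemma Z_eq : Z + Z = - Wpoly L Z.
Proof.
have PW : Pc *m Wpoly L Z *m Pc = Wpoly L Z.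
  rewrite /Wpoly !mulmxDr !mulmxDl !mulmxA PcL PcZ -!mulmxA LPc ZPc.
  by [].
rewrite {1 2}ZE (dag_Wpoly dag_Z) mulmxDr mulmxDl PW.
move: (Wpoly L Z) => W; apply/matrixP => i j; rewrite !mxE; case: (W i j) => a b.
by apply: complex_ext => /=; field.
Qed.

(** Says that [Pc + Z] is the inverse square root of [Pc + L] on the center: expanded, this is the
    equation 2 Z = - W. *)
Lemma sqrt_eq : (Pc + Z) *m (Pc + L) *m (Pc + Z) = Pc.
Proof.
have e1 : (Pc + Z) *m (Pc + L) = Pc + L + (Z + Z *m L).
  by rewrite mulmxDl !mulmxDr PcPc PcL ZPc.
have e2 : (Pc + Z) *m (Pc + L) *m (Pc + Z) =
    Pc + L + (Z + Z *m L) + (Z + L *m Z + (Z *m Z + Z *m L *m Z)).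
  rewrite e1 mulmxDr; congr (_ + _).
    by rewrite !mulmxDl PcPc LPc ZPc -(mulmxA Z) LPc.
  by rewrite !mulmxDl PcZ.
have := Z_eq; rewrite e2 /Wpoly => /eqP; rewrite -addr_eq0 => /eqP.
move: (Z *m L) (L *m Z) (Z *m Z) (Z *m L *m Z) => a b c d /matrixP e.
apply/matrixP => i j; have := e i j; rewrite !mxE => {}e.
apply/eqP; rewrite -subr_eq0 -e; apply/eqP; ring.
Qed.

(** Since Y maps into the orthogonal of the center, the cross terms vanish and [p + Y] pulls the
    form back to [Psi *m (Pc + L)] there. The self-adjoint factor [Pc + Z] on both sides cancels L
    by [sqrt_eq]. *)
Lemma center_iso : adj ((p + Y) *m (Pc + Z)) *m Psi *m ((p + Y) *m (Pc + Z)) =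
  adj Pc *m Psi *m Pc.
Proof.
have S : Pc *m (Pc + Z) = Pc + Z by rewrite mulmxDr PcPc PcZ.
have dS : Psi *m (Pc + Z) = adj (Pc + Z) *m Psi.
  by rewrite adjD mulmxDl mulmxDr Pco -{1}dag_Z Psi_dag.
have c1 : adj (Pc + Z) *m Psi *m Y = 0.
  by rewrite -{1}S adjM -!mulmxA (mulmxA (adj Pc)) PcY mulmx0.
have c2 : adj Y *m Psi *m (Pc + Z) = 0.
  have : adj (adj (Pc + Z) *m Psi *m Y) = 0 by rewrite c1 adj0.
  by rewrite adjM (adjM (adj _)) adjK skew mulNmx mulmxN mulmxA => /eqP; rewrite oppr_eq0 => /eqP.
have e : adj Pc *m (adj Y *m Psi *m Y) *m Pc = Psi *m L.
  have -> : Psi *m L = (Psi *m Pc) *m dag Y *m Y *m Pc by rewrite LE !mulmxA.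
  rewrite Pco.
  by rewrite /dag !mulmxA -(mulmxA _ Psi Lam) PL -(adjM p Pc) pPc.
have S' : adj (Pc + Z) *m adj Pc = adj (Pc + Z) by rewrite -adjM S.
have cL : adj (Pc + Z) *m (adj Y *m Psi *m Y) *m (Pc + Z) =
   adj (Pc + Z) *m (Psi *m L) *m (Pc + Z).
  by rewrite -{1}S' -{2}S -e !mulmxA.
have pS : p *m (Pc + Z) = Pc + Z by rewrite mulmxDr pPc pZ.
have c3 : adj (Pc + Z) *m Psi *m (Pc + Z) = adj (Pc + Z) *m (Psi *m Pc) *m (Pc + Z).
  by rewrite !mulmxA -(mulmxA _ Pc) S.
have -> : adj ((p + Y) *m (Pc + Z)) *m Psi *m ((p + Y) *m (Pc + Z)) =
   adj (Pc + Z) *m (Psi *m (Pc + L)) *m (Pc + Z).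
  rewrite [Psi *m (Pc + L)]mulmxDr mulmxDr (mulmxDl _ _ (Pc + Z)) -cL -c3.
  move: c1 c2 pS; move: (Pc + Z) => S1 c1 c2 pS.
  have -> : (p + Y) *m S1 = S1 + Y *m S1 by rewrite mulmxDl pS.
  rewrite adjD adjM !mulmxDl !mulmxDr !mulmxA c1 mul0mx addr0.
  have -> : adj S1 *m adj Y *m Psi *m S1 = 0.
    by rewrite -!mulmxA (mulmxA (adj Y)) c2 mulmx0.
  by rewrite add0r.
have aux (S1 X A : M) : adj S1 *m Psi = Psi *m S1 -> S1 *m X *m S1 = A ->
    adj S1 *m (Psi *m X) *m S1 = Psi *m A by move=> h <-; rewrite !mulmxA h.
by rewrite (aux _ _ _ (esym dS) sqrt_eq) -Pco -mulmxA PcPc.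
Qed.
End CenterMap.
End Dagger.

Section CenterMember.
Context {R : realType} {N : nat}.
Local Notation K := R[i].
Local Notation M := 'M[K]_N.
Variables p Psi Lam : M.
Hypotheses (pp : p *m p = p) (skew : adj Psi = - Psi) (Psip : Psi *m p = Psi)
  (LP : Lam *m Psi = p) (PL : Psi *m Lam = adj p) (pL : p *m Lam = Lam) (Lp : Lam *m adj p = Lam).

(** The equation for Y says that the adjoint of [p + E] has the right inverse [p + Y]. So [p + Y]
    carries vectors orthogonal to a subspace to vectors orthogonal to its image under [p + E]. *)
Lemma dagger_graph (E Y : M) : E *m p = E ->
  Y = - dag Psi Lam E - dag Psi Lam E *m Y ->
  p *m Y = Y /\ adj (p + E) *m Psi *m (p + Y) = Psi.
Proof.
move=> Ep YE; have pd := p_dag Psi pL E.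
have pY : p *m Y = Y by rewrite {1}YE mulmxBr mulmxN (mulmxA p _ Y) pd -YE.
split=> //.
have pdE : (p + dag Psi Lam E) *m (p + Y) = p.
  rewrite mulmxDl !mulmxDr pp pY (dag_p _ Psip) -[RHS]addr0 -addrA; congr (_ + _).
  by apply/eqP; rewrite addr_eq0 opprD -YE.
rewrite adjD mulmxDl (pPsi skew Psip) -(Psi_dag PL Ep) -{1}Psip -mulmxDr -mulmxA pdE.
exact: Psip.
Qed.

Lemma orth_sym (P Q : M) : adj P *m Psi *m Q = 0 -> adj Q *m Psi *m P = 0.
Proof.
move=> h; have : adj (adj P *m Psi *m Q) = 0 by rewrite h adj0.
by rewrite adjM (adjM (adj _)) adjK skew mulNmx mulmxN mulmxA => /eqP; rewrite oppr_eq0 => /eqP.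
Qed.

(** The difference of B and [Pc *m B] pairs to zero with all three bundles, hence vanishes because
    the form is non-degenerate. *)
Lemma center_member (Ps Pc Pu B : M) : Ps + Pc + Pu = p -> Pc *m Pc = Pc -> p *m Pc = Pc ->
  adj Pc *m Psi *m Ps = 0 -> adj Pc *m Psi *m Pu = 0 -> p *m B = B ->
  adj Ps *m Psi *m B = 0 -> adj Pu *m Psi *m B = 0 -> Pc *m B = B.
Proof.
move=> sum PP pPc cs cu pB sB uB.
have D0 : Psi *m (B - Pc *m B) = 0.
  have e : (Ps + Pu) *m B = B - Pc *m B.
    by rewrite -{2}pB -sum !mulmxDl addrAC addrK.
  rewrite -(pPsi skew Psip) -sum !adjD !mulmxDl -!mulmxA !mulmxBr.
  have z P : adj P *m Psi *m B = 0 -> adj P *m Psi *m Pc = 0 ->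
     adj P *m (Psi *m B - Psi *m (Pc *m B)) = 0.
    by move=> h1 h2; rewrite mulmxBr !mulmxA h1 h2 mul0mx subrr.
  rewrite -!mulmxBr.
  have z1 : adj Ps *m (Psi *m (B - Pc *m B)) = 0.
    by rewrite mulmxBr z// orth_sym.
  have z2 : adj Pu *m (Psi *m (B - Pc *m B)) = 0.
    by rewrite mulmxBr z// orth_sym.
  rewrite z1 z2 -e add0r addr0 mulmxDl mulmxDr mulmxDr !mulmxA cs cu.
  by rewrite !mul0mx addr0.
apply/esym/eqP; rewrite -subr_eq0; apply/eqP; apply: (Psi_eq0 LP _ D0).
by rewrite mulmxBr pB mulmxA pPc.
Qed.

End CenterMember.

(** * Transport of the center to time t *)

Section Core.
Context {R : realType} {Om : topologicalType}.
Hypothesis cOm : compact [set: Om].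
Local Notation K := R[i].
Context {N : nat}.
Local Notation mx := (Om -> 'M[K]_N).
Variables (T Tinv : Om -> Om) (A Ai : R -> mx) (p Psi Lam : mx) (I : set R).
Let Delta : R -> mx := fun t w => A t w - A 0 w.
Local Notation NF := (nsys_filter Delta).
Hypothesis I0 : I 0.
Hypothesis co : forall t, I t -> cocyc T Tinv (A t) (Ai t) p Psi.
Hypothesis sAi : small Delta (fun t w => Ai t w - Ai 0 w).
Hypotheses (skew : forall w, adj (Psi w) = - Psi w)
  (LP : forall w, Lam w *m Psi w = p w) (PL : forall w, Psi w *m Lam w = adj (p w))
  (pL : forall w, p w *m Lam w = Lam w) (Lp : forall w, Lam w *m adj (p w) = Lam w)
  (cL : forall w, cm Lam w).
Variables Ps Pc Pu : R -> mx.
Hypotheses (ips : forall t, I t -> invproj T (A t) p (Ps t))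
  (ipc : forall t, I t -> invproj T (A t) p (Pc t))
  (ipu : forall t, I t -> invproj T (A t) p (Pu t)).
Hypotheses (sc : forall t w, I t -> Ps t w *m Pc t w = 0)
  (su : forall t w, I t -> Ps t w *m Pu t w = 0)
  (cs : forall t w, I t -> Pc t w *m Ps t w = 0)
  (cu : forall t w, I t -> Pc t w *m Pu t w = 0)
  (us : forall t w, I t -> Pu t w *m Ps t w = 0)
  (uc : forall t w, I t -> Pu t w *m Pc t w = 0)
  (sum : forall t w, I t -> Ps t w + Pc t w + Pu t w = p w).
Hypotheses (dms : forall t, I t -> dominated T (A t) (Ps t) (fun w => Pc t w + Pu t w))
  (dmu : forall t, I t -> dominated T (A t) (fun w => Ps t w + Pc t w) (Pu t)).
Hypotheses (ocs : forall t w, I t -> adj (Pc t w) *m Psi w *m Ps t w = 0)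
  (ocu : forall t w, I t -> adj (Pc t w) *m Psi w *m Pu t w = 0).
Hypotheses (rks : forall t w, I t -> \rank (Ps 0 w) = \rank (Ps t w))
  (rku : forall t w, I t -> \rank (Pu 0 w) = \rank (Pu t w)).

Lemma invproj_add t P Q : I t -> invproj T (A t) p P -> invproj T (A t) p Q ->
  (forall w, P w *m Q w = 0) -> (forall w, Q w *m P w = 0) ->
  invproj T (A t) p (fun w => P w + Q w).
Proof.
move=> It iP iQ PQ QP; split=> w.
- exact: cmD (ip_c iP w) (ip_c iQ w).
- by rewrite mulmxDl !mulmxDr (ip_PP iP) (ip_PP iQ) PQ QP addr0 add0r.
- by rewrite mulmxDl (ip_p iP) (ip_p iQ).
- by rewrite mulmxDr (ip_pP iP) (ip_pP iQ).
- by rewrite mulmxDl mulmxDr (ip_A iP) (ip_A iQ).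
Qed.

(** One factor 1/2 solves 2 Z = - W, the other averages W with its adjoint; the sign is included. *)
Definition quarter : R := - (1 / 4).

(* Y is minus the Psi-adjoint of the graph transforms of the stable and unstable
   bundles, so 1 + Y maps the center at time 0 into the center at time t; the
   self-adjoint Z, of second order in Y, corrects 1 + Y to an isometry. *)
Lemma center_transport : exists Y Z : R -> mx,
  [/\ small Delta Y, small Delta Z &
  \forall S \near NF, forall t, dom S t -> I t -> forall w,
    let L := Pc 0 w *m dag (Psi w) (Lam w) (Y t w) *m Y t w *m Pc 0 w in
    let W := Wpoly L (Z t w) in
    let B := (p w + Y t w) *m (Pc 0 w + Z t w) in
    [/\ adj (Pc 0 w) *m Psi w *m Y t w = 0,
        Z t w = quarter%:C%C *: (Pc 0 w *m (W + dag (Psi w) (Lam w) W) *m Pc 0 w),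
        B *m Pc 0 w = B, Pc t w *m B = B &
        adj B *m Psi w *m B = adj (Pc 0 w) *m Psi w *m Pc 0 w]].
Proof.
have co0 := co I0.
have pp w := co_pp co0 w; have Psip w := co_Psip co0 w; have pPsiE w := co_pPsi co0 w.
have icu t : I t -> invproj T (A t) p (fun w => Pc t w + Pu t w).
  move=> It; apply: invproj_add (ipc It) (ipu It) _ _ => // w; [exact: cu|exact: uc].
have isc t : I t -> invproj T (A t) p (fun w => Ps t w + Pc t w).
  move=> It; apply: invproj_add (ips It) (ipc It) _ _ => // w; [exact: sc|exact: cs].
have [Xs sXs HXs] : exists2 X : R -> mx, small Delta X &
  \forall S \near NF, forall t, dom S t -> I t -> forall w,
    [/\ X t w = X t w *m Ps 0 w, Ps t w *m (Ps 0 w + X t w) = Ps 0 w + X t w &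
        (Ps 0 w + X t w) *m Ps t w = Ps t w].
  apply: (stable_graph cOm I0 co (small_Delta Delta) (Q := fun t w => Pc t w + Pu t w)) => //.
  - by move=> t w It; rewrite mulmxDr sc// su// addr0.
  - by move=> t w It; rewrite mulmxDl cs// us// addr0.
  - by move=> t w It; rewrite addrA sum.
have [Xu sXu HXu] : exists2 X : R -> mx, small Delta X &
  \forall S \near NF, forall t, dom S t -> I t -> forall w,
    [/\ X t w = X t w *m Pu 0 w, Pu t w *m (Pu 0 w + X t w) = Pu 0 w + X t w &
        (Pu 0 w + X t w) *m Pu t w = Pu t w].
  (* The unstable bundle is the weakest one for the inverse cocycle, which is a small perturbation
     of its value at time 0 as well. *)
  apply: (stable_graph cOm (T := Tinv) (Tinv := T) (A := Ai) (Ai := A) (p := p) (Psi := Psi) I0 _ sAi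
     (Q := fun t w => Ps t w + Pc t w)) => //.
  - by move=> t It; exact: cocyc_inv (co It).
  - by move=> t It; exact: (invproj_flip (co It) (ipu It)).
  - by move=> t It; exact: (invproj_flip (co It) (isc t It)).
  - by move=> t w It; rewrite mulmxDr us// uc// addr0.
  - by move=> t w It; rewrite mulmxDl su// cu// addr0.
  - by move=> t w It; rewrite addrC sum.
  - by move=> t It; exact: (dominated_flip (co It) (isc t It) (ipu It) (dmu It)).
pose E t w := Xs t w + Xu t w.
have sE : small Delta E by exact: smallD.
have bL : bdd Delta (fun=> Lam) by exact: bdd_cst.
have bPsi : bdd Delta (fun=> Psi) by apply: bdd_cst => // w; exact: (co_cPsi co0).
have bPc : bdd Delta (fun=> Pc 0) by apply: bdd_cst => // w; exact: (ip_c (ipc I0)).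
pose Ed t w := dag (Psi w) (Lam w) (E t w).
have sEd : small Delta Ed by apply: (small_Mr _ bPsi); apply: (small_Ml bL); exact: small_adj.
have [Y sY HY] : exists2 Y : R -> mx, small Delta Y & \forall S \near NF, forall t w, dom S t ->
    Y t w = - Ed t w - Ed t w *m Y t w.
  have [|||Y sY HY] := @fixpt_LS _ _ _ Delta (fun _ _ _ => 0)
    (fun Y t w => - Ed t w - Ed t w *m Y t w).
  - move=> S X Y M M0 _; apply: (bndX_le (M := 0)); first by rewrite divr_ge0.
    by move=> i j; apply: bndC_eq (bndC_0 S) => t w; rewrite subrr mxE.
  - by [].
  - apply: LS_D; first by apply: LS_cst; exact: smallN.
    apply: LS_N; apply: (LS_VV (Phi := fun=> Ed)); last exact: V0_id.
    by apply: LS_V0; exact: LS_cst.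
  by exists Y => //; apply: filterS HY => S h t w Dt; rewrite {1}h// add0r.
pose L t w := Pc 0 w *m dag (Psi w) (Lam w) (Y t w) *m Y t w *m Pc 0 w.
have sL : small Delta L.
  apply: (small_Mr _ bPc); apply: (small_Mr _ (small_bdd sY)); apply: (small_Ml bPc).
  by apply: (small_Mr _ bPsi); apply: (small_Ml bL); exact: small_adj.
have bQ : bdd Delta (fun _ w => quarter%:C%C *: Pc 0 w).
  apply: bdd_cst => // w; apply: cmZ; last exact: (ip_c (ipc I0)).
  exact: cc_cst.
have [Z sZ HZ] : exists2 Z : R -> mx, small Delta Z & \forall S \near NF, forall t w, dom S t ->
    Z t w = (quarter%:C%C *: Pc 0 w) *m (Wpoly (L t w) (Z t w) +
        dag (Psi w) (Lam w) (Wpoly (L t w) (Z t w))) *m Pc 0 w.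
  have lW : LS Delta (fun Z t w => Wpoly (L t w) (Z t w)).
    have lL : LS Delta (fun _ : R -> mx => L) by exact: LS_cst.
    have vL := LS_V0 lL.
    have vI : V0 Delta (fun Z : R -> mx => Z) by exact: V0_id.
    have vZL : LS Delta (fun Z t w => Z t w *m L t w) by exact: LS_VV.
    have vLZ : LS Delta (fun Z t w => L t w *m Z t w) by exact: (LS_VV vL).
    have vZLZ : LS Delta (fun Z t w => Z t w *m L t w *m Z t w).
      by exact: (LS_VV (LS_V0 vZL) vI).
    have vZZ : LS Delta (fun Z t w => Z t w *m Z t w) by exact: (LS_VV vI).
    exact: (LS_D (LS_D (LS_D (LS_D lL vZZ) vZL) vLZ) vZLZ).
  have [|||Z sZ HZ] := @fixpt_LS _ _ _ Delta (fun _ _ _ => 0)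
    (fun Z t w => (quarter%:C%C *: Pc 0 w) *m (Wpoly (L t w) (Z t w) +
        dag (Psi w) (Lam w) (Wpoly (L t w) (Z t w))) *m Pc 0 w).
  - move=> S X Z M M0 _; apply: (bndX_le (M := 0)); first by rewrite divr_ge0.
    by move=> i j; apply: bndC_eq (bndC_0 S) => t w; rewrite subrr mxE.
  - by [].
  - apply: (LS_Mr _ (LB_cst bPc)); apply: (LS_Ml (LB_cst bQ)); apply: (LS_D lW).
    by apply: (LS_Mr _ (LB_cst bPsi)); apply: (LS_Ml (LB_cst bL)); exact: LS_adj.
  by exists Z => //; apply: filterS HZ => S h t w Dt; rewrite {1}h// add0r.
exists Y, Z; split=> //.
apply: filterS2 (filterI HXs HXu) (filterI HY HZ) => S [hXs hXu] [hY hZ] t Dt It w /=.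
set B := (p w + Y t w) *m (Pc 0 w + Z t w); set W := Wpoly _ _.
have [xs1 xs2 xs3] := hXs t Dt It w; have [xu1 xu2 xu3] := hXu t Dt It w.
have PcPc := ip_PP (ipc I0) w; have Pcp := ip_p (ipc I0) w; have pPc := ip_pP (ipc I0) w.
have zE : Z t w = quarter%:C%C *: (Pc 0 w *m (W + dag (Psi w) (Lam w) W) *m Pc 0 w).
  by rewrite {1}hZ// !scalemxAl.
have Ep : E t w *m p w = E t w.
  by rewrite /E mulmxDl xs1 xu1 -!mulmxA (ip_p (ips I0)) (ip_p (ipu I0)).
have [pY MY] := dagger_graph (pp w) (skew w) (Psip w) (PL w) (pL w) Ep (hY t w Dt).
(* The map [p + E] is the identity on the center at time 0 and carries E^s_0 and E^u_0 onto the
   bundles at time t. *)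
have MPc : (p w + E t w) *m Pc 0 w = Pc 0 w.
  by rewrite /E !mulmxDl xs1 xu1 -!mulmxA sc// uc// !mulmx0 !addr0.
have MPs : (p w + E t w) *m Ps 0 w = Ps 0 w + Xs t w.
  by rewrite /E !mulmxDl {1}xu1 -!mulmxA us// mulmx0 addr0 -xs1 (ip_pP (ips I0)).
have MPu : (p w + E t w) *m Pu 0 w = Pu 0 w + Xu t w.
  by rewrite /E !mulmxDl {1}xs1 -!mulmxA su// mulmx0 add0r -xu1 (ip_pP (ipu I0)).
have PcY : adj (Pc 0 w) *m Psi w *m Y t w = 0.
  have : adj (Pc 0 w) *m Psi w *m (p w + Y t w) = adj (Pc 0 w) *m Psi w.
    by rewrite -{1}MPc adjM -!mulmxA (mulmxA (adj (_ + _))) MY.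
  rewrite mulmxDr -(mulmxA (adj _) (Psi w) (p w)) Psip => /eqP.
  by rewrite addrC eq_sym -subr_eq subrr eq_sym => /eqP.
have Pco : Psi w *m Pc 0 w = adj (Pc 0 w) *m Psi w.
  have os := ocs w I0; have ou := ocu w I0.
  have e1 : adj (Pc 0 w) *m Psi w = adj (Pc 0 w) *m Psi w *m Pc 0 w.
    by rewrite -{1}(Psip w) -(sum w I0) mulmxA !mulmxDr os ou add0r addr0.
  rewrite e1 -{1}(pPsiE w) -(sum w I0) !adjD !mulmxDl.
  by rewrite (orth_sym (skew w) os) (orth_sym (skew w) ou) add0r addr0.
have ZPc : Z t w *m Pc 0 w = Z t w by exact: ZPc zE.
have PcZ : Pc 0 w *m Z t w = Z t w by exact: PcZ zE.
have BPc : B *m Pc 0 w = B by rewrite /B -mulmxA (mulmxDl (Pc 0 w)) PcPc ZPc.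
have pB : p w *m B = B by rewrite /B mulmxA (mulmxDr (p w)) pp pY.
have PcS : Pc 0 w *m (Pc 0 w + Z t w) = Pc 0 w + Z t w by rewrite mulmxDr PcPc PcZ.
(* By [MY], pairing B with the image of [P] under [p + E] amounts to pairing the center at time 0
   with [P], which gives zero. *)
have kill (P P1 X : 'M[K]_N) : (p w + E t w) *m P = P + X -> (P + X) *m P1 = P1 ->
    adj P *m Psi w *m Pc 0 w = 0 -> adj P1 *m Psi w *m B = 0.
  move=> MP XP1 oP.
  have e : adj (P + X) *m Psi w *m B = adj P *m (adj (p w + E t w) *m Psi w *m (p w + Y t w)) *m
      (Pc 0 w *m (Pc 0 w + Z t w)) by rewrite -MP adjM PcS /B !mulmxA.
  have e2 : adj (P + X) *m Psi w *m B = 0.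
    by rewrite e MY (mulmxA (adj P *m Psi w) (Pc 0 w)) oP mul0mx.
  by rewrite -XP1 adjM -!mulmxA (mulmxA (adj (P + X))) e2 mulmx0.
split=> //.
- apply: (center_member (skew w) (Psip w) (LP w) (sum w It) (ip_PP (ipc It) w) (ip_pP (ipc It) w)
    (ocs w It) (ocu w It) pB).
    exact: (kill _ _ _ MPs xs3 (orth_sym (skew w) (ocs w I0))).
  exact: (kill _ _ _ MPu xu3 (orth_sym (skew w) (ocu w I0))).
- exact: (center_iso (skew w) (Psip w) (LP w) (PL w) (Lp w) PcPc Pcp pPc Pco pY PcY erefl zE).
Qed.

End Core.

(** * Regularity in time *)

Section Regularity.
Context {R : realType} {Om : topologicalType}.
Implicit Types (I : set R) (U : set Om) (g : R -> Om -> R).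

(** The derivatives are given by a witness family: sums, multiples and extensions by zero provide
    one directly, whereas [derive1n] would have to be computed afresh. *)
Definition Cn_fam n I U g (D : nat -> R -> Om -> R) :=
  [/\ forall t w, I t -> U w -> D 0%N t w = g t w,
      forall m t w, (m < n)%N -> I t -> U w -> is_derive t 1 (D m ^~ w) (D m.+1 t w) &
      forall m t w, (m <= n)%N -> I t -> U w ->
        {for (t, w), continuous (fun p : R * Om => D m p.1 p.2)}].

Lemma near_prod I U t w (P : R -> Om -> Prop) : open I -> open U -> I t -> U w ->
  (forall t w, I t -> U w -> P t w) -> \forall p \near (t, w), P p.1 p.2.
Proof.
move=> oI oU It Uw h; exists (I, U); first by split; exact: open_nbhs_nbhs.
by move=> [s v] [/= Is Uv]; exact: h.
Qed.

Lemma cvg_near_eq (X : topologicalType) (f f' : X -> R) x :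
  (\forall y \near x, f y = f' y) -> {for x, continuous f} -> {for x, continuous f'}.
Proof.
move=> h cf; have e : f x = f' x := nbhs_singleton h.
rewrite /prop_for /continuous_at -e.
by apply: cvg_trans cf; apply: near_eq_cvg; apply: filterS h => y.
Qed.

Lemma Cn_fam_derive n I U g D : open I -> open U -> Cn_fam n I U g D ->
  forall m t w, (m <= n)%N -> I t -> U w -> derive1n m (g ^~ w) t = D m t w.
Proof.
move=> oI oU [D0 D1 D2]; elim=> [|m ih] t w mn It Uw; first by rewrite D0.
rewrite /= derive1E.
have [d1 d2] : is_derive t 1 (derive1n m (g ^~ w)) (D m.+1 t w).
  apply: near_eq_is_derive (D1 _ _ _ mn It Uw).
  near=> s; apply/esym; apply: ih => //; first exact: ltnW.
  by near: s; exact: open_nbhs_nbhs.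
by rewrite d2.
Unshelve. all: by end_near. Qed.

Lemma unif_CnP n I U g : open I -> open U ->
  unif_Cn n I U g <-> exists D, Cn_fam n I U g D.
Proof.
move=> oI oU; split=> [h|[D HD]].
  exists (fun m t w => derive1n m (g ^~ w) t); split; first by move=> t w _ _; exact: erefl.
    move=> m t w mn It Uw; have [h1 _] := h m.+1 t w mn It Uw.
    have dm := h1 m (ltnSn m).
    by apply: (DeriveDef dm); rewrite -derive1E.
  by move=> m t w mn It Uw; have [_ h2] := h m t w mn It Uw.
have E := Cn_fam_derive oI oU HD; have [D0 D1 D2] := HD.
move=> m t w mn It Uw; split.
  move=> k km; have kn : (k < n)%N by exact: leq_trans km mn.
  have [d1 d2] : is_derive t 1 (derive1n k (g ^~ w)) (D k.+1 t w).
    apply: near_eq_is_derive (D1 _ _ _ kn It Uw).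
    near=> s; apply/esym; apply: E => //; first exact: ltnW.
    by near: s; exact: open_nbhs_nbhs.
  exact: d1.
apply: cvg_near_eq (D2 _ _ _ mn It Uw).
apply: (@near_prod I U t w (fun t w => D m t w = derive1n m (g ^~ w) t)) => //.
by move=> s v Is Uv; rewrite (E m).
Unshelve. all: by end_near. Qed.

Lemma cont_snd (a : Om -> R) (t : R) w : {for w, continuous a} ->
  {for (t, w), continuous (fun p : R * Om => a p.2)}.
Proof.
move=> ca; apply: (@cvg_comp _ _ _ (fun p : R * Om => p.2) a _ (nbhs w)); last exact: ca.
exact: cvg_snd.
Qed.

Lemma Cn_fam_add n I U g g' D D' : Cn_fam n I U g D -> Cn_fam n I U g' D' ->
  Cn_fam n I U (fun t w => g t w + g' t w) (fun m t w => D m t w + D' m t w).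
Proof.
move=> [a1 a2 a3] [b1 b2 b3]; split.
- by move=> t w It Uw; rewrite a1// b1.
- by move=> m t w mn It Uw; apply: is_deriveD; [exact: a2|exact: b2].
- by move=> m t w mn It Uw; apply: cvgD; [exact: a3|exact: b3].
Qed.

Lemma Cn_fam_scale n I U g (a : Om -> R) D : (forall w, U w -> {for w, continuous a}) ->
  Cn_fam n I U g D ->
  Cn_fam n I U (fun t w => a w * g t w) (fun m t w => a w * D m t w).
Proof.
move=> ca [a1 a2 a3]; split.
- by move=> t w It Uw; rewrite a1.
- by move=> m t w mn It Uw; apply: is_deriveZ; exact: a2.
- by move=> m t w mn It Uw; apply: cvgM; [apply: cont_snd; exact: ca|exact: a3].
Qed.

Lemma Cn_fam_0 n I U : Cn_fam n I U (fun _ _ => 0) (fun _ _ _ => 0).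
Proof.
split=> //; first by move=> *; exact: is_derive_cst.
by move=> *; exact: cvg_cst.
Qed.

Lemma an_add I U g g' : unif_analytic I U g -> unif_analytic I U g' ->
  unif_analytic I U (fun t w => g t w + g' t w).
Proof.
move=> h h' t0 w0 It Uw.
have [r [M [a [r0 H]]]] := h t0 w0 It Uw; have [r' [M' [a' [r0' H']]]] := h' t0 w0 It Uw.
exists (Num.min r r'), (M + M'), (fun n w => a n w + a' n w).
split; first by rewrite lt_min r0.
apply: filterS2 H H' => w [h1 h2] [h1' h2']; split.
  move=> n; have m0 : 0 <= Num.min r r' by rewrite le_min !ltW.
  apply: (@le_trans _ _ (`|a n w| * r ^+ n + `|a' n w| * r' ^+ n)).
    apply: (@le_trans _ _ ((`|a n w| + `|a' n w|) * Num.min r r' ^+ n)).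
      by apply: ler_wpM2r; rewrite ?exprn_ge0// ler_normD.
    have e1 : Num.min r r' ^+ n <= r ^+ n.
      by apply: lerXn2r; rewrite ?nnegrE ?ge_min ?lexx// ltW.
    have e2 : Num.min r r' ^+ n <= r' ^+ n.
      by apply: lerXn2r; rewrite ?nnegrE ?ge_min ?lexx ?orbT// ltW.
    by rewrite mulrDl; apply: lerD; apply: ler_wpM2l.
  by apply: lerD.
move=> t; rewrite lt_min => /andP[tr tr'].
have -> : pseries (fun n => a n w + a' n w) (t - t0) =
    pseries (fun n => a n w) (t - t0) \+ pseries (fun n => a' n w) (t - t0).
  apply/funext => n; rewrite /pseries /series /= -big_split /=.
  by apply: eq_bigr => i _; rewrite mulrDl.
by apply: cvgD; [exact: h2|exact: h2'].
Qed.

Lemma an_scale I U g (a : Om -> R) : (forall w, U w -> {for w, continuous a}) ->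
  unif_analytic I U g -> unif_analytic I U (fun t w => a w * g t w).
Proof.
move=> ca h t0 w0 It Uw.
have [r [M [b [r0 H]]]] := h t0 w0 It Uw.
exists r, ((`|a w0| + 1) * M), (fun n w => a w * b n w); split=> //.
have na : \forall w \near w0, `|a w| <= `|a w0| + 1.
  have /cvgrPdist_le/(_ _ ltr01) : `|a w| @[w --> w0] --> `|a w0|.
    by apply: cvg_norm; exact: ca.
  by apply: filterS => w; rewrite ler_distlC => /andP[].
apply: filterS2 na H => w aw [h1 h2]; split.
  move=> n; rewrite normrM -mulrA; apply: ler_pM => //.
  by rewrite mulr_ge0// exprn_ge0// ltW.
move=> t tr; have -> : pseries (fun n => a w * b n w) (t - t0) =
    (fun n => a w * pseries (fun n => b n w) (t - t0) n).
  apply/funext => n; rewrite /pseries /series /= mulr_sumr.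
  by apply: eq_bigr => i _; rewrite mulrA.
by apply: cvgMr; exact: h2.
Qed.

Lemma an_0 I U : unif_analytic I U (fun _ _ => 0).
Proof.
move=> t0 w0 _ _; exists 1, 0, (fun _ _ => 0); split=> //.
apply: nearW => w; split; first by move=> n; rewrite normr0 mul0r.
move=> t _; have -> : pseries (fun=> 0) (t - t0) = (fun=> 0).
  by apply/funext => n; rewrite /pseries /series /= big1// => i _; rewrite mul0r.
exact: cvg_cst.
Qed.

Lemma smooth_map l I U (P : (R -> Om -> R) -> R -> Om -> R) :
  open I -> open U ->
  (forall n g, (exists D, Cn_fam n I U g D) -> exists D, Cn_fam n I U (P g) D) ->
  (forall g, unif_analytic I U g -> unif_analytic I U (P g)) ->
  forall g, unif_smooth_fun l I U g -> unif_smooth_fun l I U (P g).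
Proof.
move=> oI oU h1 h2 g; have hn n : unif_Cn n I U g -> unif_Cn n I U (P g).
  by move/(unif_CnP _ _ oI oU) => h; apply/(unif_CnP _ _ oI oU); exact: h1.
case: l => [n||] /=; first exact: hn.
  by move=> h n; exact: hn.
by move=> [h h']; split; [move=> n; exact: hn|exact: h2].
Qed.

Lemma smooth_add l I U g g' : open I -> open U -> unif_smooth_fun l I U g ->
  unif_smooth_fun l I U g' -> unif_smooth_fun l I U (fun t w => g t w + g' t w).
Proof.
move=> oI oU; have hn n : unif_Cn n I U g -> unif_Cn n I U g' ->
    unif_Cn n I U (fun t w => g t w + g' t w).
  move=> /(unif_CnP _ _ oI oU)[D h] /(unif_CnP _ _ oI oU)[D' h'].
  by apply/(unif_CnP _ _ oI oU); exists (fun m t w => D m t w + D' m t w); exact: Cn_fam_add.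
case: l => [n||] /=; first exact: hn.
  by move=> h h' n; exact: hn.
by move=> [h1 h2] [h1' h2']; split; [move=> n; exact: hn|exact: an_add].
Qed.

Lemma smooth_scale l I U g (a : Om -> R) : open I -> open U ->
  (forall w, U w -> {for w, continuous a}) ->
  unif_smooth_fun l I U g -> unif_smooth_fun l I U (fun t w => a w * g t w).
Proof.
move=> oI oU ca; apply: (@smooth_map l I U (fun g t w => a w * g t w)) => //.
  by move=> n h [D HD]; exists (fun m t w => a w * D m t w); exact: Cn_fam_scale.
by move=> h; exact: an_scale.
Qed.

Lemma smooth_0 l I U : open I -> open U -> unif_smooth_fun l I U (fun _ _ => 0).
Proof.
move=> oI oU; have hn n : unif_Cn n I U (fun _ _ => 0).
  by apply/(unif_CnP _ _ oI oU); exists (fun _ _ _ => 0); exact: Cn_fam_0.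
by case: l => [n||] //=; split=> //; exact: an_0.
Qed.

Lemma smooth_ext l I U g g' : open I -> open U -> (forall t w, I t -> U w -> g t w = g' t w) ->
  unif_smooth_fun l I U g -> unif_smooth_fun l I U g'.
Proof.
move=> oI oU e; have hn n : unif_Cn n I U g -> unif_Cn n I U g'.
  move=> /(unif_CnP _ _ oI oU)[D [h1 h2 h3]]; apply/(unif_CnP _ _ oI oU); exists D; split=> //.
  by move=> t w It Uw; rewrite h1// e.
case: l => [n||] /=; first exact: hn.
  by move=> h n; exact: hn.
move=> [h h']; split; first by move=> n; exact: hn.
move=> t0 w0 It Uw; have [r [M [a [r0 H]]]] := h' t0 w0 It Uw.
have [r1 r10 hr1] := ball_in_open oI It.
exists (Num.min r r1), M, a; split; first by rewrite lt_min r0.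
have nU : nbhs w0 U by exact: open_nbhs_nbhs.
apply: filterS2 nU H => w Uw' [k1 k2]; split.
  move=> n; apply: le_trans (k1 n); apply: ler_wpM2l => //.
  by apply: lerXn2r; rewrite ?nnegrE ?le_min ?ge_min ?lexx ?(ltW r0) ?(ltW r10).
move=> t; rewrite lt_min => /andP[tr tr1]; rewrite -e//; first exact: k2.
exact: hr1.
Qed.

Lemma smooth_restr l I I' U U' g : I' `<=` I -> U' `<=` U ->
  unif_smooth_fun l I U g -> unif_smooth_fun l I' U' g.
Proof.
move=> II UU; have hn n : unif_Cn n I U g -> unif_Cn n I' U' g.
  by move=> h m t w mn It Uw; apply: h => //; [exact: II|exact: UU].
case: l => [n||] /=; first exact: hn.
  by move=> h n; exact: hn.
move=> [h h']; split; first by move=> n; exact: hn.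
by move=> t0 w0 /II It /UU Uw; exact: h'.
Qed.

(** Localization: [a] vanishes near every point outside [U], so the arbitrary values of [g] there,
    such as those of a local frame outside its domain, do no harm. *)
Lemma smooth_ext0 l I U g (a : Om -> R) : open I -> open U -> continuous a ->
  (forall w, ~ U w -> \forall w' \near w, a w' = 0) ->
  unif_smooth_fun l I U g -> unif_smooth_fun l I setT (fun t w => a w * g t w).
Proof.
move=> oI oU ca a0.
have hn n : unif_Cn n I U g -> unif_Cn n I setT (fun t w => a w * g t w).
  move=> /(unif_CnP _ _ oI oU)[D [h1 h2 h3]]; apply/(unif_CnP _ _ oI openT).
  exists (fun m t w => a w * D m t w); split.
  - move=> t w It _; have [Uw|/a0/nbhs_singleton ->] := pselect (U w); first by rewrite h1.
    by rewrite !mul0r.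
  - move=> m t w mn It _; have [Uw|/a0/nbhs_singleton ->] := pselect (U w).
      by apply: is_deriveZ; exact: h2.
    have -> : (fun s => 0 * D m s w) = cst 0 by apply/funext => s; rewrite mul0r.
    by rewrite mul0r; exact: is_derive_cst.
  - move=> m t w mn It _; have [Uw|nU] := pselect (U w).
      by apply: cvgM; [apply: cont_snd; exact: ca|exact: h3].
    apply: (@cvg_near_eq _ (fun=> 0)); last exact: cvg_cst.
    exists (setT, [set w' | a w' = 0]); first by split=> //=; [exact: filterT|exact: a0].
    by move=> [s v] [_ /= av]; rewrite /= av mul0r.
case: l => [n||] /=; first exact: hn.
  by move=> h n; exact: hn.
move=> [h h']; split; first by move=> n; exact: hn.
have an1 := an_scale (fun w _ => ca w) h'.
move=> t0 w0 It _; have [Uw|nU] := pselect (U w0); first exact: an1.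
exists 1, 0, (fun _ _ => 0); split=> //.
apply: filterS (a0 _ nU) => w aw; split; first by move=> n; rewrite normr0 mul0r.
move=> t _; have -> : pseries (fun=> 0) (t - t0) = (fun=> 0).
  by apply/funext => n; rewrite /pseries /series /= big1// => i _; rewrite mul0r.
by rewrite aw mul0r; exact: cvg_cst.
Qed.

Lemma smooth_Cn l n I U g : smooth_ge n l -> unif_smooth_fun l I U g -> unif_Cn n I U g.
Proof.
case: l => [m||] /= h; last by case.
  by move=> H k t w kn; apply: H; exact: leq_trans kn h.
by apply.
Qed.

Lemma smooth_of_Cn l I U g : (forall n, smooth_ge n l -> unif_Cn n I U g) ->
  (l = Comega -> unif_analytic I U g) -> unif_smooth_fun l I U g.
Proof.
case: l => [m||] h h'; first exact: (h m (leqnn m)).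
  by move=> n; exact: (h n isT).
by split; [move=> n; exact: (h n isT)|exact: h'].
Qed.

End Regularity.

(** * Smallness of given functions in the three kinds of norms *)

Section Inputs.
Context {R : realType} {Om : topologicalType}.
Hypothesis cOm : compact [set: Om].
Implicit Types (g : R -> Om -> R).

Definition symint (e : R) : set R := `]- e, e[%classic.

Lemma symintE (e t : R) : symint e t = (`|t| < e).
Proof. by rewrite /symint /= in_itv /= ltr_norml; apply/propext. Qed.

Lemma open_symint (e : R) : open (symint e).
Proof. exact: interval_open. Qed.

Lemma cont_at_time g (t : R) w : {for (t, w), continuous (fun p : R * Om => g p.1 p.2)} ->
  {for w, continuous (g t)}.
Proof.
move=> c; apply: (@continuous_comp _ _ _ (fun w : Om => (t, w)) (fun p : R * Om => g p.1 p.2) w).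
  move=> S [[U V] [nU nV] UV]; apply: filterS nV => v Vv.
  by apply: (UV (t, v)); split=> //; exact: nbhs_singleton nU.
exact: c.
Qed.

Lemma sup_input (eps : R) g d : 0 < eps -> 0 < d -> unif_Cn 0 (symint eps) setT g ->
  \forall eta \near 0^'+, forall t w, symint eta t -> `|g t w - g 0 w| <= d.
Proof.
move=> e0 d0 h; have I0 : symint eps 0 by rewrite symintE normr0.
have := compact_unif cOm (F := nbhs (0 : R)) (P := fun t w => `|g t w - g 0 w| <= d).
case.
- move=> w; have [_ c] := h 0%N 0 w (leqnn _) I0 I.
  have c0 : {for w, continuous (g 0)} by exact: cont_at_time.
  have d2 : 0 < d / 2 by rewrite divr_gt0.
  move/cvgrPdist_le/(_ _ d2): c => /= c; move/cvgrPdist_le/(_ _ d2): c0 => c0.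
  case: c => [[U V] [/= nU nV] UV]; exists ([set w' | V w' /\ `|g 0 w - g 0 w'| <= d / 2], U).
    by split=> //=; exact: filterI.
  move=> [w' t] [/= [Vw' h0] Ut] /=.
  have /= h1 := UV (t, w') (conj Ut Vw').
  have -> : g t w' - g 0 w' = - (g 0 w - g t w') + (g 0 w - g 0 w') by ring.
  by apply: (le_trans (ler_normD _ _)); rewrite normrN; lra.
move=> eta /= eta0 H; exists eta => //= e; rewrite /ball /= sub0r normrN => ee ep t w.
rewrite symintE => te; apply: H; rewrite /ball /= sub0r normrN.
by apply: lt_trans te _; rewrite gtr0_norm in ee.
Qed.

Lemma cont_bound (eta eps : R) (f : R -> Om -> R) : eta < eps ->
  (forall t w, symint eps t -> {for (t, w), continuous (fun p : R * Om => f p.1 p.2)}) ->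
  exists2 M, 0 < M & forall t w, symint eta t -> `|f t w| <= M.
Proof.
move=> ee cf; pose S : set (R * Om) := `[- eta, eta] `*` [set: Om].
have cS : compact S by apply: compact_setX => //; exact: segment_compact.
(* An upper bound for |f| is the inverse of a positive lower bound for 1 / (1 + |f|). *)
have [||e e0 he] := @compact_lb R _ S (fun p => (1 + `|f p.1 p.2|)^-1) cS.
- move=> [t w] [/= ht _]; apply: cvgV; first by rewrite gt_eqF// ltr_pwDl.
  apply: cvgD; first exact: cvg_cst.
  apply: cvg_norm; apply: cf; rewrite symintE.
  by apply: le_lt_trans ee; move: ht; rewrite in_itv /= ler_norml.
- by move=> p _; rewrite invr_gt0 ltr_pwDl.
exists e^-1; first by rewrite invr_gt0.
move=> t w; rewrite symintE ltr_norml => /andP[t1 t2].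
have := he (t, w); rewrite /S /= in_itv /= (ltW t1) (ltW t2) => /(_ (conj isT I)).
rewrite -[X in X <= _]invrK lef_pV2 ?posrE ?invr_gt0 ?ltr_pwDl// => h.
by apply: le_trans h; rewrite lerDr.
Qed.

(** Order 0 uses half of the bound [d] and is what determines [eta]; the positive orders share the
    other half once [th] is small. So [eta] is independent of n, which is what gives C^oo on one
    interval. *)
Lemma Cn_input n (eta eps : R) g d : 0 < eta -> eta < eps -> 0 < d ->
  unif_Cn n (symint eps) setT g ->
  (forall t w, symint eta t -> `|g t w - g 0 w| <= d / 2) ->
  \forall th \near 0^'+, Cn_bnd n th (symint eta) (fun t w => g t w - g 0 w) d.
Proof.
move=> eta0 ee d0 hg hd.
have [D [D0 D1 D2]] := (unif_CnP n g (@open_symint eps) openT).1 hg.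
have sub t : symint eta t -> symint eps t.
  by rewrite !symintE => /lt_trans; apply.
have I0 : symint eps 0 by rewrite symintE normr0 (lt_trans eta0).
have hM m : exists M, 0 < M /\ ((m <= n)%N -> forall t w, symint eta t -> `|D m t w| <= M).
  have [mn|_] := boolP (m <= n)%N; last by exists 1.
  have [|M M0 hM] := @cont_bound eta eps (D m) ee.
    by move=> t w It; exact: D2.
  by exists M.
have [M HM] := choice hM.
pose s m := if m is 0%N then d / 2 else M m.
pose SM := \sum_(i < n) s i.+1.
have SM0 : 0 <= SM by apply: sumr_ge0 => i _; exact: (ltW (HM _).1).
pose d' m t w := (if m is 0%N then g t w - g 0 w else D m t w / (m`!)%:R).
have f0 m : (0 : R) < (m`!)%:R by rewrite ltr0n fact_gt0.
near=> th.
have th0 : 0 < th by near: th; exact: nbhs_right_gt.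
have th1 : th <= 1 by near: th; exact: nbhs_right_le.
(* As th <= 1, the positive orders add up to at most SM * th; the summand 1 avoids division by 0. *)
have thS : th <= d / (2 * (SM + 1)).
  by near: th; apply: nbhs_right_le; rewrite divr_gt0// mulr_gt0// ltr_wpDl.
exists d', s; split.
- split=> //.
  + move=> m t w mn It; have := D1 m t w mn (sub _ It) I.
    case: m mn => [|m] mn h.
      have := is_deriveB (h : is_derive t 1 (D 0%N ^~ w) _) (is_derive_cst (g 0 w) t (1 : R)).
      rewrite subr0 /d' mul1r factS fact0 muln1 divr1 => h'.
      apply: near_eq_is_derive h'.
      near=> x; rewrite -[LHS]/(D 0%N x w - g 0 w) D0//; apply: sub; near: x.
      by apply: open_nbhs_nbhs; split=> //; exact: (@open_symint _).
    rewrite /d'.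
    have -> : m.+2%:R * (D m.+2 t w / (m.+2)`!%:R) = ((m.+1)`!%:R)^-1 * D m.+2 t w.
      by rewrite [(m.+2)`!]factS natrM; field; rewrite !gt_eqF// ?f0// ltr0n.
    have -> : (fun x => D m.+1 x w / ((m.+1)`!)%:R) = (fun x => ((m.+1)`!%:R)^-1 * D m.+1 x w).
      by apply/funext => x; rewrite mulrC.
    exact: is_deriveZ.
  + move=> m t w mn It; have c := D2 m t w mn (sub _ It) I.
    case: m mn c => [|m] mn c; last first.
      by apply: cvgM; [exact: c|exact: cvg_cst].
    apply: cvgB.
      apply: (@cvg_near_eq _ _ (fun p : R * Om => D 0%N p.1 p.2)); last exact: c.
      apply: (@near_prod _ _ (symint eps) setT t w (fun t w => D 0%N t w = g t w)) => //.
      + exact: openT.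
      + exact: sub.
    have c0 : {for w, continuous (g 0)}.
      by have [_ c0] := hg 0%N 0 w (leq0n _) I0 I; exact: cont_at_time.
    exact: cont_snd.
- by case=> [|m] /=; [rewrite divr_ge0// ltW|exact: (ltW (HM _).1)].
- case=> [|m] t w mn It; first exact: hd.
  rewrite /d' normrM normfV (gtr0_norm (f0 _)).
  apply: (@le_trans _ _ (`|D m.+1 t w|)).
    by rewrite ler_pdivrMr// ler_peMr// ler1n fact_gt0.
  by apply: (HM m.+1).2.
- rewrite big_ord_recl /= expr0 mulr1.
  rewrite [leRHS]splitr lerD2l.
  apply: (@le_trans _ _ (SM * th)).
    rewrite /SM mulr_suml; apply: ler_sum => i _; rewrite /bump /= add1n exprS.
    apply: ler_wpM2l; first exact: (ltW (HM _).1).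
    by rewrite ler_piMr ?(ltW th0)// exprn_ile1// ltW.
  apply: (@le_trans _ _ ((SM + 1) * (d / (2 * (SM + 1))))).
    by apply: ler_pM => //; rewrite ?(ltW th0)// lerDl.
  have : SM + 1 != 0 by rewrite gt_eqF// ltr_wpDl.
  by move=> h; rewrite le_eqVlt; apply/orP; left; apply/eqP; field.
Unshelve. all: by end_near. Qed.

(** Radii and bounds of the local Taylor expansions must be made uniform in w. A single parameter
    [rho], at once a radius and the inverse of a bound, lets one compactness argument do both. The
    constant coefficient is small by the sup norm, the others by a small [r]. *)
Lemma an_input (eta eps t0 : R) g d : eta <= eps -> 0 < d -> symint eta t0 ->
  unif_analytic (symint eps) setT g ->
  (forall t w, symint eta t -> `|g t w - g 0 w| <= d / 2) ->
  \forall r \near 0^'+, an_bnd t0 r (fun t w => g t w - g 0 w) d.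
Proof.
move=> ee d0 It0 hg hd.
have It : symint eps t0 by move: It0; rewrite !symintE => /lt_le_trans; apply.
pose P (rho : R) w := exists a : nat -> R, (forall n, `|a n| * rho ^+ n <= rho^-1) /\
  forall t, `|t - t0| < rho -> pseries a (t - t0) @ \oo --> g t w.
have hP : \forall rho \near 0^'+, forall w, P rho w.
  apply: (compact_unif cOm) => w0.
  have [r [M [a [r0 H]]]] := hg t0 w0 It I.
  exists ([set w | (forall n, `|a n w| * r ^+ n <= M) /\ (forall t, `|t - t0| < r ->
          pseries (fun n => a n w) (t - t0) @ \oo --> g t w)],
     [set rho | 0 < rho /\ rho <= r /\ rho <= (`|M| + 1)^-1]).
    split=> //=; near=> rho; split; first by near: rho; exact: nbhs_right_gt.
    split; first by near: rho; exact: nbhs_right_le.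
    by near: rho; apply: nbhs_right_le; rewrite invr_gt0 ltr_wpDl.
  move=> [w rho] [/= [h1 h2] [rho0 [rr rM]]]; exists (fun n => a n w); split.
    move=> n; apply: (@le_trans _ _ M).
      apply: le_trans (h1 n); apply: ler_wpM2l => //.
      by apply: lerXn2r; rewrite ?nnegrE// ltW.
    apply: (le_trans (ler_norm M)); apply: (@le_trans _ _ (`|M| + 1)); first by rewrite lerDl.
    by rewrite -[X in X <= _]invrK lef_pV2 ?posrE// invr_gt0 ltr_wpDl.
  by move=> t tr; apply: h2; exact: lt_le_trans tr rr.
have [rho [rho0 hrho]] : exists rho, 0 < rho /\ forall w, P rho w.
  have [rho []] := filter_ex (filterI (nbhs_right_gt (0 : R)) hP).
  by exists rho.
have [a ha] := choice hrho.
have a0 w : a w 0%N = g t0 w.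
  have /(_ t0) := (ha w).2; rewrite subrr normr0 => /(_ rho0) h.
  have e : (fun n => pseries (a w) 0 n.+1) = fun=> a w 0%N.
    apply/funext => n; rewrite /pseries /series /= big_nat_recl//= expr0 mulr1.
    by rewrite big1 ?addr0// => i _; rewrite expr0n /= mulr0.
  have h' : pseries (a w) 0 n.+1 @[n --> \oo] --> g t0 w by rewrite -cvg_shiftS in h.
  rewrite e in h'; exact: (cvg_unique (@Rhausdorff R) (cvg_cst _) h').
pose dd m w := if m is 0%N then a w 0%N - g 0 w else a w m.
pose s m := if m is 0%N then d / 2 else rho^-1 * rho^-1 ^+ m.
near=> r.
have r0 : 0 < r by near: r; exact: nbhs_right_gt.
have r2 : r <= rho / 2 by near: r; apply: nbhs_right_le; rewrite divr_gt0.
(* With r / rho <= 1/2 the coefficients of positive order sum to at most 2 r / rho^2, which this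
   makes at most d / 2. *)
have r3 : r <= d * (rho * rho) / 4.
  by near: r; apply: nbhs_right_le; rewrite divr_gt0// !mulr_gt0.
have ri0 : 0 < rho^-1 by rewrite invr_gt0.
exists dd, s; split.
- by case=> [|m] /=; [rewrite divr_ge0// ltW|rewrite mulr_ge0 ?exprn_ge0// ltW].
- case=> [|m] w /=; first by rewrite a0; exact: hd.
  have h := (ha w).1 m.+1.
  by rewrite exprVn -ler_pdivrMr ?invr_gt0 ?exprn_gt0// invrK.
- case=> [|k]; first by rewrite big_ord0 ltW.
  rewrite big_ord_recl /= expr0 mulr1.
  rewrite [leRHS]splitr lerD2l.
  have q1 : r / rho <= 1 / 2 by rewrite ler_pdivrMr// mulrAC mul1r.
  have q0 : 0 < r / rho by rewrite divr_gt0.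
  have -> : \sum_(i < k) rho^-1 * rho^-1 ^+ (bump 0 i) * r ^+ bump 0 i =
     series (geometric (rho^-1 * (r / rho)) (r / rho)) k.
    rewrite /series /= big_mkord; apply: eq_bigr => i _.
    rewrite /bump /= add1n -mulrA -exprMn -/(r / rho) (mulrC rho^-1 r) exprS /geometric /=.
    by rewrite mulrA.
  apply: (le_trans (geometric_le_lim k _ q0 _)).
  + by rewrite mulr_ge0// ltW.
  + by rewrite gtr0_norm//; lra.
  rewrite ler_pdivrMr; last lra.
  apply: (@le_trans _ _ (d / 4)).
    rewrite mulrC -mulrA -invfM ler_pdivrMr ?mulr_gt0//.
    by rewrite mulrAC.
  have : d / 2 * (1 / 2) <= d / 2 * (1 - r / rho).
    by apply: ler_wpM2l; [rewrite divr_ge0// ltW|lra].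
  by apply: le_trans; rewrite le_eqVlt; apply/orP; left; apply/eqP; field.
- move=> t w tr.
  have tr' : `|t - t0| < rho by apply: lt_le_trans tr _; apply: (le_trans r2); lra.
  have h := (ha w).2 t tr'.
  rewrite -cvg_shiftS; rewrite -cvg_shiftS in h.
  have -> : (fun k => \sum_(m < k.+1) dd m w * (t - t0) ^+ m) =
      (fun k => pseries (a w) (t - t0) k.+1 - g 0 w).
    apply/funext => k; rewrite /pseries /series /= big_mkord !big_ord_recl /= !expr0 !mulr1.
    by rewrite addrAC.
  by apply: cvgB; [exact: h|exact: cvg_cst].
Unshelve. all: by end_near. Qed.

End Inputs.

Section ComplexRegularity.
Context {R : realType} {Om : topologicalType}.
Local Notation K := R[i].
Implicit Types (I : set R) (U : set Om) (g : R -> Om -> K).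

Definition csmooth l I U g := unif_smooth_fun l I U (fun t w => complex.Re (g t w)) /\
  unif_smooth_fun l I U (fun t w => complex.Im (g t w)).

Variables (l : smoothness) (I : set R) (U : set Om).
Hypotheses (oI : open I) (oU : open U).

Lemma csmooth_ext g g' : (forall t w, I t -> U w -> g t w = g' t w) ->
  csmooth l I U g -> csmooth l I U g'.
Proof.
by move=> e [h1 h2]; split; [apply: smooth_ext h1|apply: smooth_ext h2] => // t w It Uw; rewrite e.
Qed.

Lemma csmooth_add g g' : csmooth l I U g -> csmooth l I U g' ->
  csmooth l I U (fun t w => g t w + g' t w).
Proof.
move=> [h1 h2] [h1' h2']; split.
  by apply: smooth_ext (smooth_add oI oU h1 h1') => // t w _ _; rewrite ReD.
by apply: smooth_ext (smooth_add oI oU h2 h2') => // t w _ _; rewrite ImD.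
Qed.

Lemma csmooth_0 : csmooth l I U (fun _ _ => 0).
Proof. by split; exact: smooth_0. Qed.

Lemma csmooth_sum (J : Type) (r : seq J) (P : pred J) (g : J -> R -> Om -> K) :
  (forall j, csmooth l I U (g j)) -> csmooth l I U (fun t w => \sum_(j <- r | P j) g j t w).
Proof.
move=> h; elim: r => [|j r ih].
  by apply: csmooth_ext csmooth_0 => t w _ _; rewrite big_nil.
have [Pj|Pj] := boolP (P j).
  by apply: csmooth_ext (csmooth_add (h j) ih) => t w _ _; rewrite big_cons Pj.
by apply: csmooth_ext ih => t w _ _; rewrite big_cons (negbTE Pj).
Qed.

Lemma csmooth_scale (a : Om -> K) g : (forall w, U w -> cplx_continuous_at a w) ->
  csmooth l I U g -> csmooth l I U (fun t w => a w * g t w).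
Proof.
move=> ca [h1 h2].
have cr w : U w -> {for w, continuous (fun w => complex.Re (a w))} by move=> /ca[].
have ci w : U w -> {for w, continuous (fun w => complex.Im (a w))} by move=> /ca[].
have cn w : U w -> {for w, continuous (fun w => - complex.Im (a w))}.
  by move=> Uw; apply: cvgN; exact: ci.
split.
  apply: smooth_ext (smooth_add oI oU (smooth_scale oI oU cr h1) (smooth_scale oI oU cn h2)) => //.
  by move=> t w _ _; rewrite RecM mulNr.
apply: smooth_ext (smooth_add oI oU (smooth_scale oI oU cr h2) (smooth_scale oI oU ci h1)) => //.
by move=> t w _ _; rewrite ImcM; ring.
Qed.

Lemma csmooth_ext0 (a : Om -> R) g : continuous a ->
  (forall w, ~ U w -> \forall w' \near w, a w' = 0) ->
  csmooth l I U g -> csmooth l I setT (fun t w => (a w)%:C%C * g t w).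
Proof.
move=> ca a0 [h1 h2]; split.
  apply: (smooth_ext oI openT _ (smooth_ext0 oI oU ca a0 h1)) => t w _ _.
  by rewrite RecM /= mul0r subr0.
apply: (smooth_ext oI openT _ (smooth_ext0 oI oU ca a0 h2)) => t w _ _.
by rewrite ImcM /= mul0r addr0.
Qed.

End ComplexRegularity.

Lemma csmooth_restr (R : realType) (Om : topologicalType) l (I I' : set R) (U U' : set Om) g :
  I' `<=` I -> U' `<=` U -> csmooth l I U g -> csmooth l I' U' g.
Proof. by move=> h1 h2 [a b]; split; exact: smooth_restr h1 h2 _. Qed.

(** * Regularity of matrix families through the norms *)

Section MatrixRegularity.
Context {R : realType} {Om : topologicalType}.
Hypothesis cOm : compact [set: Om].
Local Notation K := R[i].
Context {N : nat}.
Implicit Types (F A : R -> Om -> 'M[K]_N).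

Definition mreg l (I : set R) F := forall i j, csmooth l I setT (fun t w => F t w i j).

(* The norm systems that together detect the regularity l. *)
Definition all_sys (l : smoothness) (eta : R) (P : @normsys R Om -> Prop) :=
  [/\ P (sup_sys (symint eta)),
      forall n, smooth_ge n l -> exists th (th0 : 0 < th),
        P (Cn_sys n th0 (@open_symint R eta)) &
      l = Comega -> forall t0, symint eta t0 -> exists r (r0 : 0 < r), P (an_sys t0 r0)].

(** The order of choices matters: [eta] is fixed by the sup norm before the order n or the center t0
    is known, and only then are [th] and [r] shrunk. *)
Lemma all_sys_near l A (eps : R) (P : @normsys R Om -> Prop) : 0 < eps ->
  mreg l (symint eps) A ->
  (\forall S \near nsys_filter (fun t w => A t w - A 0 w), P S) ->
  exists eta, [/\ 0 < eta, eta < eps & all_sys l eta P].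
Proof.
move=> e0 rA [d d0 HP].
have d2 : 0 < d / 2 by rewrite divr_gt0.
pose g (b : bool) (ij : 'I_N * 'I_N) t w :=
  if b then complex.Re (A t w ij.1 ij.2) else complex.Im (A t w ij.1 ij.2).
have rg b ij : unif_smooth_fun l (symint eps) setT (g b ij).
  by have [h1 h2] := rA ij.1 ij.2; case: b.
have gX S : (forall b ij, bnd S (fun t w => g b ij t w - g b ij 0 w) d) ->
    bndX S (fun t w => A t w - A 0 w) d.
  move=> h i j; split.
    by apply: bnd_ext (h true (i, j)) => t w _; rewrite /g !mxE -ReB.
  by apply: bnd_ext (h false (i, j)) => t w _; rewrite /g !mxE -ImB.
have sm0 : smooth_ge 0 l by case: l {rA rg}.
have H : \forall eta \near 0^'+, forall b ij, forall t w, symint eta t ->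
    `|g b ij t w - g b ij 0 w| <= d / 2.
  apply: filter_forall => b; apply: filter_forall => ij.
  exact: (sup_input cOm e0 d2 (smooth_Cn sm0 (rg b ij))).
have [eta [[eta0 ee] hs]] := filter_ex (filterI (filterI (nbhs_right_gt (0 : R)) (nbhs_right_lt e0)) H).
exists eta; split=> //; split.
- apply: HP; apply: gX => b ij; split; first exact: ltW.
  by move=> t w It; apply: (le_trans (hs b ij t w It)); move: (d0 : (0 : R) < d) => d0'; lra.
- move=> n nl.
  have H2 : \forall th \near 0^'+, forall b ij,
      Cn_bnd n th (symint eta) (fun t w => g b ij t w - g b ij 0 w) d.
    apply: filter_forall => b; apply: filter_forall => ij.
    exact: (Cn_input cOm eta0 ee d0 (smooth_Cn nl (rg b ij)) (hs b ij)).
  have [th [th0 h]] := filter_ex (filterI (nbhs_right_gt (0 : R)) H2).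
  by exists th, th0; apply: HP; exact: gX.
- move=> la t0 It0.
  have H2 : \forall r \near 0^'+, forall b ij,
      an_bnd t0 r (fun t w => g b ij t w - g b ij 0 w) d.
    apply: filter_forall => b; apply: filter_forall => ij.
    have han : unif_analytic (symint eps) setT (g b ij).
      by have := rg b ij; rewrite la => -[].
    exact: (an_input cOm (ltW ee) d0 It0 han (hs b ij)).
  have [r [r0 h]] := filter_ex (filterI (nbhs_right_gt (0 : R)) H2).
  by exists r, r0; apply: HP; exact: gX.
Qed.

Lemma all_sys_imp l eta (P Q : @normsys R Om -> Prop) : (forall S, P S -> Q S) ->
  all_sys l eta P -> all_sys l eta Q.
Proof.
move=> PQ [h1 h2 h3]; split; first exact: PQ.
  by move=> n /h2[th [th0 /PQ h]]; exists th, th0.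
by move=> /h3 h t0 /h[r [r0 /PQ h']]; exists r, r0.
Qed.

Lemma Cn_output n th eta (g : R -> Om -> R) M : Cn_bnd n th (symint eta) g M ->
  unif_Cn n (symint eta) setT g.
Proof.
move=> [d [s [[d0 d1 d2] _ _ _]]].
apply/(unif_CnP _ _ (@open_symint R eta) openT); exists (fun m t w => (m`!)%:R * d m t w); split.
- by move=> t w It _; rewrite fact0 mul1r d0.
- move=> m t w mn It _.
  have -> : (m.+1)`!%:R * d m.+1 t w = (m`!)%:R * (m.+1%:R * d m.+1 t w).
    by rewrite factS natrM; ring.
  by apply: is_deriveZ; exact: d1.
- by move=> m t w mn It _; apply: cvgM; [exact: cvg_cst|exact: d2].
Qed.

Lemma an_output eta (g : R -> Om -> R) M :
  (forall t0, symint eta t0 -> exists2 r, 0 < r & an_bnd t0 r g M) ->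
  unif_analytic (symint eta) setT g.
Proof.
move=> h t0 w0 It _; have [r r0 [d [s [s0 ds sM dg]]]] := h t0 It.
exists r, M, d; split=> //; apply: nearW => w; split.
  move=> n; apply: (@le_trans _ _ (s n * r ^+ n)).
    by apply: ler_wpM2r; rewrite ?exprn_ge0// ltW.
  apply: le_trans (sM n.+1); rewrite big_ord_recr /= lerDr.
  by apply: sumr_ge0 => i _; rewrite mulr_ge0 ?exprn_ge0// ltW.
move=> t tr; have := dg t w tr.
have -> // : (fun k => \sum_(m < k) d m w * (t - t0) ^+ m) = pseries (fun n => d n w) (t - t0).
by apply/funext => k; rewrite /pseries /series /= big_mkord.
Qed.

Lemma all_sys_reg l eta F M : all_sys l eta (fun S => bndX S F M) -> mreg l (symint eta) F.
Proof.
move=> [_ h1 h2] i j; split; apply: smooth_of_Cn.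
- by move=> n /h1[th [th0 h]]; exact: (Cn_output (h i j).1).
- move=> /h2 h; apply: (an_output (M := M)) => t0 /h[r [r0 h']]; exists r => //; exact: (h' i j).1.
- by move=> n /h1[th [th0 h]]; exact: (Cn_output (h i j).2).
- move=> /h2 h; apply: (an_output (M := M)) => t0 /h[r [r0 h']]; exists r => //; exact: (h' i j).2.
Qed.

(** The fixed points are obtained in the full class l; the class asked for in the conclusion follows
    by forgetting the top order. *)
Lemma mreg_smooth_pred l I F : mreg l I F -> mreg (smooth_pred l) I F.
Proof.
move=> h i j; have [h1 h2] := h i j.
have k g : unif_smooth_fun l I setT g -> unif_smooth_fun (smooth_pred l) I setT g.
  case: l {h h1 h2} => [n||] //= hg m t w mn; apply: hg; exact: leq_trans mn (leq_pred n).
by split; exact: k.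
Qed.

Lemma mreg_C1 l I F : smooth_ge 2 l -> mreg l I F -> mreg (Cfin 1) I F.
Proof.
move=> l2 h i j; have [h1 h2] := h i j.
have l1 : smooth_ge 1 l by case: l l2 {h h1 h2} => // n /ltnW.
by split; exact: (smooth_Cn l1).
Qed.

End MatrixRegularity.

(** * Derivatives and monotonicity *)

Section ComplexDerivative.
Context {R : realType}.
Local Notation K := R[i].
Implicit Types (g h : R -> K) (t : R).

Definition cd g (dg : K) t := is_derive t 1 (fun s => complex.Re (g s)) (complex.Re dg) /\
  is_derive t 1 (fun s => complex.Im (g s)) (complex.Im dg).

Lemma cd_cst a t : cd (fun=> a) 0 t.
Proof. by split; exact: is_derive_cst. Qed.

Lemma cdD g h dg dh t : cd g dg t -> cd h dh t -> cd (fun s => g s + h s) (dg + dh) t.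
Proof.
move=> [a b] [c d]; split.
  under eq_fun do rewrite ReD; rewrite ReD; exact: is_deriveD.
under eq_fun do rewrite ImD; rewrite ImD; exact: is_deriveD.
Qed.

Lemma cdJ g dg t : cd g dg t -> cd (fun s => (g s)^*%C) (dg^*)%C t.
Proof.
move=> [a b]; split.
  by under eq_fun do rewrite ReJ; rewrite ReJ.
under eq_fun do rewrite ImJ; rewrite ImJ; exact: is_deriveN.
Qed.

Lemma is_deriveMM (f k : R -> R) df dk t : is_derive t 1 f df -> is_derive t 1 k dk ->
  is_derive t 1 (fun s => f s * k s) (f t * dk + k t * df).
Proof. by move=> hf hk; apply: (is_deriveM (f := f) (g := k)). Qed.

Lemma cdM g h dg dh t : cd g dg t -> cd h dh t ->
  cd (fun s => g s * h s) (dg * h t + g t * dh) t.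
Proof.
move=> [a b] [c d]; split.
  under eq_fun do rewrite RecM.
  have -> : complex.Re (dg * h t + g t * dh) = complex.Re (g t) * complex.Re dh +
      complex.Re (h t) * complex.Re dg -
      (complex.Im (g t) * complex.Im dh + complex.Im (h t) * complex.Im dg).
    by rewrite ReD !RecM; ring.
  exact: is_deriveB (is_deriveMM a c) (is_deriveMM b d).
under eq_fun do rewrite ImcM.
have -> : complex.Im (dg * h t + g t * dh) = complex.Re (g t) * complex.Im dh +
    complex.Im (h t) * complex.Re dg +
    (complex.Im (g t) * complex.Re dh + complex.Re (h t) * complex.Im dg).
  by rewrite ImD !ImcM; ring.
exact: is_deriveD (is_deriveMM a d) (is_deriveMM b c).
Qed.

Lemma cd_sum (J : Type) (r : seq J) (F : J -> R -> K) (dF : J -> K) t :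
  (forall j, cd (F j) (dF j) t) -> cd (fun s => \sum_(j <- r) F j s) (\sum_(j <- r) dF j) t.
Proof.
move=> h; elim: r => [|j r ih].
  by under eq_fun do rewrite big_nil; rewrite big_nil; exact: cd_cst.
by under eq_fun do rewrite big_cons; rewrite big_cons; exact: cdD.
Qed.

Lemma cd_unique g dg dg' t : cd g dg t -> cd g dg' t -> dg = dg'.
Proof.
move=> [[_ a] [_ b]] [[_ c] [_ d]]; apply: complex_ext.
  by rewrite -a -c.
by rewrite -b -d.
Qed.

Lemma cd_cplx_derive g dg t : cd g dg t -> cplx_derive g t = dg.
Proof.
move=> [[_ a] [_ b]]; rewrite /cplx_derive !derive1E a b.
by apply: complex_ext.
Qed.

Lemma cd_near g h dg t : (\forall s \near t, g s = h s) -> cd g dg t -> cd h dg t.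
Proof.
move=> e [a b]; split.
  by apply: near_eq_is_derive a; apply: filterS e => s ->.
by apply: near_eq_is_derive b; apply: filterS e => s ->.
Qed.

Definition md m n (F : R -> 'M[K]_(m, n)) (dF : 'M[K]_(m, n)) t :=
  forall i j, cd (fun s => F s i j) (dF i j) t.

Lemma md_cst m n (M : 'M[K]_(m, n)) t : md (fun=> M) 0 t.
Proof. by move=> i j; rewrite mxE; exact: cd_cst. Qed.
Lemma mdD m n (F G : R -> 'M[K]_(m, n)) dF dG t : md F dF t -> md G dG t ->
  md (fun s => F s + G s) (dF + dG) t.
Proof. by move=> a b i j; under eq_fun do rewrite mxE; rewrite mxE; exact: cdD. Qed.
Lemma md_adj m n (F : R -> 'M[K]_(m, n)) dF t : md F dF t -> md (fun s => adj (F s)) (adj dF) t.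
Proof. by move=> a i j; under eq_fun do rewrite adjE; rewrite adjE; exact: cdJ. Qed.
Lemma mdM m n q (F : R -> 'M[K]_(m, n)) (G : R -> 'M[K]_(n, q)) dF dG t :
  md F dF t -> md G dG t -> md (fun s => F s *m G s) (dF *m G t + F t *m dG) t.
Proof.
move=> a b i j; under eq_fun do rewrite mxE; rewrite !mxE -big_split.
by apply: cd_sum => k; exact: cdM.
Qed.
Lemma mdMl m n q (M : 'M[K]_(m, n)) (G : R -> 'M[K]_(n, q)) dG t :
  md G dG t -> md (fun s => M *m G s) (M *m dG) t.
Proof. by move=> h; have := mdM (md_cst M t) h; rewrite mul0mx add0r. Qed.
Lemma mdMr m n q (M : 'M[K]_(n, q)) (F : R -> 'M[K]_(m, n)) dF t :
  md F dF t -> md (fun s => F s *m M) (dF *m M) t.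
Proof. by move=> h; have := mdM h (md_cst M t); rewrite mulmx0 addr0. Qed.
Lemma mdZ m n a (F : R -> 'M[K]_(m, n)) dF t : md F dF t -> md (fun s => a *: F s) (a *: dF) t.
Proof.
move=> h i j; under eq_fun do rewrite mxE; rewrite mxE.
by have := cdM (cd_cst a t) (h i j); rewrite mul0r add0r.
Qed.
Lemma md_unique m n (F : R -> 'M[K]_(m, n)) dF dF' t : md F dF t -> md F dF' t -> dF = dF'.
Proof. by move=> a b; apply/matrixP => i j; exact: cd_unique (a i j) (b i j). Qed.
Lemma md_near m n (F G : R -> 'M[K]_(m, n)) dF t : (\forall s \near t, F s = G s) ->
  md F dF t -> md G dF t.
Proof. by move=> e a i j; apply: cd_near (a i j); apply: filterS e => s ->. Qed.
Lemma md_prod0 m n q (F : R -> 'M[K]_(m, n)) (G : R -> 'M[K]_(n, q)) dF dG t :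
  F t = 0 -> G t = 0 -> md F dF t -> md G dG t -> md (fun s => F s *m G s) 0 t.
Proof. by move=> F0 G0 a b; have := mdM a b; rewrite F0 G0 mulmx0 mul0mx addr0. Qed.

Definition mderiv m n (F : R -> 'M[K]_(m, n)) t : 'M[K]_(m, n) :=
  \matrix_(i, j) cplx_derive (fun s => F s i j) t.

End ComplexDerivative.

Lemma cplx_derive_cd {R : realType} (g : R -> R[i]) t :
  derivable (fun s => complex.Re (g s)) t 1 -> derivable (fun s => complex.Im (g s)) t 1 ->
  cd g (cplx_derive g t) t.
Proof. by move=> a b; split; [apply: (DeriveDef a)|apply: (DeriveDef b)]; rewrite -derive1E. Qed.

(** * Persistence of sign on isotropic vectors *)

Section C1Families.
Context {R : realType} {Om : topologicalType} {N : nat}.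
Hypothesis cOm : compact [set: Om].
Local Notation K := R[i].
Implicit Types (F C : R -> Om -> 'M[K]_N).

Lemma csmooth_C1 (I : set R) U (g : R -> Om -> K) t w : csmooth (Cfin 1) I U g -> I t -> U w ->
  [/\ cplx_continuous_at (fun p : R * Om => g p.1 p.2) (t, w),
      cd (g ^~ w) (cplx_derive (g ^~ w) t) t &
      cplx_continuous_at (fun p : R * Om => cplx_derive (g ^~ p.2) p.1) (t, w)].
Proof.
move=> [a b] It Uw.
have [_ a0] := a 0%N t w isT It Uw; have [_ b0] := b 0%N t w isT It Uw.
have [a1 a2] := a 1%N t w isT It Uw; have [b1 b2] := b 1%N t w isT It Uw.
by split; [split|exact: cplx_derive_cd (a1 0%N isT) (b1 0%N isT)|split].
Qed.

Lemma mreg_C1_md (J : set R) F t w : mreg (Cfin 1) J F -> J t ->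
  [/\ cm (fun p : R * Om => F p.1 p.2) (t, w), md (F ^~ w) (mderiv (F ^~ w) t) t &
      cm (fun p : R * Om => mderiv (F ^~ p.2) p.1) (t, w)].
Proof.
move=> h It; split=> i j; have [a b c] := csmooth_C1 (h i j) It (I : [set: Om] w) => //.
  by rewrite mxE.
by under eq_fun do rewrite mxE.
Qed.

Definition pairing (Psi : 'M[K]_N) (x y : 'cV[K]_N) : K := (adj x *m Psi *m y) ord0 ord0.

Lemma pairing_cont (P : Om * 'rV[R]_(N + N) -> 'M[K]_N) z : cm P z ->
  cplx_continuous_at (fun z => pairing (P z) (vec_of z.2) (vec_of z.2)) z.
Proof.
move=> cP; suff h : cm (fun z : Om * 'rV[R]_(N + N) => adj (vec_of z.2) *m P z *m vec_of z.2) z.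
  exact: h ord0 ord0.
apply: cmM (@cm_vec_of _ _ _ z); apply: cmM (cP).
by apply: cm_adj; exact: (@cm_vec_of _ _ _ z).
Qed.

Lemma pairingZ Psi (r : R) x : pairing Psi (r%:C%C *: x) (r%:C%C *: x) = (r ^+ 2)%:C%C * pairing Psi x x.
Proof.
rewrite /pairing adj_scale -!scalemxAl -scalemxAr !mxE conjc_real mulrA.
by rewrite -rmorphM expr2.
Qed.

Lemma pairing_n1 Psi (x : 'cV[K]_N) : n1 (pairing Psi x x) <= nrm Psi * nrm x ^+ 2.
Proof.
apply: (le_trans (n1_le_nrm _ _ _)); apply: (le_trans (nrmM _ _)).
rewrite expr2 mulrA; apply: ler_wpM2r; first exact: nrm_ge0.
by apply: (le_trans (nrmM _ _)); rewrite nrm_adj mulrC.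
Qed.

(* The isotropic unit vectors form a compact set, on which the pairing keeps the
   sign that it has at time 0. *)
Lemma sign_persists (eps : R) (D : R -> Om -> 'M[K]_N) (P Psi : Om -> 'M[K]_N) : 0 < eps ->
  (forall t w, symint eps t -> cm (fun p : R * Om => D p.1 p.2) (t, w)) ->
  (forall w, cm P w) -> (forall w, cm Psi w) ->
  (forall w x, P w *m x = x -> x != 0 -> pairing (Psi w) x x = 0 ->
     complex.Re (pairing (D 0 w) x x) != 0) ->
  \forall eta \near 0^'+, forall w x, P w *m x = x -> x != 0 -> pairing (Psi w) x x = 0 ->
    (forall t, symint eta t -> 0 < complex.Re (pairing (D t w) x x)) \/
    (forall t, symint eta t -> complex.Re (pairing (D t w) x x) < 0).
Proof.
move=> e0 cD cP cPsi D0.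
have I0 : symint eps 0 by rewrite symintE normr0.
have cD0 w : cm (D 0) w.
  by move=> i j; have [a b] := cD 0 w I0 i j; split; apply: (cont_at_time (g := fun t w => _ (D t w i j))).
pose f w (x : 'cV[K]_N) := `|complex.Re (pairing (D 0 w) x x)|.
pose g w (x : 'cV[K]_N) := nrm (P w *m x - x) + (n1 (pairing (Psi w) x x) + `|nrm x - 1|).
have cfst (F : Om -> 'M[K]_N) (z : Om * 'rV[R]_(N + N)) : (forall w, cm F w) -> cm (fun z => F z.1) z.
  move=> cF; apply: (@cm_comp _ _ _ _ _ F (fun z : Om * 'rV[R]_(N + N) => z.1)); last exact: cF.
  exact: cvg_fst.
have gP w x : g w x = 0 -> [/\ P w *m x = x, x != 0, pairing (Psi w) x x = 0 & nrm x = 1].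
  move=> /eqP; rewrite /g paddr_eq0 ?nrm_ge0 ?addr_ge0 ?n1_ge0// paddr_eq0 ?n1_ge0// normr_eq0 subr_eq0.
  move=> /and3P[/eqP h1 /eqP h2 /eqP h3]; split=> //.
  - by apply/eqP; rewrite -subr_eq0; apply/eqP/nrm_eq0.
  - by apply/eqP => e; move: h3; rewrite e nrm0 => /esym/eqP; rewrite oner_eq0.
  - exact: n1_eq0.
have [||w x _ gx|c c0 hc] := @ball_bundle_lb R Om cOm N 1 f g.
- move=> z; apply: cvg_norm.
  by have [] := pairing_cont (cfst _ z cD0).
- move=> z; apply: (@cvgD _ _ _ _ _ _ _ _ _).
    have h : cm (fun z : Om * 'rV[R]_(N + N) => P z.1 *m vec_of z.2 - vec_of z.2) z.
      by apply: cmB (@cm_vec_of _ _ _ z); apply: cmM (@cm_vec_of _ _ _ z); exact: cfst.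
    exact: (nrm_continuous h).
  apply: (@cvgD _ _ _ _ _ _ _ _ _).
    exact: (n1_continuous (pairing_cont (cfst _ z cPsi))).
  apply: cvg_norm; apply: cvgB; last exact: cvg_cst.
  exact: (nrm_continuous (@cm_vec_of _ _ _ z)).
- have [h1 h2 h3 _] := gP _ _ gx.
  by rewrite /f normr_gt0; exact: D0.
have c2 : 0 < c / 2 by rewrite divr_gt0.
(* The drift of [D] is a continuous scalar function vanishing at time 0, hence uniformly small for
   small t. On unit vectors a drift of c / 2 cannot change the sign of a pairing of size at least
   c. *)
have regD : unif_Cn 0 (symint eps) setT (fun t w => nrm (D t w - D 0 w)).
  apply/(unif_CnP _ _ (@open_symint R eps) openT); exists (fun _ t w => nrm (D t w - D 0 w)); split=> //.
  move=> m t w _ It _.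
  have h : cm (fun p : R * Om => D p.1 p.2 - D 0 p.2) (t, w).
    apply: cmB; first exact: cD.
    apply: (@cm_comp _ _ _ _ _ (D 0) (fun z : R * Om => z.2)); last exact: cD0.
    exact: cvg_snd.
  exact: (nrm_continuous h).
have := sup_input cOm e0 c2 regD.
apply: filterS => eta h w x Px x0 iso.
have n0 := nrm_gt0 x0; set r := (nrm x)^-1; have r0 : 0 < r by rewrite invr_gt0.
pose y : 'cV[K]_N := r%:C%C *: x.
have ny : nrm y = 1 by rewrite nrm_real gtr0_norm// mulVf// gt_eqF.
have gy : g w y = 0.
  by rewrite /g ny subrr normr0 addr0 /y pairingZ iso mulr0 n1_0 addr0 -scalemxAr Px subrr nrm0.
have fy := hc w y (eq_ind_r (fun z => z <= 1) (lexx _) ny) gy.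
have yx t : complex.Re (pairing (D t w) y y) = r ^+ 2 * complex.Re (pairing (D t w) x x).
  by rewrite pairingZ RecM /= mul0r subr0.
have d t : symint eta t -> `|complex.Re (pairing (D t w) y y) - complex.Re (pairing (D 0 w) y y)| <= c / 2.
  move=> It; rewrite -ReB; apply: (le_trans (Re_le_n1 _)).
  have -> : pairing (D t w) y y - pairing (D 0 w) y y = pairing (D t w - D 0 w) y y.
    by rewrite /pairing mulmxBr mulmxBl !mxE.
  apply: (le_trans (pairing_n1 _ _)); rewrite ny expr1n mulr1.
  have := h t w It; rewrite subrr nrm0 subr0 ger0_norm//; exact: nrm_ge0.
have r20 : 0 < r ^+ 2 by rewrite exprn_gt0.
have [p0|p0|p0] := ltgtP 0 (complex.Re (pairing (D 0 w) y y)).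
- left => t /d; rewrite -(pmulr_rgt0 _ r20) -yx; move: fy; rewrite /f (gtr0_norm p0).
  by rewrite ler_distl => h1 /andP[h2 _]; lra.
- right => t /d; rewrite -(pmulr_rlt0 _ r20) -yx; move: fy; rewrite /f (ltr0_norm p0).
  by rewrite ler_distl => h1 /andP[_ h2]; lra.
- by move: fy; rewrite /f -p0 normr0 => fy; exfalso; lra.
Qed.

End C1Families.

(** * Matrix cocycles *)

Section ConjugateMatrix.
Context {R : realType} {N : nat}.
Local Notation K := R[i].
Local Notation M := 'M[K]_N.
Variables (Pc1 Pct1 G Psi1 : M).

(** The isometry B has the left inverse [G *m adj B *m Psi1], up to the projection [Pc1]. Their
    product in the other order is a projection onto the range of B, which by rank is the whole range
    of [Pct1]. The inverse of B is thus given by a formula polynomial in B and its adjoint. *)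
Lemma conj_retract (B : M) : \rank Pc1 = \rank Pct1 -> Pct1 *m Pct1 = Pct1 ->
  G *m (adj Pc1 *m Psi1 *m Pc1) = Pc1 -> Pc1 *m G = G ->
  B *m Pc1 = B -> Pct1 *m B = B -> adj B *m Psi1 *m B = adj Pc1 *m Psi1 *m Pc1 ->
  B *m (G *m adj B *m Psi1) *m Pct1 = Pct1.
Proof.
move=> rk PP GF PG BP PB iso.
set Q := B *m (G *m adj B *m Psi1).
have QB : Q *m B = B.
  have -> : Q *m B = B *m (G *m (adj B *m Psi1 *m B)) by rewrite /Q !mulmxA.
  by rewrite iso GF.
have PQ : Pct1 *m Q = Q by rewrite /Q mulmxA PB.
have QQ : Q *m Q = Q.
  have -> : Q *m Q = (Q *m B) *m (G *m adj B *m Psi1) by rewrite /Q !mulmxA.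
  by rewrite QB.
have rB : (\rank Pc1 <= \rank B)%N.
  have -> : Pc1 = (G *m adj B *m Psi1) *m B.
    have -> : (G *m adj B *m Psi1) *m B = G *m (adj B *m Psi1 *m B) by rewrite !mulmxA.
    by rewrite iso.
  exact: mxrankM_maxr.
have GG : (Q *m Pct1) *m B = B by rewrite -mulmxA PB.
have h : (Q *m Pct1) *m Pct1 = Pct1.
  apply: proj_rank_eq => //.
  - apply/eqP; rewrite eqn_leq mxrankM_maxr /= -rk (leq_trans rB)//.
    by rewrite -{1}GG mxrankM_maxl.
  - by rewrite mulmxA PQ.
  - by rewrite -mulmxA (mulmxA Pct1) PQ mulmxA QQ.
by rewrite -mulmxA PP in h.
Qed.

End ConjugateMatrix.

(** * The theorem for matrix cocycles *)

Section MatrixTheorem.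
Context {R : realType} {Om : topologicalType}.
Hypothesis cOm : compact [set: Om].
Local Notation K := R[i].
Context {N : nat}.
Local Notation mx := (Om -> 'M[K]_N).
Variables (T Tinv : Om -> Om) (A : R -> mx) (p Psi : mx) (eps : R) (l : smoothness).
Hypotheses (cT : continuous T) (cTinv : continuous Tinv) (TK : cancel T Tinv) (TinvK : cancel Tinv T).
Hypotheses (eps0 : 0 < eps) (l2 : smooth_ge 2 l) (rA : mreg l (symint eps) A).
Hypotheses (cp : forall w, cm p w) (cPsi : forall w, cm Psi w)
  (pp : forall w, p w *m p w = p w) (skew : forall w, adj (Psi w) = - Psi w)
  (Psip : forall w, Psi w *m p w = Psi w)
  (rkp : forall w, \rank (p w) = \rank (p (T w))).
Local Notation I := (symint eps).
Hypotheses (Ap : forall t w, I t -> A t w *m p w = A t w)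
  (pA : forall t w, I t -> p (T w) *m A t w = A t w)
  (form : forall t w, I t -> adj (A t w) *m Psi (T w) *m A t w = Psi w).

Variable lam : mx.
Hypotheses (lamPsi : forall w, lam w *m Psi w = p w) (Psilam : forall w, Psi w *m lam w = adj (p w))
  (plam : forall w, p w *m lam w = lam w) (lamp : forall w, lam w *m adj (p w) = lam w)
  (cm_lam : forall w, cm lam w).
(** The inverse of a map preserving the form is its adjoint for the form. So the inverse inherits
    smallness and regularity in t from [A] by products alone. *)
Definition Ainv t : mx := fun w => lam (Tinv w) *m adj (A t (Tinv w)) *m Psi w.

Let pPsiE w : adj (p w) *m Psi w = Psi w. Proof. exact: pPsi (skew w) (Psip w). Qed.

Lemma matrix_cocyc t : I t -> cocyc T Tinv (A t) (Ainv t) p Psi.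
Proof.
move=> It.
have cA w : cm (A t) w.
  move=> i j; have [a b] := rA i j.
  have l0 : smooth_ge 0 l by case: l l2.
  have [_ ca] := (smooth_Cn l0 a) 0%N t w isT It (Logic.I : [set: Om] w).
  have [_ cb] := (smooth_Cn l0 b) 0%N t w isT It (Logic.I : [set: Om] w).
  split; first exact: (cont_at_time (g := fun t w => complex.Re (A t w i j)) ca).
  exact: (cont_at_time (g := fun t w => complex.Im (A t w i j)) cb).
have cA' w : cm (fun w => A t (Tinv w)) w by apply: cm_comp (cA _); exact: cTinv.
have AiA w : Ainv t (T w) *m A t w = p w.
  by rewrite /Ainv TK -!mulmxA (mulmxA (adj (A t w))) form// lamPsi.
have Aip w : Ainv t w *m p w = Ainv t w by rewrite /Ainv -mulmxA Psip.
have pAi w : p (Tinv w) *m Ainv t w = Ainv t w by rewrite /Ainv !mulmxA plam.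
split=> //.
- move=> w; apply: cmM (cPsi w); apply: cmM; last exact: cm_adj.
  by apply: cm_comp (cm_lam _); exact: cTinv.
- by move=> w; exact: Ap.
- by move=> w; exact: pA.
(* A left inverse between summands of equal rank is a right inverse: [S] is a projection into the
   range of [p (T w)] and has full rank there. *)
- move=> w; set S := A t w *m Ainv t (T w).
  have : S *m p (T w) = p (T w).
    apply: proj_rank_eq (pp _) _; rewrite /S.
    + apply/eqP; rewrite eqn_leq -{1}(pA w It) -mulmxA mxrankM_maxl /= -rkp.
      have -> : p w = Ainv t (T w) *m S *m A t w.
        have aux (a b : 'M[K]_N) : a *m (b *m a) *m b = (a *m b) *m (a *m b) by rewrite !mulmxA.
        by rewrite /S aux !AiA pp.
      by apply: (leq_trans (mxrankM_maxl _ _)); exact: mxrankM_maxr.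
    + by rewrite mulmxA pA.
    + by rewrite mulmxA -(mulmxA (A t w)) AiA Ap.
  by rewrite /S -mulmxA Aip.
- by move=> w; exact: form.
Qed.

Local Notation Delta := (fun t w => A t w - A 0 w).

Lemma small_Ainv : small Delta (fun t w => Ainv t w - Ainv 0 w).
Proof.
have bl : bdd Delta (fun _ w => lam (Tinv w)).
  apply: bdd_cst => // w; apply: cm_comp (cm_lam _); exact: cTinv.
have bP : bdd Delta (fun _ => Psi) by exact: bdd_cst.
have s := small_Mr (small_Ml bl (small_adj (small_comp cTinv (small_Delta Delta)))) bP.
by apply: small_eq s => t w; rewrite /Ainv -mulmxBl -mulmxBr -adjB.
Qed.

(** In the sup norm over the single time 0 the family [Delta] is zero, so this norm system belongs
    to every set of the filter; in it F is bounded by every positive number. *)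
Lemma small_at0 (F : R -> mx) : small Delta F -> forall w, F 0 w = 0.
Proof.
move=> sF w; apply: nrm_eq0; apply/eqP; rewrite eq_le nrm_ge0 andbT.
apply/ler_addgt0Pl => e e0; rewrite addr0.
have [d d0 h] := small_val sF e0.
have d0' : 0 <= d by exact: ltW.
apply: (h (sup_sys [set 0])) => //= i j; split; split=> // t w' ->.
  by rewrite !mxE subrr normr0.
by rewrite !mxE subrr normr0.
Qed.

Variables Ps Pc Pu : R -> mx.
Hypotheses (ips : forall t, I t -> invproj T (A t) p (Ps t))
  (ipc : forall t, I t -> invproj T (A t) p (Pc t))
  (ipu : forall t, I t -> invproj T (A t) p (Pu t)).
Hypotheses (sc : forall t w, I t -> Ps t w *m Pc t w = 0)
  (su : forall t w, I t -> Ps t w *m Pu t w = 0)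
  (cs : forall t w, I t -> Pc t w *m Ps t w = 0)
  (cu : forall t w, I t -> Pc t w *m Pu t w = 0)
  (us : forall t w, I t -> Pu t w *m Ps t w = 0)
  (uc : forall t w, I t -> Pu t w *m Pc t w = 0)
  (sum : forall t w, I t -> Ps t w + Pc t w + Pu t w = p w).
Hypotheses (dms : forall t, I t -> dominated T (A t) (Ps t) (fun w => Pc t w + Pu t w))
  (dmu : forall t, I t -> dominated T (A t) (fun w => Ps t w + Pc t w) (Pu t)).
Hypotheses (ocs : forall t w, I t -> adj (Pc t w) *m Psi w *m Ps t w = 0)
  (ocu : forall t w, I t -> adj (Pc t w) *m Psi w *m Pu t w = 0)
  (ndc : forall w (x : 'cV[K]_N), adj (Pc 0 w) *m Psi w *m Pc 0 w *m x = 0 -> Pc 0 w *m x = 0).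
Hypotheses (rks : forall t w, I t -> \rank (Ps 0 w) = \rank (Ps t w))
  (rku : forall t w, I t -> \rank (Pu 0 w) = \rank (Pu t w))
  (rkc : forall t w, I t -> \rank (Pc 0 w) = \rank (Pc t w)).
Hypothesis mono : forall w (x : 'cV[K]_N), p w *m x = x -> x != 0 -> pairing (Psi w) x x = 0 ->
  pairing (Psi (T w)) (A 0 w *m x) (mderiv (A ^~ w) 0 *m x) != 0.

Theorem matrix_center : exists eta (B C : R -> mx), [/\ 0 < eta, eta < eps,
  mreg l (symint eta) B /\ mreg l (symint eta) C,
  forall t w, symint eta t -> [/\ B t w *m Pc 0 w = B t w, Pc t w *m B t w = B t w,
    adj (B t w) *m Psi w *m B t w = adj (Pc 0 w) *m Psi w *m Pc 0 w,
    Pc 0 (T w) *m C t w = C t w /\ C t w *m Pc 0 w = C t w & B t (T w) *m C t w = A t w *m B t w] &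
  forall w (x : 'cV[K]_N), Pc 0 w *m x = x -> x != 0 -> pairing (Psi w) x x = 0 ->
    (forall t, symint eta t -> 0 < pairing (Psi (T w)) (C t w *m x) (mderiv (C ^~ w) t *m x)) \/
    (forall t, symint eta t -> pairing (Psi (T w)) (C t w *m x) (mderiv (C ^~ w) t *m x) < 0)].
Proof.
have I0 : I 0 by rewrite symintE normr0.
have [Y [Z [sY sZ HYZ]]] := center_transport cOm I0 matrix_cocyc small_Ainv skew lamPsi Psilam plam
  lamp cm_lam ips ipc ipu sc su cs cu us uc sum dms dmu ocs ocu rks rku.
have [B BE] : exists B : R -> mx, forall t w, B t w = (p w + Y t w) *m (Pc 0 w + Z t w).
  by exists (fun t w => (p w + Y t w) *m (Pc 0 w + Z t w)).
have cPc := ip_c (ipc I0).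
have PcPc w := ip_PP (ipc I0) w.
have [G [cG GF PG]] : exists G : mx, [/\ forall w, cm G w,
    forall w, G w *m (adj (Pc 0 w) *m Psi w *m Pc 0 w) = Pc 0 w & forall w, Pc 0 w *m G w = G w].
  exists (fun w => form_inv (Pc 0 w) (Psi w)); split=> w.
  - exact: cm_form_inv.
  - exact: form_inv_mul_form (PcPc w) (@ndc w).
  - exact: form_inv_l.
(* The conjugated cocycle, with the inverse of B at [T w] written as in [conj_retract]. *)
have [C CE] : exists C : R -> mx, forall t w,
    C t w = G (T w) *m adj (B t (T w)) *m Psi (T w) *m A t w *m B t w.
  by exists (fun t w => G (T w) *m adj (B t (T w)) *m Psi (T w) *m A t w *m B t w).
have cst F : (forall w, cm F w) -> bdd Delta (fun=> F) by exact: bdd_cst.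
have bA : bdd Delta A.
  have := bddD (small_bdd (small_Delta Delta)) (cst _ (co_cA (matrix_cocyc I0))).
  by apply: bdd_eq => t w; rewrite subrK.
have bB : bdd Delta B.
  have : bdd Delta (fun t w => (p w + Y t w) *m (Pc 0 w + Z t w)); last first.
    by apply: bdd_eq => t w; rewrite BE.
  apply: bddM; apply: bddD; try exact: small_bdd; exact: cst.
have bC : bdd Delta C.
  have : bdd Delta (fun t w => G (T w) *m adj (B t (T w)) *m Psi (T w) *m A t w *m B t w); last first.
    by apply: bdd_eq => t w; rewrite CE.
  apply: (bddM _ bB); apply: (bddM _ bA); apply: bddM; last first.
    by apply: cst => w; apply: cm_comp (cPsi _); exact: cT.
  apply: bddM; first by apply: cst => w; apply: cm_comp (cG _); exact: cT.
  by apply: bdd_adj; exact: (bdd_comp cT bB).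
have [MB MB0 hB] := bB; have [MC MC0 hC] := bC.
have [MY MY0 hY] := small_bdd sY; have [MZ MZ0 hZ] := small_bdd sZ.
have [eta [eta0 etae HS]] := all_sys_near cOm eps0 rA
  (filterI HYZ (filterI (filterI hB hC) (filterI hY hZ))).
have [[H _] _ _] := HS.
have rB : mreg l (symint eta) B.
  by apply: (all_sys_reg (M := MB)); apply: all_sys_imp HS => S [_ [[]]].
have rC : mreg l (symint eta) C.
  by apply: (all_sys_reg (M := MC)); apply: all_sys_imp HS => S [_ [[]]].
have rY : mreg l (symint eta) Y.
  by apply: (all_sys_reg (M := MY)); apply: all_sys_imp HS => S [_ [_ []]].
have rZ : mreg l (symint eta) Z.
  by apply: (all_sys_reg (M := MZ)); apply: all_sys_imp HS => S [_ [_ []]].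
have sub t : symint eta t -> I t by rewrite !symintE => /lt_trans; apply.
have E0 : symint eta 0 by rewrite symintE normr0.
have core t w : symint eta t -> [/\ B t w *m Pc 0 w = B t w, Pc t w *m B t w = B t w &
    adj (B t w) *m Psi w *m B t w = adj (Pc 0 w) *m Psi w *m Pc 0 w].
  by move=> It; have [_ _] := H t It (sub t It) w; rewrite /= -BE => h1 h2 h3.
have CC t w : symint eta t -> [/\ Pc 0 (T w) *m C t w = C t w, C t w *m Pc 0 w = C t w &
     B t (T w) *m C t w = A t w *m B t w].
  move=> It; have [b1 b2 b3] := core t w It; have [b1' b2' b3'] := core t (T w) It.
  split; rewrite CE.
  - by rewrite !mulmxA PG.
  - by rewrite -mulmxA b1.
  - have h := conj_retract (rkc (T w) (sub t It)) (ip_PP (ipc (sub t It)) (T w))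
      (GF (T w)) (PG (T w)) b1' b2' b3'.
    have e : A t w *m B t w = Pc t (T w) *m (A t w *m B t w).
      by rewrite mulmxA (ip_A (ipc (sub t It))) -mulmxA b2.
    by rewrite [in RHS]e -h -!mulmxA -e.
have Cform t w : symint eta t -> adj (C t w) *m Psi (T w) *m C t w = adj (Pc 0 w) *m Psi w *m Pc 0 w.
  move=> It; have [c1 c2 c3] := CC t w It; have [b1 b2 b3] := core t w It.
  have [b1' b2' b3'] := core t (T w) It.
  have -> : adj (C t w) *m Psi (T w) *m C t w =
     adj (C t w) *m (adj (Pc 0 (T w)) *m Psi (T w) *m Pc 0 (T w)) *m C t w.
    by rewrite -{1 2}c1 adjM !mulmxA.
  have -> : adj (C t w) *m (adj (Pc 0 (T w)) *m Psi (T w) *m Pc 0 (T w)) *m C t w =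
     adj (B t (T w) *m C t w) *m Psi (T w) *m (B t (T w) *m C t w).
    by rewrite -b3' adjM !mulmxA.
  rewrite c3 adjM -b3 -(form w (sub t It)) !mulmxA.
  by [].
pose D t w := adj (C t w) *m Psi (T w) *m mderiv (C ^~ w) t.
have rC1 := mreg_C1 l2 rC.
have cPsiT (z : R * Om) : cm (fun z : R * Om => Psi (T z.2)) z.
  apply: (@cm_comp _ _ _ _ _ Psi (fun z : R * Om => T z.2)); last exact: cPsi.
  by apply: (@continuous_comp _ _ _ (fun z : R * Om => z.2) T); [exact: cvg_snd|exact: cT].
have cD t w : symint eta t -> cm (fun q : R * Om => D q.1 q.2) (t, w).
  move=> It; have [c1 c2 c3] := mreg_C1_md w rC1 It.
  by apply: cmM c3; apply: cmM; [exact: cm_adj|exact: cPsiT].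
(* The pullback of the form by [C t] is constant in t. Differentiating it and using that the form is
   skew shows that the matrix of the pairing of C with its derivative is Hermitian, so the pairings
   below are real. *)
have Dherm t w : symint eta t -> adj (D t w) = D t w.
  move=> It; have [c1 c2 c3] := mreg_C1_md w rC1 It.
  have h := mdM (mdMr (Psi (T w)) (md_adj c2)) c2.
  have h' : md (fun s => adj (C s w) *m Psi (T w) *m C s w) 0 t.
    apply: md_near (md_cst (adj (Pc 0 w) *m Psi w *m Pc 0 w) t).
    near=> s; rewrite Cform//; near: s.
    by apply: open_nbhs_nbhs; split=> //; exact: open_symint.
  have e := md_unique h h'; rewrite /D adjM (adjM (adj _)) adjK skew mulNmx mulmxN mulmxA.
  by apply/eqP; rewrite eqr_oppLR -addr_eq0 e.
have pD t w (x : 'cV[K]_N) : pairing (Psi (T w)) (C t w *m x) (mderiv (C ^~ w) t *m x) = pairing (D t w) x x.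
  by rewrite /pairing /D adjM !mulmxA.
have Dreal t w (x : 'cV[K]_N) : symint eta t -> complex.Im (pairing (D t w) x x) = 0.
  move=> It; have : (pairing (D t w) x x)^*%C = pairing (D t w) x x.
    move: (Dherm t w It); move: (D t w) => M hM.
    by rewrite /pairing -adjE adjM (adjM (adj x)) adjK hM mulmxA.
  by move=> /(congr1 (@complex.Im R)); rewrite ImJ => /eqP; rewrite eqNr => /eqP.
have Y0 := small_at0 sY; have Z0 := small_at0 sZ.
have B0 w : B 0 w = Pc 0 w by rewrite BE Y0 Z0 !addr0 (ip_pP (ipc I0)).
have C0 w : C 0 w = A 0 w *m Pc 0 w.
  have [c1 c2 c3] := CC 0 w E0; move: c3; rewrite !B0 c1; exact.
have D0 w (x : 'cV[K]_N) : Pc 0 w *m x = x ->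
   pairing (D 0 w) x x = pairing (Psi (T w)) (A 0 w *m x) (mderiv (A ^~ w) 0 *m x).
  move=> Px.
  have mY v : md (Y ^~ v) (mderiv (Y ^~ v) 0) 0 by have [] := mreg_C1_md v (mreg_C1 l2 rY) E0.
  have mZ v : md (Z ^~ v) (mderiv (Z ^~ v) 0) 0 by have [] := mreg_C1_md v (mreg_C1 l2 rZ) E0.
  have mB v : md (B ^~ v) (mderiv (B ^~ v) 0) 0 by have [] := mreg_C1_md v (mreg_C1 l2 rB) E0.
  have [_ mC _] := mreg_C1_md w rC1 E0.
  have [_ mA _] := mreg_C1_md w (mreg_C1 l2 rA) I0.
  have dagZ0 v (F : R -> 'M[K]_N) dF : md F dF 0 -> md (fun s => dag (Psi v) (lam v) (F s)) (dag (Psi v) (lam v) dF) 0.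
    by move=> h; rewrite /dag; apply: mdMr; apply: mdMl; exact: md_adj.
  have dag0 v : dag (Psi v) (lam v) 0 = 0 by rewrite /dag adj0 mulmx0 mul0mx.
  (* Every term of W, and L itself, is a product containing two factors that vanish at t = 0; the
     equation for Z then gives Z a zero derivative. *)
  have dZ v : md (Z ^~ v) 0 0.
    pose L t := Pc 0 v *m dag (Psi v) (lam v) (Y t v) *m Y t v *m Pc 0 v.
    have mL : md L 0 0.
      rewrite -(mul0mx _ (Pc 0 v)); apply: mdMr.
      apply: md_prod0 (mY v); rewrite ?Y0 ?dag0 ?mulmx0//.
      apply: mdMl; apply: dagZ0; exact: mY.
    have L0 : L 0 = 0 by rewrite /L Y0 !(mulmx0, mul0mx).
    have mW : md (fun t => Wpoly (L t) (Z t v)) 0 0.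
      rewrite -[X in md _ X _](addr0 (0 : 'M[K]_N)); apply: mdD; last first.
        apply: md_prod0 (mZ v); rewrite ?Z0 ?mul0mx//.
        exact: mdM (mZ v) mL.
      rewrite -[X in md _ X _](addr0 (0 : 'M[K]_N)); apply: mdD; last by apply: md_prod0 (mZ v).
      rewrite -[X in md _ X _](addr0 (0 : 'M[K]_N)); apply: mdD; last by apply: md_prod0 (mZ v) mL.
      rewrite -[X in md _ X _](addr0 (0 : 'M[K]_N)); apply: mdD => //.
      by apply: md_prod0 (mZ v) (mZ v).
    have : md (fun t => (quarter : R)%:C%C *: (Pc 0 v *m (Wpoly (L t) (Z t v) +
        dag (Psi v) (lam v) (Wpoly (L t) (Z t v))) *m Pc 0 v)) 0 0.
      have := mdZ (quarter : R)%:C%C (mdMr (Pc 0 v) (mdMl (Pc 0 v) (mdD mW (dagZ0 v _ _ mW)))).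
      by rewrite dag0 addr0 mulmx0 mul0mx scaler0.
    apply: md_near; near=> s.
    have Es : symint eta s.
      by near: s; apply: open_nbhs_nbhs; split=> //; exact: open_symint.
    have [_ e _ _ _] := H s Es (sub s Es) v; exact: (esym e).
  (* Paired with the center at time 0, Y contributes nothing and B reduces to [Pc 0 + Z], whose
     derivative at 0 is zero. *)
  have dB v : adj (Pc 0 v) *m Psi v *m mderiv (B ^~ v) 0 = 0.
    apply: (md_unique (mdMl (adj (Pc 0 v) *m Psi v) (mB v))).
    have : md (fun s => adj (Pc 0 v) *m Psi v *m (Pc 0 v + Z s v)) 0 0.
      have := mdMl (adj (Pc 0 v) *m Psi v) (mdD (md_cst (Pc 0 v) 0) (dZ v)).
      by rewrite addr0 mulmx0.
    apply: md_near; near=> s.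
    have Es : symint eta s.
      by near: s; apply: open_nbhs_nbhs; split=> //; exact: open_symint.
    have [e _ _ _ _] := H s Es (sub s Es) v.
    have aux (a q y z : 'M[K]_N) : a *m q = a -> a *m y = 0 -> a *m ((q + y) *m z) = a *m z.
      by move=> h1 h2; rewrite mulmxA mulmxDr h1 h2 addr0.
    by rewrite BE (aux _ _ _ _ _ e)// -(mulmxA (adj _) (Psi v) (p v)) Psip.
  have eq1 : mderiv (B ^~ (T w)) 0 *m C 0 w + Pc 0 (T w) *m mderiv (C ^~ w) 0 =
      mderiv (A ^~ w) 0 *m Pc 0 w + A 0 w *m mderiv (B ^~ w) 0.
    rewrite -!B0; apply: (md_unique (mdM (mB (T w)) mC)).
    apply: md_near (mdM mA (mB w)); near=> s.
    have Es : symint eta s.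
      by near: s; apply: open_nbhs_nbhs; split=> //; exact: open_symint.
    by have [_ _ ->] := CC s w Es.
  have Ax : Pc 0 (T w) *m (A 0 w *m x) = A 0 w *m x.
    by rewrite mulmxA (ip_A (ipc I0)) -mulmxA Px.
  pose u := adj (A 0 w *m x) *m Psi (T w).
  have u1 : u *m mderiv (B ^~ (T w)) 0 = 0.
    by rewrite /u -Ax adjM -!mulmxA (mulmxA (adj (Pc 0 _))) dB mulmx0.
  have u2 : u *m A 0 w *m mderiv (B ^~ w) 0 = 0.
    have -> : u *m A 0 w = adj x *m Psi w by rewrite /u adjM -(form w I0) !mulmxA.
    by rewrite -Px adjM -!mulmxA (mulmxA (adj (Pc 0 w))) dB mulmx0.
  have PdC : Pc 0 (T w) *m mderiv (C ^~ w) 0 = mderiv (C ^~ w) 0.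
    apply: (md_unique (mdMl (Pc 0 (T w)) mC)); apply: md_near mC; near=> s.
    have Es : symint eta s.
      by near: s; apply: open_nbhs_nbhs; split=> //; exact: open_symint.
    by have [-> _ _] := CC s w Es.
  have key : u *m mderiv (C ^~ w) 0 *m x = u *m (mderiv (A ^~ w) 0 *m x).
    have := congr1 (fun X => u *m X *m x) eq1; rewrite !mulmxDr !mulmxDl PdC.
    rewrite !mulmxA u1 !mul0mx add0r u2 mul0mx addr0 => ->.
    by rewrite -!mulmxA Px.
  rewrite /pairing -/u -key /D C0 /u; congr (fun_of_matrix _ ord0 ord0).
  have aux (M1 P Q dC : 'M[K]_N) (y : 'cV[K]_N) : P *m y = y ->
      adj y *m (adj (M1 *m P) *m Q *m dC) *m y = adj (M1 *m y) *m Q *m dC *m y.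
    move=> Py; have -> : M1 *m y = (M1 *m P) *m y by rewrite -mulmxA Py.
    by rewrite (adjM (M1 *m P) y) !mulmxA.
  exact: aux.
have D0n w (x : 'cV[K]_N) : Pc 0 w *m x = x -> x != 0 -> pairing (Psi w) x x = 0 ->
    complex.Re (pairing (D 0 w) x x) != 0.
  move=> Px x0 iso; apply/negP => /eqP e.
  have px : p w *m x = x by rewrite -Px mulmxA (ip_pP (ipc I0)).
  have := mono px x0 iso; rewrite -D0// => /negP; apply; apply/eqP.
  by apply: complex_ext => //=; rewrite Dreal.
have sgn := sign_persists cOm eta0 cD cPc cPsi D0n.
have [e1 [[e10 e1e] h1]] := filter_ex (filterI (filterI (nbhs_right_gt (0 : R)) (nbhs_right_lt eta0)) sgn).
have sub1 : symint e1 `<=` symint eta by move=> t; rewrite !symintE => /lt_trans; apply.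
have res F : mreg l (symint eta) F -> mreg l (symint e1) F.
  by move=> h i j; exact: csmooth_restr sub1 _ (h i j).
exists e1, B, C; split=> //; first exact: lt_trans etae.
- by split; exact: res.
- move=> t w /sub1 It; have [a1 a2 a3] := core t w It; have [c1 c2 c3] := CC t w It.
  by split.
- move=> w x Px x0 iso; have [h|h] := h1 w x Px x0 iso; [left|right] => t It.
    by rewrite pD ltcE /= Dreal ?eqxx ?h//; exact: sub1.
  by rewrite pD ltcE /= Dreal ?eqxx ?h//; exact: sub1.
Unshelve. all: by end_near. Qed.

End MatrixTheorem.

(** * Signature of the center *)

Lemma char_poly_conj (F : fieldType) n (P Q D : 'M[F]_n) : Q *m P = 1%:M ->
  char_poly (Q *m D *m P) = char_poly D.
Proof.
move=> QP; have QPp : map_mx polyC Q *m map_mx polyC P = 1%:M by rewrite -map_mxM QP map_mx1.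
rewrite /char_poly.
have -> : char_poly_mx (Q *m D *m P) = map_mx polyC Q *m char_poly_mx D *m map_mx polyC P.
  rewrite /char_poly_mx !map_mxM /= mulmxBr mulmxBl; congr (_ - _).
  by rewrite scalar_mxC -mulmxA QPp mulmx1.
rewrite !det_mulmx mulrAC -det_mulmx QPp det1 mul1r.
by [].
Qed.

Section Spectral.
Context {R : realType}.
Local Notation K := R[i].

Lemma hermitian_diag n (H : 'M[K]_n) : adj H = H ->
  exists (P : 'M[K]_n) (d : 'rV[K]_n), [/\ adj P *m P = 1%:M, P *m adj P = 1%:M,
    H = adj P *m diag_mx d *m P, forall i, complex.Im (d ord0 i) = 0 &
    perm_eq (eigenvalues H) [seq d ord0 i | i <- enum 'I_n]].
Proof.
move=> Hh.
have Hherm : H \is hermsymmx.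
  apply/is_hermitianmxP; rewrite expr0 scale1r -{1}Hh.
  by apply/matrixP => i j; rewrite !mxE.
have Hn := hermitian_normalmx Hherm.
have E := orthomx_spectralP Hn.
have U := spectral_unitarymx H; have Uu := spectral_unit H.
move: E U Uu; set P := spectralmx H; set d := spectral_diag H => E U Uu.
have aE : adj P = invmx P.
  by rewrite invmx_unitary//; apply/matrixP => i j; rewrite !mxE.
have dr i : complex.Im (d ord0 i) = 0.
  have /mxOverP/(_ ord0 i) := hermitian_spectral_diag_real Hherm.
  rewrite -/d realE; case: (d ord0 i) => a b; rewrite !lecE /= => /orP[] /andP[/eqP e _].
    exact: e.
  by rewrite -e.
exists P, d; split.
- by rewrite aE mulVmx.
- by rewrite aE mulmxV.
- by rewrite aE.
- exact: dr.
- have cE : char_poly H = \prod_(i < n) ('X - (d ord0 i)%:P).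
    rewrite E char_poly_conj ?mulVmx// char_poly_trig; last first.
      by apply/is_trig_mxP => i j ij; rewrite mxE; case: eqP ij => // ->; rewrite ltnn.
    by apply: eq_bigr => i _; rewrite mxE eqxx.
  rewrite /eigenvalues; case: closed_field_poly_normal => s /= sE.
  apply: prod_XsubC_eq; rewrite big_map big_enum /= -cE sE.
  by rewrite (eqP (char_poly_monic H)) scale1r.
Qed.

End Spectral.

(** * Inertia of a Hermitian symplectic form *)

Section Inertia.
Context {R : realType} {W : vectType R[i]}.
Local Notation K := R[i].
Implicit Types (psi phi : W -> W -> K).

Section Sesquilinear.
Variable phi : W -> W -> K.
Hypothesis ses : sesquilinear_form phi.

Lemma ses0l v : phi 0 v = 0.
Proof. by have := ses.1 (-1) 0 0 v; rewrite scaler0 addr0 rmorphN rmorph1 mulN1r addNr. Qed.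
Lemma ses0r v : phi v 0 = 0.
Proof. by have := ses.2 (-1) v 0 0; rewrite scaler0 addr0 mulN1r addNr. Qed.
Lemma sesDl u v w : phi (u + v) w = phi u w + phi v w.
Proof. by have := ses.1 1 u v w; rewrite scale1r rmorph1 mul1r. Qed.
Lemma sesDr u v w : phi u (v + w) = phi u v + phi u w.
Proof. by have := ses.2 1 u v w; rewrite scale1r mul1r. Qed.
Lemma sesZl a u v : phi (a *: u) v = (a^*)%C * phi u v.
Proof. by have := ses.1 a u 0 v; rewrite addr0 ses0l addr0. Qed.
Lemma sesZr a u v : phi u (a *: v) = a * phi u v.
Proof. by have := ses.2 a u v 0; rewrite addr0 ses0r addr0. Qed.
Lemma ses_suml (I : Type) (r : seq I) (P : pred I) (F : I -> W) v :
  phi (\sum_(i <- r | P i) F i) v = \sum_(i <- r | P i) phi (F i) v.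
Proof. by elim/big_rec2: _ => [|i x y _ <-]; [exact: ses0l|exact: sesDl]. Qed.
Lemma ses_sumr (I : Type) (r : seq I) (P : pred I) (F : I -> W) v :
  phi v (\sum_(i <- r | P i) F i) = \sum_(i <- r | P i) phi v (F i).
Proof. by elim/big_rec2: _ => [|i x y _ <-]; [exact: ses0r|exact: sesDr]. Qed.

Lemma orthogonal_definite (X : seq W) : free X ->
  (forall x y, x \in X -> y \in X -> x != y -> phi x y = 0) ->
  (forall x, x \in X -> 0 < phi x x) ->
  forall v, v \in <<X>>%VS -> v != 0 -> 0 < phi v v.
Proof.
move=> fX oX pX v vX v0.
have Xi (i : 'I_(size X)) : X`_i \in X by exact: mem_nth.
have [c vE] : exists c : 'I_(size X) -> K, v = \sum_i c i *: X`_i.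
  by exists (fun i => coord (in_tuple X) i v); exact: (@coord_span _ _ _ (in_tuple X)).
have vv : phi v v = \sum_i (c i * (c i)^*%C) * phi X`_i X`_i.
  rewrite vE ses_suml; apply: eq_bigr => i _; rewrite sesZl ses_sumr (bigD1 i)//= big1.
    by rewrite addr0 sesZr; ring.
  move=> j ji; rewrite sesZr oX ?Xi ?mulr0//.
  by rewrite nth_uniq ?(free_uniq fX)// eq_sym.
have c0 i : 0 <= c i * (c i)^*%C.
  by case: (c i) => a b; rewrite lecE /=; apply/andP; split; [apply/eqP; ring|nra].
have [i ci] : exists i, c i != 0.
  apply/existsP; apply: contraNT v0 => /existsPn h; rewrite vE big1// => i _.
  by have := h i; rewrite negbK => /eqP ->; rewrite scale0r.
rewrite vv (bigD1 i)//= ltr_pwDl//.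
  apply: mulr_gt0; last exact: pX.
  rewrite lt_neqAle c0 andbT eq_sym mulf_neq0//.
  by rewrite conjc_eq0.
by apply: sumr_ge0 => j _; rewrite mulr_ge0 ?c0// ltW// pX.
Qed.

End Sesquilinear.

(** Diagonalizing the matrix of i psi by a unitary matrix gives an orthogonal basis [f].
    Non-degeneracy excludes the eigenvalue 0, and the signs of the eigenvalues sort [f] into the two
    subspaces. The later comparisons of dimensions use only their existence. *)
Lemma hs_inertia psi : hs_form psi -> exists Up Un : {vspace W},
  [/\ (\dim Up + \dim Un)%N = \dim {:W},
      hs_signature psi = (\dim Up)%:Z - (\dim Un)%:Z,
      forall v, v \in Up -> v != 0 -> 0 < 'i%C * psi v v &
      forall v, v \in Un -> v != 0 -> 'i%C * psi v v < 0].
Proof.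
move=> [ses skew nd].
set b := vbasis (fullv : {vspace W}); set n := \dim {:W}.
pose H : 'M[K]_n := \matrix_(i, j) ('i%C * psi b`_i b`_j).
have bB : basis_of fullv b by exact: vbasisP.
have Hh : adj H = H.
  apply/matrixP => i j; rewrite adjE !mxE (skew b`_i); case: (psi b`_j b`_i) => x y.
  by apply: complex_ext => /=; ring.
have [P [d [PaP PPa HE dreal dperm]]] := hermitian_diag Hh.
pose f (i : 'I_n) : W := \sum_(j < n) (adj P j i) *: b`_j.
have ff i k : 'i%C * psi (f i) (f k) = d ord0 i *+ (i == k).
  have -> : 'i%C * psi (f i) (f k) = (P *m H *m adj P) i k.
    transitivity (\sum_(j < n) \sum_(l < n) P i j * H j l * adj P l k).
      rewrite /f (ses_suml ses) mulr_sumr; apply: eq_bigr => j _.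
      rewrite (sesZl ses) (ses_sumr ses) !mulr_sumr; apply: eq_bigr => l _.
      by rewrite (sesZr ses) [H j l]mxE [adj P j i]adjE conjcK; ring.
    rewrite exchange_big mxE; apply: eq_bigr => l _.
    by rewrite [(P *m H) i l]mxE mulr_suml.
  rewrite HE !mulmxA PPa mul1mx -mulmxA PPa mulmx1 mxE.
  by case: eqP => [->|].
pose X := [seq f i | i <- enum 'I_n].
have bX (m : 'I_n) : b`_m = \sum_i P i m *: f i.
  rewrite /f; under eq_bigr do rewrite scaler_sumr.
  rewrite exchange_big; transitivity (\sum_(j < n) (adj P *m P) j m *: b`_j).
    rewrite PaP (bigD1 m)//= mxE eqxx scale1r big1 ?addr0// => j jm.
    by rewrite mxE (negbTE jm) scale0r.
  apply: eq_bigr => j _; under [RHS]eq_bigr do rewrite scalerA.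
  by rewrite -scaler_suml mxE; congr (_ *: _); apply: eq_bigr => i _; rewrite mulrC.
have fX i : f i \in X by apply: map_f; rewrite mem_enum.
have sX : (<<X>> = fullv)%VS.
  apply/eqP; rewrite eqEsubv subvf /= -(span_basis bB); apply/span_subvP => v.
  move=> /(nthP 0)[m]; rewrite size_tuple => mn <-.
  rewrite (bX (Ordinal mn)); apply: memv_suml => i _; apply: memvZ.
  exact: memv_span.
have frX : free X.
  rewrite /free sX size_map size_enum_ord.
  by [].
have f0 i : f i != 0 by exact: free_not0 frX (fX i).
have d0 k : d ord0 k != 0.
  apply: contra (f0 k) => /eqP dk; apply/eqP; apply: nd => w.
  have z i : psi (f k) (f i) = 0.
    have := ff k i; rewrite dk mul0rn => /eqP; rewrite mulf_eq0 => /orP[|/eqP//].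
    by rewrite eq_complex /= oner_eq0 andbF.
  have wE : w = \sum_(i < n) coord b i w *: b`_i.
    by apply: coord_basis bB (memvf w).
  rewrite wE (ses_sumr ses) big1// => i _; rewrite (sesZr ses) bX (ses_sumr ses) big1 ?mulr0//.
  by move=> j _; rewrite (sesZr ses) z mulr0.
pose pos v := 0 < 'i%C * psi v v; pose neg v := 'i%C * psi v v < 0.
have fpos i : pos (f i) = (0 < d ord0 i) by rewrite /pos ff eqxx.
have fneg i : neg (f i) = (d ord0 i < 0) by rewrite /neg ff eqxx.
have XP x : x \in X -> exists i, x = f i by move=> /mapP[i _ ->]; exists i.
have oX x y : x \in X -> y \in X -> x != y -> 'i%C * psi x y = 0.
  by move=> /XP[i ->] /XP[j ->] h; rewrite ff; have [e|//] := eqVneq i j; move: h; rewrite e eqxx.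
have dim (q : pred W) : \dim <<[seq x <- X | q x]>> = count q X.
  by have := filter_free q frX; rewrite /free size_filter => /eqP.
have cpos : count pos X = count (fun z => 0 < z) (eigenvalues H).
  by rewrite (permP dperm) !count_map; apply: eq_count => i /=; exact: fpos.
have cneg : count neg X = count (fun z => z < 0) (eigenvalues H).
  by rewrite (permP dperm) !count_map; apply: eq_count => i /=; exact: fneg.
exists <<[seq x <- X | pos x]>>%VS, <<[seq x <- X | neg x]>>%VS.
rewrite !dim; split.
- have -> : count neg X = count (predC pos) X.
    apply: eq_in_count => x /XP[i ->] /=; rewrite fneg fpos.
    have := d0 i; have := dreal i; case: (d ord0 i) => x1 y1 /= -> h.
    rewrite !ltcE /= eqxx /= -leNgt lt_neqAle; case: ltgtP h => //= e.
    by rewrite eq_complex /= -e eqxx.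
  by rewrite count_predC size_map size_enum_ord.
- by rewrite cpos cneg.
- have s1 : sesquilinear_form (fun u v => 'i%C * psi u v).
    split=> a u v w; first by rewrite (sesDl ses) (sesZl ses); ring.
    by rewrite (sesDr ses) (sesZr ses); ring.
  apply: (orthogonal_definite s1); first exact: filter_free.
    by move=> x y; rewrite !mem_filter => /andP[_ xX] /andP[_ yX]; exact: oX.
  by move=> x; rewrite mem_filter => /andP[].
- have s1 : sesquilinear_form (fun u v => - ('i%C * psi u v)).
    split=> a u v w; first by rewrite (sesDl ses) (sesZl ses); ring.
    by rewrite (sesDr ses) (sesZr ses); ring.
  move=> v vX v0; rewrite -oppr_gt0; move: v vX v0.
  apply: (orthogonal_definite s1); first exact: filter_free.
    by move=> x y; rewrite !mem_filter => /andP[_ xX] /andP[_ yX] xy; rewrite oX// oppr0.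
  by move=> x; rewrite mem_filter oppr_gt0 => /andP[].
Qed.

End Inertia.

Section Restriction.
Context {R : realType} {W : vectType R[i]}.
Local Notation K := R[i].
Variables (psi : W -> W -> K) (E : {vspace W}).
Hypothesis hs : hs_form psi.
Local Notation rpsi := (fun u v : subvs_of E => psi (vsval u) (vsval v)).

Lemma restr_hs_form : nondegenerate_form rpsi -> hs_form rpsi.
Proof.
have [ses skew _] := hs; split=> //; split=> a u v w.
  by rewrite linearP /= ses.1.
by rewrite linearP /= ses.2.
Qed.

Definition lift_vs (U : {vspace subvs_of E}) : {vspace W} := (linfun vsval @: U)%VS.

Lemma lift_vs_sub U : (lift_vs U <= E)%VS.
Proof.
apply/subvP => v /memv_imgP[u _ ->]; rewrite lfunE /=; exact: subvsP.
Qed.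

Lemma dim_lift_vs U : \dim (lift_vs U) = \dim U.
Proof.
apply: limg_dim_eq; apply/eqP; rewrite -subv0; apply/subvP => v; rewrite memv_cap memv_ker => /andP[_].
by rewrite lfunE /= memv0 -(inj_eq val_inj) linear0.
Qed.

Lemma lift_vsP U v : v \in lift_vs U -> exists2 u, u \in U & v = vsval u.
Proof. by move=> /memv_imgP[u uU ->]; exists u => //; rewrite lfunE. Qed.

Lemma dim_subvs : \dim {:subvs_of E} = \dim E.
Proof.
rewrite -dim_lift_vs; congr (\dim _); apply/eqP; rewrite eqEsubv lift_vs_sub /=.
apply/subvP => v vE; apply/memv_imgP; exists (vsproj E v); rewrite ?memvf//.
by rewrite lfunE /= vsprojK.
Qed.

End Restriction.

(** * Dimensions and signature in an invariant splitting *)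

Section Splitting.
Context {R : realType} {W : vectType R[i]}.
Local Notation K := R[i].
Variables (psi : W -> W -> K) (d : nat) (Eu Ec Es : {vspace W}).
Hypotheses (hs : hs_form psi) (dimW : \dim {:W} = d.*2) (sig0 : hs_signature psi = 0).
Hypotheses (full : (Eu + Ec + Es)%VS = fullv) (dir : directv (Eu + Ec + Es)).
Hypotheses (isou : forall x y, x \in Eu -> y \in Eu -> psi x y = 0)
  (isos : forall x y, x \in Es -> y \in Es -> psi x y = 0)
  (ocu : forall x y, x \in Ec -> y \in Eu -> psi x y = 0)
  (ocs : forall x y, x \in Ec -> y \in Es -> psi x y = 0).
Hypothesis ndc : nondegenerate_form (fun u v : subvs_of Ec => psi (vsval u) (vsval v)).

Let ses := let: And3 a _ _ := hs in a.
Let skew := let: And3 _ b _ := hs in b.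

(** An isotropic space E orthogonal to U contributes nothing to the form, so U + E is semidefinite
    and meets the strictly definite space X in 0 only. The scalar [s] will be i or -i. *)
Lemma semidefinite_dim (U E X : {vspace W}) (s : K) : (U <= Ec)%VS -> (Ec :&: E = 0)%VS ->
  (forall x y, x \in E -> y \in E -> psi x y = 0) ->
  (forall x y, x \in Ec -> y \in E -> psi x y = 0) ->
  (forall v, v \in U -> 0 <= complex.Re (s * psi v v)) ->
  (forall v, v \in X -> v != 0 -> complex.Re (s * psi v v) < 0) ->
  (\dim U + \dim E + \dim X <= d.*2)%N.
Proof.
move=> UE EE iso oc hU hX.
have UE0 : (U :&: E = 0)%VS by apply/eqP; rewrite -subv0 -EE capvS.
rewrite -(dimv_disjoint_sum UE0) -dimW.
have UEX : ((U + E) :&: X = 0)%VS.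
  apply/eqP; rewrite -subv0; apply/subvP => v; rewrite memv_cap memv0 => /andP[/memv_addP[x xU [y yE ->]] vX].
  apply/negPn/negP => v0; have := hX _ vX v0; rewrite ltNge.
  rewrite (sesDl ses) !(sesDr ses) (oc x y)// ?(subvP UE)// (iso y y)//.
  have -> : psi y x = 0 by rewrite skew (oc x y)// ?(subvP UE)// conjc0 oppr0.
  by rewrite !addr0 hU.
by rewrite -(dimv_disjoint_sum UEX) dimvS// subvf.
Qed.

(** Let p and q be the dimensions of maximal positive and negative parts of the center. Each of p, q
    plus each of dim E^u, dim E^s is at most d, while all four add up to 2 d; so the four
    inequalities are equalities, whence p = q and dim E^u = dim E^s. *)
Lemma signature_splitting : \dim Eu = \dim Es /\
  exists dc, \dim Ec = dc.*2 /\
    hs_signature (fun u v : subvs_of Ec => psi (vsval u) (vsval v)) = 0.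
Proof.
have [Up [Un [pn sig hp hn]]] := hs_inertia hs.
have [Cp [Cn [cpn csig hcp hcn]]] := hs_inertia (restr_hs_form hs ndc).
rewrite dim_subvs in cpn.
have dUp : \dim Up = \dim Un by apply/eqP; rewrite -eqz_nat -subr_eq0 -sig sig0.
have dn : \dim Un = d by apply: double_inj; rewrite -dimW -pn dUp addnn.
have dims : (\dim Eu + \dim Ec + \dim Es)%N = d.*2.
  by rewrite -dimW -full; apply/esym/eqP; have := dir; rewrite directvE /= => /eqP ->.
have [cu0 cs0] : (Ec :&: Eu = 0)%VS /\ (Ec :&: Es = 0)%VS.
  have := dir; rewrite directv_addE /= => /and3P[dir1 _ /eqP h2].
  have := dir1; rewrite directv_addE /= => /and3P[_ _ /eqP h1].
  split; first by rewrite capvC.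
  by apply/eqP; rewrite -subv0 -h2 capvS// addvSr.
have i0 : 0 < complex.Re (1 : K) by rewrite /= ltr01.
have Re_gt0 (z : K) : 0 < z -> 0 < complex.Re z by rewrite ltcE /= => /andP[].
have Re_lt0 (z : K) : z < 0 -> complex.Re z < 0 by rewrite ltcE /= => /andP[].
have posC v : v \in lift_vs Cp -> 0 <= complex.Re ('i%C * psi v v).
  move=> /lift_vsP[u uC ->]; have [->|u0] := eqVneq u 0.
    by rewrite linear0 (ses0l ses) mulr0.
  exact/ltW/Re_gt0/hcp.
have negC v : v \in lift_vs Cn -> 0 <= complex.Re (- 'i%C * psi v v).
  move=> /lift_vsP[u uC ->]; have [->|u0] := eqVneq u 0.
    by rewrite linear0 (ses0l ses) mulr0.
  by rewrite mulNr ReN oppr_ge0; apply/ltW/Re_lt0/hcn.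
have negV v : v \in Un -> v != 0 -> complex.Re ('i%C * psi v v) < 0.
  by move=> vU v0; apply/Re_lt0/hn.
have posV v : v \in Up -> v != 0 -> complex.Re (- 'i%C * psi v v) < 0.
  by move=> vU v0; rewrite mulNr ReN oppr_lt0; apply/Re_gt0/hp.
have := semidefinite_dim (lift_vs_sub Cp) cu0 isou ocu posC negV.
have := semidefinite_dim (lift_vs_sub Cp) cs0 isos ocs posC negV.
have := semidefinite_dim (lift_vs_sub Cn) cu0 isou ocu negC posV.
have := semidefinite_dim (lift_vs_sub Cn) cs0 isos ocs negC posV.
rewrite !dim_lift_vs dUp dn -!addnn => b1 b2 b3 b4.
rewrite -addnn in dims.
have ar (u s c p q : nat) : (p + q = c)%N -> (u + c + s = d + d)%N -> (q + s + d <= d + d)%N ->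
    (q + u + d <= d + d)%N -> (p + s + d <= d + d)%N -> (p + u + d <= d + d)%N ->
    u = s /\ c = (p + p)%N /\ p = q by lia.
have [e1 [e2 e3]] := ar _ _ _ _ _ cpn dims b1 b2 b3 b4.
split=> //; exists (\dim Cp); rewrite -addnn; split=> //.
by rewrite csig e3 subrr.
Qed.

End Splitting.

(** * Embedding into a trivial bundle *)

Section Bumps.
Context {R : realType} {Om : metricType R}.
Hypothesis cOm : compact [set: Om].

(** Twice the positive part of [r - mdist x w]. *)
Definition bump_at (x : Om) (r : R) (w : Om) : R := (r - mdist x w) + `|r - mdist x w|.

Lemma mdist_continuous (x : Om) : continuous (fun w => mdist x w : R).
Proof.
move=> w; apply/cvgrPdist_lt => e e0.
apply/nbhs_ballP; exists e => //= y; rewrite ballEmdist /= => wy.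
have h1 : mdist x w <= mdist x y + mdist w y by rewrite (metric_sym w); exact: metric_triangle.
have h2 := metric_triangle x w y.
by rewrite ltr_norml; apply/andP; split; lra.
Qed.

Lemma bump_continuous x r : continuous (bump_at x r).
Proof.
move=> w; rewrite /bump_at.
have c1 : {for w, continuous (fun w => r - mdist x w)}.
  by apply: cvgB; [exact: cvg_cst|exact: mdist_continuous].
by apply: cvgD => //; exact: cvg_norm.
Qed.

Lemma bump_ge0 x r w : 0 <= bump_at x r w.
Proof. by rewrite /bump_at -lerBlDl sub0r -normrN ler_norm. Qed.

Lemma bump_near0 x r r' w : r < r' -> ~ (mdist x w < r') -> \forall w' \near w, bump_at x r w' = 0.
Proof.
move=> rr /negP; rewrite -leNgt => h.
have : \forall w' \near w, r < mdist x w'.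
  apply: (cvgr_gt (mdist x w)); first exact: mdist_continuous.
  exact: lt_le_trans rr h.
apply: filterS => w' h'; rewrite /bump_at ler0_norm ?subrr//.
by rewrite subr_le0 ltW.
Qed.

(** A partition of unity in which every function is a product of two bumps: one multiplies the frame
    vectors and the other the coordinates, so that both extend by zero to the whole base. *)
Lemma bump_cover (D : Type) (U : D -> set Om) (good : D -> Prop) :
  (forall d, good d -> open (U d)) -> (forall w, exists2 d, good d & U d w) ->
  exists n (d : 'I_n -> D) (b g : 'I_n -> Om -> R),
   [/\ forall k, good (d k), forall k, continuous (b k) /\ continuous (g k),
      forall k w, ~ U (d k) w -> (\forall w' \near w, b k w' = 0) /\ (\forall w' \near w, g k w' = 0) &
      forall w, \sum_k b k w * g k w = 1].
Proof.
move=> oU cov; pose item := {classic (Om * R * D)%type}.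
pose ok (it : item) := let: (x, r, d) := (it : Om * R * D) in
  [/\ good d, 0 < r & forall y, mdist x y < r -> U d y].
(* The filter of finite lists of admissible balls, ordered by inclusion. Together with
   [compact_unif] it extracts a finite subcover whose radii and domains are kept as data. *)
have [F [FF Fin Fout]] : exists F : set_system (seq item), [/\ Filter F,
    forall L0 : seq item, {in L0, forall x, ok x} -> F [set L : seq item | {subset L0 <= L}] &
    forall P, F P -> exists2 L : seq item, {in L, forall x, ok x} & P L].
  exists [set P | exists2 L0 : seq item, {in L0, forall x, ok x} &
    forall L : seq item, {subset L0 <= L} -> P L]; split.
  - split; first by exists [::].
      move=> P Q [L1 o1 h1] [L2 o2 h2]; exists (L1 ++ L2).
        by move=> x; rewrite mem_cat => /orP[/o1|/o2].
      by move=> L sL; split; [apply: h1|apply: h2] => x xL; apply: sL; rewrite mem_cat xL ?orbT.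
    by move=> P Q PQ [L0 o h]; exists L0 => // L sL; apply: PQ; exact: h.
  - by move=> L0 o; exists L0.
  - by move=> P [L0 o h]; exists L0 => //; exact: h.
pose close (it : item) w := let: (x, r, d) := (it : Om * R * D) in mdist x w < r / 2.
have : \forall L \near F, forall w, exists2 it : item, it \in (L : seq item) & close it w.
  refine (@compact_unif _ cOm _ F (fun L w => exists2 it : item, it \in L & close it w) FF _) => w.
  have [d gd Uw] := cov w.
  have [r /= r0 hr] : exists2 r : R, 0 < r & ball w r `<=` U d.
    by have /nbhs_ballP := open_nbhs_nbhs (conj (oU d gd) Uw).
  pose it : item := (w, r, d).
  exists (ball w (r / 2), [set L : seq item | it \in L]).
    split=> /=; first by apply: nbhsx_ballx; rewrite divr_gt0.
    have : F [set L : seq item | {subset [:: it] <= L}]; last first.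
      by apply: filterS => L sL; apply: sL; rewrite mem_head.
    apply: Fin => x; rewrite inE => /eqP ->; split=> // y wy; apply: hr.
    by rewrite ballEmdist.
  move=> [w' L] [/=]; rewrite ballEmdist /= => h1 h2; by exists it.
move=> /Fout[L okL hL].
rewrite /close in hL.
pose it (k : 'I_(size L)) : Om * R * D := tnth (in_tuple L) k.
have okI k : ok (it k) by apply: okL; exact: mem_tnth.
(* The halved radius: the bump is positive on the half ball, and the half balls cover, yet it
   vanishes near every point outside the full ball. *)
pose b k w := bump_at (it k).1.1 ((it k).1.2 / 2) w.
pose s w := \sum_k b k w * b k w.
have bc k : continuous (b k) by exact: bump_continuous.
have sc : continuous s.
  move=> w; rewrite /s; apply: (@cvg_big _ _ +%R 0 xpredT) => [|k _]; first exact: add_continuous.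
  by apply: cvgM; exact: bc.
have s0 w : 0 < s w.
  have [i iL] := hL w; case E : (i : Om * R * D) => [[x r] d] h.
  have [k ik] : exists k, it k = i.
    have /tnthP[k ->] : i \in in_tuple L by [].
    by exists k.
  rewrite /s (bigD1 k)//= ltr_pwDl//.
    have h' : 0 < r / 2 - mdist x w by rewrite subr_gt0.
    have : 0 < b k w by rewrite /b ik E /= /bump_at gtr0_norm// addr_gt0.
    by move=> bk; rewrite mulr_gt0.
  by apply: sumr_ge0 => j _; rewrite mulr_ge0 ?bump_ge0.
exists (size L), (fun k => (it k).2), b, (fun k w => b k w / s w); split.
- by move=> k; have := okI k; rewrite /ok; case: (it k) => [[x r] d] [].
- move=> k; split; first exact: bc.
  by move=> w; apply: cvgM; [exact: bc|apply: cvgV; [rewrite gt_eqF|exact: sc]].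
- move=> k w nU.
  have nb : \forall w' \near w, b k w' = 0.
    have := okI k; move: nU; rewrite /ok /b; case: (it k) => [[x r] d] /= nU [gd r0 hr].
    apply: (@bump_near0 x (r / 2) r); last by move=> /hr.
    by rewrite ltr_pdivrMr// ltr_pMr// ltr1n.
  by split=> //; apply: filterS nb => w' ->; rewrite mul0r.
- move=> w; have : s w / s w = 1 by rewrite divff// gt_eqF.
  by rewrite {1}/s mulr_suml => <-; apply: eq_bigr => k _; rewrite mulrA.
Qed.

End Bumps.

Arguments frames {R Om} v _.

(** * Finite families of global generators *)

Section GlobalFrame.
Context {R : realType} {Om : metricType R}.
Local Notation K := R[i].
Variable V : vbundle R Om.
Hypothesis bV : is_vbundle V.

Definition sec_at (s : forall w, V w) (w : Om) := forall f, frames V f -> forall i, fdom f w ->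
  cplx_continuous_at (fun x => coord (fvec f x) i (s x)) w.

(** A bundle need not have a global basis, so the family is redundant: [g] are finitely many global
    sections and [phi] linear coordinates reproducing every vector. Each is a bump times a vector or
    a coordinate of one local frame. *)
Definition gframe N (g : 'I_N -> forall w, V w) (phi : 'I_N -> forall w, V w -> K) :=
  (forall w v, v = \sum_k phi k w v *: g k w) /\
  forall k, exists (e : lframe V) (j : 'I_(flen e)) (b c : Om -> R),
    [/\ frames V e, continuous b /\ continuous c,
        forall w, ~ fdom e w -> (\forall w' \near w, b w' = 0) /\ (\forall w' \near w, c w' = 0),
        forall w, g k w = (b w)%:C%C *: (fvec e w)`_j &
        forall w v, phi k w v = (c w)%:C%C * coord (fvec e w) j v].

Lemma frame_open e : frames V e -> open (fdom e).
Proof. by case: bV => h _ _ /h[]. Qed.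
Lemma frame_basis e w : frames V e -> fdom e w -> basis_of fullv (fvec e w).
Proof. by case: bV => h _ _ /h[_]; exact. Qed.

Lemma gframe_exists : compact [set: Om] -> exists N g phi, @gframe N g phi.
Proof.
move=> cOm; have [h1 h2 h3] := bV.
have [n [d [b [c [gd cbc zero one]]]]] := @bump_cover R Om cOm (lframe V) (@fdom _ _ _)
  (fun e => frames V e) frame_open h2.
pose J : finType := {k : 'I_n & 'I_(flen (d k))}.
pose g0 (x : J) w : V w := (b (tag x) w)%:C%C *: (fvec (d (tag x)) w)`_(tagged x).
pose p0 (x : J) w (v : V w) : K := (c (tag x) w)%:C%C * coord (fvec (d (tag x)) w) (tagged x) v.
exists #|{: J}|, (fun i => g0 (enum_val i)), (fun i => p0 (enum_val i)); split.
  move=> w v; rewrite -(big_enum_val (A := {: J}) (fun x => p0 x w v *: g0 x w)) /=.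
  transitivity (\sum_k (b k w * c k w)%:C%C *: v).
    by rewrite -scaler_suml -raddf_sum one scale1r.
  transitivity (\sum_k \sum_(j < flen (d k)) p0 (Tagged (fun k => 'I_(flen (d k))) j) w v *:
      g0 (Tagged (fun k => 'I_(flen (d k))) j) w); last first.
    rewrite sig_big_dep /=; apply: eq_big => [x|[k j] _] //.
  apply: eq_bigr => k _; rewrite /p0 /g0 /=.
  have [Uw|nU] := pselect (fdom (d k) w).
    have vE : v = \sum_j coord (fvec (d k) w) j v *: (fvec (d k) w)`_j.
      exact: coord_basis (frame_basis (gd k) Uw) (memvf v).
    rewrite {1}vE scaler_sumr; apply: eq_bigr => j _; rewrite !scalerA; congr (_ *: _).
    by rewrite rmorphM; ring.
  have [b0 _] := zero k w nU; rewrite (nbhs_singleton b0) mul0r scale0r big1// => j _.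
  by rewrite scale0r scaler0.
move=> i; exists (d (tag (enum_val i))), (tagged (enum_val i)), (b (tag (enum_val i))), (c (tag (enum_val i))).
split=> //; exact: zero.
Qed.

Variables (N : nat) (g : 'I_N -> forall w, V w) (phi : 'I_N -> forall w, V w -> K).
Arguments phi : clear implicits.
Hypothesis gf : gframe g phi.

Lemma cc_bump (b : Om -> R) (a : Om -> K) (U : set Om) w : continuous b ->
  (~ U w -> \forall w' \near w, b w' = 0) -> (U w -> cplx_continuous_at a w) ->
  cplx_continuous_at (fun x => (b x)%:C%C * a x) w.
Proof.
move=> cb b0 ca; have [Uw|nU] := pselect (U w).
  by apply: ccM (ca Uw); apply: cc_real; exact: cb.
apply: (cc_near (g := fun=> 0)); last exact: cc_cst.
by apply: filterS (b0 nU) => y ->; rewrite mul0r.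
Qed.

Lemma gsec_at k w : sec_at (g k) w.
Proof.
have [_ /(_ k)[e [j [b [c [fe [cb _] z gE _]]]]]] := gf.
move=> f ff i Uw; have [_ _ h3] := bV.
apply: (cc_near (g := fun x => (b x)%:C%C * coord (fvec f x) i (fvec e x)`_j)).
  by apply: nearW => x; rewrite gE linearZ.
apply: (cc_bump (U := fdom e)) => //; first by move=> /z[].
by move=> ew; exact: (h3 e fe j f ff i w ew Uw).
Qed.

Lemma phi_at k s w : sec_at s w -> cplx_continuous_at (fun x => phi k x (s x)) w.
Proof.
have [_ /(_ k)[e [j [b [c [fe [_ cc'] z _ pE]]]]]] := gf.
move=> hs; apply: (cc_near (g := fun x => (c x)%:C%C * coord (fvec e x) j (s x))).
  by apply: nearW => x; rewrite pE.
by apply: (cc_bump (U := fdom e)) => //; [move=> /z[]|move=> ew; exact: hs].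
Qed.

Lemma phiD k w u v : phi k w (u + v) = phi k w u + phi k w v.
Proof. by have [_ /(_ k)[e [j [b [c [_ _ _ _ pE]]]]]] := gf; rewrite !pE linearD mulrDr. Qed.
Lemma phiZ k w a v : phi k w (a *: v) = a * phi k w v.
Proof. by have [_ /(_ k)[e [j [b [c [_ _ _ _ pE]]]]]] := gf; rewrite !pE linearZ mulrCA. Qed.

(* V is a direct summand of the trivial bundle of rank N: unembed is a left
   inverse of embed, and pmat the projection onto the image. *)
Definition embed w (v : V w) : 'cV[K]_N := \col_k phi k w v.
Definition unembed w (x : 'cV[K]_N) : V w := \sum_k x k ord0 *: g k w.
Definition mat w w' (f : 'Hom(V w, V w')) : 'M[K]_N := \matrix_(k, l) phi k w' (f (g l w)).
Definition pmat w : 'M[K]_N := \matrix_(k, l) phi k w (g l w).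
Definition gram (psi : forall w, V w -> V w -> K) w : 'M[K]_N := \matrix_(k, l) psi w (g k w) (g l w).

Lemma embedK w (v : V w) : unembed w (embed v) = v.
Proof. by rewrite [RHS](gf.1 w v) /unembed; apply: eq_bigr => k _; rewrite mxE. Qed.
Lemma embed_inj w : injective (@embed w).
Proof. by move=> u v e; rewrite -(embedK u) e embedK. Qed.
Lemma embedD w (u v : V w) : embed (u + v) = embed u + embed v.
Proof. by apply/matrixP => i j; rewrite !mxE phiD. Qed.
Lemma embedZ w a (v : V w) : embed (a *: v) = a *: embed v.
Proof. by apply/matrixP => i j; rewrite !mxE phiZ. Qed.
Lemma embed0 w : embed (0 : V w) = 0.
Proof. by rewrite -(scale0r 0) embedZ scale0r. Qed.
Lemma embed_sum w (J : Type) (r : seq J) (P : pred J) (F : J -> V w) :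
  embed (\sum_(j <- r | P j) F j) = \sum_(j <- r | P j) embed (F j).
Proof. by elim/big_rec2: _ => [|j x y _ <-]; [exact: embed0|exact: embedD]. Qed.
Lemma unembedD w x y : unembed w (x + y) = unembed w x + unembed w y.
Proof. by rewrite -big_split; apply: eq_bigr => k _; rewrite mxE scalerDl. Qed.
Lemma unembedZ w a x : unembed w (a *: x) = a *: unembed w x.
Proof. by rewrite scaler_sumr; apply: eq_bigr => k _; rewrite mxE scalerA. Qed.

Lemma pmatE w x : pmat w *m x = embed (unembed w x).
Proof.
rewrite embed_sum; apply/matrixP => i j; rewrite !mxE summxE; apply: eq_bigr => k _.
by rewrite embedZ !mxE (ord1 j) mulrC.
Qed.
Lemma matE w w' (f : 'Hom(V w, V w')) x : mat f *m x = embed (f (unembed w x)).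
Proof.
rewrite linear_sum embed_sum; apply/matrixP => i j; rewrite !mxE summxE; apply: eq_bigr => k _.
by rewrite linearZ embedZ !mxE (ord1 j) mulrC.
Qed.
Lemma gramE psi w x y : sesquilinear_form (psi w) ->
  pairing (gram psi w) x y = psi w (unembed w x) (unembed w y).
Proof.
move=> ses; rewrite /pairing (ses_suml ses) -mulmxA mxE; apply: eq_bigr => k _.
rewrite (sesZl ses) (ses_sumr ses) adjE mxE; congr (_ * _); apply: eq_bigr => l _.
by rewrite (sesZr ses) mxE mulrC.
Qed.

Lemma col_ext (M M' : 'M[K]_N) : (forall x : 'cV[K]_N, M *m x = M' *m x) -> M = M'.
Proof.
move=> h; apply/matrixP => i j; have := h (delta_mx j ord0).
by rewrite -!colE => /matrixP/(_ i ord0); rewrite !mxE.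
Qed.

Lemma pmat_embed w (v : V w) : pmat w *m embed v = embed v.
Proof. by rewrite pmatE embedK. Qed.
Lemma pmat_id w : pmat w *m pmat w = pmat w.
Proof. by apply: col_ext => x; rewrite -mulmxA !pmatE embedK. Qed.
Lemma mat_pmat w w' (f : 'Hom(V w, V w')) : mat f *m pmat w = mat f.
Proof. by apply: col_ext => x; rewrite -mulmxA pmatE !matE embedK. Qed.
Lemma pmat_mat w w' (f : 'Hom(V w, V w')) : pmat w' *m mat f = mat f.
Proof. by apply: col_ext => x; rewrite -mulmxA !matE pmat_embed. Qed.
Lemma mat_comp w w' w'' (f : 'Hom(V w', V w'')) (h : 'Hom(V w, V w')) :
  mat (f \o h)%VF = mat f *m mat h.
Proof. by apply: col_ext => x; rewrite -mulmxA !matE embedK lfunE. Qed.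
Lemma mat_embed w w' (f : 'Hom(V w, V w')) (v : V w) : mat f *m embed v = embed (f v).
Proof. by rewrite matE embedK. Qed.

Lemma cm_embed s w : sec_at s w -> cm (fun x => embed (s x)) w.
Proof. by move=> h i j; under eq_fun do rewrite mxE; exact: phi_at. Qed.
Lemma cm_pmat w : cm pmat w.
Proof. by move=> i j; under eq_fun do rewrite mxE; apply: phi_at; exact: gsec_at. Qed.

Lemma form_at psi s s' w : (forall w, sesquilinear_form (psi w)) -> continuous_form psi ->
  sec_at s w -> sec_at s' w -> cplx_continuous_at (fun x => psi x (s x) (s' x)) w.
Proof.
move=> ses cpsi hs hs'; have [_ h2 _] := bV; have [f ff fw] := h2 w.
pose F i j x := (coord (fvec f x) i (s x))^*%C *
   (coord (fvec f x) j (s' x) * psi x (fvec f x)`_i (fvec f x)`_j).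
apply: (cc_near (g := fun x => \sum_i \sum_j F i j x)).
  have := open_nbhs_nbhs (conj (frame_open ff) fw); apply: filterS => x fx.
  have bx := frame_basis ff fx.
  rewrite {1}(coord_basis bx (memvf (s x))) {1}(coord_basis bx (memvf (s' x))).
  rewrite (ses_suml (ses x)); apply: eq_bigr => i _.
  rewrite (sesZl (ses x)) (ses_sumr (ses x)) mulr_sumr; apply: eq_bigr => j _.
  by rewrite (sesZr (ses x)).
apply: (@cc_sum _ _ _ _ _ (fun i x => \sum_j F i j x)) => i _; apply: (@cc_sum _ _ _ _ _ (F i)) => j _.
apply: ccM; first by apply: ccJ; exact: hs.
by apply: ccM; [exact: hs'|exact: cpsi].
Qed.

Lemma cm_gram psi w : (forall w, sesquilinear_form (psi w)) -> continuous_form psi ->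
  cm (gram psi) w.
Proof.
move=> ses cpsi i j; under eq_fun do rewrite mxE.
by apply: form_at => //; exact: gsec_at.
Qed.

Lemma gram_pmat psi w : sesquilinear_form (psi w) -> gram psi w *m pmat w = gram psi w.
Proof.
move=> ses; apply/matrixP => i j; rewrite !mxE.
rewrite [in RHS](gf.1 w (g j w)) (ses_sumr ses); apply: eq_bigr => k _.
by rewrite (sesZr ses) !mxE mulrC.
Qed.

Lemma gram_skew psi w : hs_form (psi w) -> adj (gram psi w) = - gram psi w.
Proof.
move=> [_ skew _]; apply/matrixP => i j; rewrite adjE !mxE.
by rewrite (skew (g i w)) opprK.
Qed.

End GlobalFrame.

(** The statement on column vectors is read off the row kernel of the transpose. *)
Lemma unitmx_inj (F : fieldType) n (S : 'M[F]_n) :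
  (forall y : 'cV[F]_n, S *m y = 0 -> y = 0) -> S \in unitmx.
Proof.
move=> h; rewrite -unitmx_tr -row_free_unit -kermx_eq0; apply/negPn/negP.
move=> /rowV0Pn[y /sub_kermxP yF y0].
have Fy : S *m y^T = 0 by rewrite -[S]trmxK -trmx_mul yF trmx0.
by move: y0; rewrite -[y]trmxK (h _ Fy) trmx0 eqxx.
Qed.

(** * Continuous projections onto subbundles *)

Section SubSpaces.
Context {R : realType} {Om : metricType R}.
Local Notation K := R[i].
Variable V : vbundle R Om.
Hypothesis bV : is_vbundle V.
Variables (N : nat) (g : 'I_N -> forall w, V w) (phi : 'I_N -> forall w, V w -> K).
Arguments phi : clear implicits.
Hypothesis gf : gframe g phi.
Local Notation embed := (embed phi).
Local Notation unembed := (unembed g).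
Local Notation mat := (mat g phi).
Local Notation pmat := (pmat g phi).

(** The embedded vectors of a basis of the image form a matrix [F] of full column rank; [mat f] and
    [F] each factor through the other. *)
Lemma mat_rank w w' (f : 'Hom(V w, V w')) : \rank (mat f) = \dim (limg f).
Proof.
set X := vbasis (limg f); set k := \dim (limg f).
have bX : basis_of (limg f) X by exact: vbasisP.
pose F : 'M[K]_(N, k) := \matrix_(i, j) phi i w' X`_j.
have colF j : col j F = embed X`_j by apply/matrixP => i l; rewrite !mxE.
have Fx (x : 'cV[K]_k) : F *m x = embed (\sum_j x j ord0 *: X`_j).
  rewrite (embed_sum gf); apply/matrixP => i l; rewrite !mxE summxE; apply: eq_bigr => j _.
  by rewrite (embedZ gf) !mxE (ord1 l) mulrC.
have rF : \rank F = k.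
  apply/eqP; rewrite -mxrank_tr -/(row_free _) -kermx_eq0; apply/negPn/negP.
  move=> /rowV0Pn[y /sub_kermxP yF y0].
  have Fy : F *m y^T = 0 by rewrite -[F]trmxK -trmx_mul yF trmx0.
  move: Fy; rewrite Fx -(embed0 gf w') => /(embed_inj gf) e.
  have fX : free X by exact: basis_free bX.
  have /freeP h := fX; have h0 := h (fun j => y^T j ord0) e.
  by move/eqP: y0; apply; apply/rowP => j; have := h0 j; rewrite !mxE.
apply/eqP; rewrite eqn_leq; apply/andP; split.
  pose D : 'M[K]_(k, N) := \matrix_(j, l) coord X j (f (g l w)).
  have -> : mat f = F *m D.
    apply/matrixP => i l; rewrite !mxE.
    have fl : f (g l w) \in limg f by rewrite memv_img// memvf.
    rewrite [in LHS](coord_basis bX fl).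
    have /matrixP/(_ i ord0) := embed_sum gf (index_enum 'I_k) xpredT (fun j => coord X j (f (g l w)) *: X`_j).
    rewrite mxE => ->; rewrite summxE; apply: eq_bigr => j _.
    by rewrite (embedZ gf) !mxE mulrC.
  by apply: (leq_trans (mxrankM_maxl _ _)); rewrite rF.
have hv (j : 'I_k) : exists v, f v = X`_j.
  have : X`_j \in limg f by apply: vbasis_mem; rewrite mem_nth// size_tuple.
  by move=> /memv_imgP[v _ ->]; exists v.
have [v hv'] := choice hv.
pose D : 'M[K]_(N, k) := \matrix_(i, j) phi i w (v j).
have e : F = mat f *m D.
  apply/matrixP => i j.
  have := mat_embed gf f (v j); rewrite hv' => /matrixP/(_ i ord0).
  rewrite !mxE => <-; apply: eq_bigr => l _; by rewrite !mxE.
by apply: (leq_trans _ (mxrankM_maxl (mat f) D)); rewrite -e rF.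
Qed.

(** The sections span but need not be independent, so that they can exist globally. *)
Definition gen_by (E : forall w, {vspace V w}) n (s : 'I_n -> forall w, V w) :=
  (forall k w, sec_at (s k) w) /\ forall w, E w = (\sum_k <[s k w]>)%VS.

Lemma gen_by_mem E n (s : 'I_n -> forall w, V w) k w : gen_by E s -> s k w \in E w.
Proof.
by move=> [_ ->]; apply: (subvP (sumv_sup k isT (subvv _))); exact: memv_line.
Qed.

Lemma gen_by_span E n (s : 'I_n -> forall w, V w) w v : gen_by E s -> v \in E w ->
  exists c : 'I_n -> K, v = \sum_k c k *: s k w.
Proof.
move=> [_ ->] /memv_sumP[u hu ->].
have h k : exists a, u k = a *: s k w by have /vlineP[a ->] := hu k isT; exists a.
have [c hc] := choice h; exists c; by apply: eq_bigr => k _; rewrite hc.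
Qed.

Lemma gen_by_add E E' n n' (s : 'I_n -> forall w, V w) (s' : 'I_n' -> forall w, V w) :
  gen_by E s -> gen_by E' s' ->
  gen_by (fun w => (E w + E' w)%VS) (fun (k : 'I_(n + n')) w =>
    match fintype.split k with inl i => s i w | inr j => s' j w end).
Proof.
move=> [c1 e1] [c2 e2]; split.
  by move=> k w; case: (fintype.split k) => i; [exact: c1|exact: c2].
move=> w; rewrite e1 e2 big_split_ord /=; congr (_ + _)%VS; apply: eq_bigr => i _.
  by rewrite (unsplitK (inl i)).
by rewrite (unsplitK (inr i)).
Qed.

(** A continuous subbundle is itself a bundle and has global generators of its own; read in V, these
    are continuous because the frames of the subbundle consist of continuous sections. *)
Lemma subbundle_gen (E : forall w, {vspace V w}) : compact [set: Om] -> continuous_subbundle E ->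
  exists n (s : 'I_n -> forall w, subvs_of (E w)),
    gen_by E (fun k w => vsval (s k w)) /\ forall k w, @sec_at _ _ (subbundle E) (s k) w.
Proof.
move=> cOm cE; have [n [s [p gf']]] := gframe_exists cE cOm.
exists n, s; split; last by move=> k w; exact: (gsec_at cE gf').
split=> [k w|w].
  have [_ /(_ k)[e [j [b [c [fe [cb _] z gE _]]]]]] := gf'.
  have [oe be ce] := fe.
  move=> f ff i Uw.
  apply: (cc_near (g := fun x => (b x)%:C%C * coord (fvec f x) i (vsval (fvec e x)`_j))).
    by apply: nearW => x; rewrite gE !linearZ.
  apply: (cc_bump (U := fdom e)) => //; first by move=> /z[].
  by move=> ew; exact: (ce j f ff i w ew Uw).
apply/eqP; rewrite eqEsubv; apply/andP; split; apply/subvP => v.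
  move=> vE; rewrite -(vsprojK vE) (gf'.1 w (vsproj (E w) v)) linear_sum.
  apply: memv_suml => k _; rewrite linearZ; apply: memvZ.
  by apply: (subvP (sumv_sup k isT (subvv _))); exact: memv_line.
move=> /memv_sumP[u hu ->]; apply: memv_suml => k _.
have /vlineP[a ->] := hu k isT; apply: memvZ; exact: subvsP.
Qed.

Section Projection.
Variables (E E' : forall w, {vspace V w}) (n n' : nat) (s : 'I_n -> forall w, V w)
  (s' : 'I_n' -> forall w, V w).
Hypotheses (gE : gen_by E s) (gE' : gen_by E' s').
Hypotheses (cap : forall w, (E w :&: E' w = 0)%VS) (add : forall w, (E w + E' w)%VS = fullv).

Definition vproj w : 'End(V w) := daddv_pi (E w) (E' w).

Lemma vproj_id w v : v \in E w -> vproj w v = v.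
Proof. exact: daddv_pi_id. Qed.
Lemma vproj_mem w v : vproj w v \in E w.
Proof. exact: memv_pi. Qed.
Lemma vproj_dec w v : vproj w v + daddv_pi (E' w) (E w) v = v.
Proof. by apply: daddv_pi_add; rewrite ?cap// add memvf. Qed.
Lemma vproj_0 w v : v \in E' w -> vproj w v = 0.
Proof.
move=> vE; have := vproj_dec v.
rewrite (daddv_pi_id _ vE) 1?capvC ?cap// => /(congr1 (fun x => x - v)).
by rewrite addrK subrr.
Qed.

Let O m (t : 'I_m -> forall w, V w) w : 'M[K]_N := \sum_k embed (t k w) *m adj (embed (t k w)).
Let q w : 'M[K]_N := 1%:M - pmat w.
(* Gram operator of the generators; it is positive definite, and composing its
   inverse with the summand of E gives the projection onto E along E'. *)
Definition gsum w : 'M[K]_N := O s w + O s' w + q w *m adj (q w).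

(** For y in the kernel the three non-negative terms of the quadratic form vanish separately: y is
    orthogonal to all generators, hence to the embedded fibre, and to the complement [q]. *)
Lemma gsum_unit w : gsum w \in unitmx.
Proof.
apply: unitmx_inj => y Sy.
have re m (B : 'M[K]_(N, m)) : complex.Re ((adj y *m (B *m adj B) *m y) ord0 ord0) =
    complex.Re ((adj (adj B *m y) *m (adj B *m y)) ord0 ord0).
  by rewrite adjM adjK !mulmxA.
have ge0 m (B : 'M[K]_(N, m)) : 0 <= complex.Re ((adj y *m (B *m adj B) *m y) ord0 ord0).
  by have := adj_mul_ge0 (adj B) y; rewrite adjK.
have ReO m (t : 'I_m -> forall w, V w) : complex.Re ((adj y *m O t w *m y) ord0 ord0) =
   \sum_k complex.Re ((adj y *m (embed (t k w) *m adj (embed (t k w))) *m y) ord0 ord0).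
  by rewrite /O mulmx_sumr mulmx_suml summxE Re_sum.
have zero : complex.Re ((adj y *m gsum w *m y) ord0 ord0) = 0 by rewrite -mulmxA Sy mulmx0 mxE.
have O0 m (t : 'I_m -> forall w, V w) : 0 <= complex.Re ((adj y *m O t w *m y) ord0 ord0).
  by rewrite ReO; apply: sumr_ge0 => k _; exact: ge0.
have ad (X Y : 'M[K]_1) : (X + Y) ord0 ord0 = X ord0 ord0 + Y ord0 ord0 by rewrite mxE.
have dec (A B C : 'M[K]_N) : complex.Re ((adj y *m (A + B + C) *m y) ord0 ord0) =
    complex.Re ((adj y *m A *m y) ord0 ord0) + complex.Re ((adj y *m B *m y) ord0 ord0) +
    complex.Re ((adj y *m C *m y) ord0 ord0) by rewrite !mulmxDr !mulmxDl !ad !ReD.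
move: zero; rewrite /gsum dec => /eqP.
rewrite paddr_eq0 ?addr_ge0 ?O0 ?ge0// => /andP[].
rewrite paddr_eq0 ?O0// => /andP[/eqP z1 /eqP z2] /eqP z3.
have kill m (B : 'M[K]_(N, m)) : complex.Re ((adj y *m (B *m adj B) *m y) ord0 ord0) = 0 ->
    adj y *m B = 0.
  rewrite re => /adj_mul_eq0 h; have : adj (adj B *m y) = 0 by rewrite h adj0.
  by rewrite adjM adjK.
have killO m (t : 'I_m -> forall w, V w) : complex.Re ((adj y *m O t w *m y) ord0 ord0) = 0 ->
    forall k, adj y *m embed (t k w) = 0.
  rewrite ReO => /eqP; rewrite psumr_eq0 => [/allP h k|k _]; last exact: ge0.
  by apply: kill; apply/eqP; apply: h; rewrite mem_index_enum.
have yv (v : V w) : adj y *m embed v = 0.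
  have : v \in (E w + E' w)%VS by rewrite add memvf.
  have lin m (t : 'I_m -> forall w, V w) (c : 'I_m -> K) : (forall k, adj y *m embed (t k w) = 0) ->
      adj y *m embed (\sum_k c k *: t k w) = 0.
    move=> h; rewrite (embed_sum gf) mulmx_sumr big1// => k _.
    by rewrite (embedZ gf) -scalemxAr h scaler0.
  move=> /memv_addP[a aE [b bE ->]].
  have [c ->] := gen_by_span gE aE; have [c' ->] := gen_by_span gE' bE.
  by rewrite (embedD gf) mulmxDr !lin ?addr0//; exact: killO.
have yp : adj y *m pmat w = 0.
  apply/matrixP => i j; have /matrixP/(_ i ord0) := yv (g j w).
  rewrite [RHS]mxE => h; rewrite [RHS]mxE -[RHS]h !mxE; apply: eq_bigr => k _.
  by rewrite !mxE.
have : adj y = 0.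
  by rewrite -[adj y]mulmx1 -(subrK (pmat w) 1%:M) mulmxDr (kill _ _ z3) yp addr0.
by move=> h; rewrite -[y]adjK h adj0.
Qed.

(** The projection fixes the summand built from E and kills the other two, so its product with
    [gsum] is the first summand. The resulting formula displays continuity in w. *)
Lemma vproj_mat w : mat (vproj w) = O s w *m invmx (gsum w).
Proof.
have QO : mat (vproj w) *m O s w = O s w.
  rewrite /O mulmx_sumr; apply: eq_bigr => k _.
  by rewrite mulmxA (mat_embed gf) vproj_id//; exact: gen_by_mem.
have QO' : mat (vproj w) *m O s' w = 0.
  rewrite /O mulmx_sumr big1// => k _.
  by rewrite mulmxA (mat_embed gf) vproj_0 ?(embed0 gf) ?mul0mx//; exact: gen_by_mem.
have Qq : mat (vproj w) *m q w = 0 by rewrite /q mulmxBr mulmx1 (mat_pmat gf) subrr.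
have QS : mat (vproj w) *m gsum w = O s w.
  by rewrite /gsum !mulmxDr QO QO' mulmxA Qq mul0mx !addr0.
by rewrite -QS mulmxK// gsum_unit.
Qed.

Let cmO m (t : 'I_m -> forall w, V w) w : (forall k w, sec_at (t k) w) -> cm (O t) w.
Proof.
move=> ct; rewrite /O; elim: (index_enum _) => [|k r ih].
  by under eq_fun do rewrite big_nil; exact: cm_cst.
under eq_fun do rewrite big_cons; apply: cmD ih.
by apply: cmM; [|apply: cm_adj]; exact: (cm_embed gf (ct k w)).
Qed.

Lemma cm_gsum w : cm gsum w.
Proof.
have cq : cm q w by apply: cmB; [exact: cm_cst|exact: (cm_pmat bV gf)].
by apply: cmD; [apply: cmD; apply: cmO; [exact: gE.1|exact: gE'.1]|apply: cmM => //; exact: cm_adj].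
Qed.

Lemma cm_gsum_inv w : cm (fun w => invmx (gsum w)) w.
Proof. by apply: cm_inv; [exact: gsum_unit|exact: cm_gsum]. Qed.

Lemma cm_vproj w : cm (fun w => mat (vproj w)) w.
Proof.
under eq_fun do rewrite vproj_mat.
by apply: cmM; [apply: cmO; exact: gE.1|exact: cm_gsum_inv].
Qed.

(** The generators being redundant, coordinates are a choice; these are continuous in w. They carry
    regularity from V to the trivializations of the subbundle, where coordinates are defined on its
    vectors only. *)
Lemma gen_coord : exists xi : 'I_n -> Om -> 'rV[K]_N, (forall k w, cm (xi k) w) /\
  forall w v, v \in E w -> v = \sum_k (xi k w *m embed v) ord0 ord0 *: s k w.
Proof.
exists (fun k w => adj (embed (s k w)) *m invmx (gsum w)); split.
  by move=> k w; apply: cmM; [apply: cm_adj; apply: (cm_embed gf); exact: gE.1|exact: cm_gsum_inv].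
move=> w v vE; apply: (embed_inj gf).
have e : embed v = mat (vproj w) *m embed v by rewrite (mat_embed gf) vproj_id.
rewrite {1}e vproj_mat /O !mulmx_suml (embed_sum gf).
apply: eq_bigr => k _; rewrite (embedZ gf) -!mulmxA.
by rewrite [adj _ *m _]mx11_scalar mul_mx_scalar !mxE.
Qed.

End Projection.
End SubSpaces.

(** * Partially hyperbolic cocycles as matrices *)

Lemma sq_ratio_lt (R : realType) (x y v u : R) : 0 < v -> 0 < u -> 0 <= x ->
  v^-1 * x < u^-1 * y -> x ^+ 2 * u ^+ 2 < y ^+ 2 * v ^+ 2.
Proof.
move=> v0 u0 x0 h; rewrite -!exprMn ltr_pXn2r ?nnegrE//.
- by rewrite -ltr_pdivrMr// mulrAC -ltr_pdivlMr// mulrC [ltRHS]mulrC.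
- by rewrite mulr_ge0// ltW.
- rewrite mulr_ge0 ?ltW//; have : 0 < u^-1 * y by apply: le_lt_trans h; rewrite mulr_ge0// invr_ge0 ltW.
  by rewrite pmulr_rgt0 ?invr_gt0// => /ltW.
Qed.

Lemma projected_pairing0 (R : realType) N (P Q P' : 'M[R[i]]_N) (x y : 'cV[R[i]]_N) :
  adj P *m Q *m P' = 0 -> (adj (P *m x) *m Q *m (P' *m y)) ord0 ord0 = 0.
Proof.
move=> z; have -> : adj (P *m x) *m Q *m (P' *m y) = adj x *m (adj P *m Q *m P') *m y.
  by rewrite adjM !mulmxA.
by rewrite z mulmx0 mul0mx mxE.
Qed.

Section HermNorm.
Context {R : realType} {W : vectType R[i]}.
Variable h : W -> W -> R[i].
Hypothesis hp : hermitian_product h.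

Lemma herm_gt0 v : v != 0 -> 0 < complex.Re (h v v).
Proof. by case: hp => _ _ /[apply]; rewrite ltcE /= => /andP[]. Qed.
Lemma herm_ge0 v : 0 <= complex.Re (h v v).
Proof.
have [->|v0] := eqVneq v 0; last exact/ltW/herm_gt0.
by case: hp => ses _ _; rewrite (ses0l ses).
Qed.
Lemma herm_norm_sq v : herm_norm h v ^+ 2 = complex.Re (h v v).
Proof. by rewrite /herm_norm sqr_sqrtr// herm_ge0. Qed.
Lemma herm_norm_ge0 v : 0 <= herm_norm h v. Proof. exact: sqrtr_ge0. Qed.
Lemma herm_norm_gt0 v : v != 0 -> 0 < herm_norm h v.
Proof. by move=> v0; rewrite sqrtr_gt0; exact: herm_gt0. Qed.
Lemma herm_normZ (r : R) v : 0 <= r -> herm_norm h (r%:C%C *: v) = r * herm_norm h v.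
Proof.
move=> r0; case: hp => ses _ _; rewrite /herm_norm (sesZl ses) (sesZr ses) conjc_real.
have -> : complex.Re (r%:C%C * (r%:C%C * h v v)) = r ^+ 2 * complex.Re (h v v).
  by rewrite !RecM !ImcM /= !mul0r !subr0 expr2 mulrA.
by rewrite sqrtrM ?sqr_ge0// sqrtr_sqr ger0_norm.
Qed.
End HermNorm.

(** * From bundle cocycles to matrix cocycles *)

Section Transfer.
Context {R : realType} {Om : metricType R}.
Hypothesis cOm : compact [set: Om].
Local Notation K := R[i].
Variable V : vbundle R Om.
Hypothesis bV : is_vbundle V.
Variables (N : nat) (g : 'I_N -> forall w, V w) (phi : 'I_N -> forall w, V w -> K).
Arguments phi : clear implicits.
Hypothesis gf : gframe g phi.
Local Notation embed := (embed phi).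
Local Notation unembed := (unembed g).
Local Notation mat := (mat g phi).
Local Notation p := (pmat g phi).
Variables (T Tinv : Om -> Om) (A : forall w, 'Hom(V w, V (T w))) (psi : forall w, V w -> V w -> K).
Arguments psi : clear implicits.
Local Notation Psi := (gram g psi).
Local Notation MA := (fun w => mat (A w)).

Lemma miter_embed n w (v : V w) : miter T MA n w *m embed v = embed (cocycle_iter A n w v).
Proof.
elim: n => [|n ih] /=; first by rewrite mul1mx lfunE.
by rewrite -mulmxA ih (mat_embed gf) lfunE.
Qed.

Lemma cocycle_iter_mem (E : forall w, {vspace V w}) n w v : invariant_subbundle A E ->
  v \in E w -> cocycle_iter A n w v \in E (iter n T w).
Proof.
move=> inv vE; elim: n => [|n ih] /=; first by rewrite lfunE.
by rewrite lfunE /= -inv; exact: memv_img.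
Qed.

Lemma vproj_inv (E E' : forall w, {vspace V w}) w v :
  (forall w, (E w :&: E' w = 0)%VS) -> (forall w, (E w + E' w)%VS = fullv) ->
  invariant_subbundle A E -> invariant_subbundle A E' ->
  vproj E E' (T w) (A w v) = A w (vproj E E' w v).
Proof.
move=> cap add iE iE'.
have z : vproj E E' (T w) (A w (daddv_pi (E' w) (E w) v)) = 0.
  by apply: (vproj_0 cap add); rewrite -iE'; apply: memv_img; exact: memv_pi.
have y : vproj E E' (T w) (A w (vproj E E' w v)) = A w (vproj E E' w v).
  by apply: (vproj_id cap); rewrite -iE; apply: memv_img; exact: vproj_mem.
have e := vproj_dec cap add v.
have e1 : A w v = A w (vproj E E' w v) + A w (daddv_pi (E' w) (E w) v) by rewrite -linearD e.
exact: etrans (congr1 _ e1) (etrans (linearD _ _ _) (etrans (congr2 +%R y z) (addr0 _))).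
Qed.

Variables (Ai : Om -> 'M[K]_N).
Hypotheses (co : cocyc T Tinv MA Ai p Psi) (hs : forall w, hs_form (psi w)).
Variables (Eu Ec Es : forall w, {vspace V w}) (d : nat).
Hypotheses (dimV : forall w, \dim {: V w} = d.*2) (sig0 : forall w, hs_signature (psi w) = 0).
Hypothesis ph : partially_hyperbolic A Eu Ec Es.
Hypothesis ndc : forall w, nondegenerate_form (restr_form Ec psi w).

Let ses w : sesquilinear_form (psi w). Proof. by case: (hs w). Qed.

Definition projected (E : forall w, {vspace V w}) (P : Om -> 'M[K]_N) :=
  [/\ forall w x, unembed w (P w *m x) \in E w & forall w v, v \in E w -> P w *m embed v = embed v].

Lemma compl_cap (W : vectType K) (U U' : {vspace W}) : (U + U' = fullv)%VS ->
  (\dim U + \dim U' <= \dim {:W})%N -> (U :&: U' = 0)%VS.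
Proof.
move=> add le; apply/eqP; rewrite -dimv_eq0 -leqn0 -(leq_add2l (\dim (U + U')%VS)) dimv_sum_cap.
by rewrite add addn0.
Qed.

Lemma proj_exists (E E' : forall w, {vspace V w}) n n' (s : 'I_n -> forall w, V w) (s' : 'I_n' -> forall w, V w) :
  gen_by E s -> gen_by E' s' -> (forall w, (E w + E' w)%VS = fullv) ->
  (forall w, (\dim (E w) + \dim (E' w) <= \dim {: V w})%N) ->
  invariant_subbundle A E -> invariant_subbundle A E' ->
  exists P : Om -> 'M[K]_N, [/\ invproj T MA p P, projected E P,
     forall w v, v \in E' w -> P w *m embed v = 0 & forall w, \rank (P w) = \dim (E w)].
Proof.
move=> gE gE' add le iE iE'.
have cap w : (E w :&: E' w = 0)%VS by exact: compl_cap.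
exists (fun w => mat (vproj E E' w)); split.
- split=> w.
  + exact: (cm_vproj bV gf gE gE' cap add).
  + rewrite -(mat_comp gf); congr (mat _); apply/lfunP => v; rewrite lfunE /=.
    by rewrite (vproj_id cap)// vproj_mem.
  + exact: (mat_pmat gf).
  + exact: (pmat_mat gf).
  + rewrite -!(mat_comp gf); congr (mat _); apply/lfunP => v; rewrite !lfunE /=.
    exact: vproj_inv.
- split=> [w x|w v vE]; first by rewrite (matE gf) (embedK gf) vproj_mem.
  by rewrite (mat_embed gf) (vproj_id cap).
- by move=> w v vE; rewrite (mat_embed gf) (vproj_0 cap add)// (embed0 gf).
- move=> w; rewrite (mat_rank gf); congr (\dim _); apply/eqP; rewrite eqEsubv.
  apply/andP; split; apply/subvP => v; first by move=> /memv_imgP[u _ ->]; exact: vproj_mem.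
  by move=> vE; apply/memv_imgP; exists v; rewrite ?memvf// (vproj_id cap).
Qed.

Lemma projected_eq (E : forall w, {vspace V w}) P w (x : 'cV[K]_N) : invproj T MA p P -> projected E P ->
  P w *m x = x -> unembed w x \in E w /\ embed (unembed w x) = x.
Proof.
move=> iP [pE _] Px; split; first by rewrite -Px.
by rewrite -(pmatE gf) -Px mulmxA (ip_pP iP).
Qed.

Lemma projected_form0 (E E' : forall w, {vspace V w}) P P' w u v : projected E P -> projected E' P' ->
  adj (P w) *m Psi w *m P' w = 0 -> u \in E w -> v \in E' w -> psi w u v = 0.
Proof.
move=> [_ pE] [_ pE'] z uE vE.
rewrite -(embedK gf u) -(embedK gf v) -(gramE g _ _ (ses w)) /pairing -(pE w u uE) -(pE' w v vE).
by rewrite (projected_pairing0 _ _ z).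
Qed.

Section HermMetric.
Variable h : forall w, V w -> V w -> K.
Arguments h : clear implicits.
Hypotheses (hp : forall w, hermitian_product (h w)) (ch : continuous_form h).
Local Notation H := (gram g h).

Lemma quad_norm w (v : V w) : quad H w (embed v) = herm_norm (h w) v ^+ 2.
Proof.
rewrite (herm_norm_sq (hp w)) /quad -/(pairing (H w) (embed v) (embed v)) (gramE g).
  by rewrite (embedK gf).
by case: (hp w).
Qed.

Lemma quad_pos w x : p w *m x = x -> x != 0 -> 0 < quad H w x.
Proof.
move=> px x0; have e : embed (unembed w x) = x by rewrite -(pmatE gf).
rewrite -e quad_norm exprn_gt0//; apply: (herm_norm_gt0 (hp w)).
by apply: contra x0 => /eqP z; rewrite -e z (embed0 gf).
Qed.

Lemma cm_herm w : cm H w.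
Proof. by apply: (cm_gram bV gf) => // v; case: (hp v). Qed.

(** The order is reversed: [dominates] names the stronger bundle first, [dominated_at] the weaker
    one. Normalizing both vectors makes the inequality for unit vectors homogeneous. *)
Lemma dominates_transfer (E F : forall w, {vspace V w}) P Q b : (0 < b)%N ->
  invproj T MA p P -> invproj T MA p Q -> projected F P -> projected E Q ->
  dominates A h b E F -> dominated_at T MA b P Q.
Proof.
move=> b0 iP iQ pP pQ dom.
apply: (dominated_quad cOm co cm_herm quad_pos b0 iP iQ) => w v u Pv Qu v0 u0.
have [vF ev] := projected_eq iP pP Pv; have [uE eu] := projected_eq iQ pQ Qu.
move: ev eu vF uE; set v' := unembed w v; set u' := unembed w u => ev eu vF uE.
have nz (x : 'cV[K]_N) (x' : V w) : embed x' = x -> x != 0 -> 0 < herm_norm (h w) x'.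
  move=> <- x0; apply: (herm_norm_gt0 (hp w)); apply: contra x0 => /eqP ->.
  by rewrite (embed0 gf).
have nv := nz _ _ ev v0; have nu := nz _ _ eu u0.
rewrite -ev -eu !miter_embed !quad_norm.
have iv : 0 <= (herm_norm (h w) v')^-1 by rewrite invr_ge0 ltW.
have iu : 0 <= (herm_norm (h w) u')^-1 by rewrite invr_ge0 ltW.
have := dom w (((herm_norm (h w) u')^-1)%:C%C *: u') (((herm_norm (h w) v')^-1)%:C%C *: v').
rewrite !linearZ /= !(herm_normZ (hp _))// !mulVf ?gt_eqF// => /(_ (memvZ _ uE) (memvZ _ vF) erefl erefl).
apply: sq_ratio_lt => //; exact: herm_norm_ge0.
Qed.

Lemma cocycle_iter_inj n w : lker (cocycle_iter A n w) == 0%VS.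
Proof.
rewrite -subv0; apply/subvP => v; rewrite memv_ker memv0 => /eqP z.
have := miter_embed n v; rewrite z (embed0 gf) => /(miter_inj co (pmat_embed gf v)) e.
by rewrite -(embedK gf v) e -(embed0 gf w) (embedK gf).
Qed.

Lemma contraction_transfer (E : forall w, {vspace V w}) P (k c : R) :
  invproj T MA p P -> projected E P -> 0 < k -> 0 < c ->
  (forall n w v, v \in E w -> herm_norm (h (iter n T w)) (cocycle_iter A n w v) <=
     k * expR (- c * n%:R) * herm_norm (h w) v) ->
  exists2 C, 0 < C & forall n w (v : 'cV[K]_N), P w *m v = v ->
    nrm (miter T MA n w *m v) <= C * expR (- c) ^+ n * nrm v.
Proof.
move=> iP pP k0 c0 rate.
apply: (rate_quad cOm co cm_herm quad_pos iP k0); first by rewrite expR_ge0 expR_lt1 oppr_lt0.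
move=> n w v Pv; have [vE <-] := projected_eq iP pP Pv.
rewrite miter_embed !quad_norm -exprMn ler_pXn2r ?nnegrE ?herm_norm_ge0//.
  by rewrite -expRM_natr; exact: rate.
by rewrite !mulr_ge0 ?exprn_ge0 ?expR_ge0 ?herm_norm_ge0// ltW.
Qed.

Lemma expansion_transfer (E : forall w, {vspace V w}) P (k c : R) : invariant_subbundle A E ->
  invproj T MA p P -> projected E P -> 0 < k -> 0 < c ->
  (forall n w v, v \in E (iter n T w) -> herm_norm (h w) ((cocycle_iter A n w)^-1%VF v) <=
     k * expR (- c * n%:R) * herm_norm (h (iter n T w)) v) ->
  exists2 C, 0 < C & forall n w (v : 'cV[K]_N), P w *m v = v ->
    nrm v <= C * expR (- c) ^+ n * nrm (miter T MA n w *m v).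
Proof.
move=> iE iP pP k0 c0 rate.
apply: (rate_quad_inv cOm co cm_herm quad_pos iP k0); first by rewrite expR_ge0 expR_lt1 oppr_lt0.
move=> n w v Pv; have [vE <-] := projected_eq iP pP Pv.
rewrite miter_embed !quad_norm -exprMn ler_pXn2r ?nnegrE ?herm_norm_ge0//.
  rewrite -expRM_natr.
  by have := rate n w _ (cocycle_iter_mem n iE vE); rewrite (lker0_lfunK (cocycle_iter_inj n w)).
by rewrite !mulr_ge0 ?exprn_ge0 ?expR_ge0 ?herm_norm_ge0// ltW.
Qed.

End HermMetric.

Record splitting_matrices (Ps Pc Pu : Om -> 'M[K]_N) : Prop := SplittingMatrices {
  spl_s : invproj T MA p Ps;
  spl_c : invproj T MA p Pc;
  spl_u : invproj T MA p Pu;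
  spl_Es : projected Es Ps;
  spl_Ec : projected Ec Pc;
  spl_Eu : projected Eu Pu;
  spl_sc : forall w, Ps w *m Pc w = 0;
  spl_su : forall w, Ps w *m Pu w = 0;
  spl_cs : forall w, Pc w *m Ps w = 0;
  spl_cu : forall w, Pc w *m Pu w = 0;
  spl_us : forall w, Pu w *m Ps w = 0;
  spl_uc : forall w, Pu w *m Pc w = 0;
  spl_sum : forall w, Ps w + Pc w + Pu w = p w;
  spl_doms : dominated T MA Ps (fun w => Pc w + Pu w);
  spl_domu : dominated T MA (fun w => Ps w + Pc w) Pu;
  spl_orths : forall w, adj (Pc w) *m Psi w *m Ps w = 0;
  spl_orthu : forall w, adj (Pc w) *m Psi w *m Pu w = 0;
  spl_nd : forall w (x : 'cV[K]_N), adj (Pc w) *m Psi w *m Pc w *m x = 0 -> Pc w *m x = 0;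
  spl_ranks : forall w, \rank (Ps w) = \dim (Es w);
  spl_rankc : forall w, \rank (Pc w) = \dim (Ec w);
  spl_ranku : forall w, \rank (Pu w) = \dim (Eu w);
  spl_sig : forall w, \dim (Eu w) = \dim (Es w) /\ exists dc, \dim (Ec w) = dc.*2 /\
    hs_signature (restr_form Ec psi w) = 0 }.

Lemma vec_mat0 (P Q : Om -> 'M[K]_N) w : (forall x : 'cV[K]_N, P w *m (Q w *m x) = 0) -> P w *m Q w = 0.
Proof.
move=> H; apply: col_ext => x; rewrite mul0mx -mulmxA; exact: H.
Qed.

Lemma projected_vec0 (E : forall w, {vspace V w}) (P Q : Om -> 'M[K]_N) w : invproj T MA p Q -> projected E Q ->
  (forall v, v \in E w -> P w *m embed v = 0) -> P w *m Q w = 0.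
Proof.
move=> iQ [QE _] H; apply: vec_mat0 => x.
have -> : Q w *m x = embed (unembed w (Q w *m x)).
  by rewrite -(pmatE gf) mulmxA (ip_pP iQ).
exact/H/QE.
Qed.

Lemma hyperbolic_matrices : exists Ps Pc Pu, splitting_matrices Ps Pc Pu.
Proof.
have [fulldir [cu cc cs] [ieu iec ies] [h [hp ch [b b0 [duc dcs]] [k [c [k0 c0 rs ru]]]]]] := ph.
have [nu [su [gu _]]] := subbundle_gen cOm cu.
have [nc [sc [gc _]]] := subbundle_gen cOm cc.
have [ns [ss [gs _]]] := subbundle_gen cOm cs.
have full w : (Eu w + Ec w + Es w)%VS = fullv by case: (fulldir w).
have dims w : (\dim (Eu w) + \dim (Ec w) + \dim (Es w))%N = \dim {: V w}.
  have [f dir] := fulldir w; rewrite -f; apply/esym/eqP; have := dir; by rewrite directvE /= => /eqP ->.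
have le2 (W : vectType K) (U U' : {vspace W}) : (\dim (U + U') <= \dim U + \dim U')%N.
  exact: (dimv_add_leqif U U').1.
have inv2 (E E' : forall w, {vspace V w}) : invariant_subbundle A E -> invariant_subbundle A E' ->
    invariant_subbundle A (fun w => (E w + E' w)%VS).
  by move=> i i' w; rewrite limgD i i'.
have [Ps [iPs pEs ks rks]] := proj_exists gs (gen_by_add gu gc) (fun w => etrans (addvC _ _) (full w))
  (fun w => leq_trans (leq_add (leqnn _) (le2 _ _ _)) (eq_leq (etrans (addnC _ _) (dims w)))) ies (inv2 _ _ ieu iec).
have [Pu [iPu pEu ku rku]] := proj_exists gu (gen_by_add gc gs) (fun w => etrans (addvA _ _ _) (full w))
  (fun w => leq_trans (leq_add (leqnn _) (le2 _ _ _)) (eq_leq (etrans (addnA _ _ _) (dims w)))) ieu (inv2 _ _ iec ies).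
have fc w : (Ec w + (Eu w + Es w))%VS = fullv by rewrite addvA (addvC (Ec w)) full.
have dc w : (\dim (Ec w) + (\dim (Eu w) + \dim (Es w)))%N = \dim {: V w}.
  by rewrite addnA (addnC (\dim (Ec w))) dims.
have [Pc [iPc pEc kc rkc]] := proj_exists gc (gen_by_add gu gs) fc
  (fun w => leq_trans (leq_add (leqnn _) (le2 _ _ _)) (eq_leq (dc w))) iec (inv2 _ _ ieu ies).
have inL w (U U' : {vspace V w}) v : v \in U -> v \in (U + U')%VS by apply/subvP; exact: addvSl.
have inR w (U U' : {vspace V w}) v : v \in U' -> v \in (U + U')%VS by apply/subvP; exact: addvSr.
have Zsc w : Ps w *m Pc w = 0 by apply: (projected_vec0 iPc pEc) => v vE; apply: ks; exact: inR.
have Zsu w : Ps w *m Pu w = 0 by apply: (projected_vec0 iPu pEu) => v vE; apply: ks; exact: inL.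
have Zcs w : Pc w *m Ps w = 0 by apply: (projected_vec0 iPs pEs) => v vE; apply: kc; exact: inR.
have Zcu w : Pc w *m Pu w = 0 by apply: (projected_vec0 iPu pEu) => v vE; apply: kc; exact: inL.
have Zus w : Pu w *m Ps w = 0 by apply: (projected_vec0 iPs pEs) => v vE; apply: ku; exact: inR.
have Zuc w : Pu w *m Pc w = 0 by apply: (projected_vec0 iPc pEc) => v vE; apply: ku; exact: inL.
have sum w : Ps w + Pc w + Pu w = p w.
  have h1 (v : V w) : (Ps w + Pc w + Pu w) *m embed v = embed v.
    have := memvf v; rewrite -full => /memv_addP[x /memv_addP[xu xuE [xc xcE ->]] [xs xsE ->]].
    rewrite !(embedD gf) !mulmxDl !mulmxDr (pEs.2 _ _ xsE) (pEc.2 _ _ xcE) (pEu.2 _ _ xuE).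
    rewrite (ks _ xu (inL _ _ _ _ xuE)) (ks _ xc (inR _ _ _ _ xcE)).
    rewrite (kc _ xu (inL _ _ _ _ xuE)) (kc _ xs (inR _ _ _ _ xsE)).
    rewrite (ku _ xc (inL _ _ _ _ xcE)) (ku _ xs (inR _ _ _ _ xsE)).
    by rewrite !addr0 !add0r addrC (addrC (embed xs)) addrA.
  apply: col_ext => x; have -> : (Ps w + Pc w + Pu w) *m x = (Ps w + Pc w + Pu w) *m (p w *m x).
    by rewrite mulmxA !mulmxDl (ip_p iPs) (ip_p iPc) (ip_p iPu).
  by rewrite (pmatE gf) h1.
have dcs' := dominates_transfer hp ch b0 iPs iPc pEs pEc dcs.
have duc' := dominates_transfer hp ch b0 iPc iPu pEc pEu duc.
have [C1 C10 h1] := contraction_transfer hp ch iPs pEs k0 c0 rs.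
have [C2 C20 h2] := expansion_transfer hp ch ieu iPu pEu k0 c0 ru.
have r01 : 0 <= expR (- c) < 1 by rewrite expR_ge0 expR_lt1 oppr_lt0.
(* The comparison of the two outer bundles comes from the rates, at the same block length as the
   others so that they can be added. *)
have dus' := dominated_rates (A := MA) b0 C10 C20 r01 h1 h2.
have DS := dominated_atP b0 (dominated_addr cOm iPc iPu dcs' dus').
have DU := dominated_atP b0 (dominated_addl cOm (ip_c iPs) (ip_c iPc) (ip_PP iPs) (ip_PP iPc) dus' duc').
have nd w (x : 'cV[K]_N) : adj (Pc w) *m Psi w *m Pc w *m x = 0 -> Pc w *m x = 0.
  move=> z; have [pm pe] := pEc.
  pose v := vsproj (Ec w) (unembed w (Pc w *m x)).
  have ev : embed (vsval v) = Pc w *m x.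
    by rewrite vsprojK ?pm// -(pmatE gf) mulmxA (ip_pP iPc).
  have v0 : v = 0.
    apply: (ndc (w := w)) => u; rewrite /restr_form.
    have [_ skew _] := hs w; rewrite skew.
    suff -> : psi w (vsval u) (vsval v) = 0 by rewrite conjc0 oppr0.
    rewrite -(embedK gf (vsval u)) -(embedK gf (vsval v)) -(gramE g _ _ (ses w)) /pairing ev.
    rewrite -(pe w _ (subvsP u)).
    have -> : adj (Pc w *m embed (vsval u)) *m Psi w *m (Pc w *m x) =
      adj (embed (vsval u)) *m (adj (Pc w) *m Psi w *m Pc w *m x).
      by rewrite adjM !mulmxA.
    by rewrite z mulmx0 mxE.
  by rewrite -ev v0 linear0 (embed0 gf).
have ci := cocyc_inv co.
have os : forall w, adj (Pc w) *m Psi w *m Ps w = 0.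
  apply: (dominated_orth cOm co iPs iPc DS) => // w.
  by rewrite mulmxDl (ip_PP iPc) Zuc addr0.
have iPc' := invproj_flip co iPc; have iPu' := invproj_flip co iPu; have iPs' := invproj_flip co iPs.
have ou : forall w, adj (Pc w) *m Psi w *m Pu w = 0.
  have iPsc : invproj T MA p (fun w => Ps w + Pc w).
    split=> w.
    - exact: cmD (ip_c iPs w) (ip_c iPc w).
    - by rewrite mulmxDl !mulmxDr (ip_PP iPs) (ip_PP iPc) Zsc Zcs addr0 add0r.
    - by rewrite mulmxDl (ip_p iPs) (ip_p iPc).
    - by rewrite mulmxDr (ip_pP iPs) (ip_pP iPc).
    - by rewrite mulmxDl mulmxDr (ip_A iPs) (ip_A iPc).
  (* In reversed time E^u is the weaker bundle, so the argument given for E^s applies to it. *)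
  apply: (dominated_orth cOm ci iPu' iPc' (dominated_flip co iPsc iPu DU)) => // w.
  by rewrite mulmxDl (ip_PP iPc) Zsc add0r.
have is0 := contracted_isotropic cOm co iPs r01 h1.
have iu0 := contracted_isotropic cOm ci iPu' r01 (rate_flip co iPu h2).
exists Ps, Pc, Pu; split=> // w.
apply: (signature_splitting (psi := psi w) (d := d)) => //.
- by case: (fulldir w).
- by move=> x y; exact: projected_form0 (iu0 w).
- by move=> x y; exact: projected_form0 (is0 w).
- by move=> x y; exact: projected_form0 (ou w).
- by move=> x y; exact: projected_form0 (os w).
- exact: (ndc (w := w)).
Qed.

End Transfer.

(** * The center cocycle *)

Section Paths.
Context {R : realType} {W : vectType R[i]}.
Local Notation K := R[i].

(** Velocity is defined through the coordinates of a basis, but paths are given here by coefficients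
    on a redundant family [g]. Linearity shows that differentiating these coefficients yields the
    velocity. *)
Lemma path_C1 n (I : set R) (g : 'I_n -> W) (F dF : R -> 'cV[K]_n) (gamma : R -> W) : open I ->
  (forall t, I t -> md F (dF t) t) -> (forall t, I t -> cm dF t) ->
  (forall t, I t -> gamma t = \sum_k F t k ord0 *: g k) ->
  C1_path I gamma /\ forall t, I t -> velocity gamma t = \sum_k dF t k ord0 *: g k.
Proof.
move=> oI dFE cF gE.
have fb := vbasisP (fullv : {vspace W}).
have cdE t i : I t -> cd (path_coord gamma i) (\sum_k dF t k ord0 * coord (vbasis (fullv : {vspace W})) i (g k)) t.
  move=> It; apply: (cd_near (g := fun s => \sum_k F s k ord0 * coord (vbasis (fullv : {vspace W})) i (g k))).
    have : \forall s \near t, I s by exact: open_nbhs_nbhs.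
    apply: filterS => s Is; rewrite /path_coord gE// linear_sum; apply: eq_bigr => k _.
    by rewrite linearZ.
  apply: cd_sum => k; have := cdM (dFE t It k ord0) (cd_cst (coord (vbasis (fullv : {vspace W})) i (g k)) t).
  by rewrite mulr0 addr0.
split=> [i t It|t It].
  have [[d1 _] [d2 _]] := cdE t i It; split; [exact: d1|exact: d2|].
  apply: (cc_near (g := fun s => \sum_k dF s k ord0 * coord (vbasis (fullv : {vspace W})) i (g k))).
    have : \forall s \near t, I s by exact: open_nbhs_nbhs.
    by apply: filterS => s Is; rewrite (cd_cplx_derive (cdE s i Is)).
  apply: (@cc_sum _ _ _ _ _ (fun k s => dF s k ord0 * coord (vbasis (fullv : {vspace W})) i (g k))) => k _.
  by apply: ccM; [exact: cF|exact: cc_cst].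
rewrite /velocity; under eq_bigr => i _ do rewrite (cd_cplx_derive (cdE t i It)) scaler_suml.
rewrite exchange_big; apply: eq_bigr => k _ /=.
rewrite [in RHS](coord_vbasis (memvf (g k))) scaler_sumr.
by apply: eq_bigr => i _; rewrite scalerA.
Qed.

End Paths.

Lemma range_pairing0 (R : realType) N (P Q : 'M[R[i]]_N) (x y : 'cV[R[i]]_N) :
  adj P *m Q *m P *m x = 0 -> (adj (P *m y) *m Q *m (P *m x)) ord0 ord0 = 0.
Proof.
move=> z; have -> : adj (P *m y) *m Q *m (P *m x) = adj y *m (adj P *m Q *m P *m x).
  by rewrite adjM !mulmxA.
by rewrite z mulmx0 mxE.
Qed.

Lemma pairing_mul (R : realType) N (Q M : 'M[R[i]]_N) x y :
  pairing Q (M *m x) (M *m y) = pairing (adj M *m Q *m M) x y.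
Proof. by rewrite /pairing adjM !mulmxA. Qed.

Lemma pairing_ext (R : realType) N (Q Q' : 'M[R[i]]_N) :
  (forall x y, pairing Q x y = pairing Q' x y) -> Q = Q'.
Proof.
move=> h; apply/matrixP => i j; have := h (delta_mx i ord0) (delta_mx j ord0).
have e : adj (delta_mx i ord0 : 'cV[R[i]]_N) = delta_mx ord0 i.
  by apply/matrixP => k m; rewrite adjE !mxE andbC; case: andP; rewrite ?conjc1 ?conjc0.
by rewrite /pairing e -!rowE -!colE !mxE.
Qed.

Lemma mreg_path {R : realType} {Om : topologicalType} {N : nat} (J : set R) (F : R -> Om -> 'M[R[i]]_N) w x :
  mreg (Cfin 1) J F -> (forall t, J t -> md (fun t => F t w *m x) (mderiv (F ^~ w) t *m x) t) /\
    (forall t, J t -> cm (fun t => mderiv (F ^~ w) t *m x : 'cV_N) t).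
Proof.
move=> rF; split=> t Jt; have [_ a b] := mreg_C1_md w rF Jt; first exact: mdMr.
apply: cmM; last exact: cm_cst.
apply: (cm_comp (F := fun p : R * Om => mderiv (F ^~ p.2) p.1) (f := fun t => (t, w))) => //.
by move=> S [[U W] [nU nW] UW]; apply: filterS nU => s Us; apply: (UW (s, w)); split=> //; exact: nbhs_singleton nW.
Qed.

Section MatrixOfFamily.
Context {R : realType} {Om : metricType R}.
Local Notation K := R[i].
Variable V : vbundle R Om.
Hypothesis bV : is_vbundle V.
Variables (N : nat) (g : 'I_N -> forall w, V w) (phi : 'I_N -> forall w, V w -> K).
Arguments phi : clear implicits.
Hypothesis gf : gframe g phi.
Local Notation embed := (embed phi).
Local Notation unembed := (unembed g).
Local Notation mat := (mat g phi).
Variables (T : Om -> Om).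
Hypothesis cT : continuous T.

(** An entry of the global matrix is an entry in local trivializations times a bump at w and a bump
    at T w, extended by zero. *)
Lemma mat_mreg l (I : set R) (F : R -> forall w, 'Hom(V w, V (T w))) : open I ->
  @unif_smooth R Om l I V V T F -> mreg l I (fun t w => mat (F t w)).
Proof.
move=> oI sF k m.
have [_ /(_ k)[e [j [b [c [fe [cb cc'] z gE pE]]]]]] := gf.
have [_ /(_ m)[e' [j' [b' [c' [fe' [cb' cc''] z' gE' pE']]]]]] := gf.
have oU : open (fdom e' `&` T @^-1` fdom e).
  apply: openI; first exact: frame_open fe'.
  by apply: open_comp; [move=> w _; exact: cT|exact: frame_open fe].
apply: (csmooth_ext oI openT (g := fun t w => (c (T w) * b' w)%:C%C *
   coord (fvec e (T w)) j (F t w (fvec e' w)`_j'))).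
  by move=> t w _ _; rewrite mxE pE gE' !linearZ /= rmorphM -!mulrA.
apply: (csmooth_ext0 oI oU (a := fun w => c (T w) * b' w)).
- move=> w; apply: cvgM; last exact: cb'.
  by apply: (@continuous_comp _ _ _ T c); [exact: cT|exact: cc'].
- move=> w nU; have [e'w|ne'] := pselect (fdom e' w); last first.
    by apply: filterS (z' w ne').1 => x ->; rewrite mulr0.
  have nT : ~ fdom e (T w) by move=> eT; exact: nU.
  have := cT (z _ nT).2; rewrite /= nbhs_filterE /=.
  by apply: filterS => x /= ->; rewrite mul0r.
exact: sF.
Qed.

End MatrixOfFamily.

(** * Matrix data of the center cocycle *)

Section Center.
Context {R : realType} {Om : metricType R}.
Local Notation K := R[i].
Hypothesis cOm : compact [set: Om].
Variables (d c : nat) (V : vbundle R Om) (psi : forall w, V w -> V w -> K).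
Arguments psi : clear implicits.
Variables (T Tinv : Om -> Om) (eps : R) (l : smoothness)
  (A : R -> forall w, 'Hom(V w, V (T w))) (Eu Ec Es : R -> forall w, {vspace V w}).
Hypotheses (V_hs : hs_bundle d V psi) (cT : continuous T) (cTinv : continuous Tinv)
  (TK : cancel T Tinv) (TinvK : cancel Tinv T) (eps0 : 0 < eps) (l2 : smooth_ge 2 l).
Local Notation I := (symint eps).
Hypotheses (A_mono : monotonic_family I psi A) (A_smooth : unif_smooth l I A)
  (ph : forall t, I t -> partially_hyperbolic (A t) (Eu t) (Ec t) (Es t))
  (Ec_dim : forall t w, I t -> \dim (Ec t w) = c)
  (Ec_nd : forall t w, I t -> nondegenerate_form (restr_form (Ec t) psi w)).
Let bV : is_vbundle V. Proof. by case: V_hs. Qed.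
Let hs w : hs_form (psi w). Proof. by case: V_hs. Qed.
Let cpsi : continuous_form psi. Proof. by case: V_hs. Qed.
Let dimV w : \dim {: V w} = d.*2. Proof. by case: V_hs => _ _ _ /(_ w)[]. Qed.
Let sig0 w : hs_signature (psi w) = 0. Proof. by case: V_hs => _ _ _ /(_ w)[]. Qed.
Let ses w : sesquilinear_form (psi w). Proof. by case: (hs w). Qed.
Variables (N : nat) (g : 'I_N -> forall w, V w) (phi : 'I_N -> forall w, V w -> K).
Arguments phi : clear implicits.
Hypothesis gf : gframe g phi.
Local Notation embed := (embed phi).
Local Notation unembed := (unembed g).
Local Notation p := (pmat g phi).
Local Notation Psi := (gram g psi).
Local Notation MA := (fun t w => mat g phi (A t w)).

Lemma gram_nd w (x : 'cV[K]_N) : adj (p w) *m Psi w *m p w *m x = 0 -> p w *m x = 0.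
Proof.
move=> z; rewrite (pmatE gf); suff -> : unembed w x = 0 by rewrite (embed0 gf).
have e v : psi w v (unembed w x) = 0.
  rewrite -(embedK gf v) -(embedK gf (unembed w x)) -(pmatE gf) -(gramE g _ _ (ses w)) /pairing.
  by rewrite -(pmat_embed gf v) (range_pairing0 _ z).
by have [_ skew nd] := hs w; apply: nd => v; rewrite skew e conjc0 oppr0.
Qed.

Lemma center_matrices : exists eta (B C : R -> Om -> 'M[K]_N), [/\ 0 < eta, eta < eps,
  mreg l (symint eta) B /\ mreg l (symint eta) C,
  (forall w, \dim (Ec 0 w) = c./2.*2 /\ hs_signature (restr_form (Ec 0) psi w) = 0) &
  [/\ forall t w v, symint eta t -> v \in Ec 0 w -> unembed w (B t w *m embed v) \in Ec t w,
    forall t w u v, symint eta t -> u \in Ec 0 w -> v \in Ec 0 w ->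
      psi w (unembed w (B t w *m embed u)) (unembed w (B t w *m embed v)) = psi w u v,
    forall t w v, symint eta t -> v \in Ec 0 w -> unembed (T w) (C t w *m embed v) \in Ec 0 (T w) /\
      unembed (T w) (mderiv (C ^~ w) t *m embed v) \in Ec 0 (T w),
    forall t w v, symint eta t -> v \in Ec 0 w ->
      unembed (T w) (B t (T w) *m embed (unembed (T w) (C t w *m embed v))) =
      A t w (unembed w (B t w *m embed v)) &
    forall w v, v \in Ec 0 w -> v != 0 -> psi w v v = 0 ->
      (forall t, symint eta t -> 0 < psi (T w) (unembed (T w) (C t w *m embed v))
         (unembed (T w) (mderiv (C ^~ w) t *m embed v))) \/
      (forall t, symint eta t -> psi (T w) (unembed (T w) (C t w *m embed v))
         (unembed (T w) (mderiv (C ^~ w) t *m embed v)) < 0)]].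
Proof.
have oI : open I := @open_symint R eps.
have I0 : I 0 by rewrite symintE normr0.
have rA : mreg l I MA by exact: mat_mreg.
have skew w : adj (Psi w) = - Psi w by exact: gram_skew.
have Psip w : Psi w *m p w = Psi w by exact: (gram_pmat gf).
have pP w : adj (p w) *m Psi w = Psi w.
  exact: pPsi (skew w) (Psip w).
have pp w : p w *m p w = p w by exact: (pmat_id gf).
have form0 w : adj (p w) *m Psi w *m p w = Psi w by rewrite pP Psip.
have [lam lamE] : exists lam : Om -> 'M[K]_N, forall w, lam w = form_inv (p w) (Psi w) by eexists.
have lamPsi w : lam w *m Psi w = p w.
  by rewrite lamE; have := form_inv_mul_form (pp w) (@gram_nd w); rewrite form0.
have Psilam w : Psi w *m lam w = adj (p w).
  by rewrite lamE; have := mul_form_inv (pp w) (@gram_nd w); rewrite form0.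
have plam w : p w *m lam w = lam w by rewrite lamE; exact: form_inv_l.
have lamp w : lam w *m adj (p w) = lam w by rewrite lamE; exact: form_inv_r.
have cp : forall w, cm p w by move=> w; exact: (cm_pmat bV gf).
have cPsi : forall w, cm Psi w by move=> w; exact: (cm_gram bV gf).
have cm_lam : forall w, cm lam w.
  move=> w; rewrite (_ : lam = fun w => form_inv (p w) (Psi w)); last exact/funext.
  by apply: cm_form_inv => //; exact: gram_nd.
have rkp w : \rank (p w) = \rank (p (T w)).
  have e v : p v = mat g phi (\1%VF : 'Hom(V v, V v)) by apply/matrixP => i j; rewrite !mxE lfunE.
  by rewrite !e !(mat_rank gf) !lim1g !dimV.
have Ap t w : I t -> MA t w *m p w = MA t w by move=> _; exact: (mat_pmat gf).
have pA t w : I t -> p (T w) *m MA t w = MA t w by move=> _; exact: (pmat_mat gf).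
have [Ahs A1 Amono] := A_mono.
have form t w : I t -> adj (MA t w) *m Psi (T w) *m MA t w = Psi w.
  move=> It; apply: pairing_ext => x y; rewrite -pairing_mul !(matE gf).
  rewrite (gramE g _ _ (ses (T w))) !(embedK gf) (Ahs t It) -(gramE g _ _ (ses w)).
  by [].
have co t (It : I t) := matrix_cocyc cT cTinv TK TinvK l2 rA cp cPsi pp skew Psip rkp Ap pA form
  lamPsi plam cm_lam It.
(* The projections are chosen separately for each t, with default 0 outside the interval; their
   regularity in t is not part of the choice. *)
have [P PE] : exists P : R -> (Om -> 'M[K]_N) * (Om -> 'M[K]_N) * (Om -> 'M[K]_N), forall t, I t ->
    splitting_matrices g phi (A t) psi (Eu t) (Ec t) (Es t) (P t).1.1 (P t).1.2 (P t).2.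
  have /choice[P HP] t : exists P : (Om -> 'M[K]_N) * (Om -> 'M[K]_N) * (Om -> 'M[K]_N), I t ->
      splitting_matrices g phi (A t) psi (Eu t) (Ec t) (Es t) P.1.1 P.1.2 P.2.
    have [It|nI] := pselect (I t); last by exists (fun=> 0, fun=> 0, fun=> 0).
    have [Ps [Pc [Pu h]]] := hyperbolic_matrices cOm bV gf (co t It) hs dimV sig0 (ph It) (fun w => @Ec_nd t w It).
    by exists (Ps, Pc, Pu).
  by exists P.
(* Either sign of monotonicity gives a non-zero pairing at t = 0. *)
have mono w (x : 'cV[K]_N) : p w *m x = x -> x != 0 -> pairing (Psi w) x x = 0 ->
    pairing (Psi (T w)) (MA 0 w *m x) (mderiv (MA ^~ w) 0 *m x) != 0.
  move=> px x0; rewrite (gramE g _ _ (ses w)) => iso.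
  have ex : embed (unembed w x) = x by rewrite -(pmatE gf).
  have v0 : unembed w x != 0 by apply: contra x0 => /eqP z; rewrite -ex z (embed0 gf).
  have [_ _ sgn] := Amono w _ v0 iso.
  have [mdF cmF] := mreg_path w x (mreg_C1 l2 rA).
  have [_ vel] := path_C1 oI mdF cmF (gamma := fun t => A t w (unembed w x)) (g := fun k => g k (T w))
    (fun t _ => etrans (esym (embedK gf _)) (congr1 (unembed (T w)) (esym (matE gf (A t w) x)))).
  rewrite (gramE g _ _ (ses (T w))) (matE gf) (embedK gf) /unembed -(vel 0 I0).
  by case: sgn => /(_ 0 I0) h; [rewrite gt_eqF|rewrite lt_eqF].
(* As dim E^u = dim E^s, constancy of the center dimension fixes the ranks of all three bundles. *)
have dimE t w : I t -> (\dim (Es t w) + \dim (Es t w) + c)%N = d.*2 /\ \dim (Eu t w) = \dim (Es t w).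
  move=> It; have [eus _] := spl_sig (PE t It) w; split=> //.
  have [fulldir _ _ _] := ph It; have [f dir] := fulldir w.
  have := dir; rewrite directvE /= f dimV => /eqP ->; rewrite eus (Ec_dim w It).
  by rewrite addnAC.
have rks t w : I t -> \rank ((P 0).1.1 w) = \rank ((P t).1.1 w).
  move=> It; rewrite (spl_ranks (PE 0 I0)) (spl_ranks (PE t It)); apply: double_inj; rewrite -!addnn.
  by apply/eqP; rewrite -(eqn_add2r c) (dimE t w It).1 (dimE 0 w I0).1.
have rku t w : I t -> \rank ((P 0).2 w) = \rank ((P t).2 w).
  move=> It; rewrite (spl_ranku (PE 0 I0)) (spl_ranku (PE t It)) (dimE t w It).2 (dimE 0 w I0).2.
  by rewrite -(spl_ranks (PE 0 I0)) -(spl_ranks (PE t It)) (rks t w It).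
have rkc t w : I t -> \rank ((P 0).1.2 w) = \rank ((P t).1.2 w).
  by move=> It; rewrite (spl_rankc (PE 0 I0)) (spl_rankc (PE t It)) !Ec_dim.
have [eta [B [C [eta0 etae reg HB HC]]]] := matrix_center cOm cT cTinv TK TinvK eps0 l2 rA cp cPsi pp skew Psip rkp Ap pA form
  lamPsi Psilam plam lamp cm_lam (fun t It => spl_s (PE t It)) (fun t It => spl_c (PE t It))
  (fun t It => spl_u (PE t It)) (fun t w It => spl_sc (PE t It) w) (fun t w It => spl_su (PE t It) w)
  (fun t w It => spl_cs (PE t It) w) (fun t w It => spl_cu (PE t It) w) (fun t w It => spl_us (PE t It) w)
  (fun t w It => spl_uc (PE t It) w) (fun t w It => spl_sum (PE t It) w)
  (fun t It => spl_doms (PE t It)) (fun t It => spl_domu (PE t It))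
  (fun t w It => spl_orths (PE t It) w) (fun t w It => spl_orthu (PE t It) w) (spl_nd (PE 0 I0))
  rks rku rkc mono.
have Isub t : symint eta t -> I t by rewrite !symintE => /lt_trans; apply.
have PcE t (It : I t) := spl_Ec (PE t It).
have fixE t w v (It : I t) : v \in Ec t w -> (P t).1.2 w *m embed v = embed v by move/((PcE t It).2 w v).
have memE t w (x : 'cV[K]_N) (It : I t) : (P t).1.2 w *m x = x -> unembed w x \in Ec t w.
  by move=> <-; exact: (PcE t It).1.
have C1 := mreg_C1 l2 reg.2.
have PC w t x : symint eta t -> (P 0).1.2 (T w) *m (C t w *m x) = C t w *m x.
  by move=> Et; have [_ _ _ [e _] _] := HB t w Et; rewrite mulmxA e.
have PC' w t x : symint eta t -> (P 0).1.2 (T w) *m (mderiv (C ^~ w) t *m x) = mderiv (C ^~ w) t *m x.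
  move=> Et; rewrite mulmxA; congr (_ *m _); have [_ a _] := mreg_C1_md w C1 Et.
  apply: (@md_unique _ _ _ (C ^~ w) _ _ t _ a).
  apply: (md_near (F := fun s => (P 0).1.2 (T w) *m C s w)); last exact: mdMl.
  have : \forall s \near t, symint eta s by apply: open_nbhs_nbhs; split=> //; exact: open_symint.
  by apply: filterS => s Es'; have [_ _ _ [e _] _] := HB s w Es'.
have emb w (x : 'cV[K]_N) : (P 0).1.2 w *m x = x -> embed (unembed w x) = x.
  by move=> e; rewrite -(pmatE gf) -{1}e mulmxA (ip_pP (spl_c (PE 0 I0))) e.
exists eta, B, C; split=> //.
  move=> w; have [_ [dc [e1 e2]]] := spl_sig (PE 0 I0) w.
  by rewrite e1 e2; rewrite (Ec_dim w I0) in e1; rewrite e1 doubleK.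
split.
- move=> t w v Et vE; apply: (memE _ _ _ (Isub t Et)).
  by have [_ e _ _ _] := HB t w Et; rewrite mulmxA e.
- move=> t w u v Et uE vE; rewrite -(gramE g _ _ (ses w)) pairing_mul.
  have [_ _ -> _ _] := HB t w Et.
  by rewrite -pairing_mul !fixE// (gramE g _ _ (ses w)) !(embedK gf).
- by move=> t w v Et vE; split; apply: (memE _ _ _ I0); [exact: PC|exact: PC'].
- move=> t w v Et vE; rewrite emb; last exact: PC.
  have [_ _ _ _ e] := HB t w Et.
  by rewrite mulmxA e -mulmxA (matE gf) (embedK gf).
- move=> w v vE v0 iso.
  have := HC w (embed v) (fixE _ _ _ I0 vE).
  have -> : embed v != 0.
    by apply: contra v0 => /eqP z; rewrite -(embedK gf v) z -(embed0 gf w) (embedK gf).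
  rewrite (gramE g _ _ (ses w)) (embedK gf) iso => /(_ erefl erefl) [h|h]; [left|right] => t Et.
    by have := h t Et; rewrite (gramE g _ _ (ses (T w))).
  by have := h t Et; rewrite (gramE g _ _ (ses (T w))).
Qed.
End Center.

Lemma linfunE (F : fieldType) (aT rT : vectType F) (f : aT -> rT) : linear f -> linfun f =1 f.
Proof.
move=> lin; pose f' : {linear aT -> rT} := HB.pack f (GRing.isLinear.Build _ _ _ _ f lin).
exact: (lfunE f').
Qed.

Lemma cc_comp (R : realType) (X Y : topologicalType) (g : Y -> R[i]) (f : X -> Y) x :
  {for x, continuous f} -> cplx_continuous_at g (f x) -> cplx_continuous_at (fun y => g (f y)) x.
Proof.
by move=> cf [a b]; split; [exact: (@continuous_comp _ _ _ f _ x cf a)|exact: (@continuous_comp _ _ _ f _ x cf b)].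
Qed.

(** * From matrices back to bundle maps *)

Section Assembly.
Context {R : realType} {Om : metricType R}.
Local Notation K := R[i].
Hypothesis cOm : compact [set: Om].
Variables (d c : nat) (V : vbundle R Om) (psi : forall w, V w -> V w -> K).
Arguments psi : clear implicits.
Variables (T Tinv : Om -> Om) (eps : R) (l : smoothness)
  (A : R -> forall w, 'Hom(V w, V (T w))) (Eu Ec Es : R -> forall w, {vspace V w}).
Hypotheses (V_hs : hs_bundle d V psi) (cT : continuous T) (l2 : smooth_ge 2 l).
Local Notation I := (symint eps).
Hypotheses (A_hs : forall t, I t -> hs_cocycle psi (A t))
  (ph : partially_hyperbolic (A 0) (Eu 0) (Ec 0) (Es 0))
  (Ec_dim : forall t w, I t -> \dim (Ec t w) = c)
  (Ec_nd : forall w, nondegenerate_form (restr_form (Ec 0) psi w)).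
Let bV : is_vbundle V. Proof. by case: V_hs. Qed.
Let hs w : hs_form (psi w). Proof. by case: V_hs. Qed.
Let cpsi : continuous_form psi. Proof. by case: V_hs. Qed.
Let ses w : sesquilinear_form (psi w). Proof. by case: (hs w). Qed.
Variables (N : nat) (g : 'I_N -> forall w, V w) (phi : 'I_N -> forall w, V w -> K).
Arguments phi : clear implicits.
Hypothesis gf : gframe g phi.
Local Notation embed := (embed phi).
Local Notation unembed := (unembed g).
Variables (eta : R) (B C : R -> Om -> 'M[K]_N).
Local Notation J := (symint eta).
Hypotheses (JI : forall t, J t -> I t) (J0 : J 0).
Hypotheses (rB : mreg l J B) (rC : mreg l J C)
  (sig : forall w, \dim (Ec 0 w) = c./2.*2 /\ hs_signature (restr_form (Ec 0) psi w) = 0)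
  (B_mem : forall t w v, J t -> v \in Ec 0 w -> unembed w (B t w *m embed v) \in Ec t w)
  (B_iso : forall t w u v, J t -> u \in Ec 0 w -> v \in Ec 0 w ->
    psi w (unembed w (B t w *m embed u)) (unembed w (B t w *m embed v)) = psi w u v)
  (C_mem : forall t w v, J t -> v \in Ec 0 w -> unembed (T w) (C t w *m embed v) \in Ec 0 (T w) /\
      unembed (T w) (mderiv (C ^~ w) t *m embed v) \in Ec 0 (T w))
  (BC : forall t w v, J t -> v \in Ec 0 w ->
      unembed (T w) (B t (T w) *m embed (unembed (T w) (C t w *m embed v))) =
      A t w (unembed w (B t w *m embed v)))
  (C_sgn : forall w v, v \in Ec 0 w -> v != 0 -> psi w v v = 0 ->
      (forall t, J t -> 0 < psi (T w) (unembed (T w) (C t w *m embed v))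
         (unembed (T w) (mderiv (C ^~ w) t *m embed v))) \/
      (forall t, J t -> psi (T w) (unembed (T w) (C t w *m embed v))
         (unembed (T w) (mderiv (C ^~ w) t *m embed v)) < 0)).

(** For t in the interval the vector already lies in [Ec t w], and [vsproj] only changes its
    type. *)
Definition center_map t w : 'Hom(subvs_of (Ec 0 w), subvs_of (Ec t w)) :=
  linfun (fun u => vsproj (Ec t w) (unembed w (B t w *m embed (vsval u)))).

Lemma center_mapE t w u : center_map t w u = vsproj (Ec t w) (unembed w (B t w *m embed (vsval u))).
Proof.
rewrite /center_map linfunE// => a x y.
by rewrite linearP (embedD gf) (embedZ gf) mulmxDr -scalemxAr unembedD unembedZ linearP.
Qed.

Lemma vsval_center_map t w u : J t -> vsval (center_map t w u) = unembed w (B t w *m embed (vsval u)).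
Proof. by move=> Jt; rewrite center_mapE vsprojK// B_mem// subvsP. Qed.

Lemma center_map_iso t w u v : J t ->
  restr_form (Ec t) psi w (center_map t w u) (center_map t w v) = restr_form (Ec 0) psi w u v.
Proof. by move=> Jt; rewrite /restr_form !vsval_center_map// B_iso ?subvsP. Qed.

(** An isometry defined on a non-degenerate space is injective. *)
Lemma center_map_ker t w : J t -> lker (center_map t w) == 0%VS.
Proof.
move=> Jt; rewrite -subv0; apply/subvP => u; rewrite memv_ker memv0 => /eqP z.
apply/eqP; apply: (Ec_nd (w := w)) => v; rewrite -(center_map_iso u v Jt) z /restr_form.
by rewrite linear0 (ses0l (ses w)).
Qed.

Lemma center_map_bij t w : J t -> bijective (center_map t w).
Proof.
move=> Jt; have k0 := center_map_ker w Jt.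
exists (center_map t w)^-1%VF; first exact: lker0_lfunK.
move=> v; apply: limg_lfunVK; suff -> : limg (center_map t w) = fullv by exact: memvf.
apply/eqP; rewrite eqEdim subvf limg_dim_eq; last by rewrite (eqP k0) capv0.
by rewrite /= !dim_subvs (Ec_dim w (JI Jt)) (Ec_dim w (JI J0)).
Qed.

(** By injectivity of B it suffices to compare after applying B at [T w], which is the relation
    [BC]. *)
Lemma conj_cocycleE t w u : J t -> conj_cocycle A center_map t w u =
  vsproj (Ec 0 (T w)) (unembed (T w) (C t w *m embed (vsval u))).
Proof.
move=> Jt; rewrite /conj_cocycle !comp_lfunE.
rewrite (linfunE (f := fun u => vsproj (Ec t (T w)) (A t w (vsval u)))); last first.
  by move=> a x y; rewrite (linearP vsval) (linearP (A t w)) (linearP (vsproj (Ec t (T w)))).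
set z := RHS.
suff -> : vsproj (Ec t (T w)) (A t w (vsval (center_map t w u))) = center_map t (T w) z.
  exact: lker0_lfunK (center_map_ker _ Jt) _.
have [Cm _] := C_mem Jt (subvsP u).
have ez : vsval z = unembed (T w) (C t w *m embed (vsval u)) by rewrite vsprojK.
by rewrite [RHS]center_mapE ez BC ?subvsP// vsval_center_map.
Qed.

Lemma vsval_conj_cocycle t w u : J t -> vsval (conj_cocycle A center_map t w u) =
  unembed (T w) (C t w *m embed (vsval u)).
Proof. by move=> Jt; rewrite conj_cocycleE// vsprojK//; case: (C_mem Jt (subvsP u)). Qed.

Lemma conj_cocycle_hs t : J t -> hs_cocycle (restr_form (Ec 0) psi) (conj_cocycle A center_map t).
Proof.
move=> Jt w u v; rewrite /restr_form !vsval_conj_cocycle//.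
have [Cu _] := C_mem Jt (subvsP u); have [Cv _] := C_mem Jt (subvsP v).
by rewrite -(B_iso Jt Cu Cv) !BC ?subvsP// (A_hs (JI Jt)) B_iso ?subvsP.
Qed.

Lemma entry_csmooth l' (U : set Om) (M : R -> Om -> 'M[K]_N) (rho : Om -> 'rV[K]_N) (s : Om -> 'cV[K]_N) :
  open U -> mreg l' J M -> (forall w, U w -> cm rho w) -> (forall w, U w -> cm s w) ->
  csmooth l' J U (fun t w => (rho w *m M t w *m s w) ord0 ord0).
Proof.
move=> oU rM crho cs; have oJ := @open_symint R eta.
apply: (csmooth_ext oJ oU (g := fun t w => \sum_m \sum_k s w m ord0 * (rho w ord0 k * M t w k m))).
  move=> t w _ _; rewrite mxE; apply: eq_bigr => m _; rewrite mxE mulr_suml.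
  by apply: eq_bigr => k _; rewrite mulrC.
apply: (csmooth_sum oJ oU) => m; apply: (csmooth_sum oJ oU) => k.
apply: (csmooth_scale oJ oU (a := fun w => s w m ord0)) => [w Uw|]; first exact: cs.
apply: (csmooth_scale oJ oU (a := fun w => rho w ord0 k)) => [w Uw|]; first exact: crho.
exact: csmooth_restr (rM k m).
Qed.

Lemma subbundle_sec e j w : frames (subbundle (Ec 0)) e -> fdom e w ->
  sec_at (fun x => vsval (fvec e x)`_(j : 'I_(flen e))) w.
Proof. by move=> [_ _ h] ew f ff i fw; exact: (h j f ff i w ew fw). Qed.

Lemma incl_smooth l' : mreg l' J B -> unif_smooth l' J (incl_family center_map).
Proof.
move=> rB' e f fe ff j i; set U := _ `&` _.
suff : csmooth l' J U (fun t w => coord (fvec f (id w)) i (incl_family center_map t w (fvec e w)`_j)) by [].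
have oJ := @open_symint R eta.
have oU : open U by apply: openI; [case: fe|exact: frame_open ff].
apply: (csmooth_ext oJ oU (g := fun t w => ((\row_k coord (fvec f w) i (g k w)) *m B t w *m
  embed (vsval (fvec e w)`_j)) ord0 ord0)).
  move=> t w Jt _; rewrite /incl_family comp_lfunE lfunE /= vsval_center_map//.
  rewrite -mulmxA mxE linear_sum; apply: eq_bigr => k _.
  by rewrite linearZ mxE mulrC.
apply: (entry_csmooth oU rB') => w [ew fw].
  by move=> a k; under eq_fun do rewrite mxE; exact: (gsec_at bV gf k ff).
by apply: (cm_embed gf); exact: subbundle_sec.
Qed.

Lemma conj_smooth l' : mreg l' J C -> @unif_smooth R Om l' J (subbundle (Ec 0)) (subbundle (Ec 0)) T
  (conj_cocycle A center_map).
Proof.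
move=> rC' e f fe ff j i; set U := _ `&` _.
suff : csmooth l' J U (fun t w => coord (fvec f (T w)) i (conj_cocycle A center_map t w (fvec e w)`_j)) by [].
have oJ := @open_symint R eta.
have oU : open U.
  by apply: openI; [case: fe|apply: open_comp; [move=> w _; exact: cT|case: ff]].
have [fulldir [cu cc cs] _ _] := ph.
have [nu [su [gu _]]] := subbundle_gen cOm cu.
have [nc [sc [gc scc]]] := subbundle_gen cOm cc.
have [ns [ss [gs _]]] := subbundle_gen cOm cs.
have add w : (Ec 0 w + (Eu 0 w + Es 0 w))%VS = fullv.
  by case: (fulldir w) => <- _; rewrite addvA (addvC (Ec 0 w)).
have cap w : (Ec 0 w :&: (Eu 0 w + Es 0 w) = 0)%VS.
  apply: (compl_cap (add w)); case: (fulldir w) => <-; rewrite directvE /= => /eqP ->.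
  by rewrite (addnC (\dim (Eu 0 w))) -addnA leq_add2l (dimv_add_leqif _ _).1.
(* A coordinate in the target frame applies only to vectors of the center; expanding the image in
   the global generators, with continuous coordinates [xi], turns it into a continuous row applied
   to the matrix [C t w]. *)
have [xi [cxi xiE]] := gen_coord bV gf gc (gen_by_add gu gs) cap add.
pose rho w : 'rV[K]_N := \sum_k coord (fvec f (T w)) i (sc k (T w)) *: (xi k (T w) *m pmat g phi (T w)).
apply: (csmooth_ext oJ oU (g := fun t w => (rho w *m C t w *m embed (vsval (fvec e w)`_j)) ord0 ord0)).
  move=> t w Jt _; rewrite conj_cocycleE//.
  have [vE _] := C_mem Jt (subvsP (fvec e w)`_j).
  set x := embed _; rewrite {1}(xiE _ _ vE) !linear_sum -mulmxA mulmx_suml summxE.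
  apply: eq_bigr => k _; rewrite !linearZ /= vsvalK -scalemxAl mxE mulrC; congr (_ * _).
  by rewrite -(pmatE gf) !mulmxA.
apply: (entry_csmooth oU rC') => w [ew fw]; last by apply: (cm_embed gf); exact: subbundle_sec.
move=> a m; under eq_fun do rewrite summxE.
apply: (@cc_sum _ _ _ _ _ (fun k w => (coord (fvec f (T w)) i (sc k (T w)) *: (xi k (T w) *m pmat g phi (T w))) a m)) => k _.
under eq_fun do rewrite mxE; apply: ccM.
  have c1 := scc k (T w) f ff i fw.
  exact: (cc_comp (@cT w) c1).
apply: (cm_comp (F := fun w => xi k w *m pmat g phi w) (f := T)); first exact: cT.
by apply: cmM; [exact: cxi|exact: (cm_pmat bV gf)].
Qed.

Lemma conj_monotonic w (u : subvs_of (Ec 0 w)) : u != 0 -> restr_form (Ec 0) psi w u u = 0 ->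
  monotonic_path J (restr_form (Ec 0) psi (T w)) (fun t => conj_cocycle A center_map t w u).
Proof.
move=> u0 iso; have oJ := @open_symint R eta.
have [mdF cmF] := mreg_path w (embed (vsval u)) (mreg_C1 l2 rC).
have gE t : J t -> conj_cocycle A center_map t w u =
    \sum_k (C t w *m embed (vsval u)) k ord0 *: vsproj (Ec 0 (T w)) (g k (T w)).
  move=> Jt; rewrite conj_cocycleE// /unembed linear_sum; apply: eq_bigr => k _.
  by rewrite linearZ.
have [C1 vel] := path_C1 oJ mdF cmF (gamma := fun t => conj_cocycle A center_map t w u)
  (g := fun k => vsproj (Ec 0 (T w)) (g k (T w))) gE.
have velE t : J t -> vsval (velocity (fun t => conj_cocycle A center_map t w u) t) =
    unembed (T w) (mderiv (C ^~ w) t *m embed (vsval u)).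
  move=> Jt; rewrite vel//; have [_ h] := C_mem Jt (subvsP u).
  have e : vsproj (Ec 0 (T w)) (unembed (T w) (mderiv (C ^~ w) t *m embed (vsval u))) =
      \sum_k (mderiv (C ^~ w) t *m embed (vsval u)) k ord0 *: vsproj (Ec 0 (T w)) (g k (T w)).
    by rewrite /unembed linear_sum; apply: eq_bigr => k _; rewrite linearZ.
  by rewrite -e vsprojK.
split=> // [t Jt|].
  apply: contra u0 => /eqP z; apply/eqP; apply: (Ec_nd (w := w)) => v.
  by rewrite -(conj_cocycle_hs Jt) z /restr_form linear0 (ses0l (ses _)).
have vu0 : vsval u != 0 by apply: contra u0 => /eqP z; apply/eqP/val_inj; rewrite /= z.
by have [h|h] := C_sgn (subvsP u) vu0 iso; [left|right] => t Jt;
  have := h t Jt; rewrite -velE// -vsval_conj_cocycle.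
Qed.

Lemma center_hs_bundle : hs_bundle c./2 (subbundle (Ec 0)) (restr_form (Ec 0) psi).
Proof.
have [_ [_ cc _] _ _] := ph.
split=> // [w|e fe i j w ew|w]; first exact: restr_hs_form (hs w) (@Ec_nd w).
  by apply: (form_at bV (psi := psi)) => //; exact: subbundle_sec.
by have [h1 h2] := sig w; split=> //; rewrite dim_subvs.
Qed.

End Assembly.

Theorem theorem4p2 (R : realType) (Om : metricType R) (d c : nat)
  (V : vbundle R Om) (psi : forall w, V w -> V w -> R[i])
  (T Tinv : Om -> Om) (eps : R) (l : smoothness)
  (A : R -> forall w, 'Hom(V w, V (T w)))
  (Eu Ec Es : R -> forall w, {vspace V w})
  (Omega_compact : compact [set: Om])
  (V_hs : hs_bundle d V psi)
  (T_cont : continuous T) (Tinv_cont : continuous Tinv)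
  (TK : cancel T Tinv) (TinvK : cancel Tinv T)
  (eps_gt0 : 0 < eps)
  (l_ge2 : smooth_ge 2 l)
  (A_mono : monotonic_family `]-eps, eps[ psi A)
  (A_smooth : unif_smooth l `]-eps, eps[ A)
  (A_ph : forall t : R, t \in `]-eps, eps[ ->
            partially_hyperbolic (A t) (Eu t) (Ec t) (Es t))
  (Ec_dim : forall (t : R) w, t \in `]-eps, eps[ -> \dim (Ec t w) = c)
  (Ec_hs : forall (t : R) w, t \in `]-eps, eps[ ->
             nondegenerate_form (restr_form (Ec t) psi w)) :
  exists eps' : R, [/\ 0 < eps', eps' <= eps &
  exists B : forall t w, 'Hom(subvs_of (Ec 0 w), subvs_of (Ec t w)),
    [/\ forall (t : R) w, t \in `]-eps', eps'[ ->
          bijective (B t w) /\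
          (forall u v, restr_form (Ec t) psi w (B t w u) (B t w v) =
                       restr_form (Ec 0) psi w u v),
        unif_smooth (smooth_pred l) `]-eps', eps'[ (incl_family B),
        unif_smooth (Cfin 1) `]-eps', eps'[ (incl_family B) &
        exists2 dc, hs_bundle dc (subbundle (Ec 0)) (restr_form (Ec 0) psi) &
          monotonic_family `]-eps', eps'[ (restr_form (Ec 0) psi)
            (conj_cocycle A B)]].
Proof.
have bV : is_vbundle V by case: V_hs.
have [N [g [phi gf]]] := gframe_exists bV Omega_compact.
have [eta [B [C [eta0 etae [rB rC] sig [B_mem B_iso C_mem BC C_sgn]]]]] := center_matrices Omega_compact V_hs
  T_cont Tinv_cont TK TinvK eps_gt0 l_ge2 A_mono A_smooth A_ph Ec_dim Ec_hs gf.
have JI t : symint eta t -> symint eps t by rewrite !symintE => /lt_trans; apply.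
have J0 : symint eta 0 by rewrite symintE normr0.
have [A_hs _ _] := A_mono; have ph0 := A_ph 0 (JI 0 J0); have nd0 w := @Ec_hs 0 w (JI 0 J0).
exists eta; split=> //; first exact: ltW.
exists (center_map Ec g phi B); split.
- move=> t w Jt; split; first exact: (center_map_bij V_hs Ec_dim nd0 gf JI J0 B_mem B_iso w Jt).
  by move=> u v; exact: (center_map_iso gf B_mem B_iso u v Jt).
- exact: (incl_smooth V_hs gf B_mem (mreg_smooth_pred rB)).
- exact: (incl_smooth V_hs gf B_mem (mreg_C1 l_ge2 rB)).
- exists c./2; first exact: (center_hs_bundle V_hs ph0 nd0 sig).
  split=> [t Jt||w u u0 iso].
  + exact: (conj_cocycle_hs V_hs A_hs nd0 gf JI B_mem B_iso C_mem BC Jt).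
  + exact: (conj_smooth Omega_compact V_hs T_cont ph0 nd0 gf B_mem B_iso C_mem BC (mreg_C1 l_ge2 rC)).
  + exact: (conj_monotonic V_hs l_ge2 A_hs nd0 gf JI rC B_mem B_iso C_mem BC C_sgn u0 iso).
Qed.
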